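(* Let $\varepsilon_0>0$ be a constant such that for all $(\theta_0,\rho,\varepsilon)\in\mathbb R\times(-\varepsilon_0,\varepsilon_0+1/2)\times(0,\varepsilon_0)$ the primary stable and primary unstable solutions (defined in the context) exist, are unique, and depend real analytically on $(\theta_0,\rho,\varepsilon)$. There exists a constant $\varepsilon_1>0$ with $\varepsilon_1\ll\varepsilon_0$ such that for every fixed $\varepsilon\in(0,\varepsilon_1)$ there exists a corresponding sufficiently small $\rho(\varepsilon)>0$ such that, for all $\rho\in(0,\rho(\varepsilon))$, the primary stable manifold $W^s$ and the primary unstable manifold $W^u$ admit transversal homoclinic intersections.
   Context: Consider the planar restricted circular three-body problem with primaries of masses $m_1=1-\rho$, $m_2=\rho$, restricted to the three-dimensional invariant surface with Jacobi constant $J=-1/\varepsilon$. In suitable coordinates $(\theta,X,Y)$ and time $\tau$ it reads $$\frac{d\theta}{d\tau}=\sqrt2\left(X-\frac1{\varepsilon^3U^3X^3}\right),\quad \frac{dX}{d\tau}=Y+\sqrt2\varepsilon^2U^2X^2G,\quad \frac{dY}{d\tau}=X-X^3-XF+\sqrt2\varepsilon^2U^2XYG,\qquad( * )$$ where $$F=1-(1-\rho)(1+\rho\varepsilon^2U^2X^2\cos\theta)R_{13}^{-3}-\rho(1-(1-\rho)\varepsilon^2U^2X^2\cos\theta)R_{23}^{-3},\quad G=\rho(1-\rho)\sin\theta\,(R_{13}^{-3}-R_{23}^{-3}),$$ $$R_{13}=\sqrt{1+\rho^2\varepsilon^4U^4X^4+2\rho\varepsilon^2U^2X^2\cos\theta},\quad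 R_{23}=\sqrt{1+(1-\rho)^2\varepsilon^4U^4X^4-2(1-\rho)\varepsilon^2U^2X^2\cos\theta},$$ and $U=U(\theta,X,Y)$ (near $1$) is determined by $$U=1-\varepsilon^3U^3Y^2-\tfrac12\varepsilon^3U^3X^4+(1-\rho)\varepsilon^3U^3X^2R_{13}^{-1}+\rho\varepsilon^3U^3X^2R_{23}^{-1}.$$ Let $a(\tau)=\frac{2\sqrt2}{e^\tau+e^{-\tau}}$, $b(\tau)=\frac{2\sqrt2(e^{-\tau}-e^\tau)}{(e^\tau+e^{-\tau})^2}$. Let $D_\ell^{+}$ (resp. $D_\ell^-$) be a small neighborhood in the $(X,Y)$-plane of $\{(a(\tau),b(\tau)):\tau\ge0\}\cup\{(0,0)\}$ (resp. with $\tau\le0$), and $I$ a small segment of the $X$-axis centered at $a(0)=\sqrt2$. For $\theta_0\in\mathbb R$, a primary stable solution is a solution of $( * )$ on $[0,\infty)$ with $(X(0),Y(0),\theta(0))=(X_0,0,\theta_0)$ for some $X_0\in I$, $(X(\tau),Y(\tau))\in D_\ell^+$ for all $\tau\ge0$, and $(X(\tau),Y(\tau))\to(0,0)$ as $\tau\to+\infty$. A primary unstable solution is defined likewise on $(-\infty,0]$ with $D_\ell^-$ and $\tau\to-\infty$. For fixed $(\rho,\varepsilon)$, $W^s$ (resp. $W^u$) is the immersed two-dimensional manifold, in the three-dimensional Jacobi surface, formed by the primary stable (resp. unstable) solutions as $\theta_0$ ranges over $\mathbb R$. A transversal homoclinic intersection means: for some $\theta_0$ the primary stable and primary unstable solutions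 agree at $\tau=0$, so that together they form a homoclinic orbit, and along this orbit $W^s$ and $W^u$ intersect transversally in the three-dimensional surface. The notation $\varepsilon_1\ll\varepsilon_0$ means $\varepsilon_1$ is sufficiently small compared with $\varepsilon_0$ (in particular $\varepsilon_1<\varepsilon_0$). *)

(* Defs.v *)
From Stdlib Require Import Reals.
From Coquelicot Require Import Coquelicot.
Open Scope R_scope.

(** A state is ((theta, X), Y).  The angle theta is kept as a real number; the
    equations are 2 PI-periodic in it. *)
Definition state : NormedModule R_AbsRing :=
  prod_NormedModule R_AbsRing
    (prod_NormedModule R_AbsRing R_NormedModule R_NormedModule) R_NormedModule.

Definition mk_state (th x y : R) : state := ((th, x), y).
Definition st_theta (p : state) : R := fst (fst p).
Definition st_X (p : state) : R := snd (fst p).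
Definition st_Y (p : state) : R := snd p.

Definition R13 (rho eps u th x : R) : R :=
  sqrt (1 + rho ^ 2 * eps ^ 4 * u ^ 4 * x ^ 4
          + 2 * rho * eps ^ 2 * u ^ 2 * x ^ 2 * cos th).

Definition R23 (rho eps u th x : R) : R :=
  sqrt (1 + (1 - rho) ^ 2 * eps ^ 4 * u ^ 4 * x ^ 4
          - 2 * (1 - rho) * eps ^ 2 * u ^ 2 * x ^ 2 * cos th).

Definition Ffun (rho eps u th x : R) : R :=
  1 - (1 - rho) * (1 + rho * eps ^ 2 * u ^ 2 * x ^ 2 * cos th)
      * / (R13 rho eps u th x) ^ 3
    - rho * (1 - (1 - rho) * eps ^ 2 * u ^ 2 * x ^ 2 * cos th)
      * / (R23 rho eps u th x) ^ 3.

Definition Gfun (rho eps u th x : R) : R :=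
  rho * (1 - rho) * sin th
  * (/ (R13 rho eps u th x) ^ 3 - / (R23 rho eps u th x) ^ 3).

(** [u] is the value U(theta, X, Y): the root near 1 of the implicit equation.
    For (X, Y) bounded and eps small there is exactly one root within distance
    1/2 of 1.  The conditions on [R13] and [R23] exclude collisions, where the
    equation is not defined. *)
Definition is_U (rho eps : R) (p : state) (u : R) : Prop :=
  let th := st_theta p in let x := st_X p in let y := st_Y p in
  R13 rho eps u th x <> 0 /\ R23 rho eps u th x <> 0 /\
  Rabs (u - 1) < 1 / 2 /\
  u = 1 - eps ^ 3 * u ^ 3 * y ^ 2
        - 1 / 2 * eps ^ 3 * u ^ 3 * x ^ 4
        + (1 - rho) * eps ^ 3 * u ^ 3 * x ^ 2 * / R13 rho eps u th x
        + rho * eps ^ 3 * u ^ 3 * x ^ 2 * / R23 rho eps u th x.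

Definition vector_field (rho eps u : R) (p : state) : state :=
  let th := st_theta p in let x := st_X p in let y := st_Y p in
  mk_state
    (sqrt 2 * (x - 1 / (eps ^ 3 * u ^ 3 * x ^ 3)))
    (y + sqrt 2 * eps ^ 2 * u ^ 2 * x ^ 2 * Gfun rho eps u th x)
    (x - x ^ 3 - x * Ffun rho eps u th x
       + sqrt 2 * eps ^ 2 * u ^ 2 * x * y * Gfun rho eps u th x).

(** Derivative at [t] of [f] as a function on the interval [J]; it is one-sided
    at an end point of [J] and the ordinary derivative at an interior point. *)
Definition is_derive_within {V : NormedModule R_AbsRing} (J : R -> Prop)
    (f : R -> V) (t : R) (l : V) : Prop :=
  filterlim (fun s => scal (/ (s - t)) (minus (f s) (f t)))
            (within (fun s => J s /\ s <> t) (locally t)) (locally l).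

(** [X <> 0] because the right-hand side of the theta-equation is singular
    at X = 0. *)
Definition solves (rho eps : R) (J : R -> Prop) (gam : R -> state) : Prop :=
  forall t, J t ->
    st_X (gam t) <> 0 /\
    exists u, is_U rho eps (gam t) u /\
      is_derive_within J gam t (vector_field rho eps u (gam t)).

Definition a_sol (t : R) : R := 2 * sqrt 2 / (exp t + exp (- t)).
Definition b_sol (t : R) : R :=
  2 * sqrt 2 * (exp (- t) - exp t) / (exp t + exp (- t)) ^ 2.

Definition loop_plus (q : R * R) : Prop :=
  (exists t, 0 <= t /\ q = (a_sol t, b_sol t)) \/ q = (0, 0).
Definition loop_minus (q : R * R) : Prop :=
  (exists t, t <= 0 /\ q = (a_sol t, b_sol t)) \/ q = (0, 0).

(** [D] is a neighborhood of [A] contained in the [delta]-neighborhood of [A]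
    (for the sup distance of the plane). *)
Definition small_neighborhood (delta : R) (A D : R * R -> Prop) : Prop :=
  (forall q, A q -> locally q D) /\
  (forall q, D q -> exists p, A p /\ ball p delta q).

(** [r] is the half-length of the segment centered at a(0) = sqrt 2 in which
    X(0) has to lie. *)
Definition primary_stable (Dp : R * R -> Prop) (r rho eps theta0 : R)
    (gam : R -> state) : Prop :=
  solves rho eps (fun t => 0 <= t) gam /\
  (exists X0, Rabs (X0 - sqrt 2) <= r /\ gam 0 = mk_state theta0 X0 0) /\
  (forall t, 0 <= t -> Dp (st_X (gam t), st_Y (gam t))) /\
  is_lim (fun t => st_X (gam t)) p_infty 0 /\
  is_lim (fun t => st_Y (gam t)) p_infty 0.

Definition primary_unstable (Dm : R * R -> Prop) (r rho eps theta0 : R)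
    (gam : R -> state) : Prop :=
  solves rho eps (fun t => t <= 0) gam /\
  (exists X0, Rabs (X0 - sqrt 2) <= r /\ gam 0 = mk_state theta0 X0 0) /\
  (forall t, t <= 0 -> Dm (st_X (gam t), st_Y (gam t))) /\
  is_lim (fun t => st_X (gam t)) m_infty 0 /\
  is_lim (fun t => st_Y (gam t)) m_infty 0.

(** Real analyticity of a function of three real variables at (x, y, z): an
    absolutely convergent triple power series expansion on a cube. *)
Definition analytic3_at (f : R -> R -> R -> R) (x y z : R) : Prop :=
  exists (c : nat -> nat -> nat -> R) (d : R), 0 < d /\
  forall h k l, Rabs h < d -> Rabs k < d -> Rabs l < d ->
    let psum (g : R -> R) (n : nat) : R :=
      sum_n (fun i1 => sum_n (fun i2 => sum_n (fun i3 =>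
        g (c i1 i2 i3 * h ^ i1 * k ^ i2 * l ^ i3)) n) n) n in
    ex_finite_lim_seq (psum Rabs) /\
    is_lim_seq (psum (fun v => v)) (f (x + h) (y + k) (z + l)).

Definition param_range (eps0 rho eps : R) : Prop :=
  - eps0 < rho < eps0 + 1 / 2 /\ 0 < eps < eps0.

(** On the time interval [J], the solutions characterized by [P] (which is
    [primary_stable Dp r] or [primary_unstable Dm r]) exist, are unique, and at
    each time depend analytically on (theta0, rho, eps). *)
Definition exist_unique_analytic (eps0 : R) (J : R -> Prop)
    (P : R -> R -> R -> (R -> state) -> Prop) : Prop :=
  exists Gam : R -> R -> R -> R -> state,
  forall theta0 rho eps, param_range eps0 rho eps ->
    P rho eps theta0 (Gam theta0 rho eps) /\
    (forall gam, P rho eps theta0 gam ->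
       forall t, J t -> gam t = Gam theta0 rho eps t) /\
    (forall t, J t ->
       analytic3_at (fun th r e => st_theta (Gam th r e t)) theta0 rho eps /\
       analytic3_at (fun th r e => st_X (Gam th r e t)) theta0 rho eps /\
       analytic3_at (fun th r e => st_Y (Gam th r e t)) theta0 rho eps).

(** [Psi] is the parametrization by (theta0', t) |-> Psi theta0' t of the part
    of W^s formed by the primary stable solutions with theta0' near [theta0],
    continued by the flow to a time interval containing [t0] in its interior
    (t0 may be negative). *)
Definition stable_sheet (Dp : R * R -> Prop) (r rho eps theta0 t0 : R)
    (Psi : R -> R -> state) : Prop :=
  exists d, 0 < d /\ forall th, Rabs (th - theta0) < d ->
    primary_stable Dp r rho eps th (Psi th) /\
    solves rho eps (fun t => Rmin 0 t0 - d < t) (Psi th).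

Definition unstable_sheet (Dm : R * R -> Prop) (r rho eps theta0 t0 : R)
    (Psi : R -> R -> state) : Prop :=
  exists d, 0 < d /\ forall th, Rabs (th - theta0) < d ->
    primary_unstable Dm r rho eps th (Psi th) /\
    solves rho eps (fun t => t < Rmax 0 t0 + d) (Psi th).

Definition tangent_basis (Psi : R -> R -> state) (theta0 t0 : R)
    (vt vth : state) : Prop :=
  is_derive (fun t => Psi theta0 t) t0 vt /\
  is_derive (fun th => Psi th t0) theta0 vth.

Definition transversal_at (Psis Psiu : R -> R -> state) (theta0 t0 : R) : Prop :=
  exists vt vth wt wth : state,
    tangent_basis Psis theta0 t0 vt vth /\
    tangent_basis Psiu theta0 t0 wt wth /\
    forall z : state, exists c1 c2 c3 c4 : R,
      z = plus (plus (scal c1 vt) (scal c2 vth))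
               (plus (scal c3 wt) (scal c4 wth)).

(** [gam], defined for all times, is at once the primary stable solution (on
    [0, +oo)) and the primary unstable solution (on (-oo, 0]) with the same
    theta0, i.e. these two agree at time 0; transversality is required at every
    point [gam t0] of this homoclinic orbit. *)
Definition transversal_homoclinic_intersection (Dp Dm : R * R -> Prop)
    (r rho eps : R) : Prop :=
  exists (theta0 : R) (gam : R -> state),
    primary_stable Dp r rho eps theta0 gam /\
    primary_unstable Dm r rho eps theta0 gam /\
    forall t0 : R, exists Psis Psiu : R -> R -> state,
      stable_sheet Dp r rho eps theta0 t0 Psis /\
      unstable_sheet Dm r rho eps theta0 t0 Psiu /\
      Psis theta0 t0 = gam t0 /\ Psiu theta0 t0 = gam t0 /\
      transversal_at Psis Psiu theta0 t0.

(* Main.v *)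
Require Import Defs.
From Stdlib Require Import Factorial Arith Lra Lia Psatz ClassicalEpsilon.
From Stdlib Require Import Reals.
From Coquelicot Require Import Coquelicot.
Open Scope R_scope.

(** The quantity [u = U] along a solution satisfies
    [u' = - sqrt 2 eps^2 u^3 X G] with [G = O(rho)], and [u -> 1] as [(X, Y) -> (0, 0)],
    where [X] decays exponentially.  Hence, for a fixed [eps], the
    values of [u] at time 0 on the primary stable and unstable solutions differ by
    [- rho] times an integral along the unperturbed loop, up to [o(rho)].  In the
    variable [z = sinh t] this is the Melnikov integral
    [int s sin Th ((1 + s^2 - 2 s cos Th)^(-3/2) - 1) dz] with [s = 2 eps^2 / (1 + z^2)],
    [Th = th + 2 atan z - (z + z^3 / 3) / (2 eps^3)].  As [Y = 0] at time 0, the relation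
    between [U] and [X] turns the difference of the [u] into one of the [X(0)].

    The Melnikov integral is odd in [th], hence vanishes at [th = 0], and it is at least
    [c sin th] with an exponentially small [c > 0].  To see this, write
    [(1 + s^2 - 2 s cos Th)^(-3/2)] as [|f|^2], [f] being the series of
    [(1 - s e^(i Th))^(-3/2)].  The integral of the harmonic [cos (k (Th - th))] against a
    power of [s] is, with [w = 1 + i z], a contour integral of
    [w^(-m) (2 - w)^(-q) e^(k L (w^2 - w^3 / 3))], [L = 1 / (2 eps^3)], and is of size
    [e^(-2 k L / 3)]: the line [Re w = 1] is shifted to [Re w = L^(-1/2)].  The first
    harmonic of [s^3] dominates, and its coefficient is positive.

    Analyticity in [(theta0, rho)] then produces, for small [rho], a simple zero of the
    difference of the [X(0)].  There the tangent vectors [(1, dX^s/dth, 0)] and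
    [(1, dX^u/dth, 0)] of the two manifolds and the flow direction, which has [Y' <> 0],
    span the space.  All three are values at time 0 of solutions of the linear variational
    equation, so they span it along the whole orbit. *)

(** * The Melnikov integral *)

(** The lower bound for the Melnikov integral is exponentially small in 1/eps, whereas estimating
    its terms in absolute value on the real line gives only powers of eps. This dictates the order
    of choices: the constant c depends on eps alone, then come eta and the truncation order N, and
    the cut-off T of the integral comes last, since the O(1/T) errors grow with N. The smallness of
    c does no harm, because rho(eps) may depend on eps in any way and all other errors are o(rho) at
    fixed eps. The theta-equation is singular at X = 0, where the solutions end, so nothing is
    proved about the flow there. Existence and analyticity of the solutions are hypotheses, and two
    facts are added to them: the tail bound |U - 1| <= 4 rho X once X < 1/4, and convergence to the
    loop on compact time intervals. Unstable solutions are turned into stable ones by reversing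
    time, theta and Y, so that every estimate is made once. *)

Ltac ringR := match goal with |- @eq _ ?a ?b => change (@eq R a b); cbv beta; ring end.

(** The upper bound is excluded, which makes the empty sum available as the base of inductions. *)
Fixpoint rsum (f : nat -> R) (n : nat) : R :=
  match n with O => 0 | S n => rsum f n + f n end.

Lemma rsum_ext f g n : (forall i, (i < n)%nat -> f i = g i) -> rsum f n = rsum g n.
Proof.
  induction n as [|n IH]; intros H; simpl; [reflexivity|].
  rewrite IH, H; auto.
Qed.

Lemma rsum_plus f g n : rsum (fun i => f i + g i) n = rsum f n + rsum g n.
Proof. induction n as [|n IH]; simpl; [ring|rewrite IH; ring]. Qed.

Lemma rsum_scal c f n : rsum (fun i => c * f i) n = c * rsum f n.
Proof. induction n as [|n IH]; simpl; [ring|rewrite IH; ring]. Qed.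

Lemma rsum_le f g n : (forall i, (i < n)%nat -> f i <= g i) -> rsum f n <= rsum g n.
Proof.
  induction n as [|n IH]; intros H; simpl; [lra|].
  apply Rplus_le_compat; auto.
Qed.

Lemma rsum_abs f n : Rabs (rsum f n) <= rsum (fun i => Rabs (f i)) n.
Proof.
  induction n as [|n IH]; simpl; [rewrite Rabs_R0; lra|].
  eapply Rle_trans; [apply Rabs_triang|]. lra.
Qed.

Lemma rsum_geom_half n : rsum (fun i => (/ 2) ^ i) n <= 2.
Proof.
  assert (rsum (fun i => (/ 2) ^ i) n = 2 - 2 * (/ 2) ^ n) as ->.
  { induction n as [|n IH]; simpl; [ring|rewrite IH; field]. }
  assert (0 < (/ 2) ^ n) by (apply pow_lt; lra). lra.
Qed.

(** The coefficients of [(1 - x)^(-3/2)]. *)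
Fixpoint beta (j : nat) : R :=
  match j with O => 1 | S j => beta j * ((2 * INR j + 3) / (2 * INR j + 2)) end.

Lemma beta_pos j : 0 < beta j.
Proof.
  induction j as [|j IH]; cbn [beta]; [lra|].
  assert (0 <= INR j) by apply pos_INR.
  apply Rmult_lt_0_compat; [exact IH|apply Rdiv_lt_0_compat; lra].
Qed.

Lemma beta_le_pow2 j : beta j <= 2 ^ j.
Proof.
  induction j as [|j IH]; cbn [beta pow]; [lra|].
  assert (Hj : 0 <= INR j) by apply pos_INR.
  replace (2 * 2 ^ j) with (2 ^ j * 2) by ring.
  apply Rmult_le_compat; [left; apply beta_pos| |exact IH|].
  - left; apply Rdiv_lt_0_compat; lra.
  - apply Rmult_le_reg_r with (2 * INR j + 2); [lra|].
    unfold Rdiv; rewrite Rmult_assoc, Rinv_l; lra.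
Qed.

Lemma beta_succ j : INR (S j) * beta (S j) = (INR j + 3 / 2) * beta j.
Proof.
  cbn [beta]; rewrite S_INR.
  assert (0 <= INR j) by apply pos_INR. field. lra.
Qed.

(** [fre] + i [fim] is the sum of the first N terms of the series of (1 - s e^(i th))^(-3/2), so
    that [fre]^2 + [fim]^2 approximates (1 + s^2 - 2 s cos th)^(-3/2). *)
Definition fre (N : nat) (s th : R) := rsum (fun j => beta j * s ^ j * cos (INR j * th)) N.

Definition fim (N : nat) (s th : R) := rsum (fun j => beta j * s ^ j * sin (INR j * th)) N.

Definition dfre (N : nat) (s th : R) :=
  rsum (fun j => beta j * (INR j * s ^ pred j) * cos (INR j * th)) N.

Definition dfim (N : nat) (s th : R) :=
  rsum (fun j => beta j * (INR j * s ^ pred j) * sin (INR j * th)) N.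

Lemma is_derive_fre N s th : is_derive (fun s => fre N s th) s (dfre N s th).
Proof.
  unfold fre, dfre; induction N as [|N IH]; cbn [rsum]; [auto_derive; auto|].
  apply (is_derive_plus (V := R_NormedModule)); [exact IH|].
  auto_derive; [exact I|ring].
Qed.

Lemma is_derive_fim N s th : is_derive (fun s => fim N s th) s (dfim N s th).
Proof.
  unfold fim, dfim; induction N as [|N IH]; cbn [rsum]; [auto_derive; auto|].
  apply (is_derive_plus (V := R_NormedModule)); [exact IH|].
  auto_derive; [exact I|ring].
Qed.

(* The partial sums [f] satisfy [(1 - A) f' = 3/2 e^(i th) f - N beta_N s^(N-1) e^(i N th)]
   with [A = s e^(i th)]; these are its real and imaginary parts. *)
Lemma f_ode N s th :
  (1 - s * cos th) * dfre N s th + s * sin th * dfim N s th =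
    3 / 2 * (cos th * fre N s th - sin th * fim N s th)
    - INR N * beta N * s ^ pred N * cos (INR N * th) /\
  (1 - s * cos th) * dfim N s th - s * sin th * dfre N s th =
    3 / 2 * (cos th * fim N s th + sin th * fre N s th)
    - INR N * beta N * s ^ pred N * sin (INR N * th).
Proof.
  unfold fre, fim, dfre, dfim; induction N as [|N [IH1 IH2]]; cbn [rsum].
  { simpl; split; ring. }
  rewrite beta_succ; cbn [pred].
  assert (Hc : cos (INR (S N) * th) = cos (INR N * th) * cos th - sin (INR N * th) * sin th).
  { rewrite S_INR, Rmult_plus_distr_r, Rmult_1_l. apply cos_plus. }
  assert (Hs : sin (INR (S N) * th) = sin (INR N * th) * cos th + cos (INR N * th) * sin th).
  { rewrite S_INR, Rmult_plus_distr_r, Rmult_1_l. apply sin_plus. }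
  rewrite Hc, Hs.
  assert (Hp : INR N * s ^ N = s * (INR N * s ^ pred N)).
  { destruct N; simpl; ring. }
  set (p := INR N * s ^ pred N) in *.
  split.
  - transitivity ((1 - s * cos th) * rsum (fun j => beta j * (INR j * s ^ pred j) * cos (INR j * th)) N
      + s * sin th * rsum (fun j => beta j * (INR j * s ^ pred j) * sin (INR j * th)) N
      + beta N * p * cos (INR N * th)
      - beta N * (s * p) * (cos (INR N * th) * cos th - sin (INR N * th) * sin th)); [ring|].
    rewrite IH1, <- Hp. unfold p. ring.
  - transitivity ((1 - s * cos th) * rsum (fun j => beta j * (INR j * s ^ pred j) * sin (INR j * th)) N
      - s * sin th * rsum (fun j => beta j * (INR j * s ^ pred j) * cos (INR j * th)) N
      + beta N * p * sin (INR N * th)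
      - beta N * (s * p) * (sin (INR N * th) * cos th + cos (INR N * th) * sin th)); [ring|].
    rewrite IH2, <- Hp. unfold p. ring.
Qed.

Lemma beta_pow_quarter j s : 0 <= s <= 1 / 4 -> beta j * s ^ j <= (/ 2) ^ j.
Proof.
  intros Hs.
  apply Rle_trans with (2 ^ j * (1 / 4) ^ j).
  - apply Rmult_le_compat; [left; apply beta_pos|apply pow_le; lra|apply beta_le_pow2|].
    apply pow_incr; lra.
  - rewrite <- Rpow_mult_distr. right; f_equal; lra.
Qed.

Lemma Rabs_mult_le a b A B : Rabs a <= A -> Rabs b <= B -> Rabs (a * b) <= A * B.
Proof.
  intros; rewrite Rabs_mult.
  apply Rmult_le_compat; auto using Rabs_pos.
Qed.

Lemma f_bound N s th : 0 <= s <= 1 / 4 ->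
  Rabs (fre N s th) <= 2 /\ Rabs (fim N s th) <= 2.
Proof.
  intros Hs; unfold fre, fim.
  split; (eapply Rle_trans; [apply rsum_abs|]);
    (eapply Rle_trans; [apply rsum_le|apply (rsum_geom_half N)]);
    intros i _; cbv beta;
    replace ((/ 2) ^ i) with ((/ 2) ^ i * 1) by ring;
    (apply Rabs_mult_le;
     [rewrite Rabs_pos_eq; [apply beta_pow_quarter; exact Hs|
       apply Rmult_le_pos; [left; apply beta_pos|apply pow_le; lra]]
     |apply Rabs_le; first [apply COS_bound|apply SIN_bound]]).
Qed.

Lemma MVT_abs_le (f df : R -> R) (a b M : R) :
  (forall x, Rmin a b <= x <= Rmax a b -> is_derive f x (df x)) ->
  (forall x, Rmin a b <= x <= Rmax a b -> Rabs (df x) <= M) ->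
  Rabs (f b - f a) <= M * Rabs (b - a).
Proof.
  intros Hd HM.
  destruct (MVT_gen f a b df) as [c [Hc ->]].
  - intros x Hx; apply Hd; lra.
  - intros x Hx. apply continuity_pt_filterlim.
    apply (ex_derive_continuous (K := R_AbsRing) (V := R_NormedModule) f x). exists (df x); apply Hd; lra.
  - rewrite Rabs_mult. apply Rmult_le_compat_r; [apply Rabs_pos|auto].
Qed.

(** For the full series the product |f|^2 q^(3/2) is identically 1. For the truncation, [f_ode]
    leaves in its s-derivative only the defect N beta_N s^(N-1), of size N 2^(-N) when s <= 1/4, and
    the mean value theorem from s = 0 gives the bound. N = 0 is apart because the empty sum is not 1
    at s = 0. *)
Lemma f_remainder N s th : 0 <= s <= 1 / 4 ->
  Rabs ((fre N s th ^ 2 + fim N s th ^ 2) * sqrt (1 + s ^ 2 - 2 * s * cos th) ^ 3 - 1)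
  <= 200 * INR N * (/ 2) ^ N \/ N = O.
Proof.
  intros Hs. destruct N as [|N]; [now right|left].
  set (q := fun s => 1 + s ^ 2 - 2 * s * cos th).
  assert (Hq : forall s, 0 <= s <= 1 / 4 -> 1 / 4 <= q s <= 2).
  { intros t Ht; unfold q. pose proof (COS_bound th). nra. }
  assert (Hsq : forall s, 0 <= s <= 1 / 4 -> 0 < sqrt (q s) <= 2).
  { intros t Ht; specialize (Hq t Ht). split; [apply sqrt_lt_R0; lra|].
    replace 2 with (sqrt (2 * 2)) by (apply sqrt_square; lra).
    apply sqrt_le_1_alt; lra. }
  set (r := fun s => INR (S N) * beta (S N) * s ^ N).
  set (h := fun s => (fre (S N) s th ^ 2 + fim (S N) s th ^ 2) * sqrt (q s) ^ 3).
  set (ra := fun s => r s * cos (INR (S N) * th)).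
  set (rb := fun s => r s * sin (INR (S N) * th)).
  (* The derivative of [h] after f' has been eliminated through [f_ode]: apart from f itself, only
     the defect [ra] + i [rb] is left. *)
  set (dh := fun s => - 2 * sqrt (q s) *
     (fre (S N) s th * (ra s * (1 - s * cos th) - rb s * (s * sin th))
      + fim (S N) s th * (rb s * (1 - s * cos th) + ra s * (s * sin th)))).
  assert (Hd : forall s, 0 <= s <= 1 / 4 -> is_derive h s (dh s)).
  { intros t Ht. specialize (Hq t Ht). specialize (Hsq t Ht).
    assert (Hdq : is_derive q t (2 * t - 2 * cos th)) by (unfold q; auto_derive; [exact I|ring]).
    assert (Hds : is_derive (fun s => sqrt (q s)) t ((2 * t - 2 * cos th) / (2 * sqrt (q t)))).
    { apply is_derive_sqrt; [exact Hdq|lra]. }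
    pose proof (is_derive_fre (S N) t th) as H1.
    pose proof (is_derive_fim (S N) t th) as H2.
    destruct (f_ode (S N) t th) as [E1 E2]. cbn [pred] in E1, E2.
    assert (E3 : sqrt (q t) * sqrt (q t) = q t) by (apply sqrt_sqrt; lra).
    unfold h.
    evar_last.
    - apply (is_derive_mult (K := R_AbsRing) (fun s => fre (S N) s th ^ 2 + fim (S N) s th ^ 2)
              (fun s => sqrt (q s) ^ 3)).
      + apply (is_derive_plus (V := R_NormedModule)).
        * apply (is_derive_pow _ 2); exact H1.
        * apply (is_derive_pow _ 2); exact H2.
      + apply (is_derive_pow _ 3); exact Hds.
      + intros; apply Rmult_comm.
    - unfold plus, mult; simpl. unfold dh, ra, rb, r.
      set (x := fre (S N) t th) in *. set (y := fim (S N) t th) in *.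
      set (x' := dfre (S N) t th) in *. set (y' := dfim (S N) t th) in *.
      set (Q := sqrt (q t)) in *.
      set (A := INR (S N) * beta (S N) * t ^ N * cos (INR (S N) * th)) in *.
      set (B := INR (S N) * beta (S N) * t ^ N * sin (INR (S N) * th)) in *.
      change (match N with O => 1 | S _ => INR N + 1 end) with (INR (S N)).
      assert (EQ : Q * Q = (1 - t * cos th) ^ 2 + (t * sin th) ^ 2).
      { rewrite E3. unfold q. pose proof (sin2_cos2 th) as Hsc. unfold Rsqr in Hsc.
        replace ((1 - t * cos th) ^ 2 + (t * sin th) ^ 2) with
          (1 - 2 * t * cos th + t ^ 2 * (sin th * sin th + cos th * cos th)) by ring.
        rewrite Hsc; ring. }
      set (al := 1 - t * cos th) in *. set (bt := t * sin th) in *.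
      assert (EA : A = 3 / 2 * (cos th * x - sin th * y) - (al * x' + bt * y')) by lra.
      assert (EB : B = 3 / 2 * (cos th * y + sin th * x) - (al * y' - bt * x')) by lra.
      change (INR (S N) * beta (S N) * t ^ N * cos (INR (S N) * th)) with A.
      change (INR (S N) * beta (S N) * t ^ N * sin (INR (S N) * th)) with B.
      rewrite EA, EB.
      transitivity (Q * (2 * (x * x' + y * y') * (Q * Q) + (x * x + y * y) * 3 * (t - cos th))).
      + field. lra.
      + rewrite EQ. 
        assert (Ec : cos th * al - sin th * bt = cos th - t).
        { unfold al, bt. pose proof (sin2_cos2 th) as Hsc. unfold Rsqr in Hsc.
          replace (cos th * (1 - t * cos th) - sin th * (t * sin th)) with
            (cos th - t * (sin th * sin th + cos th * cos th)) by ring.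
          rewrite Hsc; ring. }
        replace (t - cos th) with (- (cos th * al - sin th * bt)) by lra.
        field. }
  assert (Hr : forall s, 0 <= s <= 1 / 4 -> Rabs (r s) <= 4 * INR (S N) * (/ 2) ^ S N).
  { intros t Ht; unfold r. rewrite Rmult_assoc, Rabs_mult, (Rabs_pos_eq (INR _)) by apply pos_INR.
    rewrite (Rmult_comm 4), Rmult_assoc. apply Rmult_le_compat_l; [apply pos_INR|].
    rewrite Rabs_pos_eq by (apply Rmult_le_pos; [left; apply beta_pos|apply pow_le; lra]).
    apply Rle_trans with (2 ^ S N * (1 / 4) ^ N).
    - apply Rmult_le_compat; [left; apply beta_pos|apply pow_le; lra|apply beta_le_pow2|].
      apply pow_incr; lra.
    - right. simpl. replace (1 / 4) with (/ 2 * / 2) by field.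
      rewrite Rpow_mult_distr. rewrite pow_inv. field. apply pow_nonzero; lra. }
  set (K := 4 * INR (S N) * (/ 2) ^ S N) in *.
  assert (HK : 0 <= K).
  { unfold K. apply Rmult_le_pos; [apply Rmult_le_pos; [lra|apply pos_INR]|apply pow_le; lra]. }
  assert (Hb : forall s, 0 <= s <= 1 / 4 -> Rabs (dh s) <= 48 * K).
  { intros t Ht. specialize (Hsq t Ht). specialize (Hr t Ht).
    destruct (f_bound (S N) t th Ht) as [F1 F2].
    assert (Hcos : Rabs (cos (INR (S N) * th)) <= 1) by (apply Rabs_le, COS_bound).
    assert (Hsin : Rabs (sin (INR (S N) * th)) <= 1) by (apply Rabs_le, SIN_bound).
    assert (Hra : Rabs (ra t) <= K * 1) by (apply Rabs_mult_le; auto).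
    assert (Hrb : Rabs (rb t) <= K * 1) by (apply Rabs_mult_le; auto).
    assert (Hal : Rabs (1 - t * cos th) <= 5 / 4).
    { pose proof (COS_bound th). apply Rabs_le. nra. }
    assert (Hbe : Rabs (t * sin th) <= 1 / 4).
    { pose proof (SIN_bound th). apply Rabs_le. nra. }
    unfold dh.
    replace (48 * K) with (4 * (2 * (K * 1 * (5 / 4) + K * 1 * (1 / 4)) * 2 + 2 * (K * 1 * (5 / 4) + K * 1 * (1/4)) * 2)) by field.
    rewrite Rmult_plus_distr_l. 
    rewrite (Rmult_plus_distr_l 4).
    assert (H2 : Rabs (- 2 * sqrt (q t)) <= 4).
    { rewrite Rabs_mult, Rabs_left, Rabs_pos_eq by lra. lra. }
    eapply Rle_trans; [apply Rabs_triang|].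
    apply Rplus_le_compat; (eapply Rle_trans; [apply Rabs_mult_le; [exact H2|apply Rabs_mult_le; [eassumption|]]|]).
    - eapply Rle_trans; [apply Rabs_triang|]. rewrite Rabs_Ropp. apply Rplus_le_compat; apply Rabs_mult_le; eassumption.
    - lra.
    - eapply Rle_trans; [apply Rabs_triang|]. apply Rplus_le_compat; apply Rabs_mult_le; eassumption.
    - lra. }
  assert (H0 : h 0 = 1).
  { unfold h, q. replace (1 + 0 ^ 2 - 2 * 0 * cos th) with 1 by ring. rewrite sqrt_1.
    assert (E : forall n, fre (S n) 0 th = 1 /\ fim (S n) 0 th = 0).
    { induction n as [|n [I1 I2]]; unfold fre, fim in *; cbn [rsum] in *.
      - simpl. rewrite Rmult_0_l, cos_0, sin_0. lra.
      - rewrite I1, I2. simpl. lra. }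
    destruct (E N) as [-> ->]. ring. }
  fold (q s). fold (h s). rewrite <- H0.
  eapply Rle_trans.
  - apply (MVT_abs_le h dh 0 s (48 * K)); intros x; rewrite Rmin_left, Rmax_right by lra; intros Hx.
    + apply Hd; lra.
    + apply Hb; lra.
  - rewrite Rminus_0_r, Rabs_pos_eq by lra.
    fold K. replace (200 * INR (S N) * (/ 2) ^ S N) with (50 * K) by (unfold K; ring). nra.
Qed.

(** This is the imaginary part of e^(i th) f conj(f) multiplied out: the term (j, l) is the harmonic
    of order 1 + j - l with amplitude s^(j + l). *)
Lemma sin_f_double N s th :
  sin th * (fre N s th ^ 2 + fim N s th ^ 2) =
  rsum (fun j => rsum (fun l =>
    beta j * beta l * s ^ (j + l) * sin ((1 + INR j - INR l) * th)) N) N.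
Proof.
  (* The outer range gets its own variable, since the induction over it must leave the inner range
     at [N]. *)
  assert (E : forall M, rsum (fun j => rsum (fun l =>
    beta j * beta l * s ^ (j + l) * sin ((1 + INR j - INR l) * th)) N) M =
    rsum (fun j => beta j * s ^ j *
      (sin th * (cos (INR j * th) * fre N s th + sin (INR j * th) * fim N s th)
       + cos th * (sin (INR j * th) * fre N s th - cos (INR j * th) * fim N s th))) M).
  { intros M. apply rsum_ext; intros j _.
    unfold fre, fim. generalize N; intros K. induction K as [|K IH]; cbn [rsum]; [ring|].
    rewrite IH, pow_add.
    replace ((1 + INR j - INR K) * th) with (th + (INR j * th - INR K * th)) by ring.
    rewrite sin_plus, cos_minus, sin_minus. ring. }
  rewrite E.
  assert (E2 : forall M A B, rsum (fun j => beta j * s ^ j *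
      (sin th * (cos (INR j * th) * A + sin (INR j * th) * B)
       + cos th * (sin (INR j * th) * A - cos (INR j * th) * B))) M
     = sin th * (fre M s th * A + fim M s th * B) + cos th * (fim M s th * A - fre M s th * B)).
  { intros M A B. unfold fre, fim. induction M as [|M IH]; cbn [rsum]; [ring|]. rewrite IH. ring. }
  rewrite E2. ring.
Qed.

(* Cauchy's theorem on a rectangle; of the two Cauchy-Riemann equations for [P + i Q] only
   [dP/dx = dQ/dy] is needed. *)
Lemma vertical_shift (P Q D : R -> R -> R) (a b d T M : R) :
  a <= b -> 0 < d -> 0 <= T ->
  (forall x y, a - d < x < b + d ->
     is_derive (fun x => P x y) x (D x y) /\ is_derive (fun y => Q x y) y (D x y)
     /\ continuity_2d_pt D x y /\ continuous (P x) y) ->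
  (forall x, a <= x <= b -> Rabs (Q x T) <= M /\ Rabs (Q x (- T)) <= M) ->
  Rabs (RInt (P b) (- T) T - RInt (P a) (- T) T) <= 2 * M * (b - a).
Proof.
  intros Hab Hd HT HD HM.
  rewrite <- (Rabs_pos_eq (b - a)) by lra.
  apply (MVT_abs_le (fun x => RInt (P x) (- T) T) (fun x => Q x T - Q x (- T))).
  - intros x; rewrite Rmin_left, Rmax_right by lra; intros Hx.
    assert (HDl : forall z y, Rabs (z - x) < d ->
       is_derive (fun x => P x y) z (D z y) /\ is_derive (fun y => Q z y) y (D z y)
       /\ continuity_2d_pt D z y /\ continuous (P z) y).
    { intros z y Hz; apply HD. apply Rabs_def2 in Hz; lra. }
    assert (Hx0 : Rabs (x - x) < d) by (rewrite Rminus_diag, Rabs_R0; exact Hd).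
    (* Differentiation under the integral sign turns dP/dx into dQ/dy, whose integral over the
       vertical segment is a difference of boundary values. *)
    assert (E : RInt (fun t => Derive (fun u => P u t) x) (- T) T = Q x T - Q x (- T)).
    { rewrite (RInt_ext _ (fun t => D x t)).
      - apply is_RInt_unique, (is_RInt_derive (Q x)); intros t _.
        + apply HDl; exact Hx0.
        + destruct (HDl x t Hx0) as [_ [_ [HDc _]]].
          apply continuity_pt_filterlim.
          intros e He. destruct (HDc (mkposreal e He)) as [del Hdel].
          exists del; split; [apply cond_pos|]. intros z [_ Hz].
          apply Hdel; [rewrite Rminus_diag, Rabs_R0; apply cond_pos|exact Hz].
      - intros t _. apply is_derive_unique, HDl, Hx0. }
    rewrite <- E.
    apply (is_derive_RInt_param P (- T) T x).
    + exists (mkposreal d Hd). intros z Hz t _. exists (D z t); apply HDl; exact Hz.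
    + intros t _. apply continuity_2d_pt_ext_loc with D; [|apply HDl, Hx0].
      exists (mkposreal d Hd). intros u v Hu _. symmetry; apply is_derive_unique, HDl, Hu.
    + exists (mkposreal d Hd). intros z Hz. apply (ex_RInt_continuous (V := R_CompleteNormedModule)); intros y _.
      apply HDl, Hz.
  - intros x; rewrite Rmin_left, Rmax_right by lra; intros Hx.
    destruct (HM x Hx) as [H1 H2]. unfold Rminus.
    eapply Rle_trans; [apply Rabs_triang|]. rewrite Rabs_Ropp; lra.
Qed.

(* With [w = x + i y], the functions [cont_re] and [cont_im] are the real and imaginary
   parts of [w^(-m) (2 - w)^(-q) exp (lam (w^2 - w^3 / 3))]. *)
Definition cont_log (m q lam x y : R) : R :=
  - m * (ln (x ^ 2 + y ^ 2) / 2) - q * (ln ((2 - x) ^ 2 + y ^ 2) / 2)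
  + lam * (x ^ 2 - y ^ 2 - (x ^ 3 - 3 * x * y ^ 2) / 3).

Definition cont_arg (m q lam x y : R) : R :=
  - m * atan (y / x) + q * atan (y / (2 - x))
  + lam * (2 * x * y - (3 * x ^ 2 * y - y ^ 3) / 3).

Definition cont_re m q lam x y := exp (cont_log m q lam x y) * cos (cont_arg m q lam x y).

Definition cont_im m q lam x y := exp (cont_log m q lam x y) * sin (cont_arg m q lam x y).

Definition cont_logx (m q lam x y : R) : R :=
  - m * (x / (x ^ 2 + y ^ 2)) + q * ((2 - x) / ((2 - x) ^ 2 + y ^ 2))
  + lam * (2 * x - x ^ 2 + y ^ 2).

Definition cont_logy (m q lam x y : R) : R :=
  - m * (y / (x ^ 2 + y ^ 2)) - q * (y / ((2 - x) ^ 2 + y ^ 2))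
  + lam * (2 * x * y - 2 * y).

Definition cont_d (m q lam x y : R) : R :=
  exp (cont_log m q lam x y) *
  (cont_logx m q lam x y * cos (cont_arg m q lam x y)
   + cont_logy m q lam x y * sin (cont_arg m q lam x y)).

Lemma is_derive_exp_cos (u v : R -> R) t du dv :
  is_derive u t du -> is_derive v t dv ->
  is_derive (fun t => exp (u t) * cos (v t)) t (exp (u t) * (du * cos (v t) - dv * sin (v t))).
Proof.
  intros Hu Hv.
  assert (Eu : Derive (fun t : R => u t) t = du) by exact (is_derive_unique _ _ _ Hu).
  assert (Ev : Derive (fun t : R => v t) t = dv) by exact (is_derive_unique _ _ _ Hv).
  auto_derive; [split; [exists du; exact Hu|split; [exists dv; exact Hv|exact I]]|].
  rewrite Eu, Ev. ring.
Qed.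

Lemma is_derive_exp_sin (u v : R -> R) t du dv :
  is_derive u t du -> is_derive v t dv ->
  is_derive (fun t => exp (u t) * sin (v t)) t (exp (u t) * (du * sin (v t) + dv * cos (v t))).
Proof.
  intros Hu Hv.
  assert (Eu : Derive (fun t : R => u t) t = du) by exact (is_derive_unique _ _ _ Hu).
  assert (Ev : Derive (fun t : R => v t) t = dv) by exact (is_derive_unique _ _ _ Hv).
  auto_derive; [split; [exists du; exact Hu|split; [exists dv; exact Hv|exact I]]|].
  rewrite Eu, Ev. ring.
Qed.

(** [cont_log] + i [cont_arg] is holomorphic, and its Cauchy-Riemann equations pass through the
    exponential. The third derivative supplies the continuity of [cont_re] along vertical lines. *)
Lemma cont_partials (m q lam x y : R) : 0 < x < 2 ->
  is_derive (fun x => cont_re m q lam x y) x (cont_d m q lam x y) /\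
  is_derive (fun y => cont_im m q lam x y) y (cont_d m q lam x y) /\
  is_derive (fun y => cont_re m q lam x y) y
    (exp (cont_log m q lam x y) *
     (cont_logy m q lam x y * cos (cont_arg m q lam x y)
      - cont_logx m q lam x y * sin (cont_arg m q lam x y))).
Proof.
  intros Hx.
  assert (H1 : 0 < x ^ 2 + y ^ 2) by nra.
  assert (H2 : 0 < (2 - x) ^ 2 + y ^ 2) by nra.
  assert (Hlx : is_derive (fun x => cont_log m q lam x y) x (cont_logx m q lam x y)).
  { unfold cont_log, cont_logx. auto_derive; [repeat split; nra|]. field; repeat split; nra. }
  assert (Hly : is_derive (fun y => cont_log m q lam x y) y (cont_logy m q lam x y)).
  { unfold cont_log, cont_logy. auto_derive; [repeat split; nra|]. field; repeat split; nra. }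
  assert (Hax : is_derive (fun x => cont_arg m q lam x y) x (- cont_logy m q lam x y)).
  { unfold cont_arg, cont_logy. auto_derive; [repeat split; nra|]. field; repeat split; nra. }
  assert (Hay : is_derive (fun y => cont_arg m q lam x y) y (cont_logx m q lam x y)).
  { unfold cont_arg, cont_logx. auto_derive; [repeat split; nra|]. field; repeat split; nra. }
  unfold cont_re, cont_im, cont_d. split; [|split].
  - evar_last; [exact (is_derive_exp_cos _ _ _ _ _ Hlx Hax)|ringR].
  - evar_last; [exact (is_derive_exp_sin _ _ _ _ _ Hly Hay)|ringR].
  - exact (is_derive_exp_cos _ _ _ _ _ Hly Hay).
Qed.

Lemma continuity_2d_pt_pow (f : R -> R -> R) n x y :
  continuity_2d_pt f x y -> continuity_2d_pt (fun x y => f x y ^ n) x y.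
Proof.
  intros Hf; induction n as [|n IH]; simpl.
  - apply continuity_2d_pt_const.
  - apply continuity_2d_pt_mult; [exact Hf|exact IH].
Qed.

Lemma continuity_2d_pt_deriv1 (g : R -> R) (f : R -> R -> R) x y :
  ex_derive g (f x y) -> continuity_2d_pt f x y -> continuity_2d_pt (fun x y => g (f x y)) x y.
Proof.
  intros Hg Hf. apply (continuity_1d_2d_pt_comp g f); [|exact Hf].
  apply continuity_pt_filterlim.
  apply (ex_derive_continuous (K := R_AbsRing) (V := R_NormedModule)), Hg.
Qed.

Ltac cont2 :=
  repeat first
    [ apply continuity_2d_pt_const | apply continuity_2d_pt_id1 | apply continuity_2d_pt_id2
    | apply continuity_2d_pt_plus | apply continuity_2d_pt_minus | apply continuity_2d_pt_opp
    | apply continuity_2d_pt_mult | apply continuity_2d_pt_pow | apply continuity_2d_pt_inv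
    | match goal with
      | |- continuity_2d_pt (fun x y => ?g _) _ _ => apply (continuity_2d_pt_deriv1 g)
      end ].

Lemma cont_d_continuous (m q lam x y : R) : 0 < x < 2 ->
  continuity_2d_pt (cont_d m q lam) x y.
Proof.
  intros Hx.
  assert (H1 : 0 < x ^ 2 + y ^ 2) by nra.
  assert (H2 : 0 < (2 - x) ^ 2 + y ^ 2) by nra.
  unfold cont_d, cont_log, cont_logx, cont_logy, cont_arg, Rdiv.
  cont2; try lra; try (auto_derive; lra).
Qed.

(** * Estimates of the contour integrals *)

Lemma exp_le_mono x y : x <= y -> exp x <= exp y.
Proof. intros [H| ->]; [left; apply exp_increasing, H|right; reflexivity]. Qed.

(** Here |w| >= x, |2 - w| >= 1 and Re (w^2 - w^3 / 3) = x^2 - x^3 / 3 - (1 - x) y^2: left of the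
    line Re w = 1 the integrand decays like a Gaussian in y. *)
Lemma cont_log_le (m q lam x y : R) : 0 <= m -> 0 <= q -> 0 <= lam -> 0 < x <= 1 ->
  cont_log m q lam x y <= - m * ln x + lam * (x ^ 2 - (1 - x) * y ^ 2).
Proof.
  intros Hm Hq Hl Hx. unfold cont_log.
  assert (H1 : ln x <= ln (x ^ 2 + y ^ 2) / 2).
  { replace (ln x) with (ln (x ^ 2) / 2) by (rewrite ln_pow by lra; simpl; field).
    apply Rmult_le_compat_r; [lra|]. apply ln_le; nra. }
  assert (H2 : 0 <= ln ((2 - x) ^ 2 + y ^ 2) / 2).
  { rewrite <- ln_1. assert (ln 1 <= ln ((2 - x) ^ 2 + y ^ 2)) by (apply ln_le; nra). rewrite ln_1 in *. lra. }
  assert (H3 : x ^ 2 - y ^ 2 - (x ^ 3 - 3 * x * y ^ 2) / 3 <= x ^ 2 - (1 - x) * y ^ 2) by nra.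
  assert (0 <= q * (ln ((2 - x) ^ 2 + y ^ 2) / 2)) by nra.
  assert (m * ln x <= m * (ln (x ^ 2 + y ^ 2) / 2)) by nra.
  assert (lam * (x ^ 2 - y ^ 2 - (x ^ 3 - 3 * x * y ^ 2) / 3) <= lam * (x ^ 2 - (1 - x) * y ^ 2))
    by (apply Rmult_le_compat_l; lra).
  lra.
Qed.

(** These are the horizontal ends of the rectangle. One factor 1 / |w| suffices for the decay,
    because Re (w^2 - w^3 / 3) <= 1 there. *)
Lemma cont_im_far (m q lam x T : R) : 1 <= m -> 0 <= q -> 0 <= lam -> 0 < x <= 1 -> 1 <= T ->
  Rabs (cont_im m q lam x T) <= exp lam / T /\ Rabs (cont_im m q lam x (- T)) <= exp lam / T.
Proof.
  intros Hm Hq Hl Hx HT.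
  assert (E : forall y, y ^ 2 = T ^ 2 -> Rabs (cont_im m q lam x y) <= exp lam / T).
  { intros y Hy. unfold cont_im. rewrite Rabs_mult, (Rabs_pos_eq (exp _)) by (left; apply exp_pos).
    apply Rle_trans with (exp (cont_log m q lam x y) * 1).
    { apply Rmult_le_compat_l; [left; apply exp_pos|apply Rabs_le, SIN_bound]. }
    rewrite Rmult_1_r.
    replace (exp lam / T) with (exp (lam - ln T)).
    2:{ unfold Rminus; rewrite exp_plus, exp_Ropp, exp_ln by lra. reflexivity. }
    apply exp_le_mono. unfold cont_log. rewrite Hy.
    assert (H1 : ln T <= ln (x ^ 2 + T ^ 2) / 2).
    { replace (ln T) with (ln (T ^ 2) / 2) by (rewrite ln_pow by lra; simpl; field).
      apply Rmult_le_compat_r; [lra|]. apply ln_le; nra. }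
    assert (H0 : 0 <= ln T) by (rewrite <- ln_1; apply ln_le; lra).
    assert (H2 : 0 <= ln ((2 - x) ^ 2 + T ^ 2) / 2).
    { assert (ln 1 <= ln ((2 - x) ^ 2 + T ^ 2)) by (apply ln_le; nra). rewrite ln_1 in *. lra. }
    assert (H3 : x ^ 2 - T ^ 2 - (x ^ 3 - 3 * x * T ^ 2) / 3 <= 1) by nra.
    assert (0 <= q * (ln ((2 - x) ^ 2 + T ^ 2) / 2)) by nra.
    assert (1 * ln T <= m * (ln (x ^ 2 + T ^ 2) / 2)) by (apply Rmult_le_compat; lra).
    assert (lam * (x ^ 2 - T ^ 2 - (x ^ 3 - 3 * x * T ^ 2) / 3) <= lam * 1)
      by (apply Rmult_le_compat_l; lra).
    lra. }
  split; apply E; ring.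
Qed.

Lemma cont_re_continuous (m q lam x y : R) : 0 < x < 2 -> continuous (cont_re m q lam x) y.
Proof.
  intros Hx. apply (ex_derive_continuous (K := R_AbsRing) (V := R_NormedModule)).
  eexists; apply (cont_partials m q lam x y Hx).
Qed.

Lemma cont_shift (m q lam c T : R) : 1 <= m -> 0 <= q -> 0 <= lam -> 0 < c <= 1 -> 1 <= T ->
  Rabs (RInt (cont_re m q lam 1) (- T) T - RInt (cont_re m q lam c) (- T) T) <= 2 * exp lam / T.
Proof.
  intros Hm Hq Hl Hc HT.
  eapply Rle_trans.
  - apply (vertical_shift (cont_re m q lam) (cont_im m q lam) (cont_d m q lam) c 1 (c / 2) T (exp lam / T)); try lra.
    + intros x y Hx.
      assert (Hx' : 0 < x < 2) by lra.
      destruct (cont_partials m q lam x y Hx') as [H1 [H2 _]].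
      split; [exact H1|split; [exact H2|split; [apply cont_d_continuous, Hx'|apply cont_re_continuous, Hx']]].
    + intros x Hx. apply cont_im_far; lra.
  - assert (0 < exp lam / T) by (apply Rdiv_lt_0_compat; [apply exp_pos|lra]).
    replace (2 * exp lam / T) with (2 * (exp lam / T)) by (field; lra). nra.
Qed.

(** The Lorentzian serves as majorant in place of Gaussians: its primitive is explicit and its
    integral is bounded uniformly in T. *)
Lemma RInt_lorentz (sig T : R) : 0 < sig -> 0 <= T ->
  ex_RInt (fun y => / (1 + (sig * y) ^ 2)) (- T) T /\
  RInt (fun y => / (1 + (sig * y) ^ 2)) (- T) T <= PI / sig.
Proof.
  intros Hs HT.
  assert (H : is_RInt (fun y => / (1 + (sig * y) ^ 2)) (- T) T
      (minus (atan (sig * T) / sig) (atan (sig * (- T)) / sig))).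
  { apply (is_RInt_derive (fun y => atan (sig * y) / sig)); intros y _.
    - auto_derive; [exact I|]. field. split; [|lra]. nra.
    - apply (ex_derive_continuous (K := R_AbsRing) (V := R_NormedModule)). auto_derive. nra. }
  split; [eexists; exact H|].
  rewrite (is_RInt_unique _ _ _ _ H). unfold minus, plus, opp; simpl.
  replace (sig * - T) with (- (sig * T)) by ring. rewrite atan_opp.
  pose proof (atan_bound (sig * T)).
  apply Rmult_le_reg_r with sig; [exact Hs|]. field_simplify; lra.
Qed.

Lemma exp_lorentz t : 0 <= t -> exp (- t / 2) <= 2 * / (1 + t).
Proof.
  intros Ht. replace (- t / 2) with (- (t / 2)) by field. rewrite exp_Ropp.
  assert (H := exp_ineq1_le (t / 2)).
  apply Rmult_le_reg_r with (exp (t / 2)); [apply exp_pos|]. rewrite Rinv_l by (apply Rgt_not_eq, exp_pos).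
  apply Rmult_le_reg_r with (1 + t); [lra|]. field_simplify; lra.
Qed.

Lemma RInt_abs_le (f g : R -> R) (a b : R) : a <= b ->
  (forall x, continuous f x) -> ex_RInt g a b ->
  (forall x, a <= x <= b -> Rabs (f x) <= g x) ->
  Rabs (RInt f a b) <= RInt g a b.
Proof.
  intros Hab Hf Hg H.
  apply (norm_RInt_le f g a b (RInt f a b) (RInt g a b)).
  - exact Hab.
  - exact H.
  - apply (RInt_correct (V := R_CompleteNormedModule)), (ex_RInt_continuous (V := R_CompleteNormedModule)). intros z _; apply Hf.
  - apply (RInt_correct (V := R_CompleteNormedModule)), Hg.
Qed.

Lemma RInt_scal_R (c : R) (f : R -> R) (a b : R) :
  ex_RInt f a b -> RInt (fun x => c * f x) a b = c * RInt f a b.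
Proof. exact (RInt_scal (V := R_CompleteNormedModule) f a b c). Qed.

(** On Re w = 1 / sigma with lam = k sigma^2 the term lam x^2 of the exponent equals k, |w|^(-m) is
    at most sigma^m, and the Gaussian in y has width of order 1 / sigma. A line further left would
    raise the bound for |w|^(-m) and gain at most the factor e^k. *)
Lemma cont_bound (m : nat) (q k sig T : R) : 0 <= q -> 1 <= k -> 2 <= sig -> 0 <= T ->
  Rabs (RInt (cont_re (INR m) q (k * sig ^ 2) (/ sig)) (- T) T)
  <= sig ^ m * exp k * (2 * PI / sig).
Proof.
  intros Hq Hk Hs HT.
  assert (Hm := pos_INR m).
  assert (Hi : 0 < / sig <= / 2).
  { split; [apply Rinv_0_lt_compat; lra|apply Rinv_le_contravar; lra]. }
  destruct (RInt_lorentz sig T) as [Hex Hle]; [lra|exact HT|].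
  set (C := sig ^ m * exp k * 2).
  assert (HC : 0 < C).
  { unfold C. repeat apply Rmult_lt_0_compat; try lra; [apply pow_lt; lra|apply exp_pos]. }
  apply Rle_trans with (RInt (fun y => C * / (1 + (sig * y) ^ 2)) (- T) T).
  - apply RInt_abs_le; [lra| | |].
    + intros y; apply cont_re_continuous; lra.
    + apply (ex_RInt_scal (V := R_NormedModule) _ _ _ C), Hex.
    + intros y _. unfold cont_re.
      rewrite Rabs_mult, (Rabs_pos_eq (exp _)) by (left; apply exp_pos).
      eapply Rle_trans.
      { apply Rmult_le_compat_l; [left; apply exp_pos|apply Rabs_le, COS_bound]. }
      rewrite Rmult_1_r. unfold C. rewrite Rmult_assoc.
      replace (sig ^ m) with (exp (- INR m * ln (/ sig))).
      2:{ rewrite ln_Rinv by lra. replace (- INR m * - ln sig) with (INR m * ln sig) by ring.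
          rewrite <- ln_pow, exp_ln by (try apply pow_lt; lra). reflexivity. }
      eapply Rle_trans; [|apply Rmult_le_compat_l;
        [apply Rmult_le_pos; left; apply exp_pos|apply exp_lorentz; nra]].
      rewrite <- !exp_plus. apply exp_le_mono.
      eapply Rle_trans; [apply cont_log_le; nra|].
      assert (E : (/ sig) ^ 2 * sig ^ 2 = 1) by (field; lra).
      assert (k * sig ^ 2 * ((/ sig) ^ 2 - (1 - / sig) * y ^ 2) <= k - (sig * y) ^ 2 / 2); [|lra].
      replace (k * sig ^ 2 * ((/ sig) ^ 2 - (1 - / sig) * y ^ 2)) with
        (k * ((/ sig) ^ 2 * sig ^ 2) - k * (1 - / sig) * (sig * y) ^ 2) by ring.
      rewrite E.
      assert (/ 2 <= k * (1 - / sig)) by nra.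
      pose proof (pow2_ge_0 (sig * y)). nra.
  - rewrite (RInt_scal_R _ _ _ _ Hex).
    replace (sig ^ m * exp k * (2 * PI / sig)) with (C * (PI / sig)) by (unfold C; field; lra).
    apply Rmult_le_compat_l; lra.
Qed.

(** Polar form of w = x + i y with ln (x^2 + y^2) / 2 as log |w|. With its inverse it lets factors w
    and 2 - w be absorbed into the exponents m and q. *)
Lemma polar_half_log (x y : R) : 0 < x ->
  exp (ln (x ^ 2 + y ^ 2) / 2) * cos (atan (y / x)) = x /\
  exp (ln (x ^ 2 + y ^ 2) / 2) * sin (atan (y / x)) = y.
Proof.
  intros Hx.
  assert (Hr : 0 < x ^ 2 + y ^ 2) by nra.
  assert (E : exp (ln (x ^ 2 + y ^ 2) / 2) = x * sqrt (1 + (y / x) ^ 2)).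
  { replace (x ^ 2 + y ^ 2) with (x ^ 2 * (1 + (y / x) ^ 2)) by (field; lra).
    assert (0 < 1 + (y / x) ^ 2) by (pose proof (pow2_ge_0 (y / x)); lra).
    rewrite ln_mult, ln_pow by (try apply pow_lt; lra).
    rewrite <- (exp_ln (sqrt (1 + (y / x) ^ 2))) by (apply sqrt_lt_R0; lra).
    rewrite <- (exp_ln x) at 3 by exact Hx. rewrite <- exp_plus. f_equal.
    rewrite <- (sqrt_sqrt (1 + (y / x) ^ 2)) at 1 by lra.
    rewrite ln_mult by (apply sqrt_lt_R0; lra). simpl. field. }
  rewrite E, cos_atan, sin_atan. rewrite Rsqr_pow2.
  assert (0 < sqrt (1 + (y / x) ^ 2)) by (apply sqrt_lt_R0; pose proof (pow2_ge_0 (y / x)); lra).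
  split; field; repeat split; lra.
Qed.

Lemma polar_half_log_inv (x y : R) : 0 < x ->
  exp (- (ln (x ^ 2 + y ^ 2) / 2)) * cos (atan (y / x)) = x / (x ^ 2 + y ^ 2) /\
  exp (- (ln (x ^ 2 + y ^ 2) / 2)) * sin (atan (y / x)) = y / (x ^ 2 + y ^ 2).
Proof.
  intros Hx.
  assert (Hr : 0 < x ^ 2 + y ^ 2) by nra.
  destruct (polar_half_log x y Hx) as [H1 H2].
  assert (E : exp (- (ln (x ^ 2 + y ^ 2) / 2)) = exp (ln (x ^ 2 + y ^ 2) / 2) / (x ^ 2 + y ^ 2)).
  { transitivity (exp (ln (x ^ 2 + y ^ 2) / 2) * exp (- ln (x ^ 2 + y ^ 2))).
    - rewrite <- exp_plus. f_equal; field.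
    - rewrite exp_Ropp, exp_ln by exact Hr. reflexivity. }
  rewrite E. split.
  - transitivity (exp (ln (x ^ 2 + y ^ 2) / 2) * cos (atan (y / x)) / (x ^ 2 + y ^ 2));
      [unfold Rdiv; ring|rewrite H1; reflexivity].
  - transitivity (exp (ln (x ^ 2 + y ^ 2) / 2) * sin (atan (y / x)) / (x ^ 2 + y ^ 2));
      [unfold Rdiv; ring|rewrite H2; reflexivity].
Qed.

(** The derivative of w^2 - w^3 / 3 is w (2 - w), so differentiating the exponential lowers both
    exponents by one and all three terms stay within the family [cont_re]. *)
Lemma cont_d_parts (a b lam x y : R) : 0 < x < 2 ->
  cont_d (a + 1) (b + 1) lam x y =
    - (a + 1) * cont_re (a + 2) (b + 1) lam x y
    + (b + 1) * cont_re (a + 1) (b + 2) lam x y + lam * cont_re a b lam x y.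
Proof.
  intros Hx.
  destruct (polar_half_log x y) as [A1 A2]; [lra|].
  destruct (polar_half_log (2 - x) y) as [B1 B2]; [lra|].
  destruct (polar_half_log_inv x y) as [C1 C2]; [lra|].
  destruct (polar_half_log_inv (2 - x) y) as [D1 D2]; [lra|].
  unfold cont_re, cont_d.
  set (l1 := ln (x ^ 2 + y ^ 2) / 2) in *. set (l2 := ln ((2 - x) ^ 2 + y ^ 2) / 2) in *.
  set (al := atan (y / x)) in *. set (be := atan (y / (2 - x))) in *.
  set (E := cont_log (a + 1) (b + 1) lam x y). set (ph := cont_arg (a + 1) (b + 1) lam x y).
  replace (cont_log (a + 2) (b + 1) lam x y) with (E + - l1) by (unfold E, cont_log; fold l1 l2; ring).
  replace (cont_log (a + 1) (b + 2) lam x y) with (E + - l2) by (unfold E, cont_log; fold l1 l2; ring).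
  replace (cont_log a b lam x y) with (E + l1 + l2) by (unfold E, cont_log; fold l1 l2; ring).
  replace (cont_arg (a + 2) (b + 1) lam x y) with (ph - al) by (unfold ph, cont_arg; fold al be; ring).
  replace (cont_arg (a + 1) (b + 2) lam x y) with (ph + be) by (unfold ph, cont_arg; fold al be; ring).
  replace (cont_arg a b lam x y) with (ph + al - be) by (unfold ph, cont_arg; fold al be; ring).
  rewrite cos_minus, cos_plus, cos_minus, sin_plus, cos_plus, !exp_plus.
  transitivity (exp E * (- (a + 1) * (cos ph * (exp (- l1) * cos al) + sin ph * (exp (- l1) * sin al))
     + (b + 1) * (cos ph * (exp (- l2) * cos be) - sin ph * (exp (- l2) * sin be))
     + lam * ((cos ph * (exp l1 * cos al) - sin ph * (exp l1 * sin al)) * (exp l2 * cos be)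
        + (sin ph * (exp l1 * cos al) + cos ph * (exp l1 * sin al)) * (exp l2 * sin be)))).
  2: ring.
  rewrite A1, A2, B1, B2, C1, C2, D1, D2. unfold cont_logx, cont_logy.
  field. split; nra.
Qed.

Lemma cont_parts (a b lam c T : R) : 0 < c < 2 -> 0 <= T ->
  - (a + 1) * RInt (cont_re (a + 2) (b + 1) lam c) (- T) T
  + (b + 1) * RInt (cont_re (a + 1) (b + 2) lam c) (- T) T
  + lam * RInt (cont_re a b lam c) (- T) T
  = cont_im (a + 1) (b + 1) lam c T - cont_im (a + 1) (b + 1) lam c (- T).
Proof.
  intros Hc HT.
  assert (Hex : forall m q, is_RInt (cont_re m q lam c) (- T) T (RInt (cont_re m q lam c) (- T) T)).
  { intros m q. apply (RInt_correct (V := R_CompleteNormedModule)), (ex_RInt_continuous (V := R_CompleteNormedModule)).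
    intros y _; apply cont_re_continuous, Hc. }
  assert (H1 : is_RInt (cont_d (a + 1) (b + 1) lam c) (- T) T
     (- (a + 1) * RInt (cont_re (a + 2) (b + 1) lam c) (- T) T
  + (b + 1) * RInt (cont_re (a + 1) (b + 2) lam c) (- T) T
  + lam * RInt (cont_re a b lam c) (- T) T)).
  { eapply is_RInt_ext.
    { intros y _. symmetry. apply cont_d_parts, Hc. }
    apply (is_RInt_plus (V := R_NormedModule)); [apply (is_RInt_plus (V := R_NormedModule))|];
      apply (is_RInt_scal (V := R_NormedModule)), Hex. }
  assert (H2 : is_RInt (cont_d (a + 1) (b + 1) lam c) (- T) T
     (minus (cont_im (a + 1) (b + 1) lam c T) (cont_im (a + 1) (b + 1) lam c (- T)))).
  { apply (is_RInt_derive (cont_im (a + 1) (b + 1) lam c)).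
    - intros y _. apply cont_partials, Hc.
    - intros y _. apply continuity_pt_filterlim.
      intros e He. destruct (cont_d_continuous (a + 1) (b + 1) lam c y Hc (mkposreal e He)) as [del Hdel].
      exists del; split; [apply cond_pos|]. intros z [_ Hz].
      apply Hdel; [rewrite Rminus_diag, Rabs_R0; apply cond_pos|exact Hz]. }
  rewrite <- (is_RInt_unique _ _ _ _ H1), (is_RInt_unique _ _ _ _ H2). reflexivity.
Qed.

(** The exponent w^2 - w^3 / 3 is written without logarithm and arctangent, so that for m = q = 0
    the line may reach Re w = 0, where [cont_arg] divides by zero. *)
Definition cubic_re (x y : R) := x ^ 2 - y ^ 2 - (x ^ 3 - 3 * x * y ^ 2) / 3.

Definition cubic_im (x y : R) := 2 * x * y - (3 * x ^ 2 * y - y ^ 3) / 3.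

Lemma cont_re_00 lam x y :
  cont_re 0 0 lam x y = exp (lam * cubic_re x y) * cos (lam * cubic_im x y).
Proof.
  unfold cont_re, cont_log, cont_arg, cubic_re, cubic_im. f_equal; f_equal; ring.
Qed.

(** Without poles the line can be moved to Re w = 0. There w^2 - w^3 / 3 = - y^2 + i y^3 / 3, and
    what remains is a Gaussian with a phase that is nearly constant over its width. *)
Lemma cont_shift_00 (lam c T : R) : 1 <= lam -> 0 < c <= 1 / 2 -> 1 <= T ->
  Rabs (RInt (cont_re 0 0 lam c) (- T) T
    - RInt (fun y => exp (- lam * y ^ 2) * cos (lam * y ^ 3 / 3)) (- T) T) <= 2 * exp lam / T.
Proof.
  intros Hl Hc HT.
  set (P := fun x y => exp (lam * cubic_re x y) * cos (lam * cubic_im x y)).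
  set (Q := fun x y => exp (lam * cubic_re x y) * sin (lam * cubic_im x y)).
  set (D := fun x y => exp (lam * cubic_re x y) *
    (lam * (2 * x - x ^ 2 + y ^ 2) * cos (lam * cubic_im x y)
     + lam * (2 * x * y - 2 * y) * sin (lam * cubic_im x y))).
  rewrite (RInt_ext (cont_re 0 0 lam c) (P c)) by (intros; apply cont_re_00).
  rewrite (RInt_ext (fun y => exp (- lam * y ^ 2) * cos (lam * y ^ 3 / 3)) (P 0)).
  2:{ intros y _. unfold P, cubic_re, cubic_im. f_equal; f_equal; field. }
  eapply Rle_trans.
  - apply (vertical_shift P Q D 0 c 1 T (exp lam / T)); try lra.
    + intros x y Hx.
      assert (Hax : is_derive (fun x => lam * cubic_re x y) x (lam * (2 * x - x ^ 2 + y ^ 2))).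
      { unfold cubic_re. auto_derive; [exact I|]. field. }
      assert (Hbx : is_derive (fun x => lam * cubic_im x y) x (- (lam * (2 * x * y - 2 * y)))).
      { unfold cubic_im. auto_derive; [exact I|]. field. }
      assert (Hay : is_derive (fun y => lam * cubic_re x y) y (lam * (2 * x * y - 2 * y))).
      { unfold cubic_re. auto_derive; [exact I|]. field. }
      assert (Hby : is_derive (fun y => lam * cubic_im x y) y (lam * (2 * x - x ^ 2 + y ^ 2))).
      { unfold cubic_im. auto_derive; [exact I|]. field. }
      split; [|split; [|split]].
      * evar_last; [exact (is_derive_exp_cos _ _ _ _ _ Hax Hbx)|unfold D; ringR].
      * evar_last; [exact (is_derive_exp_sin _ _ _ _ _ Hay Hby)|unfold D; ringR].
      * unfold D, cubic_re, cubic_im, Rdiv. cont2; try lra; auto_derive; lra.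
      * unfold P, cubic_re, cubic_im.
        apply (ex_derive_continuous (K := R_AbsRing) (V := R_NormedModule)). auto_derive. exact I.
    + intros x Hx.
      assert (E : forall y, y ^ 2 = T ^ 2 -> Rabs (Q x y) <= exp lam / T).
      { intros y Hy. unfold Q. rewrite Rabs_mult, (Rabs_pos_eq (exp _)) by (left; apply exp_pos).
        eapply Rle_trans.
        { apply Rmult_le_compat_l; [left; apply exp_pos|apply Rabs_le, SIN_bound]. }
        rewrite Rmult_1_r.
        apply Rle_trans with (exp (lam + - (T ^ 2 / 2))).
        { apply exp_le_mono. unfold cubic_re. rewrite Hy.
          assert (x ^ 2 - T ^ 2 - (x ^ 3 - 3 * x * T ^ 2) / 3 <= 1 - T ^ 2 / 2).
          { assert (0 <= x ^ 3) by (apply pow_le; lra). nra. }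
          apply Rle_trans with (lam * (1 - T ^ 2 / 2)); [apply Rmult_le_compat_l; lra|].
          nra. }
        rewrite exp_plus, exp_Ropp. unfold Rdiv. apply Rmult_le_compat_l; [left; apply exp_pos|].
        apply Rinv_le_contravar; [lra|].
        assert (H := exp_ineq1_le (T ^ 2 * / 2)). nra. }
      split; apply E; ring.
  - assert (0 < exp lam / T) by (apply Rdiv_lt_0_compat; [apply exp_pos|lra]).
    replace (2 * exp lam / T) with (2 * (exp lam / T)) by (field; lra). nra.
Qed.

(** * Lower bound for the dominant integral *)

Lemma cos_ge_quadratic u : 1 - u ^ 2 / 2 <= cos u.
Proof.
  replace u with (2 * (u / 2)) at 2 by field. rewrite cos_2a_sin.
  assert (H : Rabs (sin (u / 2)) <= Rabs (u / 2)).
  { destruct (MVT_gen sin 0 (u / 2) cos) as [c [_ Hc]].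
    - intros; auto_derive; [exact I|ring].
    - intros; apply continuity_pt_filterlim, (ex_derive_continuous (K := R_AbsRing) (V := R_NormedModule)). auto_derive; exact I.
    - rewrite sin_0, !Rminus_0_r in Hc. rewrite Hc, Rabs_mult.
      rewrite <- (Rmult_1_l (Rabs (u / 2))) at 2.
      apply Rmult_le_compat_r; [apply Rabs_pos|apply Rabs_le, COS_bound]. }
  apply Rsqr_le_abs_1 in H. unfold Rsqr in H. nra.
Qed.

Lemma exp_minus_cube t : 0 <= t -> t ^ 3 * exp (- t) <= 30 * / (1 + t).
Proof.
  intros Ht. rewrite exp_Ropp.
  assert (H : t ^ 3 * (1 + t) <= 30 * exp t).
  { assert (E : forall n, t ^ n / INR (fact n) <= exp t).
    { intros n. eapply Rle_trans; [|apply (exp_ge_taylor t n Ht)].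
      destruct n as [|n]; [simpl; lra|].
      rewrite tech5. assert (0 <= sum_f_R0 (fun k => t ^ k / INR (fact k)) n); [|lra].
      apply cond_pos_sum. intros k. apply Rmult_le_pos; [apply pow_le, Ht|].
      left; apply Rinv_0_lt_compat, INR_fact_lt_0. }
    assert (E3 := E 3%nat). assert (E4 := E 4%nat).
    change (fact 3) with 6%nat in E3. change (fact 4) with 24%nat in E4.
    rewrite INR_IZR_INZ in E3, E4. simpl IZR in E3, E4.
    replace (t ^ 3 * (1 + t)) with (6 * (t ^ 3 / 6) + 24 * (t ^ 4 / 24)) by field. lra. }
  apply Rmult_le_reg_r with (exp t * (1 + t)).
  { apply Rmult_lt_0_compat; [apply exp_pos|lra]. }
  assert (exp t <> 0) by (apply Rgt_not_eq, exp_pos).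
  field_simplify; [|lra|lra]. nra.
Qed.

(** The Gaussian alone contributes at least 2 / (e sigma), from the interval |y| <= 1 / sigma. By
    cos u >= 1 - u^2 / 2 the phase costs only O(sigma^(-3)), because (sigma y)^6 times the Gaussian
    is bounded by a Lorentzian. *)
Lemma airy_lower (sig T : R) : 10 <= sig -> 1 <= T ->
  / (2 * sig) <= RInt (fun y => exp (- sig ^ 2 * y ^ 2) * cos (sig ^ 2 * y ^ 3 / 3)) (- T) T.
Proof.
  intros Hs HT.
  set (g := fun y => exp (- sig ^ 2 * y ^ 2)).
  set (k := fun y => / (1 + (sig * y) ^ 2)).
  (* 5 / 3 = 30 / 18: the 30 comes from [exp_minus_cube], the 1 / 18 from half the square of the
     phase sigma^2 y^3 / 3. *)
  set (C := 5 / 3 / sig ^ 2).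
  assert (HC : 0 < C) by (unfold C; apply Rdiv_lt_0_compat; [lra|apply pow_lt; lra]).
  destruct (RInt_lorentz sig T) as [Hex Hle]; [lra|lra|]. fold k in Hex, Hle.
  assert (Hgc : forall y, continuous g y).
  { intros y; apply (ex_derive_continuous (K := R_AbsRing) (V := R_NormedModule)). unfold g; auto_derive; exact I. }
  assert (Hge : forall a b, ex_RInt g a b).
  { intros a b; apply (ex_RInt_continuous (V := R_CompleteNormedModule)); intros; apply Hgc. }
  assert (H1 : RInt g (- T) T - C * RInt k (- T) T <= 
     RInt (fun y => exp (- sig ^ 2 * y ^ 2) * cos (sig ^ 2 * y ^ 3 / 3)) (- T) T).
  { rewrite <- (RInt_scal_R C k _ _ Hex).
    assert (E := RInt_minus (V := R_CompleteNormedModule) g (fun y => C * k y) (- T) T (Hge _ _)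
       (ex_RInt_scal (V := R_NormedModule) _ _ _ C Hex)).
    change (RInt (fun y => g y - C * k y) (- T) T = RInt g (- T) T - RInt (fun y => C * k y) (- T) T) in E.
    rewrite <- E.
    apply RInt_le; [lra| | |].
    - apply (ex_RInt_minus (V := R_NormedModule)); [apply Hge|apply (ex_RInt_scal (V := R_NormedModule)), Hex].
    - apply (ex_RInt_continuous (V := R_CompleteNormedModule)); intros y _.
      apply (ex_derive_continuous (K := R_AbsRing) (V := R_NormedModule)). auto_derive; exact I.
    - intros y _. unfold g, k.
      assert (Hcube := exp_minus_cube ((sig * y) ^ 2) (pow2_ge_0 _)).
      replace (- (sig * y) ^ 2) with (- sig ^ 2 * y ^ 2) in Hcube by ring.
      set (e := exp (- sig ^ 2 * y ^ 2)) in *.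
      assert (He : 0 < e) by apply exp_pos.
      assert (Hcos := cos_ge_quadratic (sig ^ 2 * y ^ 3 / 3)).
      apply Rle_trans with (e * (1 - (sig ^ 2 * y ^ 3 / 3) ^ 2 / 2)); [|apply Rmult_le_compat_l; lra].
      replace (e * (1 - (sig ^ 2 * y ^ 3 / 3) ^ 2 / 2)) with
        (e - / 18 / sig ^ 2 * (((sig * y) ^ 2) ^ 3 * e)) by (field; lra).
      unfold C.
      assert (/ 18 / sig ^ 2 * (((sig * y) ^ 2) ^ 3 * e) <= / 18 / sig ^ 2 * (30 * / (1 + (sig * y) ^ 2))).
      { apply Rmult_le_compat_l; [|exact Hcube]. left; apply Rdiv_lt_0_compat; [lra|apply pow_lt; lra]. }
      replace (5 / 3 / sig ^ 2 * / (1 + (sig * y) ^ 2)) with (/ 18 / sig ^ 2 * (30 * / (1 + (sig * y) ^ 2))).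
      2:{ field. split; [nra|lra]. }
      lra. }
  assert (H2 : 2 / sig * exp (- 1) <= RInt g (- T) T).
  { assert (Hi : 0 < / sig <= 1).
    { split; [apply Rinv_0_lt_compat; lra|]. rewrite <- Rinv_1. apply Rinv_le_contravar; lra. }
    assert (Hp : forall a b, a <= b -> 0 <= RInt g a b).
    { intros a b Hab. apply RInt_ge_0; [exact Hab|apply Hge|]. intros; left; apply exp_pos. }
    rewrite <- (RInt_Chasles (V := R_CompleteNormedModule) g (- T) (- / sig) T (Hge _ _) (Hge _ _)).
    rewrite <- (RInt_Chasles (V := R_CompleteNormedModule) g (- / sig) (/ sig) T (Hge _ _) (Hge _ _)).
    unfold plus; simpl.
    assert (P1 := Hp (- T) (- / sig)). assert (P2 := Hp (/ sig) T).
    assert (2 / sig * exp (- 1) <= RInt g (- / sig) (/ sig)); [|lra].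
    replace (2 / sig * exp (- 1)) with (RInt (fun _ => exp (- 1)) (- / sig) (/ sig)).
    2:{ rewrite (RInt_const (V := R_CompleteNormedModule)). unfold scal; simpl; unfold mult; simpl. field; lra. }
    apply RInt_le; [lra|apply (ex_RInt_const (V := R_NormedModule))|apply Hge|].
    intros y Hy. unfold g. apply exp_le_mono.
    assert (sig ^ 2 * y ^ 2 <= 1); [|lra].
    assert (y ^ 2 <= (/ sig) ^ 2) by nra.
    replace 1 with (sig ^ 2 * (/ sig) ^ 2) by (field; lra).
    apply Rmult_le_compat_l; [apply pow2_ge_0|assumption]. }
  assert (He : / 3 <= exp (- 1)).
  { replace (-1) with (Ropp 1) by lra. rewrite exp_Ropp. apply Rinv_le_contravar; [apply exp_pos|apply exp_le_3]. }
  assert (Hpi : PI <= 4) by (apply PI_4).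
  assert (H3 : C * RInt k (- T) T <= C * (PI / sig)) by (apply Rmult_le_compat_l; lra).
  assert (H4 : C * (PI / sig) <= / sig * (/ 10)).
  { unfold C. apply Rmult_le_reg_r with (sig ^ 3); [apply pow_lt; lra|]. field_simplify; [|lra|lra]. nra. }
  assert (H5 : 2 / sig * / 3 <= 2 / sig * exp (- 1)).
  { apply Rmult_le_compat_l; [left; apply Rdiv_lt_0_compat; lra|exact He]. }
  assert (0 < / sig) by (apply Rinv_0_lt_compat; lra).
  unfold Rdiv in *. rewrite Rinv_mult. lra.
Qed.

(* Integrating by parts on the segment [Re w = 1/sig]:
   3 I(4,2) = 3 I(2,4) + 2 lam I(1,2) + lam^2 I(0,0) + boundary terms. *)
Lemma main_term_lower (sig T : R) : 1000 <= sig -> 1 <= T ->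
  sig ^ 3 / 10 - 10 * sig ^ 4 * exp (sig ^ 2) / T <= RInt (cont_re 4 2 (sig ^ 2) 1) (- T) T.
Proof.
  intros Hs HT. set (lam := sig ^ 2) in *.
  assert (Hl : 1 <= lam) by (unfold lam; nra).
  assert (Hi : 0 < / sig <= / 1000).
  { split; [apply Rinv_0_lt_compat; lra|apply Rinv_le_contravar; lra]. }
  set (c := / sig) in *.
  (* The instances (1, 2) and (2, 1) are added, which cancels I(3,3); the instance (0, 0) then
     expresses I(2,1) by I(1,2) and lam I(0,0). *)
  assert (P0 := cont_parts 0 0 lam c T ltac:(lra) ltac:(lra)).
  assert (P12 := cont_parts 1 2 lam c T ltac:(lra) ltac:(lra)).
  assert (P21 := cont_parts 2 1 lam c T ltac:(lra) ltac:(lra)).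
  replace (0 + 1) with 1 in P0 by ring. replace (0 + 2) with 2 in P0 by ring.
  replace (1 + 1) with 2 in P12 by ring. replace (1 + 2) with 3 in P12 by ring.
  replace (2 + 1) with 3 in P12 by ring. replace (2 + 2) with 4 in P12 by ring.
  replace (1 + 1) with 2 in P21 by ring. replace (1 + 2) with 3 in P21 by ring.
  replace (2 + 1) with 3 in P21 by ring. replace (2 + 2) with 4 in P21 by ring.
  assert (F0 := cont_im_far 1 1 lam c T ltac:(lra) ltac:(lra) ltac:(lra) ltac:(lra) HT).
  assert (F12 := cont_im_far 2 3 lam c T ltac:(lra) ltac:(lra) ltac:(lra) ltac:(lra) HT).
  assert (F21 := cont_im_far 3 2 lam c T ltac:(lra) ltac:(lra) ltac:(lra) ltac:(lra) HT).
  assert (S42 := cont_shift 4 2 lam c T ltac:(lra) ltac:(lra) ltac:(lra) ltac:(lra) HT).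
  assert (S00 := cont_shift_00 lam c T ltac:(lra) ltac:(lra) HT).
  assert (B24 := cont_bound 2 4 1 sig T ltac:(lra) ltac:(lra) ltac:(lra) ltac:(lra)).
  assert (B12 := cont_bound 1 2 1 sig T ltac:(lra) ltac:(lra) ltac:(lra) ltac:(lra)).
  rewrite Rmult_1_l in B24, B12. fold lam c in B24, B12.
  change (INR 2) with 2 in B24. change (INR 1) with 1 in B12.
  assert (A := airy_lower sig T ltac:(lra) HT). fold lam in A.
  set (e := exp lam / T) in *.
  replace (2 * exp lam / T) with (2 * e) in S42, S00 by (unfold e; field; lra).
  replace (10 * sig ^ 4 * exp lam / T) with (10 * lam ^ 2 * e) by (unfold e, lam; field; lra).
  assert (He : 0 < e) by (apply Rdiv_lt_0_compat; [apply exp_pos|lra]).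
  set (I00 := RInt (cont_re 0 0 lam c) (- T) T) in *.
  set (I24 := RInt (cont_re 2 4 lam c) (- T) T) in *.
  set (I12 := RInt (cont_re 1 2 lam c) (- T) T) in *.
  set (I21 := RInt (cont_re 2 1 lam c) (- T) T) in *.
  set (I33 := RInt (cont_re 3 3 lam c) (- T) T) in *.
  set (I42 := RInt (cont_re 4 2 lam c) (- T) T) in *.
  set (J42 := RInt (cont_re 4 2 lam 1) (- T) T) in *.
  set (A0 := RInt (fun y => exp (- lam * y ^ 2) * cos (lam * y ^ 3 / 3)) (- T) T) in *.
  destruct F0 as [F0 F0']. destruct F12 as [F12 F12']. destruct F21 as [F21 F21'].
  apply Rabs_le_between in F0, F0', F12, F12', F21, F21', S42, S00, B24, B12.
  assert (Hpi : 0 < PI <= 4) by (split; [apply PI_RGT_0|apply PI_4]).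
  assert (He1 : exp 1 <= 3) by apply exp_le_3.
  assert (Hep : 0 < exp 1 * PI <= 12) by (pose proof (exp_pos 1); split; nra).
  assert (B24' : - (24 * sig) <= I24).
  { apply Rle_trans with (- (lam * exp 1 * (2 * PI / sig))); [|lra].
    replace (lam * exp 1 * (2 * PI / sig)) with (2 * sig * (exp 1 * PI)) by (unfold lam; field; lra). nra. }
  assert (B12' : - 24 <= I12).
  { apply Rle_trans with (- (sig ^ 1 * exp 1 * (2 * PI / sig))); [|lra].
    replace (sig ^ 1 * exp 1 * (2 * PI / sig)) with (2 * (exp 1 * PI)) by (field; lra). nra. }
  assert (A' : sig ^ 3 / 2 - 2 * lam ^ 2 * e <= lam ^ 2 * I00).
  { replace (sig ^ 3 / 2) with (lam ^ 2 * (/ (2 * sig))) by (unfold lam; field; lra).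
    replace (lam ^ 2 * / (2 * sig) - 2 * lam ^ 2 * e) with (lam ^ 2 * (/ (2 * sig) - 2 * e)) by ring.
    apply Rmult_le_compat_l; [apply pow2_ge_0|lra]. }
  set (d0 := cont_im 1 1 lam c T - cont_im 1 1 lam c (- T)) in *.
  set (d12 := cont_im 2 3 lam c T - cont_im 2 3 lam c (- T)) in *.
  set (d21 := cont_im 3 2 lam c T - cont_im 3 2 lam c (- T)) in *.
  assert (E : 3 * I42 = 3 * I24 + 2 * lam * I12 + lam ^ 2 * I00 - d21 - d12 - lam * d0) by nra.
  assert (D1 : - 2 * e <= - d12) by (unfold d12; lra).
  assert (D2 : - 2 * e <= - d21) by (unfold d21; lra).
  assert (D0 : - 2 * lam * e <= - (lam * d0)).
  { assert (d0 <= 2 * e) by (unfold d0; lra). nra. }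
  assert (G : lam * - 24 <= lam * I12) by (apply Rmult_le_compat_l; lra).
  assert (K1 : lam <= lam ^ 2) by nra.
  assert (K2 : lam * e <= lam ^ 2 * e) by (apply Rmult_le_compat_r; lra).
  assert (K3 : e <= lam ^ 2 * e) by nra.
  (* I(2,4) = O(sigma) and lam I(1,2) = O(sigma^2) are small against lam^2 I(0,0) >= sigma^3 / 2. Up
     to boundary terms 3 I(4,2) >= (1/2 - 1/5) sigma^3, whence the factor 1 / 10. *)
  assert (K4 : 48 * lam + 72 * sig <= sig ^ 3 / 5).
  { unfold lam. nra. }
  lra.
Qed.

(* Along the unperturbed loop, in the variable [z = sinh t]: [sdist] is [eps^2 X^2] and
   [phase] is [theta - theta0]. *)
Definition sdist (eps z : R) : R := 2 * eps ^ 2 / (1 + z ^ 2).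

Definition phase (eps z : R) : R := 2 * atan z - / (2 * eps ^ 3) * (z + z ^ 3 / 3).

Definition osc (eps : R) (n : nat) (k T : R) : R :=
  RInt (fun z => sdist eps z ^ n * cos (k * phase eps z)) (- T) T.

(** The integral is cut off at T. All estimates carry explicit O(1 / T) errors, so the improper
    integral is never formed. *)
Definition melnikov (eps th T : R) : R :=
  RInt (fun z => sdist eps z * (sin (th + phase eps z) *
     (/ sqrt (1 + sdist eps z ^ 2 - 2 * sdist eps z * cos (th + phase eps z)) ^ 3 - 1))) (- T) T.

(** * Harmonics of the Melnikov integral *)

Lemma continuous_of_ex_derive (f : R -> R) x : ex_derive f x -> continuous f x.
Proof. exact (ex_derive_continuous (K := R_AbsRing) (V := R_NormedModule) f x). Qed.

Lemma ex_RInt_of_continuous (f : R -> R) a b : (forall x, continuous f x) -> ex_RInt f a b.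
Proof. intros H; apply (ex_RInt_continuous (V := R_CompleteNormedModule)); intros; apply H. Qed.

Lemma RInt_ext_R (f g : R -> R) a b : (forall x, f x = g x) -> RInt f a b = RInt g a b.
Proof. intros H; apply (RInt_ext (V := R_CompleteNormedModule)); intros; apply H. Qed.

Lemma RInt_plus_R (f g : R -> R) a b : ex_RInt f a b -> ex_RInt g a b ->
  RInt (fun x => f x + g x) a b = RInt f a b + RInt g a b.
Proof. exact (RInt_plus (V := R_CompleteNormedModule) f g a b). Qed.

Lemma sdist_range eps z : 0 < eps <= 1 / 4 -> 0 < sdist eps z <= 1 / 4.
Proof.
  intros He. unfold sdist. assert (0 <= z ^ 2) by apply pow2_ge_0.
  split; [apply Rdiv_lt_0_compat; nra|].
  apply Rmult_le_reg_r with (1 + z ^ 2); [lra|]. unfold Rdiv at 1. rewrite Rmult_assoc, Rinv_l by lra. nra.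
Qed.

Lemma ex_derive_sdist eps z : ex_derive (sdist eps) z.
Proof. unfold sdist; auto_derive. nra. Qed.

Lemma ex_derive_phase eps z : ex_derive (phase eps) z.
Proof. unfold phase; auto_derive. exact I. Qed.

Lemma sdist_opp eps z : sdist eps (- z) = sdist eps z.
Proof. unfold sdist. replace ((- z) ^ 2) with (z ^ 2) by ring. reflexivity. Qed.

Lemma phase_opp eps z : phase eps (- z) = - phase eps z.
Proof. unfold phase. rewrite atan_opp. replace ((- z) ^ 3) with (- z ^ 3) by ring. unfold Rdiv; ring. Qed.

Lemma RInt_odd (f : R -> R) T : (forall x, continuous f x) -> (forall x, f (- x) = - f x) ->
  RInt f (- T) T = 0.
Proof.
  intros Hc Ho.
  assert (E := RInt_comp_lin (V := R_CompleteNormedModule) f (-1) 0 (- T) T).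
  replace (-1 * - T + 0) with T in E by ring. replace (-1 * T + 0) with (- T) in E by ring.
  assert (H := E (ex_RInt_of_continuous f _ _ Hc)).
  rewrite (RInt_ext _ f) in H.
  - assert (S := opp_RInt_swap (V := R_CompleteNormedModule) f (- T) T (ex_RInt_of_continuous f _ _ Hc)).
    change (- RInt f (- T) T = RInt f T (- T)) in S. lra.
  - intros x _. replace (-1 * x + 0) with (- x) by ring. rewrite Ho.
    unfold scal; simpl; unfold mult; simpl; ring.
Qed.

(** [sdist] is even and [phase] is odd in z, so in the addition formula the part with the sine of
    the phase integrates to zero. *)
Lemma RInt_osc_sin eps n k th T :
  RInt (fun z => sdist eps z ^ n * sin (k * (th + phase eps z))) (- T) T = sin (k * th) * osc eps n k T.
Proof.
  assert (Hc1 : forall z, continuous (fun z => sdist eps z ^ n * cos (k * phase eps z)) z).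
  { intros z. apply continuous_of_ex_derive. auto_derive.
    split; [apply ex_derive_sdist|split; [apply ex_derive_phase|exact I]]. }
  assert (Hc2 : forall z, continuous (fun z => sdist eps z ^ n * sin (k * phase eps z)) z).
  { intros z. apply continuous_of_ex_derive. auto_derive.
    split; [apply ex_derive_sdist|split; [apply ex_derive_phase|exact I]]. }
  rewrite (RInt_ext_R _ (fun z => sin (k * th) * (sdist eps z ^ n * cos (k * phase eps z))
     + cos (k * th) * (sdist eps z ^ n * sin (k * phase eps z)))).
  2:{ intros z. rewrite Rmult_plus_distr_l, sin_plus. ring. }
  rewrite RInt_plus_R by
    (apply (ex_RInt_scal (V := R_NormedModule)), ex_RInt_of_continuous; assumption).
  rewrite !RInt_scal_R by (apply ex_RInt_of_continuous; assumption).
  rewrite (RInt_odd (fun z => sdist eps z ^ n * sin (k * phase eps z))).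
  - unfold osc. ringR.
  - exact Hc2.
  - intros z. rewrite sdist_opp, phase_opp. replace (k * - phase eps z) with (- (k * phase eps z)) by ring.
    rewrite sin_neg. ring.
Qed.

Lemma osc_opp eps n k T : osc eps n (- k) T = osc eps n k T.
Proof.
  unfold osc. apply RInt_ext_R. intros z.
  replace (- k * phase eps z) with (- (k * phase eps z)) by ring. rewrite cos_neg. reflexivity.
Qed.

(** With w = 1 + i z one has 1 + z^2 = w (2 - w) and 2 atan z = arg w - arg (2 - w). For s^(k + 2 l)
    in the k-th harmonic the exponents are thus m = 2 k + 2 l and q = 2 l. On Re w = 1 the cubic has
    real part 2 / 3 and imaginary part z + z^3 / 3: the former is the exponentially small factor,
    the latter the phase. *)
Lemma osc_cont eps (k l : nat) T :
  osc eps (k + 2 * l) (INR k) T =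
  (2 * eps ^ 2) ^ (k + 2 * l) * exp (- (2 / 3 * (INR k * / (2 * eps ^ 3)))) *
  RInt (cont_re (INR (2 * k + 2 * l)) (INR (2 * l)) (INR k * / (2 * eps ^ 3)) 1) (- T) T.
Proof.
  rewrite <- RInt_scal_R.
  2:{ apply ex_RInt_of_continuous. intros; apply cont_re_continuous; lra. }
  unfold osc. apply RInt_ext_R. intros z.
  set (L := / (2 * eps ^ 3)). unfold cont_re, cont_log, cont_arg, sdist, phase. fold L.
  assert (Hz : 0 < 1 + z ^ 2) by nra.
  replace (2 - 1) with 1 by ring. replace (z / 1) with z by field.
  replace (1 ^ 2 + z ^ 2) with (1 + z ^ 2) by ring.
  replace (- INR (2 * k + 2 * l) * atan z + INR (2 * l) * atan z +
     INR k * L * (2 * 1 * z - (3 * 1 ^ 2 * z - z ^ 3) / 3))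
   with (- (INR k * (2 * atan z - L * (z + z ^ 3 / 3)))).
  2:{ rewrite !plus_INR, !mult_INR. simpl (INR 2). field. }
  rewrite cos_neg.
  replace (- INR (2 * k + 2 * l) * (ln (1 + z ^ 2) / 2) - INR (2 * l) * (ln (1 + z ^ 2) / 2) +
      INR k * L * (1 ^ 2 - z ^ 2 - (1 ^ 3 - 3 * 1 * z ^ 2) / 3))
   with (2 / 3 * (INR k * L) + - (INR (k + 2 * l) * ln (1 + z ^ 2))).
  2:{ rewrite !plus_INR, !mult_INR. simpl (INR 2). field. }
  rewrite exp_plus, (exp_Ropp (INR (k + 2 * l) * _)), <- ln_pow, exp_ln by (try apply pow_lt; lra).
  rewrite exp_Ropp. unfold Rdiv. rewrite Rpow_mult_distr, pow_inv.
  assert (exp (2 * / 3 * (INR k * L)) <> 0) by (apply Rgt_not_eq, exp_pos).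
  assert ((1 + z ^ 2) ^ (k + 2 * l) <> 0) by (apply pow_nonzero; lra).
  field. split; assumption.
Qed.

Lemma Rabs_sin_mult k th : 0 <= th <= PI -> Rabs (sin (INR k * th)) <= INR k * sin th.
Proof.
  intros Hth. assert (0 <= sin th) by (apply sin_ge_0; lra).
  induction k as [|k IH].
  - simpl. rewrite !Rmult_0_l, sin_0, Rabs_R0. lra.
  - rewrite S_INR, Rmult_plus_distr_r, Rmult_1_l, sin_plus.
    eapply Rle_trans; [apply Rabs_triang|].
    assert (Rabs (sin (INR k * th) * cos th) <= INR k * sin th * 1)
      by (apply Rabs_mult_le; [exact IH|apply Rabs_le, COS_bound]).
    assert (Rabs (cos (INR k * th) * sin th) <= 1 * sin th)
      by (apply Rabs_mult_le; [apply Rabs_le, COS_bound|rewrite Rabs_pos_eq; lra]).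
    lra.
Qed.

(* Size of the first harmonic: [exp (-2 L / 3)] times powers of [eps]. *)
Definition harm (eps : R) : R := exp 1 / eps * exp (- (2 / 3 * / (2 * eps ^ 3))).

(** exp (- x) <= 1 / x is crude but enough to trade the extra powers of [harm] in higher harmonics
    for powers of eps. *)
Lemma harm_bound eps : 0 < eps -> 0 < harm eps <= 9 * eps ^ 2.
Proof.
  intros He. assert (H3 : 0 < eps ^ 3) by (apply pow_lt; lra).
  assert (0 < exp 1 / eps) by (apply Rdiv_lt_0_compat; [apply exp_pos|lra]).
  unfold harm. split.
  - apply Rmult_lt_0_compat; [assumption|apply exp_pos].
  - replace (9 * eps ^ 2) with (3 / eps * (3 * eps ^ 3)) by (field; lra).
    apply Rmult_le_compat; [lra|left; apply exp_pos| |].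
    + apply Rmult_le_compat_r; [left; apply Rinv_0_lt_compat; lra|apply exp_le_3].
    + rewrite exp_Ropp.
      replace (2 / 3 * / (2 * eps ^ 3)) with (/ (3 * eps ^ 3)) by (field; lra).
      rewrite <- (Rinv_inv (3 * eps ^ 3)) at 2.
      apply Rinv_le_contravar; [apply Rinv_0_lt_compat; lra|].
      assert (Hexp := exp_ineq1_le (/ (3 * eps ^ 3))). lra.
Qed.

Lemma sigma_spec eps : 0 < eps <= / 10 ^ 9 ->
  exists sig, 1000 <= sig /\ sig ^ 2 = / (2 * eps ^ 3).
Proof.
  intros He.
  assert (H3 : 0 < eps ^ 3) by (apply pow_lt; lra).
  assert (0 < / (2 * eps ^ 3)) by (apply Rinv_0_lt_compat; lra).
  exists (sqrt (/ (2 * eps ^ 3))). split.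
  - replace 1000 with (sqrt (1000 * 1000)) by (apply sqrt_square; lra).
    apply sqrt_le_1_alt. replace (1000 * 1000) with (/ / 1000000) by field.
    apply Rinv_le_contravar; [lra|]. assert (eps <= / 1000) by lra. nra.
  - rewrite <- Rsqr_pow2. apply Rsqr_sqrt. lra.
Qed.

(** As sigma^2 = 1 / (2 eps^3), the powers (2 eps^2)^(k + 2 l) and sigma^(2 k + 2 l) combine to
    eps^(- k) (2 eps)^l. Each order of the harmonic thus costs a factor [harm], while an extra s^2
    gains only 2 eps. *)
Lemma osc_bound eps sig (k l : nat) : 0 < eps -> 1000 <= sig -> sig ^ 2 = / (2 * eps ^ 3) ->
  (1 <= k)%nat ->
  exists C, 0 <= C /\ forall T, 1 <= T ->
    Rabs (osc eps (k + 2 * l) (INR k) T) <= 2 * PI / sig * (harm eps ^ k * (2 * eps) ^ l) + C / T.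
Proof.
  intros He Hs Hsig Hk.
  assert (H3 : 0 < eps ^ 3) by (apply pow_lt; lra).
  assert (Hk1 : 1 <= INR k) by (apply (le_INR 1); exact Hk).
  set (A := (2 * eps ^ 2) ^ (k + 2 * l) * exp (- (2 / 3 * (INR k * / (2 * eps ^ 3))))).
  assert (HA : 0 < A).
  { apply Rmult_lt_0_compat; [apply pow_lt; nra|apply exp_pos]. }
  exists (A * (2 * exp (INR k * / (2 * eps ^ 3)))). split.
  { apply Rmult_le_pos; [lra|]. pose proof (exp_pos (INR k * / (2 * eps ^ 3))). lra. }
  intros T HT. rewrite osc_cont. fold A. rewrite <- Hsig.
  assert (Hq : 0 <= INR (2 * l)) by apply pos_INR.
  assert (Hm : 1 <= INR (2 * k + 2 * l)) by (apply (le_INR 1); lia).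
  assert (Hl : 0 <= INR k * sig ^ 2) by nra.
  assert (Hc : 0 < / sig <= 1).
  { split; [apply Rinv_0_lt_compat; lra|rewrite <- Rinv_1; apply Rinv_le_contravar; lra]. }
  assert (B1 := cont_shift _ _ _ _ T Hm Hq Hl Hc HT).
  assert (B2 := cont_bound (2 * k + 2 * l) _ (INR k) sig T Hq Hk1 ltac:(lra) ltac:(lra)).
  set (X := RInt (cont_re (INR (2 * k + 2 * l)) (INR (2 * l)) (INR k * sig ^ 2) 1) (- T) T) in *.
  set (Y := RInt (cont_re (INR (2 * k + 2 * l)) (INR (2 * l)) (INR k * sig ^ 2) (/ sig)) (- T) T) in *.
  assert (B3 : Rabs X <= sig ^ (2 * k + 2 * l) * exp (INR k) * (2 * PI / sig) + 2 * exp (INR k * sig ^ 2) / T).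
  { replace X with ((X - Y) + Y) by ring. eapply Rle_trans; [apply Rabs_triang|lra]. }
  rewrite Rabs_mult, (Rabs_pos_eq A) by lra.
  apply Rle_trans with (A * (sig ^ (2 * k + 2 * l) * exp (INR k) * (2 * PI / sig) + 2 * exp (INR k * sig ^ 2) / T)).
  { apply Rmult_le_compat_l; lra. }
  right. rewrite Rmult_plus_distr_l. f_equal; [|field; lra].
  assert (E : A * (sig ^ (2 * k + 2 * l) * exp (INR k)) = harm eps ^ k * (2 * eps) ^ l).
  { unfold A, harm.
    assert (Ee : forall x, exp (INR k * x) = exp x ^ k).
    { clear. intros x; induction k as [|k IH]; [simpl; rewrite Rmult_0_l; apply exp_0|].
      rewrite S_INR, Rmult_plus_distr_r, exp_plus, IH, Rmult_1_l. simpl; ring. }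
    rewrite <- (Rmult_1_r (INR k)) at 2. rewrite (Ee 1).
    replace (- (2 / 3 * (INR k * / (2 * eps ^ 3)))) with (INR k * (- (2 / 3 * / (2 * eps ^ 3)))) by ring.
    rewrite Ee.
    rewrite pow_add, (pow_add sig), !pow_mult, Hsig.
    transitivity ((2 * eps ^ 2 * (/ (2 * eps ^ 3)) * exp 1 * exp (- (2 / 3 * / (2 * eps ^ 3)))) ^ k
       * ((2 * eps ^ 2) ^ 2 * (/ (2 * eps ^ 3))) ^ l).
    { rewrite !Rpow_mult_distr. ring. }
    f_equal; f_equal; field; lra. }
  rewrite <- E. ring.
Qed.

Lemma osc_main eps sig : 0 < eps -> 1000 <= sig -> sig ^ 2 = / (2 * eps ^ 3) ->
  exists C, 0 <= C /\ forall T, 1 <= T ->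
    harm eps * eps / (15 * sig) - C / T <= osc eps 3 1 T.
Proof.
  intros He Hs Hsig.
  assert (H3 : 0 < eps ^ 3) by (apply pow_lt; lra).
  set (A := (2 * eps ^ 2) ^ 3 * exp (- (2 / 3 * / (2 * eps ^ 3)))).
  assert (HA : 0 < A).
  { apply Rmult_lt_0_compat; [apply pow_lt; nra|apply exp_pos]. }
  exists (A * (10 * sig ^ 4 * exp (sig ^ 2))). split.
  { apply Rmult_le_pos; [lra|]. apply Rmult_le_pos; [|left; apply exp_pos].
    apply Rmult_le_pos; [lra|apply pow_le; lra]. }
  intros T HT.
  assert (E := osc_cont eps 1 1 T). change (1 + 2 * 1)%nat with 3%nat in E. change (2 * 1 + 2 * 1)%nat with 4%nat in E. change (2 * 1)%nat with 2%nat in E. change (INR 1) with 1 in E.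
  rewrite !Rmult_1_l in E. rewrite E. fold A. rewrite <- Hsig.
  replace (INR 4) with 4 by (simpl; ring). replace (INR 2) with 2 by (simpl; ring).
  assert (M := main_term_lower sig T Hs HT).
  apply Rle_trans with (A * (sig ^ 3 / 10 - 10 * sig ^ 4 * exp (sig ^ 2) / T)).
  2:{ apply Rmult_le_compat_l; lra. }
  rewrite Rmult_minus_distr_l.
  replace (A * (10 * sig ^ 4 * exp (sig ^ 2) / T)) with (A * (10 * sig ^ 4 * exp (sig ^ 2)) / T) by (field; lra).
  apply Rplus_le_compat_r.
  assert (EA : A * sig ^ 4 = exp (- (2 / 3 * / (2 * eps ^ 3))) * 2).
  { unfold A. replace (sig ^ 4) with ((sig ^ 2) ^ 2) by ring. rewrite Hsig. field; lra. }
  replace (A * (sig ^ 3 / 10)) with (A * sig ^ 4 / (10 * sig)) by (field; lra).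
  rewrite EA. unfold harm.
  set (x := exp (- (2 / 3 * / (2 * eps ^ 3)))). assert (Hx : 0 < x) by apply exp_pos.
  replace (exp 1 / eps * x * eps / (15 * sig)) with (x / (15 * sig) * exp 1) by (field; lra).
  replace (x * 2 / (10 * sig)) with (x / (15 * sig) * 3) by (field; lra).
  apply Rmult_le_compat_l; [left; apply Rdiv_lt_0_compat; lra|apply exp_le_3].
Qed.

(** Contribution of the term (j, l) of [sin_f_double]. The Melnikov integrand has one more factor s,
    hence the exponent j + l + 1. *)
Definition mode (eps th T : R) (j l : nat) : R :=
  beta j * beta l * (sin ((1 + INR j - INR l) * th) * osc eps (j + l + 1) (1 + INR j - INR l) T).

(** With q = 4 [harm] and x = 8 eps one has q <= x^2, so the mode is at most q x^e with e = 2 (k -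
    1) + l'. Two factors x give the eps^2, one eps better than the dominant mode; since j + l <= 2
    e, the others pay for the geometric decay in j and l. *)
Lemma mode_bound_aux eps sig (j l k l' : nat) kap :
  0 < eps <= / 10 ^ 9 -> 1000 <= sig -> sig ^ 2 = / (2 * eps ^ 3) ->
  (1 <= k)%nat -> (j + l + 1 = k + 2 * l')%nat -> (2 <= 2 * (k - 1) + l')%nat ->
  (j + l <= 2 * (2 * (k - 1) + l'))%nat -> kap = INR k \/ kap = - INR k ->
  exists C, 0 <= C /\ forall T th, 1 <= T -> 0 <= th <= PI ->
    Rabs (beta j * beta l * (sin (kap * th) * osc eps (j + l + 1) kap T)) <=
    sin th * (2 * PI / sig * (harm eps * eps ^ 2 * 70000) * ((/ 4) ^ j * (/ 4) ^ l) + C / T).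
Proof.
  intros He Hs Hsig Hk Hn He2 Hejl Hkap.
  destruct (osc_bound eps sig k l' ltac:(lra) Hs Hsig Hk) as [C [HC HB]].
  set (D := beta j * beta l * INR k).
  assert (HD0 : 0 <= D).
  { unfold D. pose proof (beta_pos j). pose proof (beta_pos l). pose proof (pos_INR k).
    apply Rmult_le_pos; [apply Rmult_le_pos; lra|lra]. }
  (* The coefficients are at most 2^(j + l + k), and j + l + k = 2 k + 2 l' - 1. The factors 4^k and
     4^l' are absorbed by the constants in q and x. *)
  assert (HD : D <= 4 ^ k * 4 ^ l').
  { unfold D.
    apply Rle_trans with (2 ^ j * 2 ^ l * 2 ^ k).
    - apply Rmult_le_compat; [pose proof (beta_pos j); pose proof (beta_pos l); nra|apply pos_INR| |].
      + apply Rmult_le_compat; try apply beta_le_pow2; left; apply beta_pos.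
      + clear. induction k as [|k IH]; [simpl; lra|]. rewrite S_INR. simpl.
        assert (1 <= 2 ^ k) by (apply pow_R1_Rle; lra). lra.
    - rewrite <- !pow_add. replace 4 with (2 ^ 2) by ring. rewrite <- !pow_mult.
      apply Rle_pow; [lra|lia]. }
  exists (D * C). split; [apply Rmult_le_pos; assumption|].
  intros T th HT Hth.
  assert (Hsin : 0 <= sin th) by (apply sin_ge_0; lra).
  assert (E1 : Rabs (sin (kap * th)) <= INR k * sin th).
  { destruct Hkap as [-> | ->]; [apply Rabs_sin_mult, Hth|].
    rewrite Ropp_mult_distr_l_reverse, sin_neg, Rabs_Ropp. apply Rabs_sin_mult, Hth. }
  assert (E2 : Rabs (osc eps (j + l + 1) kap T) <= 2 * PI / sig * (harm eps ^ k * (2 * eps) ^ l') + C / T).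
  { rewrite Hn. destruct Hkap as [-> | ->]; [|rewrite osc_opp]; apply HB, HT. }
  rewrite Rabs_mult, (Rabs_pos_eq (beta j * beta l))
    by (apply Rmult_le_pos; left; apply beta_pos).
  eapply Rle_trans.
  { apply Rmult_le_compat_l; [apply Rmult_le_pos; left; apply beta_pos|].
    apply Rabs_mult_le; eassumption. }
  replace (beta j * beta l * (INR k * sin th * (2 * PI / sig * (harm eps ^ k * (2 * eps) ^ l') + C / T)))
    with (sin th * (2 * PI / sig * (D * (harm eps ^ k * (2 * eps) ^ l')) + D * C / T)) by (unfold D; field; lra).
  apply Rmult_le_compat_l; [exact Hsin|]. apply Rplus_le_compat_r.
  rewrite Rmult_assoc. apply Rmult_le_compat_l.
  { left; apply Rdiv_lt_0_compat; [pose proof PI_RGT_0; lra|lra]. }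
  destruct (harm_bound eps ltac:(lra)) as [Hh0 Hh1].
  set (x := 8 * eps). set (q := 4 * harm eps).
  assert (Hx : 0 < x <= / 16) by (unfold x; lra).
  assert (Hq : 0 < q <= x ^ 2) by (unfold q, x; nra).
  apply Rle_trans with (q * x ^ (2 * (k - 1) + l')).
  - apply Rle_trans with (q ^ k * x ^ l').
    + replace (q ^ k * x ^ l') with (4 ^ k * 4 ^ l' * (harm eps ^ k * (2 * eps) ^ l')).
      2:{ unfold q, x. replace (8 * eps) with (4 * (2 * eps)) by ring.
          rewrite (Rpow_mult_distr 4 (harm eps)), (Rpow_mult_distr 4 (2 * eps)). ring. }
      apply Rmult_le_compat_r; [|exact HD].
      apply Rmult_le_pos; apply pow_le; lra.
    + replace k with (S (k - 1)) at 1 by lia. rewrite <- tech_pow_Rmult. rewrite Rmult_assoc.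
      apply Rmult_le_compat_l; [lra|]. rewrite pow_add, pow_mult.
      apply Rmult_le_compat_r; [apply pow_le; lra|]. apply pow_incr; lra.
  - replace (2 * (k - 1) + l')%nat with (2 + (2 * (k - 1) + l' - 2))%nat by lia.
    set (e := (2 * (k - 1) + l')%nat) in *.
    rewrite pow_add.
    assert (Hxe : x ^ (e - 2) <= 256 * ((/ 4) ^ j * (/ 4) ^ l)).
    { rewrite <- pow_add.
      apply Rle_trans with ((/ 16) ^ (e - 2)); [apply pow_incr; lra|].
      replace (/ 16) with ((/ 4) ^ 2) by field. rewrite <- pow_mult.
      replace (256 * (/ 4) ^ (j + l)) with ((/ 4) ^ (j + l) * 4 ^ 4) by ring.
      apply Rmult_le_reg_r with ((/ 4) ^ 4); [apply pow_lt; lra|].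
      rewrite Rmult_assoc, <- Rpow_mult_distr, <- pow_add. replace (4 * / 4) with 1 by field.
      rewrite pow1, Rmult_1_r.
      replace (2 * (e - 2) + 4)%nat with (j + l + (2 * (e - 2) + 4 - (j + l)))%nat by lia.
      rewrite pow_add. rewrite <- (Rmult_1_r ((/ 4) ^ (j + l))) at 2.
      apply Rmult_le_compat_l; [apply pow_le; lra|].
      rewrite <- (pow1 (2 * (e - 2) + 4 - (j + l))). apply pow_incr; lra. }
    assert (Hp : 0 < (/ 4) ^ j * (/ 4) ^ l) by (apply Rmult_lt_0_compat; apply pow_lt; lra).
    apply Rle_trans with (q * (x ^ 2 * (256 * ((/ 4) ^ j * (/ 4) ^ l)))).
    + apply Rmult_le_compat_l; [lra|]. apply Rmult_le_compat_l; [apply pow_le; lra|exact Hxe].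
    (* 4 * 8^2 * 256 = 65536 accounts for the constant 70000. *)
    + unfold q, x.
      replace (4 * harm eps * ((8 * eps) ^ 2 * (256 * ((/ 4) ^ j * (/ 4) ^ l))))
        with (harm eps * eps ^ 2 * 65536 * ((/ 4) ^ j * (/ 4) ^ l)) by ring.
      apply Rmult_le_compat_r; [lra|].
      apply Rmult_le_compat_l; [|lra]. apply Rmult_le_pos; [lra|apply pow2_ge_0].
Qed.

(* The mode (0, 0), which the summand [-1] of the integrand cancels, and the modes of the
   next order in which the first harmonic appears. *)
Definition leading (j l : nat) : bool :=
  ((j =? 0) && (l =? 0) || (j =? 1) && (l =? 1) || (j =? 0) && (l =? 2))%nat%bool.

(** The order 1 + j - l is positive for l <= j, zero for l = j + 1, where the sine vanishes, and
    negative beyond. Apart from the vanishing modes, the pairs in [leading] are exactly those for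
    which the exponent 2 (k - 1) + l' stays below 2. *)
Lemma mode_bound eps sig (j l : nat) :
  0 < eps <= / 10 ^ 9 -> 1000 <= sig -> sig ^ 2 = / (2 * eps ^ 3) -> leading j l = false ->
  exists C, 0 <= C /\ forall T th, 1 <= T -> 0 <= th <= PI ->
    Rabs (mode eps th T j l) <=
    sin th * (2 * PI / sig * (harm eps * eps ^ 2 * 70000) * ((/ 4) ^ j * (/ 4) ^ l) + C / T).
Proof.
  intros He Hs Hsig Hl.
  assert (Hl' : ~ (j = 0 /\ l = 0)%nat /\ ~ (j = 1 /\ l = 1)%nat /\ ~ (j = 0 /\ l = 2)%nat).
  { unfold leading in Hl. repeat split; intros [-> ->]; simpl in Hl; discriminate. }
  unfold mode.
  destruct (le_lt_dec l j) as [Hlj|Hlj].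
  - apply (mode_bound_aux eps sig j l (j - l + 1) l); try assumption; try lia.
    left. rewrite plus_INR, minus_INR by exact Hlj. simpl; ring.
  - destruct (Nat.eq_dec l (j + 1)) as [->|Hne].
    + exists 0. split; [lra|]. intros T th HT Hth.
      replace (1 + INR j - INR (j + 1)) with 0 by (rewrite plus_INR; simpl; ring).
      rewrite Rmult_0_l, sin_0, Rmult_0_l, Rmult_0_r, Rabs_R0.
      apply Rmult_le_pos; [apply sin_ge_0; lra|].
      unfold Rdiv. rewrite (Rmult_0_l (/ T)), Rplus_0_r.
      destruct (harm_bound eps ltac:(lra)) as [Hh0 _].
      assert (0 < / sig) by (apply Rinv_0_lt_compat; lra).
      assert (0 < (/ 4) ^ j) by (apply pow_lt; lra).
      assert (0 < (/ 4) ^ (j + 1)) by (apply pow_lt; lra).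
      pose proof PI_RGT_0. pose proof (pow2_ge_0 eps).
      repeat first [lra | apply Rmult_le_pos].
    + apply (mode_bound_aux eps sig j l (l - j - 1) (j + 1)); try assumption; try lia.
      right. rewrite !minus_INR by lia. simpl; ring.
Qed.

(** Both geometric sums are at most 4 / 3, and (4/3)^2 <= 2. The constant C depends on N but not on
    T or th, so T can be chosen after N. *)
Lemma double_sum_bound (b : R -> R -> nat -> nat -> R) (B : R) (N : nat) : 0 <= B ->
  (forall j l, exists C, 0 <= C /\ forall T th, 1 <= T -> 0 <= th <= PI ->
     Rabs (b th T j l) <= sin th * (B * ((/ 4) ^ j * (/ 4) ^ l) + C / T)) ->
  exists C, 0 <= C /\ forall T th, 1 <= T -> 0 <= th <= PI ->
     Rabs (rsum (fun j => rsum (b th T j) N) N) <= sin th * (2 * B + C / T).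
Proof.
  intros HB H.
  assert (Hrow : forall M j, exists C, 0 <= C /\ forall T th, 1 <= T -> 0 <= th <= PI ->
     Rabs (rsum (b th T j) M) <= sin th * (B * (/ 4) ^ j * (4 / 3 - 4 / 3 * (/ 4) ^ M) + C / T)).
  { intros M j; induction M as [|M [C [HC IH]]].
    - exists 0; split; [lra|]. intros T th HT Hth. simpl. rewrite Rabs_R0.
      replace (B * (/ 4) ^ j * (4 / 3 - 4 / 3 * 1) + 0 / T) with 0 by (field; lra). lra.
    - destruct (H j M) as [C' [HC' H']]. exists (C + C'); split; [lra|].
      intros T th HT Hth. cbn [rsum].
      eapply Rle_trans; [apply Rabs_triang|].
      eapply Rle_trans; [apply Rplus_le_compat; [apply (IH T th HT Hth)|apply (H' T th HT Hth)]|].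
      right. simpl. field. lra. }
  assert (Hall : forall M, exists C, 0 <= C /\ forall T th, 1 <= T -> 0 <= th <= PI ->
     Rabs (rsum (fun j => rsum (b th T j) N) M) <= sin th * (B * (4 / 3) * (4 / 3 - 4 / 3 * (/ 4) ^ M) + C / T)).
  { intros M; induction M as [|M [C [HC IH]]].
    - exists 0; split; [lra|]. intros T th HT Hth. simpl. rewrite Rabs_R0.
      replace (B * (4 / 3) * (4 / 3 - 4 / 3 * 1) + 0 / T) with 0 by (field; lra). lra.
    - destruct (Hrow N M) as [C' [HC' H']]. exists (C + C'); split; [lra|].
      intros T th HT Hth. cbn [rsum].
      eapply Rle_trans; [apply Rabs_triang|].
      eapply Rle_trans; [apply Rplus_le_compat; [apply (IH T th HT Hth)|apply (H' T th HT Hth)]|].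
      rewrite <- Rmult_plus_distr_l. apply Rmult_le_compat_l; [apply sin_ge_0; lra|].
      assert (0 < (/ 4) ^ N) by (apply pow_lt; lra).
      assert (0 < (/ 4) ^ M) by (apply pow_lt; lra).
      assert (0 <= B * (/ 4) ^ M * (4 / 3 * (/ 4) ^ N)).
      { apply Rmult_le_pos; [apply Rmult_le_pos; lra|lra]. }
      replace ((C + C') / T) with (C / T + C' / T) by (field; lra).
      replace ((/ 4) ^ S M) with (/ 4 * (/ 4) ^ M) by reflexivity. lra. }
  destruct (Hall N) as [C [HC HN]]. exists C; split; [exact HC|]. intros T th HT Hth.
  eapply Rle_trans; [apply HN; assumption|].
  apply Rmult_le_compat_l; [apply sin_ge_0; lra|].
  assert (0 < (/ 4) ^ N) by (apply pow_lt; lra).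
  apply Rplus_le_compat_r. assert (0 <= B * (/ 4) ^ N) by (apply Rmult_le_pos; lra). lra.
Qed.

Lemma leading_sum (t : nat -> nat -> R) (n : nat) :
  rsum (fun j => rsum (fun l => if leading j l then t j l else 0) (n + 3)) (n + 3) =
  t 0%nat 0%nat + t 1%nat 1%nat + t 0%nat 2%nat.
Proof.
  assert (E : forall j m, rsum (fun l => if leading j l then t j l else 0) (m + 3) =
     match j with 0%nat => t 0%nat 0%nat + t 0%nat 2%nat | 1%nat => t 1%nat 1%nat | _ => 0 end).
  { intros j m. induction m as [|m IH].
    - destruct j as [|[|j]]; simpl; ring.
    - cbn [Nat.add rsum]. rewrite IH.
      replace (leading j (m + 3)) with false; [ring|].
      unfold leading. replace (m + 3)%nat with (S (S (S m))) by lia.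
      destruct j as [|[|j]]; reflexivity. }
  rewrite (rsum_ext _ (fun j => match j with 0%nat => t 0%nat 0%nat + t 0%nat 2%nat | 1%nat => t 1%nat 1%nat | _ => 0 end)) by (intros; apply E).
  induction n as [|n IH].
  - simpl; ring.
  - cbn [Nat.add rsum]. rewrite IH. replace (n + 3)%nat with (S (S (S n))) by lia. ring.
Qed.

(** The mode (1, 1) contributes beta_1^2 = 9/4 and the mode (0, 2), of order - 1, contributes -
    beta_2 = - 15/8 times the same integral. The net coefficient 3/8 exceeds the 1/8 allowed to the
    remaining modes, and 1/4 is left. At least three terms are taken so that both modes occur. *)
Lemma modes_lower eps : 0 < eps <= / 10 ^ 9 ->
  exists c, 0 < c /\ forall n, exists C, 0 <= C /\ forall T th, 1 <= T -> 0 <= th <= PI ->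
    sin th * (c - C / T) <=
    rsum (fun j => rsum (mode eps th T j) (n + 3)) (n + 3) - sin th * osc eps 1 1 T.
Proof.
  intros He. destruct (sigma_spec eps He) as [sig [Hs Hsig]].
  destruct (harm_bound eps ltac:(lra)) as [Hh0 _].
  assert (Hpi : 0 < PI <= 4) by (split; [apply PI_RGT_0|apply PI_4]).
  set (B := 2 * PI / sig * (harm eps * eps ^ 2 * 70000)).
  assert (HB : 0 <= B).
  { assert (0 < / sig) by (apply Rinv_0_lt_compat; lra).
    unfold B, Rdiv. pose proof (pow2_ge_0 eps). repeat first [lra | apply Rmult_le_pos]. }
  set (m := harm eps * eps / (15 * sig)).
  assert (Hm : 0 < m) by (apply Rdiv_lt_0_compat; nra).
  (* This comparison fixes the size of eps: it amounts to 4200000 PI eps <= 1/8. *)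
  assert (HBm : 2 * B <= m / 8).
  { replace (2 * B) with (m * (eps * PI * 4200000)) by (unfold B, m; field; lra).
    replace (m / 8) with (m * (/ 8)) by field. apply Rmult_le_compat_l; [lra|nra]. }
  exists (m / 4). split; [lra|]. intros n.
  destruct (osc_main eps sig ltac:(lra) Hs Hsig) as [C1 [HC1 H1]]. fold m in H1.
  set (b := fun th T j l => if leading j l then 0 else mode eps th T j l).
  destruct (double_sum_bound b B (n + 3) HB) as [C2 [HC2 H2]].
  { intros j l. unfold b. destruct (leading j l) eqn:El.
    - exists 0. split; [lra|]. intros T th HT Hth. rewrite Rabs_R0.
      apply Rmult_le_pos; [apply sin_ge_0; lra|].
      assert (0 < (/ 4) ^ j * (/ 4) ^ l) by (apply Rmult_lt_0_compat; apply pow_lt; lra).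
      replace (0 / T) with 0 by (field; lra). nra.
    - apply mode_bound; assumption. }
  exists (C1 + C2). split; [lra|]. intros T th HT Hth.
  specialize (H1 T HT). specialize (H2 T th HT Hth).
  assert (Hsin : 0 <= sin th) by (apply sin_ge_0; lra).
  assert (E : rsum (fun j => rsum (mode eps th T j) (n + 3)) (n + 3) =
     rsum (fun j => rsum (fun l => if leading j l then mode eps th T j l else 0) (n + 3)) (n + 3)
     + rsum (fun j => rsum (b th T j) (n + 3)) (n + 3)).
  { rewrite <- rsum_plus. apply rsum_ext; intros j _. rewrite <- rsum_plus. apply rsum_ext; intros l _.
    unfold b; destruct (leading j l); ring. }
  rewrite E, leading_sum.
  assert (M00 : mode eps th T 0 0 = sin th * osc eps 1 1 T).
  { unfold mode; simpl. replace (1 + 0 - 0) with 1 by ring. rewrite (Rmult_1_l th); ring. }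
  assert (M11 : mode eps th T 1 1 = 9 / 4 * (sin th * osc eps 3 1 T)).
  { unfold mode; simpl. replace (1 + 1 - 1) with 1 by ring. rewrite (Rmult_1_l th); field. }
  assert (M02 : mode eps th T 0 2 = - (15 / 8) * (sin th * osc eps 3 1 T)).
  { unfold mode; simpl. replace (1 + 0 - (1 + 1)) with (Ropp 1) by ring.
    rewrite osc_opp. rewrite Ropp_mult_distr_l_reverse, (Rmult_1_l th), sin_neg. field. }
  rewrite M00, M11, M02.
  apply Rabs_le_between in H2.
  assert (H3 : sin th * (m - C1 / T) <= sin th * osc eps 3 1 T) by (apply Rmult_le_compat_l; lra).
  assert (H4 : sin th * (2 * B) <= sin th * (m / 8)) by (apply Rmult_le_compat_l; lra).
  assert (0 <= sin th * (C1 / T)).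
  { apply Rmult_le_pos; [lra|]. apply Rmult_le_pos; [lra|left; apply Rinv_0_lt_compat; lra]. }
  replace ((C1 + C2) / T) with (C1 / T + C2 / T) by (field; lra).
  lra.
Qed.

Lemma is_RInt_rsum (f : nat -> R -> R) (I : nat -> R) a b N :
  (forall i, is_RInt (f i) a b (I i)) ->
  is_RInt (fun x => rsum (fun i => f i x) N) a b (rsum I N).
Proof.
  intros H; induction N as [|N IH]; cbn [rsum].
  - assert (E := is_RInt_const (V := R_NormedModule) a b 0).
    evar_last; [exact E|]. change ((b - a) * 0 = 0). ring.
  - apply (is_RInt_plus (V := R_NormedModule)); auto.
Qed.

Lemma square_le_pow2 n : INR n ^ 2 <= 2 * 2 ^ n.
Proof.
  assert (H : forall n, INR n + 1 <= 2 ^ n).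
  { intros k; induction k as [|k IH]; [simpl; lra|]. rewrite S_INR. simpl. pose proof (pos_INR k). lra. }
  induction n as [|n IH]; [simpl; lra|]. rewrite S_INR. specialize (H n). simpl in *. lra.
Qed.

(** The truncation error is integrable uniformly in T because the integrand carries the factor
    [sdist], a multiple of 1 / (1 + z^2). So N can be fixed by eta, and T0 afterwards by N and
    eta. *)
Lemma melnikov_lower eps : 0 < eps <= / 10 ^ 9 ->
  exists c, 0 < c /\ forall th eta, 0 <= th <= PI -> 0 < eta ->
    exists T0, 1 <= T0 /\ forall T, T0 <= T -> c * sin th - eta <= melnikov eps th T.
Proof.
  intros He. destruct (modes_lower eps He) as [c [Hc H]]. exists c; split; [exact Hc|].
  intros th eta Hth Heta.
  (* By N^2 <= 2 * 2^N the error 200 N 2^(-N) is at most 400 / N, which has to be below eta / 2. *)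
  destruct (nfloor_ex (400 / (eta / 2)) ltac:(apply Rlt_le, Rdiv_lt_0_compat; lra)) as [n [_ Hn]].
  destruct (H n) as [C [HC HT]].
  exists (Rmax 1 (2 * C / eta)). split; [apply Rmax_l|]. intros T HT1.
  assert (T1 : 1 <= T) by (eapply Rle_trans; [apply Rmax_l|exact HT1]).
  assert (T2 : 2 * C / eta <= T) by (eapply Rle_trans; [apply Rmax_r|exact HT1]).
  specialize (HT T th T1 Hth).
  assert (Hsin : 0 <= sin th <= 1) by (split; [apply sin_ge_0; lra|apply SIN_bound]).
  set (N := (n + 3)%nat) in *.
  set (g := fun z => sdist eps z * (sin (th + phase eps z) *
     (fre N (sdist eps z) (th + phase eps z) ^ 2 + fim N (sdist eps z) (th + phase eps z) ^ 2 - 1))).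
  assert (Hg : is_RInt g (- T) T
     (rsum (fun j => rsum (mode eps th T j) N) N - sin th * osc eps 1 1 T)).
  { assert (Hterm : forall m k, is_RInt (fun z => sdist eps z ^ m * sin (k * (th + phase eps z))) (- T) T
       (sin (k * th) * osc eps m k T)).
    { intros m k. rewrite <- RInt_osc_sin. apply (RInt_correct (V := R_CompleteNormedModule)), ex_RInt_of_continuous.
      intros z. apply continuous_of_ex_derive. auto_derive.
      split; [apply ex_derive_sdist|split; [apply ex_derive_phase|exact I]]. }
    assert (Hterm1 := Hterm 1%nat 1). rewrite (Rmult_1_l th) in Hterm1.
    eapply is_RInt_ext.
    2:{ apply (is_RInt_minus (V := R_NormedModule)).
        - apply (is_RInt_rsum (fun j z => rsum (fun l => beta j * beta l *
             (sdist eps z ^ (j + l + 1) * sin ((1 + INR j - INR l) * (th + phase eps z)))) N)).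
          intros j. apply is_RInt_rsum. intros l. unfold mode.
          apply (is_RInt_scal (V := R_NormedModule)), Hterm.
        - exact Hterm1. }
    intros z _. unfold g. 
    rewrite Rmult_minus_distr_l, sin_f_double.
    change (rsum (fun j => rsum (fun l => beta j * beta l *
             (sdist eps z ^ (j + l + 1) * sin ((1 + INR j - INR l) * (th + phase eps z)))) N) N
      - sdist eps z ^ 1 * sin (1 * (th + phase eps z)) =
      sdist eps z * (rsum (fun j => rsum (fun l => beta j * beta l * sdist eps z ^ (j + l) *
         sin ((1 + INR j - INR l) * (th + phase eps z))) N) N - sin (th + phase eps z) * 1)).
    rewrite Rmult_minus_distr_l, <- rsum_scal. rewrite Rmult_1_l, pow_1, Rmult_1_r. f_equal.
    apply rsum_ext; intros j _. rewrite <- rsum_scal. apply rsum_ext; intros l _.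
    rewrite (pow_add _ (j + l) 1). ring. }
  set (h := fun z => sdist eps z * (sin (th + phase eps z) *
     (/ sqrt (1 + sdist eps z ^ 2 - 2 * sdist eps z * cos (th + phase eps z)) ^ 3 - 1))).
  assert (Hq : forall z, / 4 <= 1 + sdist eps z ^ 2 - 2 * sdist eps z * cos (th + phase eps z)).
  { intros z. pose proof (sdist_range eps z ltac:(lra)). pose proof (COS_bound (th + phase eps z)). nra. }
  assert (Hhc : forall z, continuous h z).
  { intros z. apply continuous_of_ex_derive. unfold h. specialize (Hq z). auto_derive.
    assert (0 < sqrt (1 + sdist eps z ^ 2 - 2 * sdist eps z * cos (th + phase eps z))) by (apply sqrt_lt_R0; lra).
    assert (Es : 1 + sdist eps z * (sdist eps z * 1) + - (2 * sdist eps z * cos (th + phase eps z)) =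
        1 + sdist eps z ^ 2 - 2 * sdist eps z * cos (th + phase eps z)) by ring.
    assert (Hsd : ex_derive (fun x => sdist eps x) z) by exact (ex_derive_sdist eps z).
    assert (Hph : ex_derive (fun x => phase eps x) z) by exact (ex_derive_phase eps z).
    rewrite Es. repeat match goal with |- _ /\ _ => split end; try assumption; try exact I; try lra.
    apply Rgt_not_eq. repeat apply Rmult_lt_0_compat; lra. }
  assert (Hh : is_RInt h (- T) T (melnikov eps th T)).
  { apply (RInt_correct (V := R_CompleteNormedModule)), ex_RInt_of_continuous, Hhc. }
  assert (Hdiff : Rabs (melnikov eps th T -
     (rsum (fun j => rsum (mode eps th T j) N) N - sin th * osc eps 1 1 T)) <= 200 * INR N * (/ 2) ^ N).
  { destruct (RInt_lorentz 1 T ltac:(lra) ltac:(lra)) as [Hex Hle].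
    set (del := 200 * INR N * (/ 2) ^ N).
    assert (Hdel : 0 <= del).
    { unfold del. apply Rmult_le_pos; [|apply pow_le; lra]. pose proof (pos_INR N). lra. }
    assert (Hpi : 0 < PI <= 4) by (split; [apply PI_RGT_0|apply PI_4]).
    (* 16 eps^2 is the product of the 2 eps^2 in [sdist] and the bound 8 for the inverse cube of the
       distance, which is at least 1/2. *)
    apply Rle_trans with (RInt (fun z => 16 * eps ^ 2 * del * / (1 + (1 * z) ^ 2)) (- T) T).
    - apply (norm_RInt_le (V := R_NormedModule) (fun z => minus (h z) (g z)) (fun z => 16 * eps ^ 2 * del * / (1 + (1 * z) ^ 2)) (- T) T).
      + lra.
      + intros z _. pose proof (sdist_range eps z ltac:(lra)) as Hsd. specialize (Hq z).
        destruct (f_remainder N (sdist eps z) (th + phase eps z) ltac:(lra)) as [Hr|Hr];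
          [|unfold N in Hr; lia].
        fold del in Hr.
        change (Rabs (h z - g z) <= 16 * eps ^ 2 * del * / (1 + (1 * z) ^ 2)).
        unfold h, g.
        set (s := sdist eps z) in *. set (Th := th + phase eps z) in *.
        set (R3 := sqrt (1 + s ^ 2 - 2 * s * cos Th)) in *.
        assert (HR : / 2 <= R3).
        { replace (/ 2) with (sqrt (/ 4)); [apply sqrt_le_1_alt, Hq|].
          replace (/ 4) with (/ 2 * / 2) by field. apply sqrt_square; lra. }
        assert (HR3 : / 8 <= R3 ^ 3).
        { replace (/ 8) with ((/ 2) ^ 3) by field. apply pow_incr; lra. }
        set (E := fre N s Th ^ 2 + fim N s Th ^ 2) in *.
        replace (s * (sin Th * (/ R3 ^ 3 - 1)) - s * (sin Th * (E - 1)))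
          with (- (s * (sin Th * (/ R3 ^ 3 * (E * R3 ^ 3 - 1))))) by (field; lra).
        rewrite Rabs_Ropp.
        replace (16 * eps ^ 2 * del * / (1 + (1 * z) ^ 2)) with (s * (1 * (8 * del))).
        2:{ unfold s, sdist. replace (1 * z) with z by ring. field. nra. }
        apply Rabs_mult_le; [rewrite Rabs_pos_eq; lra|].
        apply Rabs_mult_le; [apply Rabs_le, SIN_bound|].
        apply Rabs_mult_le; [|exact Hr].
        rewrite Rabs_pos_eq by (left; apply Rinv_0_lt_compat; lra).
        rewrite <- (Rinv_inv 8). apply Rinv_le_contravar; lra.
      + apply (is_RInt_minus (V := R_NormedModule)); [exact Hh|exact Hg].
      + apply (RInt_correct (V := R_CompleteNormedModule)), (ex_RInt_scal (V := R_NormedModule)), Hex.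
    - rewrite RInt_scal_R by exact Hex.
      apply Rle_trans with (16 * eps ^ 2 * del * (PI / 1)).
      + apply Rmult_le_compat_l; [|exact Hle]. pose proof (pow2_ge_0 eps). nra.
      + replace (16 * eps ^ 2 * del * (PI / 1)) with (del * (16 * eps ^ 2 * PI)) by field.
        rewrite <- (Rmult_1_r del) at 2. apply Rmult_le_compat_l; [exact Hdel|nra]. }
  assert (Hsmall : 200 * INR N * (/ 2) ^ N <= eta / 2).
  { assert (HN : INR n + 1 <= INR N) by (unfold N; rewrite plus_INR; simpl; lra).
    assert (H2 := square_le_pow2 N). rewrite pow_inv.
    assert (0 < 2 ^ N) by (apply pow_lt; lra).
    assert (HN0 : 0 < INR N) by (pose proof (pos_INR n); lra).
    assert (H400 : 400 <= eta / 2 * INR N).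
    { apply Rle_trans with (eta / 2 * (400 / (eta / 2))); [right; field; lra|].
      apply Rmult_le_compat_l; lra. }
    apply Rmult_le_reg_r with (2 ^ N); [assumption|]. rewrite Rmult_assoc, Rinv_l by lra. nra. }
  assert (HCT : C / T <= eta / 2).
  { apply Rmult_le_reg_r with (2 * T / eta); [apply Rdiv_lt_0_compat; lra|].
    field_simplify; [|lra|lra]. replace (2 * C / eta) with (2 * C / eta) in T2 by reflexivity. lra. }
  assert (sin th * (C / T) <= eta / 2).
  { assert (0 <= C / T) by (apply Rmult_le_pos; [lra|left; apply Rinv_0_lt_compat; lra]). nra. }
  apply Rabs_le_between in Hdiff. lra.
Qed.

(** * Ordinary differential equations *)

(** The distance given by the norm. The balls of a normed module are comparable to it only up to
    [norm_factor], so estimates with exact constants are stated with [dist]. *)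
Definition dist {V : NormedModule R_AbsRing} (x y : V) : R := norm (minus x y).

Lemma dist_sym {V : NormedModule R_AbsRing} (x y : V) : dist x y = dist y x.
Proof. unfold dist. rewrite <- opp_minus. apply norm_opp. Qed.

Lemma dist_refl {V : NormedModule R_AbsRing} (x : V) : dist x x = 0.
Proof. unfold dist. rewrite minus_eq_zero. apply norm_zero. Qed.

Lemma dist_pos {V : NormedModule R_AbsRing} (x y : V) : 0 <= dist x y.
Proof. apply norm_ge_0. Qed.

Lemma dist_triangle {V : NormedModule R_AbsRing} (x y z : V) : dist x z <= dist x y + dist y z.
Proof. unfold dist. rewrite (minus_trans y x z). apply norm_triangle. Qed.

Lemma dist_eq_0 {V : NormedModule R_AbsRing} (x y : V) : dist x y = 0 -> x = y.
Proof. intros H. apply norm_eq_zero in H. apply plus_reg_r with (opp y). rewrite plus_opp_r. exact H. Qed.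

Lemma plus_minus_r {V : NormedModule R_AbsRing} (x y : V) : plus y (minus x y) = x.
Proof.
  unfold minus. eapply eq_trans; [apply plus_comm|].
  eapply eq_trans; [symmetry; apply plus_assoc|].
  eapply eq_trans; [exact (f_equal (plus x) (plus_opp_l (G := V) y))|]. apply plus_zero_r.
Qed.

Lemma norm_le_dist {V : NormedModule R_AbsRing} (x y : V) : norm x <= norm y + dist x y.
Proof. rewrite <- (plus_minus_r x y) at 1. apply norm_triangle. Qed.

Lemma plus_plus_swap {V : NormedModule R_AbsRing} (a b c d : V) :
  plus (plus a b) (plus c d) = plus (plus a c) (plus b d).
Proof.
  rewrite <- (plus_assoc a b (plus c d)), <- (plus_assoc a c (plus b d)).
  rewrite (plus_assoc b c d), (plus_assoc c b d), (plus_comm b c). reflexivity.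
Qed.

Lemma minus_plus_plus {V : NormedModule R_AbsRing} (a b c d : V) :
  minus (plus a b) (plus c d) = plus (minus a c) (minus b d).
Proof.
  exact (eq_trans (f_equal (plus (plus a b)) (opp_plus (G := V) c d))
    (plus_plus_swap a b (opp c) (opp d))).
Qed.

Lemma minus_minus_minus {V : NormedModule R_AbsRing} (a b c d : V) :
  minus (minus a b) (minus c d) = minus (minus a c) (minus b d).
Proof.
  eapply eq_trans; [exact (f_equal (plus (plus a (opp b))) (opp_plus (G := V) c (opp d)))|].
  eapply eq_trans; [apply plus_plus_swap|]. symmetry.
  exact (f_equal (plus (plus a (opp c))) (opp_plus (G := V) b (opp d))).
Qed.

Lemma dist_plus_l {V : NormedModule R_AbsRing} (a b c : V) : dist (plus a b) (plus a c) = dist b c.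
Proof. unfold dist. apply f_equal. eapply eq_trans; [apply minus_plus_plus|].
  eapply eq_trans; [exact (f_equal (fun u => plus u (minus b c)) (minus_eq_zero (G := V) a))|]. apply plus_zero_l.
 Qed.

Lemma dist_plus_self {V : NormedModule R_AbsRing} (x u : V) : dist (plus x u) x = norm u.
Proof.
  transitivity (dist (plus x u) (plus x zero)).
  - apply f_equal. symmetry. apply plus_zero_r.
  - eapply eq_trans; [apply dist_plus_l|]. unfold dist. apply f_equal. exact (minus_zero_r (G := V) u).
Qed.

Lemma continuous_dist {V : NormedModule R_AbsRing} (g : R -> V) (x : R) :
  continuous g x <->
  (forall e, 0 < e -> exists d, 0 < d /\ forall y, Rabs (y - x) < d -> dist (g y) (g x) < e).
Proof.
  split.
  - intros H e He.
    destruct (H _ (locally_ball_norm (g x) (mkposreal e He))) as [d Hd].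
    exists d. split; [apply cond_pos|]. intros y Hy. apply (Hd y Hy).
  - intros H P [e He].
    destruct (H e (cond_pos e)) as [d [Hd H']].
    exists (mkposreal d Hd). intros y Hy. apply He.
    apply norm_compat1. apply H'. exact Hy.
Qed.

Lemma continuous_lip {V W : NormedModule R_AbsRing} (f : V -> W) (L : R) (g : R -> V) (x : R) :
  0 <= L -> (forall p q, dist (f p) (f q) <= L * dist p q) ->
  continuous g x -> continuous (fun t => f (g t)) x.
Proof.
  intros HL Hf Hg. apply continuous_dist. intros e He.
  destruct (proj1 (continuous_dist g x) Hg (e / (L + 1))) as [d [Hd H]].
  { apply Rdiv_lt_0_compat; lra. }
  exists d; split; [exact Hd|]. intros y Hy.
  eapply Rle_lt_trans; [apply Hf|].
  specialize (H y Hy). apply Rle_lt_trans with (L * (e / (L + 1))).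
  - apply Rmult_le_compat_l; lra.
  - replace e with (e / (L + 1) * (L + 1)) at 2 by (field; lra).
    assert (0 < e / (L + 1)) by (apply Rdiv_lt_0_compat; lra). nra.
Qed.

(** The nearest point of [a, b]. Composition with it extends curves given on an interval to
    continuous curves on the whole line, so that integrals over any range exist. *)
Definition clamp (a b t : R) : R := Rmax a (Rmin b t).

Lemma clamp_range a b t : a <= b -> a <= clamp a b t <= b.
Proof. intros H. unfold clamp, Rmax, Rmin. destruct (Rle_dec b t); destruct (Rle_dec a _); lra. Qed.

Lemma clamp_id a b t : a <= t <= b -> clamp a b t = t.
Proof. intros H. unfold clamp, Rmax, Rmin. destruct (Rle_dec b t); destruct (Rle_dec a _); lra. Qed.

Lemma clamp_lip a b t s : a <= b -> Rabs (clamp a b t - clamp a b s) <= Rabs (t - s).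
Proof.
  intros H. unfold clamp, Rmax, Rmin.
  destruct (Rle_dec b t); destruct (Rle_dec b s); repeat match goal with |- context [Rle_dec ?x ?y] => destruct (Rle_dec x y) end;
    unfold Rabs; repeat destruct Rcase_abs; lra.
Qed.

Lemma continuous_clamp {V : NormedModule R_AbsRing} (g : R -> V) (a b : R) : a <= b ->
  (forall t, a <= t <= b -> continuous g t) -> forall t, continuous (fun t => g (clamp a b t)) t.
Proof.
  intros Hab Hg t. apply continuous_dist. intros e He.
  destruct (proj1 (continuous_dist g _) (Hg _ (clamp_range a b t Hab)) e He) as [d [Hd H]].
  exists d; split; [exact Hd|]. intros y Hy. apply H.
  eapply Rle_lt_trans; [apply clamp_lip, Hab|exact Hy].
Qed.

Lemma continuous_norm_comp {V : NormedModule R_AbsRing} (g : R -> V) (x : R) :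
  continuous g x -> continuous (fun t => norm (g t)) x.
Proof.
  intros H. apply (proj2 (continuous_dist (V := R_NormedModule) (fun t => norm (g t)) x)). intros e He.
  destruct (proj1 (continuous_dist g x) H e He) as [d [Hd H']].
  exists d; split; [exact Hd|]. intros y Hy. specialize (H' y Hy).
  eapply Rle_lt_trans; [|exact H'].
  change (Rabs (norm (g y) - norm (g x)) <= dist (g y) (g x)).
  apply Rabs_le. pose proof (norm_le_dist (g y) (g x)). pose proof (norm_le_dist (g x) (g y)).
  rewrite (dist_sym (g x)) in *. lra.
Qed.

Lemma continuous_is_derive {V : NormedModule R_AbsRing} (g : R -> V) (x : R) (l : V) :
  is_derive g x l -> continuous g x.
Proof. intros H. apply (ex_derive_continuous (K := R_AbsRing)). exists l; exact H. Qed.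

Lemma continuity_pt_is_derive (f : R -> R) x l : is_derive f x l -> continuity_pt f x.
Proof.
  intros H. apply continuity_pt_filterlim. exact (continuous_is_derive (V := R_NormedModule) f x l H).
Qed.

Lemma ex_RInt_cont {V : CompleteNormedModule R_AbsRing} (g : R -> V) a b :
  (forall t, continuous g t) -> ex_RInt g a b.
Proof. intros H. apply ex_RInt_continuous. intros; apply H. Qed.

Lemma is_derive_RInt_cont {V : CompleteNormedModule R_AbsRing} (g : R -> V) a t :
  (forall t, continuous g t) -> is_derive (fun t => RInt g a t) t (g t).
Proof.
  intros H. apply is_derive_RInt with a; [|apply H].
  exists (mkposreal 1 Rlt_0_1). intros y _. apply RInt_correct, ex_RInt_cont, H.
Qed.

Lemma norm_RInt_le_gen {V : CompleteNormedModule R_AbsRing} (g : R -> V) (k : R -> R) a b :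
  (forall t, continuous g t) -> (forall t, continuous k t) ->
  (forall t, Rmin a b <= t <= Rmax a b -> norm (g t) <= k t) ->
  norm (RInt g a b) <= Rabs (RInt k a b).
Proof.
  intros Hg Hk H.
  assert (E : forall a b, a <= b -> (forall t, a <= t <= b -> norm (g t) <= k t) ->
     norm (RInt g a b) <= RInt k a b).
  { intros a' b' Hab H'. apply (norm_RInt_le g k a' b').
    - exact Hab.
    - exact H'.
    - apply RInt_correct, ex_RInt_cont, Hg.
    - apply (RInt_correct (V := R_CompleteNormedModule)), (ex_RInt_cont (V := R_CompleteNormedModule)), Hk. }
  destruct (Rle_dec a b) as [Hab|Hab].
  - rewrite Rmin_left, Rmax_right in H by exact Hab.
    eapply Rle_trans; [apply E; assumption|apply Rle_abs].
  - rewrite Rmin_right, Rmax_left in H by lra.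
    rewrite <- (opp_RInt_swap g) by (apply ex_RInt_cont, Hg).
    eapply Rle_trans; [right; exact (norm_opp (V := V) _)|].
    rewrite <- (opp_RInt_swap (V := R_CompleteNormedModule) k) by (apply (ex_RInt_cont (V := R_CompleteNormedModule)), Hk).
    change (opp (RInt k b a)) with (- RInt k b a). rewrite Rabs_Ropp.
    eapply Rle_trans; [apply E; [lra|assumption]|apply Rle_abs].
Qed.

(** The norm of z need not be differentiable, so its integral majorant Phi = A + L J is used
    instead: Phi exp (- L (t - a)) has nonpositive derivative on [a, b]. *)
Lemma gronwall {V : CompleteNormedModule R_AbsRing} (z F : R -> V) (L del a b : R) :
  a <= b -> 0 <= L -> 0 <= del ->
  (forall t, continuous F t) ->
  (forall t, a <= t <= b -> is_derive z t (F t)) ->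
  (forall t, a <= t <= b -> norm (F t) <= L * norm (z t) + del) ->
  forall t, a <= t <= b -> norm (z t) <= (norm (z a) + del * (b - a)) * exp (L * (t - a)).
Proof.
  intros Hab HL Hdel HF Hz HLz t Ht.
  set (phi := fun t => norm (z (clamp a b t))).
  assert (Hphi : forall t, continuous phi t).
  { intros s. apply continuous_norm_comp, (continuous_clamp (V := CompleteNormedModule.NormedModule _ V) z); [exact Hab|].
    intros u Hu. eapply continuous_is_derive, Hz, Hu. }
  set (A := norm (z a) + del * (b - a)).
  (* The primitive is hidden behind a name, so that [auto_derive] treats it as an atom. *)
  assert (HJ : exists J : R -> R, J = fun t => RInt phi a t) by (eexists; reflexivity).
  destruct HJ as [J EJ].
  set (Phi := fun t => A + L * J t).
  assert (HPhi : forall t, a <= t <= b -> norm (z t) <= Phi t).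
  { intros s Hs.
    assert (E : minus (z s) (z a) = RInt F a s).
    { symmetry. apply is_RInt_unique, is_RInt_derive; rewrite Rmin_left, Rmax_right by lra.
      - intros u Hu; apply Hz; lra.
      - intros u _; apply HF. }
    set (k := fun t => L * phi t + del).
    assert (Hk : forall t, continuous k t).
    { intros u. apply (continuous_plus (V := R_NormedModule)); [|apply continuous_const].
      apply (continuous_scal_r (V := R_NormedModule)), Hphi. }
    assert (B : norm (RInt F a s) <= Rabs (RInt k a s)).
    { apply norm_RInt_le_gen; [exact HF|exact Hk|].
      rewrite Rmin_left, Rmax_right by lra. intros u Hu. unfold k, phi.
      rewrite clamp_id by lra. apply HLz; lra. }
    assert (Ek : RInt k a s = L * RInt phi a s + del * (s - a)).
    { apply is_RInt_unique. apply (is_RInt_plus (V := R_NormedModule)).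
      - apply (is_RInt_scal (V := R_NormedModule)), (RInt_correct (V := R_CompleteNormedModule)),
          (ex_RInt_cont (V := R_CompleteNormedModule)), Hphi.
      - assert (Ec := is_RInt_const (V := R_NormedModule) a s del).
        evar_last; [exact Ec|]. change ((s - a) * del = del * (s - a)). ring. }
    assert (Hpos : 0 <= RInt phi a s).
    { apply RInt_ge_0; [lra|apply (ex_RInt_cont (V := R_CompleteNormedModule)), Hphi|].
      intros; apply norm_ge_0. }
    change (0 <= (RInt phi a s : R)) in Hpos.
    rewrite <- E, Ek, Rabs_pos_eq in B.
    2:{ apply Rplus_le_le_0_compat; apply Rmult_le_pos; lra. }
    change (dist (z s) (z a) <= L * RInt phi a s + del * (s - a)) in B.
    pose proof (norm_le_dist (z s) (z a)) as HN.
    unfold Phi, A. rewrite EJ. assert (del * (s - a) <= del * (b - a)) by (apply Rmult_le_compat_l; lra). lra. }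
  set (psi := fun t => Phi t * exp (- L * (t - a))).
  assert (Hd : forall t, is_derive psi t ((L * phi t - L * Phi t) * exp (- L * (t - a)))).
  { intros s.
    assert (H1 := is_derive_RInt_cont (V := R_CompleteNormedModule) phi a s Hphi).
    change (is_derive (fun t => RInt phi a t) s (phi s)) in H1.
    assert (H2 : is_derive J s (phi s)) by (rewrite EJ; exact H1). clear H1. rename H2 into H1.
    assert (EDJ : Derive (fun x : R => J x) s = phi s) by exact (is_derive_unique _ _ _ H1).
    unfold psi, Phi. auto_derive.
    - exists (phi s); exact H1.
    - rewrite EDJ. change (s + - a) with (s - a). ring. }
  assert (Hpsi : psi t <= psi a).
  { destruct (MVT_gen psi a t (fun t => (L * phi t - L * Phi t) * exp (- L * (t - a)))) as [c [Hc E]].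
    - intros x _; apply Hd.
    - intros x _. eapply continuity_pt_is_derive, Hd.
    - rewrite Rmin_left, Rmax_right in Hc by lra.
      assert (Hle : phi c <= Phi c).
      { unfold phi. rewrite clamp_id by lra. apply HPhi; lra. }
      assert (0 < exp (- L * (c - a))) by apply exp_pos.
      assert ((L * phi c - L * Phi c) * exp (- L * (c - a)) <= 0).
      { rewrite <- Rmult_minus_distr_l. 
        assert (L * (phi c - Phi c) <= 0) by nra. nra. }
      assert (0 <= t - a) by lra. nra. }
  unfold psi in Hpsi.
  replace (Phi a) with A in Hpsi.
  2:{ unfold Phi. rewrite EJ, RInt_point. change (A = A + L * 0). ring. }
  replace (- L * (a - a)) with 0 in Hpsi by ring. rewrite exp_0, Rmult_1_r in Hpsi.
  apply Rle_trans with (Phi t); [apply HPhi, Ht|].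
  replace (Phi t) with (Phi t * exp (- L * (t - a)) * exp (L * (t - a))).
  - apply Rmult_le_compat_r; [left; apply exp_pos|exact Hpsi].
  - rewrite Rmult_assoc, <- exp_plus. replace (- L * (t - a) + L * (t - a)) with 0 by ring.
    rewrite exp_0; ring.
Qed.

Lemma is_derive_reflect {V : NormedModule R_AbsRing} (z : R -> V) (t : R) (l : V) :
  is_derive z (- t) l -> is_derive (fun s => z (- s)) t (opp l).
Proof.
  intros H. 
  assert (E := is_derive_comp z (fun s => - s) t l (-1) H).
  evar_last.
  - apply E. auto_derive; [exact I|ring].
  - replace (-1) with (Ropp 1) by lra. exact (scal_opp_one l).
Qed.

Lemma gronwall_both {V : CompleteNormedModule R_AbsRing} (z F : R -> V) (L del T : R) :
  0 <= T -> 0 <= L -> 0 <= del ->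
  (forall t, continuous F t) ->
  (forall t, - T <= t <= T -> is_derive z t (F t)) ->
  (forall t, - T <= t <= T -> norm (F t) <= L * norm (z t) + del) ->
  forall t, - T <= t <= T -> norm (z t) <= (norm (z 0) + del * T) * exp (L * T).
Proof.
  intros HT HL Hdel HF Hz HLz t Ht.
  assert (Hmono : forall s, 0 <= s <= T ->
    (norm (z 0) + del * T) * exp (L * s) <= (norm (z 0) + del * T) * exp (L * T)).
  { intros s Hs. apply Rmult_le_compat_l.
    - apply Rplus_le_le_0_compat; [apply norm_ge_0|apply Rmult_le_pos; lra].
    - destruct (Req_dec (L * s) (L * T)) as [->|Hne]; [lra|left; apply exp_increasing].
      assert (L * s <= L * T) by (apply Rmult_le_compat_l; lra). lra. }
  destruct (Rle_dec 0 t) as [H0|H0].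
  - assert (G := gronwall z F L del 0 T HT HL Hdel HF ltac:(intros; apply Hz; lra)
      ltac:(intros; apply HLz; lra) t ltac:(lra)).
    rewrite !Rminus_0_r in G. eapply Rle_trans; [exact G|apply Hmono; lra].
  - assert (G := gronwall (fun s => z (- s)) (fun s => opp (F (- s))) L del 0 T HT HL Hdel).
    assert (G' := fun H1 H2 H3 => G H1 H2 H3 (- t)). clear G.
    rewrite !Rminus_0_r, Ropp_involutive, Ropp_0 in G'.
    eapply Rle_trans; [apply G'|apply Hmono; lra].
    + intros s. apply (continuous_opp (V := CompleteNormedModule.NormedModule _ V)).
      apply (continuous_comp (fun s : R => - s) F); [|apply HF].
      apply (continuous_opp (V := R_NormedModule)), continuous_id.
    + intros s Hs. apply (is_derive_reflect (V := CompleteNormedModule.NormedModule _ V) z s (F (- s))), Hz. lra.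
    + intros s Hs. eapply Rle_trans; [right; exact (norm_opp (V := V) _)|]. apply HLz; lra.
    + lra.
Qed.

(** The clamped upper limit makes every iterate continuous on the line and constant outside
    [t0 - T, t0 + T], so distances have to be controlled only inside. *)
Definition picard_map {V : CompleteNormedModule R_AbsRing} (f : R -> V -> V) (x0 : V) (t0 T : R)
    (y : R -> V) (t : R) : V :=
  plus x0 (RInt (fun s => f s (y s)) t0 (clamp (t0 - T) (t0 + T) t)).

Fixpoint picard_iter {V : CompleteNormedModule R_AbsRing} (f : R -> V -> V) (x0 : V) (t0 T : R)
    (n : nat) : R -> V :=
  match n with
  | O => fun _ => x0
  | S n => picard_map f x0 t0 T (picard_iter f x0 t0 T n)
  end.

Lemma continuous_plus_RInt {V : CompleteNormedModule R_AbsRing} (g : R -> V) (x0 : V) (t0 t : R) :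
  (forall t, continuous g t) -> is_derive (fun t => plus x0 (RInt g t0 t)) t (g t).
Proof.
  intros Hg. evar_last.
  - apply (is_derive_plus (V := V)).
    + apply is_derive_const.
    + apply is_derive_RInt_cont, Hg.
  - apply plus_zero_l.
Qed.

Lemma cosh_ge_1 x : 1 <= cosh x.
Proof.
  unfold cosh. assert (H1 : 0 < exp (- x)) by apply exp_pos.
  assert (H2 : exp x * exp (- x) = 1).
  { rewrite <- exp_plus. replace (x + - x) with 0 by ring. apply exp_0. }
  assert (H3 : 0 <= (exp x - 1) ^ 2 * exp (- x)) by (apply Rmult_le_pos; [apply pow2_ge_0|lra]).
  replace ((exp x - 1) ^ 2 * exp (- x)) with
    (exp x * (exp x * exp (- x)) - 2 * (exp x * exp (- x)) + exp (- x)) in H3 by ring.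
  rewrite H2 in H3. lra.
Qed.

Lemma Rabs_sinh_le_cosh x : Rabs (sinh x) <= cosh x.
Proof.
  unfold sinh, cosh. assert (0 < exp x) by apply exp_pos. assert (0 < exp (- x)) by apply exp_pos.
  apply Rabs_le. lra.
Qed.

(* The weight [cosh (2 L (t - t0))] makes the Picard map a contraction of ratio 1/2. *)
Lemma picard_contract {V : CompleteNormedModule R_AbsRing} (f : R -> V -> V) (x0 : V) (t0 T L K : R)
    (y y' : R -> V) : 0 < L -> 0 <= T -> 0 <= K ->
  (forall t p q, dist (f t p) (f t q) <= L * dist p q) ->
  (forall t, continuous (fun t => f t (y t)) t) ->
  (forall t, continuous (fun t => f t (y' t)) t) ->
  (forall t, t0 - T <= t <= t0 + T -> dist (y t) (y' t) <= K * cosh (2 * L * (t - t0))) ->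
  forall t, t0 - T <= t <= t0 + T ->
  dist (picard_map f x0 t0 T y t) (picard_map f x0 t0 T y' t) <= K / 2 * cosh (2 * L * (t - t0)).
Proof.
  intros HL HT HK Hf Hy Hy' H t Ht.
  unfold picard_map. rewrite clamp_id by exact Ht.
  eapply Rle_trans; [right; exact (dist_plus_l (V := V) _ _ _)|].
  assert (E : minus (RInt (fun s => f s (y s)) t0 t) (RInt (fun s => f s (y' s)) t0 t) =
     RInt (fun s => minus (f s (y s)) (f s (y' s))) t0 t).
  { symmetry. apply RInt_minus; apply ex_RInt_cont; assumption. }
  set (k := fun s => L * K * cosh (2 * L * (s - t0))).
  assert (Hk : forall s, is_derive (fun s => K / 2 * sinh (2 * L * (s - t0))) s (k s)).
  { intros s. unfold k, sinh, cosh. auto_derive; [exact I|]. 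
    change (s + - t0) with (s - t0). field. }
  assert (Hkc : forall s, continuous k s).
  { intros s. apply (ex_derive_continuous (K := R_AbsRing) (V := R_NormedModule)).
    unfold k, cosh. auto_derive. exact I. }
  assert (B : norm (RInt (fun s => minus (f s (y s)) (f s (y' s))) t0 t) <= Rabs (RInt k t0 t)).
  { apply norm_RInt_le_gen.
    - intros s. apply (continuous_minus (V := V)); [apply Hy|apply Hy'].
    - exact Hkc.
    - intros s Hs.
      assert (Hs' : t0 - T <= s <= t0 + T).
      { unfold Rmin, Rmax in Hs; destruct (Rle_dec t0 t); lra. }
      change (dist (f s (y s)) (f s (y' s)) <= k s).
      eapply Rle_trans; [apply Hf|]. unfold k. rewrite Rmult_assoc.
      apply Rmult_le_compat_l; [lra|apply H, Hs']. }
  rewrite <- E in B.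
  change (dist (RInt (fun s => f s (y s)) t0 t) (RInt (fun s => f s (y' s)) t0 t) <= Rabs (RInt k t0 t)) in B.
  eapply Rle_trans; [exact B|].
  assert (Ei : RInt k t0 t = K / 2 * sinh (2 * L * (t - t0)) - K / 2 * sinh (2 * L * (t0 - t0))).
  { apply is_RInt_unique, (is_RInt_derive (fun s => K / 2 * sinh (2 * L * (s - t0)))); intros s _; [apply Hk|apply Hkc]. }
  rewrite Ei. replace (2 * L * (t0 - t0)) with 0 by ring. rewrite sinh_0, Rmult_0_r, Rminus_0_r.
  rewrite Rabs_mult, Rabs_pos_eq by lra.
  apply Rmult_le_compat_l; [lra|apply Rabs_sinh_le_cosh].
Qed.

Lemma half_pow_small C e : 0 <= C -> 0 < e -> exists n, C * (/ 2) ^ n < e.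
Proof.
  intros HC He.
  destruct (pow_lt_1_zero (/ 2) ltac:(rewrite Rabs_pos_eq; lra) (e / (C + 1))) as [n Hn].
  { apply Rdiv_lt_0_compat; lra. }
  exists n. specialize (Hn n (le_n n)). rewrite Rabs_pos_eq in Hn by (apply pow_le; lra).
  assert (0 < (/ 2) ^ n) by (apply pow_lt; lra).
  apply Rmult_lt_compat_r with (r := C + 1) in Hn; [|lra].
  unfold Rdiv in Hn. rewrite Rmult_assoc, Rinv_l in Hn by lra. lra.
Qed.

(** The interval may be arbitrarily long because the Lipschitz condition is global and the weight
    makes the map a contraction on all of it. Time dependence is allowed for the sake of the
    variational equation. *)
Lemma picard {V : CompleteNormedModule R_AbsRing} (f : R -> V -> V) (L T t0 : R) (x0 : V) :
  0 < L -> 0 <= T ->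
  (forall t p q, dist (f t p) (f t q) <= L * dist p q) ->
  (forall y : R -> V, (forall t, continuous y t) -> forall t, continuous (fun t => f t (y t)) t) ->
  exists z : R -> V, z t0 = x0 /\
    forall t, t0 - T <= t <= t0 + T -> is_derive z t (f t (z t)).
Proof.
  intros HL HT Hf Hc.
  set (y := picard_iter f x0 t0 T).
  assert (Hab : t0 - T <= t0 + T) by lra.
  assert (Hmapc : forall u, (forall t, continuous u t) -> forall t, continuous (picard_map f x0 t0 T u) t).
  { intros u Hu. 
    apply (continuous_clamp (V := V)
      (fun t => plus x0 (RInt (fun s => f s (u s)) t0 t)) (t0 - T) (t0 + T) Hab).
    intros t _. eapply continuous_is_derive, continuous_plus_RInt, Hc, Hu. }
  assert (Hyc : forall n t, continuous (y n) t).
  { induction n as [|n IH]; intros t; [apply continuous_const|]. apply Hmapc, IH. }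
  set (w := fun t => cosh (2 * L * (t - t0))).
  assert (Hw : forall t, 1 <= w t) by (intros; apply cosh_ge_1).
  destruct (continuity_ab_maj (fun t => norm (f t x0)) (t0 - T) (t0 + T) Hab) as [tm [Htm _]].
  { intros c _. apply continuity_pt_filterlim.
    apply (continuous_norm_comp (V := V) (fun t => f t x0)).
    apply (Hc (fun _ => x0)). intros; apply continuous_const. }
  set (M1 := norm (f tm x0)) in *.
  assert (HM1 : 0 <= M1) by apply norm_ge_0.
  set (M := M1 * T). assert (HM : 0 <= M) by (apply Rmult_le_pos; assumption).
  assert (Hstep : forall n t, t0 - T <= t <= t0 + T -> dist (y (S n) t) (y n t) <= M * (/ 2) ^ n * w t).
  { induction n as [|n IH]; intros t Ht.
    - change (dist (plus x0 (RInt (fun s => f s x0) t0 (clamp (t0 - T) (t0 + T) t))) x0 <= M * 1 * w t).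
      rewrite clamp_id by exact Ht.
      assert (E : dist (plus x0 (RInt (fun s => f s x0) t0 t)) x0 = norm (RInt (fun s => f s x0) t0 t)).
      { exact (dist_plus_self (V := V) x0 _). }
      rewrite E.
      assert (B : norm (RInt (fun s => f s x0) t0 t) <= Rabs (RInt (fun _ => M1) t0 t)).
      { apply norm_RInt_le_gen.
        - apply (Hc (fun _ => x0)). intros; apply continuous_const.
        - intros; apply continuous_const.
        - intros s Hs. apply Htm. unfold Rmin, Rmax in Hs; destruct (Rle_dec t0 t); lra. }
      eapply Rle_trans; [exact B|].
      rewrite (RInt_const (V := R_CompleteNormedModule)).
      change (Rabs ((t - t0) * M1) <= M * 1 * w t).
      rewrite Rabs_mult, (Rabs_pos_eq M1) by exact HM1.
      assert (Rabs (t - t0) <= T) by (apply Rabs_le; lra).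
      apply Rle_trans with M; [unfold M; rewrite Rmult_comm; apply Rmult_le_compat_l; lra|].
      specialize (Hw t). nra.
    - replace (M * (/ 2) ^ S n * w t) with (M * (/ 2) ^ n / 2 * w t) by (simpl; field).
      apply picard_contract; try assumption.
      + apply Rmult_le_pos; [exact HM|apply pow_le; lra].
      + apply Hc, (Hyc (S n)).
      + apply Hc, (Hyc n). }
  set (W := w (t0 + T)).
  assert (HwW : forall t, t0 - T <= t <= t0 + T -> w t <= W).
  { assert (Hmono : forall a b, 0 <= a <= b -> cosh a <= cosh b).
    { intros a b Hab'. destruct (MVT_gen cosh a b sinh) as [c [Hc' E]].
      - intros; unfold cosh, sinh. auto_derive; [exact I|]. field.
      - intros. apply continuity_pt_filterlim. apply (ex_derive_continuous (K := R_AbsRing) (V := R_NormedModule)).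
        unfold cosh; auto_derive; exact I.
      - rewrite Rmin_left, Rmax_right in Hc' by lra.
        assert (0 <= sinh c). 
        { unfold sinh. assert (exp (- c) <= exp c) by (destruct (Req_dec c 0) as [->|]; [rewrite Ropp_0; lra|left; apply exp_increasing; lra]). lra. }
        nra. }
    intros t Ht. unfold W, w. destruct (Rle_dec t0 t).
    - apply Hmono. split; [apply Rmult_le_pos; lra|apply Rmult_le_compat_l; lra].
    - replace (cosh (2 * L * (t - t0))) with (cosh (2 * L * (t0 - t))).
      + apply Hmono. split; [apply Rmult_le_pos; lra|apply Rmult_le_compat_l; lra].
      + replace (2 * L * (t - t0)) with (- (2 * L * (t0 - t))) by ring.
        unfold cosh. rewrite Ropp_involutive. lra. }
  assert (HW : 1 <= W) by apply Hw.
  set (C := 2 * (M * W)). assert (HC : 0 <= C) by (unfold C; nra).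
  assert (Hclamp : forall n t, y n (clamp (t0 - T) (t0 + T) t) = y n t).
  { intros [|n] t; [reflexivity|]. unfold y; simpl. unfold picard_map.
    rewrite (clamp_id _ _ (clamp _ _ t)) by (apply clamp_range; lra). reflexivity. }
  (* The bound is written in telescoping form so that the induction on m closes. *)
  assert (Hcauchy : forall n m t, dist (y (n + m)%nat t) (y n t) <= C * (/ 2) ^ n - C * (/ 2) ^ (n + m)).
  { intros n m t. rewrite <- (Hclamp (n + m)%nat), <- (Hclamp n).
    assert (Ht := clamp_range (t0 - T) (t0 + T) t Hab).
    set (s := clamp (t0 - T) (t0 + T) t) in *.
    induction m as [|m IH].
    - rewrite Nat.add_0_r, dist_refl. lra.
    - rewrite Nat.add_succ_r.
      eapply Rle_trans; [apply (dist_triangle _ (y (n + m)%nat s))|].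
      assert (H1 := Hstep (n + m)%nat s Ht). specialize (HwW s Ht).
      assert (0 < (/ 2) ^ (n + m)) by (apply pow_lt; lra).
      assert (M * (/ 2) ^ (n + m) * w s <= M * (/ 2) ^ (n + m) * W) by (apply Rmult_le_compat_l; nra).
      simpl pow. unfold C in *. nra. }
  set (Fl := fun t => filtermap (fun n => y n t) eventually).
  set (yi := fun t => lim (Fl t) : V).
  assert (Hlim : forall t e, 0 < e -> exists N, forall n, (N <= n)%nat -> dist (y n t) (yi t) < e).
  { intros t e He.
    assert (PF : ProperFilter (Fl t)) by (apply filtermap_proper_filter, eventually_filter).
    assert (HCau : cauchy (Fl t)).
    { intros eps. destruct (half_pow_small C (pos eps) HC (cond_pos eps)) as [N HN].
      exists (y N t). exists N. intros n Hn. apply (norm_compat1 (V := V)).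
      change (dist (y n t) (y N t) < eps).
      replace n with (N + (n - N))%nat by lia.
      eapply Rle_lt_trans; [apply Hcauchy|].
      assert (0 <= C * (/ 2) ^ (N + (n - N))) by (apply Rmult_le_pos; [exact HC|apply pow_le; lra]). lra. }
    (* Completeness speaks about balls; the radius is divided by [norm_factor] to obtain an estimate
       in the norm. *)
    assert (Hnf : 0 < @norm_factor R_AbsRing V) by apply norm_factor_gt_0.
    assert (He' : 0 < e / @norm_factor R_AbsRing V) by (apply Rdiv_lt_0_compat; assumption).
    destruct (complete_cauchy (Fl t) PF HCau (mkposreal _ He')) as [N HN].
    exists N. intros n Hn. specialize (HN n Hn). apply (norm_compat2 (V := V)) in HN.
    simpl pos in HN. replace (norm_factor * (e / @norm_factor R_AbsRing V)) with e in HN by (field; lra).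
    exact HN. }
  assert (Hunif : forall n t, dist (yi t) (y n t) <= C * (/ 2) ^ n).
  { intros n t. apply Rnot_lt_le. intros Hlt.
    destruct (Hlim t (dist (yi t) (y n t) - C * (/ 2) ^ n) ltac:(lra)) as [N HN].
    specialize (HN (n + N)%nat ltac:(lia)).
    assert (H1 := Hcauchy n N t).
    assert (H2 := dist_triangle (yi t) (y (n + N)%nat t) (y n t)).
    rewrite (dist_sym (yi t) (y (n + N)%nat t)) in H2.
    assert (0 <= C * (/ 2) ^ (n + N)) by (apply Rmult_le_pos; [exact HC|apply pow_le; lra]). lra. }
  assert (Hyi : forall t, continuous yi t).
  { intros t. apply (proj2 (continuous_dist (V := V) yi t)).
    intros e He. destruct (half_pow_small C (e / 3) HC ltac:(lra)) as [N HN].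
    destruct (proj1 (continuous_dist (V := V) (y N) t) (Hyc N t) (e / 3) ltac:(lra)) as [d [Hd H]].
    exists d; split; [exact Hd|]. intros s Hs. specialize (H s Hs).
    assert (H1 := Hunif N s). assert (H2 := Hunif N t). rewrite dist_sym in H2.
    assert (H3 := dist_triangle (yi s) (y N s) (yi t)).
    assert (H4 := dist_triangle (y N s) (y N t) (yi t)). lra. }
  assert (Hfix : forall t, t0 - T <= t <= t0 + T -> picard_map f x0 t0 T yi t = yi t).
  { intros t Ht. apply (dist_eq_0 (V := V)).
    apply Rle_antisym; [|apply dist_pos]. apply Rnot_lt_le. intros Hlt.
    destruct (half_pow_small (C * W + C) _ ltac:(nra) Hlt) as [n Hn].
    assert (H1 : dist (picard_map f x0 t0 T yi t) (y (S n) t) <= C * (/ 2) ^ n / 2 * w t).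
    { apply picard_contract; try assumption.
      - apply Rmult_le_pos; [exact HC|apply pow_le; lra].
      - apply Hc, Hyi.
      - apply Hc, (Hyc n).
      - intros s Hs. eapply Rle_trans; [apply Hunif|]. fold (w s). specialize (Hw s).
        assert (0 <= C * (/ 2) ^ n) by (apply Rmult_le_pos; [exact HC|apply pow_le; lra]).
        fold y. nra. }
    assert (H2 := Hunif (S n) t). rewrite dist_sym in H2.
    assert (H3 := dist_triangle (picard_map f x0 t0 T yi t) (y (S n) t) (yi t)).
    specialize (HwW t Ht). assert (0 < (/ 2) ^ n) by (apply pow_lt; lra).
    assert (C * (/ 2) ^ n / 2 * w t <= C * (/ 2) ^ n / 2 * W) by (apply Rmult_le_compat_l; nra).
    simpl pow in H2. assert (0 <= C * (/ 2) ^ n * W) by (apply Rmult_le_pos; nra).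
    assert (0 <= C * (/ 2) ^ n) by nra. lra. }
  (* The integral without clamp is the witness: [yi] itself is constant beyond the end points and
     need not have a two-sided derivative there. *)
  exists (fun t => plus x0 (RInt (fun s => f s (yi s)) t0 t)). split.
  - rewrite RInt_point. apply plus_zero_r.
  - intros t Ht.
    assert (E : plus x0 (RInt (fun s => f s (yi s)) t0 t) = yi t).
    { rewrite <- (Hfix t Ht). unfold picard_map. rewrite clamp_id by exact Ht. reflexivity. }
    rewrite E. apply (continuous_plus_RInt (fun s => f s (yi s))). apply Hc, Hyi.
Qed.

(** * Functions with Lipschitz derivative *)

(** [D] is a bounded Lipschitz derivative of [F] on [B]. The set need not be convex or open, so the
    Taylor estimate is demanded for all pairs of points rather than deduced from the Lipschitz bound
    on [D]. *)
Definition C11 {V : NormedModule R_AbsRing} (B : V -> Prop) (F : V -> R) (D : V -> V -> R) : Prop :=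
  exists C, 0 <= C /\
  forall p, B p ->
    (forall u v, D p (plus u v) = D p u + D p v) /\
    (forall k v, D p (scal k v) = k * D p v) /\
    Rabs (F p) <= C /\
    (forall v, Rabs (D p v) <= C * norm v) /\
    forall q, B q ->
      (forall v, Rabs (D q v - D p v) <= C * dist q p * norm v) /\
      Rabs (F q - F p - D p (minus q p)) <= C * dist q p ^ 2.

(** As B need not be convex, the Taylor estimate serves for points at distance at most 1 and the
    bound on F for all others. *)
Lemma C11_lip {V : NormedModule R_AbsRing} (B : V -> Prop) F D : C11 B F D ->
  exists L, 0 <= L /\ forall p q, B p -> B q -> Rabs (F q - F p) <= L * dist q p.
Proof.
  intros [C [HC H]]. exists (2 * C); split; [lra|]. intros p q Hp Hq.
  destruct (H p Hp) as [_ [_ [Fp [Dp Hpq]]]]. destruct (Hpq q Hq) as [_ T].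
  destruct (H q Hq) as [_ [_ [Fq _]]]. specialize (Dp (minus q p)).
  fold (dist q p) in Dp. pose proof (dist_pos q p) as Hd.
  destruct (Rle_dec (dist q p) 1) as [H1|H1].
  - replace (F q - F p) with ((F q - F p - D p (minus q p)) + D p (minus q p)) by ring.
    eapply Rle_trans; [apply Rabs_triang|].
    assert (C * dist q p ^ 2 <= C * dist q p) by (apply Rmult_le_compat_l; nra). lra.
  - unfold Rminus. eapply Rle_trans; [apply Rabs_triang|]. rewrite Rabs_Ropp.
    assert (2 * C * 1 <= 2 * C * dist q p) by (apply Rmult_le_compat_l; lra). lra.
Qed.

Lemma C11_ext {V : NormedModule R_AbsRing} (B : V -> Prop) F G D :
  (forall p, B p -> F p = G p) -> C11 B F D -> C11 B G D.
Proof.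
  intros E [C [HC H]]. exists C; split; [exact HC|]. intros p Hp.
  destruct (H p Hp) as [A1 [A2 [A3 [A4 A5]]]].
  rewrite <- (E p Hp). repeat split; try assumption.
  - apply (A5 q H0).
  - rewrite <- (E q H0). apply (A5 q H0).
Qed.

Lemma C11_const {V : NormedModule R_AbsRing} (B : V -> Prop) (c : R) : C11 B (fun _ => c) (fun _ _ => 0).
Proof.
  exists (Rabs c). split; [apply Rabs_pos|]. intros p _.
  assert (Hz : forall x, 0 <= x -> Rabs 0 <= Rabs c * x).
  { intros x Hx. rewrite Rabs_R0. apply Rmult_le_pos; [apply Rabs_pos|exact Hx]. }
  split; [intros; ring|]. split; [intros; ring|]. split; [lra|].
  split; [intros v; apply Hz, norm_ge_0|]. intros q _. split.
  - intros v. rewrite Rminus_diag, Rmult_assoc. apply Hz.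
    apply Rmult_le_pos; [apply dist_pos|apply norm_ge_0].
  - replace (c - c - 0) with 0 by ring. apply Hz, pow2_ge_0.
Qed.

Lemma C11_plus {V : NormedModule R_AbsRing} (B : V -> Prop) F DF G DG :
  C11 B F DF -> C11 B G DG -> C11 B (fun p => F p + G p) (fun p v => DF p v + DG p v).
Proof.
  intros [C1 [HC1 H1]] [C2 [HC2 H2]]. exists (C1 + C2). split; [lra|]. intros p Hp.
  destruct (H1 p Hp) as [A1 [A2 [A3 [A4 A5]]]]. destruct (H2 p Hp) as [B1 [B2 [B3 [B4 B5]]]].
  split; [intros; rewrite A1, B1; ring|]. split; [intros; rewrite A2, B2; ring|].
  split; [eapply Rle_trans; [apply Rabs_triang|lra]|].
  split.
  { intros v. eapply Rle_trans; [apply Rabs_triang|]. specialize (A4 v). specialize (B4 v). lra. }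
  intros q Hq. destruct (A5 q Hq) as [A6 A7]. destruct (B5 q Hq) as [B6 B7]. split.
  - intros v. specialize (A6 v). specialize (B6 v).
    replace (DF q v + DG q v - (DF p v + DG p v)) with ((DF q v - DF p v) + (DG q v - DG p v)) by ring.
    eapply Rle_trans; [apply Rabs_triang|]. lra.
  - replace (F q + G q - (F p + G p) - (DF p (minus q p) + DG p (minus q p))) with
      ((F q - F p - DF p (minus q p)) + (G q - G p - DG p (minus q p))) by ring.
    eapply Rle_trans; [apply Rabs_triang|]. lra.
Qed.

Lemma C11_mult {V : NormedModule R_AbsRing} (B : V -> Prop) F DF G DG :
  C11 B F DF -> C11 B G DG -> C11 B (fun p => F p * G p) (fun p v => F p * DG p v + G p * DF p v).
Proof.
  intros HF HG.
  destruct (C11_lip _ _ _ HF) as [L1 [HL1 LF]]. destruct (C11_lip _ _ _ HG) as [L2 [HL2 LG]].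
  destruct HF as [C1 [HC1 H1]]. destruct HG as [C2 [HC2 H2]].
  set (C := 2 * (C1 * C2) + L1 * C2 + L2 * C1 + L1 * L2).
  assert (HC12 : 0 <= C1 * C2) by (apply Rmult_le_pos; assumption).
  assert (HL1C : 0 <= L1 * C2) by (apply Rmult_le_pos; assumption).
  assert (HL2C : 0 <= L2 * C1) by (apply Rmult_le_pos; assumption).
  assert (HLL : 0 <= L1 * L2) by (apply Rmult_le_pos; assumption).
  exists C. split; [unfold C; lra|]. intros p Hp.
  destruct (H1 p Hp) as [A1 [A2 [A3 [A4 A5]]]]. destruct (H2 p Hp) as [B1 [B2 [B3 [B4 B5]]]].
  split; [intros; rewrite A1, B1; ring|]. split; [intros; rewrite A2, B2; ring|].
  split.
  { eapply Rle_trans; [apply Rabs_mult_le; eassumption|unfold C; lra]. }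
  split.
  { intros v. eapply Rle_trans; [apply Rabs_triang|].
    apply Rle_trans with (C1 * (C2 * norm v) + C2 * (C1 * norm v)).
    - apply Rplus_le_compat; apply Rabs_mult_le; auto.
    - pose proof (norm_ge_0 v). unfold C. nra. }
  intros q Hq. destruct (A5 q Hq) as [A6 A7]. destruct (B5 q Hq) as [B6 B7].
  assert (A4q := proj1 (proj2 (proj2 (proj2 (H1 q Hq))))).
  assert (B4q := proj1 (proj2 (proj2 (proj2 (H2 q Hq))))).
  specialize (LF p q Hp Hq). specialize (LG p q Hp Hq).
  pose proof (dist_pos q p) as Hd. split.
  - intros v. pose proof (norm_ge_0 v) as Hv.
    replace (F q * DG q v + G q * DF q v - (F p * DG p v + G p * DF p v)) with
      (((F q - F p) * DG q v + F p * (DG q v - DG p v))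
       + ((G q - G p) * DF q v + G p * (DF q v - DF p v))) by ring.
    eapply Rle_trans; [apply Rabs_triang|].
    apply Rle_trans with ((L1 * dist q p * (C2 * norm v) + C1 * (C2 * dist q p * norm v))
      + (L2 * dist q p * (C1 * norm v) + C2 * (C1 * dist q p * norm v))).
    + apply Rplus_le_compat; (eapply Rle_trans; [apply Rabs_triang|]);
        apply Rplus_le_compat; apply Rabs_mult_le; auto.
    + assert (Hdv : 0 <= dist q p * norm v) by (apply Rmult_le_pos; assumption).
      unfold C. nra.
  - replace (F q * G q - F p * G p - (F p * DG p (minus q p) + G p * DF p (minus q p))) with
      ((F p * (G q - G p - DG p (minus q p)) + G p * (F q - F p - DF p (minus q p)))
       + (F q - F p) * (G q - G p)) by ring.
    eapply Rle_trans; [apply Rabs_triang|].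
    apply Rle_trans with ((C1 * (C2 * dist q p ^ 2) + C2 * (C1 * dist q p ^ 2)) + L1 * dist q p * (L2 * dist q p)).
    + apply Rplus_le_compat; [|apply Rabs_mult_le; assumption].
      eapply Rle_trans; [apply Rabs_triang|]. apply Rplus_le_compat; apply Rabs_mult_le; auto.
    + pose proof (pow2_ge_0 (dist q p)). unfold C. nra.
Qed.

Lemma C11_comp {V : NormedModule R_AbsRing} (B : V -> Prop) (S : R -> Prop) F DF (g g' : R -> R) :
  C11 B F DF -> C11 (V := R_NormedModule) S g (fun x h => g' x * h) ->
  (forall p, B p -> S (F p)) ->
  C11 B (fun p => g (F p)) (fun p v => g' (F p) * DF p v).
Proof.
  intros HF HG HS.
  destruct (C11_lip _ _ _ HF) as [L [HL LF]].
  destruct HF as [C1 [HC1 H1]]. destruct HG as [C2 [HC2 H2]].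
  assert (HC12 : 0 <= C1 * C2) by (apply Rmult_le_pos; assumption).
  assert (HLC : 0 <= C2 * L * C1) by (apply Rmult_le_pos; [apply Rmult_le_pos|]; assumption).
  assert (HLL : 0 <= C2 * (L * L)) by (apply Rmult_le_pos; [|apply Rmult_le_pos]; assumption).
  set (C := C2 + 2 * (C1 * C2) + C2 * L * C1 + C2 * (L * L)).
  assert (Hg' : forall x, S x -> Rabs (g' x) <= C2).
  { intros x Hx. destruct (H2 x Hx) as [_ [_ [_ [A _]]]]. specialize (A 1).
    rewrite Rmult_1_r in A. change (norm 1) with (Rabs 1) in A. rewrite Rabs_R1 in A. lra. }
  exists C. split; [unfold C; lra|]. intros p Hp.
  destruct (H1 p Hp) as [A1 [A2 [A3 [A4 A5]]]].
  destruct (H2 (F p) (HS p Hp)) as [_ [_ [B3 [_ B5]]]].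
  split; [intros; rewrite A1; ring|]. split; [intros; rewrite A2; ring|].
  split; [unfold C; lra|]. split.
  { intros v. eapply Rle_trans; [apply Rabs_mult_le; [apply Hg', HS, Hp|apply A4]|].
    pose proof (norm_ge_0 v). unfold C. nra. }
  intros q Hq. destruct (A5 q Hq) as [A6 A7].
  assert (A4q := proj1 (proj2 (proj2 (proj2 (H1 q Hq))))).
  destruct (B5 (F q) (HS q Hq)) as [B6 B7].
  specialize (LF p q Hp Hq).
  change (Rabs (g (F q) - g (F p) - g' (F p) * (F q - F p)) <= C2 * Rabs (F q - F p) ^ 2) in B7.
  assert (B6' : Rabs (g' (F q) - g' (F p)) <= C2 * Rabs (F q - F p)).
  { specialize (B6 1). rewrite !Rmult_1_r in B6.
    change (Rabs (g' (F q) - g' (F p)) <= C2 * Rabs (F q - F p) * Rabs 1) in B6. rewrite Rabs_R1 in B6. lra. }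
  pose proof (dist_pos q p) as Hd. pose proof (Rabs_pos (F q - F p)) as HdF. split.
  - intros v. pose proof (norm_ge_0 v) as Hv.
    replace (g' (F q) * DF q v - g' (F p) * DF p v) with
      ((g' (F q) - g' (F p)) * DF q v + g' (F p) * (DF q v - DF p v)) by ring.
    eapply Rle_trans; [apply Rabs_triang|].
    apply Rle_trans with (C2 * (L * dist q p) * (C1 * norm v) + C2 * (C1 * dist q p * norm v)).
    + apply Rplus_le_compat; apply Rabs_mult_le; auto.
      eapply Rle_trans; [exact B6'|]. apply Rmult_le_compat_l; assumption.
    + assert (Hdv : 0 <= dist q p * norm v) by (apply Rmult_le_pos; assumption).
      unfold C. nra.
  - replace (g (F q) - g (F p) - g' (F p) * DF p (minus q p)) with
      ((g (F q) - g (F p) - g' (F p) * (F q - F p)) + g' (F p) * (F q - F p - DF p (minus q p))) by ring.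
    eapply Rle_trans; [apply Rabs_triang|].
    apply Rle_trans with (C2 * (L * dist q p) ^ 2 + C2 * (C1 * dist q p ^ 2)).
    + apply Rplus_le_compat; [|apply Rabs_mult_le; auto].
      eapply Rle_trans; [exact B7|]. apply Rmult_le_compat_l; [exact HC2|]. apply pow_incr; lra.
    + pose proof (pow2_ge_0 (dist q p)). unfold C. nra.
Qed.

(** The angle is unbounded on the sets considered and hence not itself of this class, but its sine
    and cosine are. This calls for composition with a linear form that satisfies no bound on B. *)
Lemma C11_comp_lin {V : NormedModule R_AbsRing} (B : V -> Prop) (S : R -> Prop) (l : V -> R) (g g' : R -> R) :
  (forall u v, l (plus u v) = l u + l v) -> (forall k v, l (scal k v) = k * l v) ->
  (forall v, Rabs (l v) <= norm v) ->
  C11 (V := R_NormedModule) S g (fun x h => g' x * h) ->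
  (forall p, B p -> S (l p)) ->
  C11 B (fun p => g (l p)) (fun p v => g' (l p) * l v).
Proof.
  intros Hp Hk Hn [C [HC H2]] HS.
  assert (Hm : forall q p, l (minus q p) = l q - l p).
  { intros q p. unfold minus. rewrite Hp.
    replace (l (opp p)) with (- l p); [reflexivity|].
    replace (opp p) with (scal (opp one) p) by (symmetry; symmetry; exact (scal_opp_one p)).
    rewrite Hk. change (- l p = - 1 * l p). ring. }
  exists C. split; [exact HC|]. intros p Bp.
  destruct (H2 (l p) (HS p Bp)) as [_ [_ [B3 [B4 B5]]]].
  split; [intros; rewrite Hp; ring|]. split; [intros; rewrite Hk; ring|].
  split; [exact B3|]. split.
  { intros v. eapply Rle_trans; [apply B4|]. apply Rmult_le_compat_l; [exact HC|apply Hn]. }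
  intros q Bq. destruct (B5 (l q) (HS q Bq)) as [B6 B7].
  change (Rabs (g (l q) - g (l p) - g' (l p) * (l q - l p)) <= C * Rabs (l q - l p) ^ 2) in B7.
  assert (Hd : Rabs (l q - l p) <= dist q p) by (rewrite <- Hm; apply Hn).
  pose proof (Rabs_pos (l q - l p)). split.
  - intros v. eapply Rle_trans; [apply B6|].
    change (C * Rabs (l q - l p) * Rabs (l v) <= C * dist q p * norm v).
    apply Rmult_le_compat; [apply Rmult_le_pos; [exact HC|apply Rabs_pos]|apply Rabs_pos| |apply Hn].
    apply Rmult_le_compat_l; assumption.
  - rewrite Hm. eapply Rle_trans; [exact B7|]. apply Rmult_le_compat_l; [exact HC|].
    apply pow_incr; lra.
Qed.

Lemma C11_of_derive2 (S : R -> Prop) (g g' g'' : R -> R) (K : R) :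
  (forall x y z, S x -> S y -> Rmin x y <= z <= Rmax x y -> S z) ->
  (forall x, S x -> is_derive g x (g' x) /\ is_derive g' x (g'' x) /\
     Rabs (g x) <= K /\ Rabs (g' x) <= K /\ Rabs (g'' x) <= K) ->
  C11 (V := R_NormedModule) S g (fun x h => g' x * h).
Proof.
  intros Hconv H. exists (Rabs K). split; [apply Rabs_pos|].
  pose proof (Rle_abs K) as HK. intros x Hx.
  destruct (H x Hx) as [_ [_ [A1 [A2 A3]]]].
  assert (L : forall y, S y -> Rabs (g' y - g' x) <= Rabs K * Rabs (y - x)).
  { intros y Hy. apply (MVT_abs_le g' g''); intros z Hz; specialize (H z (Hconv _ _ _ Hx Hy Hz)); [tauto|lra]. }
  split; [intros u v; change (plus u v) with (u + v); ring|].
  split; [intros k v; change (scal k v) with (k * v); ring|].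
  split; [lra|]. split.
  { intros v. apply Rabs_mult_le; [lra|apply Rle_refl]. }
  intros y Hy. split.
  - intros v. rewrite <- Rmult_minus_distr_r. apply Rabs_mult_le; [apply L, Hy|apply Rle_refl].
  - change (Rabs (g y - g x - g' x * (y - x)) <= Rabs K * Rabs (y - x) ^ 2).
    replace (g y - g x - g' x * (y - x)) with ((g y - g' x * y) - (g x - g' x * x)) by ring.
    replace (Rabs K * Rabs (y - x) ^ 2) with (Rabs K * Rabs (y - x) * Rabs (y - x)) by ring.
    apply (MVT_abs_le (fun z => g z - g' x * z) (fun z => g' z - g' x)); intros z Hz.
    + destruct (H z (Hconv _ _ _ Hx Hy Hz)) as [Hd _].
      assert (Ed : Derive (fun z : R => g z) z = g' z) by exact (is_derive_unique _ _ _ Hd).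
      auto_derive; [exists (g' z); exact Hd|]. rewrite Ed. ring.
    + eapply Rle_trans; [apply L, (Hconv _ _ _ Hx Hy Hz)|].
      apply Rmult_le_compat_l; [apply Rabs_pos|].
      unfold Rmin, Rmax in Hz. unfold Rabs. destruct (Rle_dec x y); repeat destruct Rcase_abs; lra.
Qed.

Lemma C11_sin : C11 (V := R_NormedModule) (fun _ => True) sin (fun x h => cos x * h).
Proof.
  apply (C11_of_derive2 _ _ _ (fun x => - sin x) 1); [auto|].
  intros x _. split; [auto_derive; [exact I|ring]|]. split; [auto_derive; [exact I|ring]|].
  rewrite Rabs_Ropp. pose proof (SIN_bound x). pose proof (COS_bound x).
  repeat split; apply Rabs_le; lra.
Qed.

Lemma C11_cos : C11 (V := R_NormedModule) (fun _ => True) cos (fun x h => - sin x * h).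
Proof.
  apply (C11_of_derive2 _ _ _ (fun x => - cos x) 1); [auto|].
  intros x _. split; [auto_derive; [exact I|ring]|]. split; [auto_derive; [exact I|ring]|].
  rewrite !Rabs_Ropp. pose proof (SIN_bound x). pose proof (COS_bound x).
  repeat split; apply Rabs_le; lra.
Qed.

Lemma interval_convex (a b x y z : R) :
  a <= x <= b -> a <= y <= b -> Rmin x y <= z <= Rmax x y -> a <= z <= b.
Proof. unfold Rmin, Rmax; destruct (Rle_dec x y); lra. Qed.

Lemma C11_id (a b : R) : C11 (V := R_NormedModule) (fun x => a <= x <= b) (fun x => x) (fun x h => 1 * h).
Proof.
  apply (C11_of_derive2 _ _ _ (fun _ => 0) (Rabs a + Rabs b + 1)); [apply interval_convex|].
  intros x Hx. split; [auto_derive; [exact I|ring]|]. split; [auto_derive; [exact I|ring]|].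
  rewrite Rabs_R0, Rabs_R1. pose proof (Rabs_pos a). pose proof (Rabs_pos b).
  repeat split; try lra. unfold Rabs; repeat destruct Rcase_abs; lra.
Qed.

Lemma C11_inv (a b : R) : 0 < a ->
  C11 (V := R_NormedModule) (fun x => a <= x <= b) Rinv (fun x h => - / x ^ 2 * h).
Proof.
  intros Ha. assert (Hia : 0 < / a) by (apply Rinv_0_lt_compat; exact Ha).
  assert (H2 : 0 < / a * / a) by (apply Rmult_lt_0_compat; assumption).
  assert (H3 : 0 < 2 * (/ a * (/ a * / a))) by (repeat apply Rmult_lt_0_compat; lra).
  apply (C11_of_derive2 _ _ _ (fun x => 2 * / x ^ 3) (/ a + / a * / a + 2 * (/ a * (/ a * / a)))); [apply interval_convex|].
  intros x Hx. split; [auto_derive; [lra|field; lra]|].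
  split; [auto_derive; [nra|field; lra]|].
  assert (Hix : 0 < / x <= / a) by (split; [apply Rinv_0_lt_compat; lra|apply Rinv_le_contravar; lra]).
  assert (Hix2 : 0 < / x * / x <= / a * / a) by (split; [apply Rmult_lt_0_compat; lra|apply Rmult_le_compat; lra]).
  assert (Hix3 : / x * (/ x * / x) <= / a * (/ a * / a)) by (apply Rmult_le_compat; lra).
  rewrite Rabs_Ropp, Rabs_mult.
  replace (/ x ^ 2) with (/ x * / x) by (field; lra).
  replace (/ x ^ 3) with (/ x * (/ x * / x)) by (field; lra).
  rewrite !Rabs_pos_eq; try lra; try nra.
Qed.

Lemma C11_sqrt (a b : R) : 0 < a <= b ->
  exists s', C11 (V := R_NormedModule) (fun x => a <= x <= b) sqrt (fun x h => s' x * h).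
Proof.
  intros Ha. exists (fun x => / (2 * sqrt x)).
  assert (Hsa : 0 < sqrt a) by (apply sqrt_lt_R0; lra).
  assert (Hi : 0 < / (2 * sqrt a)) by (apply Rinv_0_lt_compat; lra).
  assert (Hi2 : 0 < / a) by (apply Rinv_0_lt_compat; lra).
  apply (C11_of_derive2 _ _ _ (fun x => - (/ 2 * (/ x * / (2 * sqrt x))))
    (sqrt b + / (2 * sqrt a) + / a * / (2 * sqrt a))); [apply interval_convex|].
  intros x Hx.
  assert (Hsx : sqrt a <= sqrt x) by (apply sqrt_le_1_alt; lra).
  assert (Hss : sqrt x * sqrt x = x) by (apply sqrt_sqrt; lra).
  split; [auto_derive; [lra|field; lra]|].
  split.
  { auto_derive; [split; [lra|split; [lra|exact I]]|]. set (r := sqrt x) in *. rewrite <- Hss. field. lra. }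
  assert (sqrt x <= sqrt b) by (apply sqrt_le_1_alt; lra).
  assert (Hix : 0 < / (2 * sqrt x) <= / (2 * sqrt a)) by (split; [apply Rinv_0_lt_compat; lra|apply Rinv_le_contravar; lra]).
  assert (Hix2 : 0 < / x <= / a) by (split; [apply Rinv_0_lt_compat; lra|apply Rinv_le_contravar; lra]).
  assert (Hp : 0 < / x * / (2 * sqrt x) <= / a * / (2 * sqrt a)) by (split; [apply Rmult_lt_0_compat; lra|apply Rmult_le_compat; lra]).
  assert (0 < sqrt b) by lra.
  rewrite Rabs_Ropp. rewrite !Rabs_pos_eq; lra.
Qed.

Lemma norm_pair_ge {V : NormedModule R_AbsRing} (v : V) (h : R) :
  norm v <= norm ((v, h) : prod_NormedModule R_AbsRing V R_NormedModule) /\ Rabs h <= norm ((v, h) : prod_NormedModule R_AbsRing V R_NormedModule).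
Proof.
  destruct (norm_prod (K := R_AbsRing) (U := V) (V := R_NormedModule) v h) as [H _].
  split; (eapply Rle_trans; [|exact H]); [apply Rmax_l|apply Rmax_r].
Qed.

Lemma norm_pair_le {V : NormedModule R_AbsRing} (v : V) (h : R) : norm ((v, h) : prod_NormedModule R_AbsRing V R_NormedModule) <= norm v + Rabs h.
Proof.
  change (sqrt (norm v ^ 2 + Rabs h ^ 2) <= norm v + Rabs h).
  pose proof (norm_ge_0 v). pose proof (Rabs_pos h).
  rewrite <- (sqrt_Rsqr (norm v + Rabs h)) by lra. apply sqrt_le_1_alt. unfold Rsqr. nra.
Qed.

(** Strong monotonicity in the last variable takes the place of a condition on the partial
    derivative. Directly it makes U Lipschitz; applied to small increments it bounds that partial
    derivative below by m, so that DU = - D_v / D_e is defined with all constants explicit. *)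
Lemma C11_implicit {V : NormedModule R_AbsRing} (B : V -> Prop) (a b m : R)
    (Phi : V * R -> R) (D : V * R -> V * R -> R) (U : V -> R) :
  0 < m -> a < b ->
  C11 (V := prod_NormedModule R_AbsRing V R_NormedModule) (fun w => B (fst w) /\ a <= snd w <= b) Phi D ->
  (forall p u u', B p -> a <= u <= u' -> u' <= b -> m * (u' - u) <= Phi (p, u') - Phi (p, u)) ->
  (forall p, B p -> a <= U p <= b /\ Phi (p, U p) = 0) ->
  exists DU, C11 B U DU.
Proof.
  intros Hm Hab HPhi Hmono HU.
  set (VR := prod_NormedModule R_AbsRing V R_NormedModule) in *.
  destruct (C11_lip _ _ _ HPhi) as [L [HL LPhi]].
  destruct HPhi as [C [HC H]].
  set (e := ((zero : V), 1) : VR).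
  assert (He : norm e <= 1).
  { eapply Rle_trans; [apply norm_pair_le|]. rewrite Rabs_R1.
    assert (E0 := norm_zero (V := V)). rewrite E0. lra. }
  set (inj := fun v : V => ((v, 0) : VR)).
  assert (Hinj : forall v, norm (inj v) <= norm v).
  { intros v. eapply Rle_trans; [apply norm_pair_le|]. rewrite Rabs_R0. lra. }
  set (P := fun p => ((p, U p) : VR)).
  assert (HP : forall p, B p -> B (fst (P p)) /\ a <= snd (P p) <= b) by (intros p Hp; split; [exact Hp|apply HU, Hp]).
  assert (Hlin : forall p, B p -> forall (v : V) (k : R), D (P p) ((v, k) : VR) = D (P p) (inj v) + k * D (P p) e).
  { intros p Hp v k. destruct (H (P p) (HP p Hp)) as [A1 [A2 _]].
    rewrite <- A2, <- A1. f_equal. unfold inj, e.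
    change ((v, k) = (plus v (scal k zero), 0 + k * 1)). apply (f_equal2 (@pair V R)); [|simpl; ring].
    eapply eq_trans; [symmetry; exact (plus_zero_r (G := V) v)|].
    apply f_equal. symmetry. exact (scal_zero_r (K := R_AbsRing) (V := V) k). }
  (* strong monotonicity in the last variable bounds the partial derivative from below *)
  assert (Hd : forall p, B p -> m <= D (P p) e).
  { intros p Hp. destruct (HU p Hp) as [HUp _].
    apply Rnot_lt_le. intros Hlt.
    (* For increments up to [h0] the quadratic Taylor error is at most half of the supposed gap,
       which contradicts monotonicity. *)
    set (h0 := (m - D (P p) e) / (2 * (C + 1))).
    assert (Hh0 : 0 < h0) by (apply Rdiv_lt_0_compat; lra).
    assert (E : forall k, a <= U p + k <= b -> k <> 0 -> m * Rabs k <= Rabs k * D (P p) e + C * k ^ 2).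
    { intros k Hk Hk0.
      destruct (H (P p) (HP p Hp)) as [_ [_ [_ [_ A5]]]].
      assert (Q : B (fst ((p, U p + k) : VR)) /\ a <= snd ((p, U p + k) : VR) <= b) by (split; [exact Hp|exact Hk]).
      destruct (A5 _ Q) as [_ T].
      assert (Em : minus ((p, U p + k) : VR) (P p) = scal k e).
      { unfold P, e. change ((minus p p, U p + k - U p) = (scal k zero, k * 1)). apply (f_equal2 (@pair V R)); [|simpl; ring].
        eapply eq_trans; [exact (minus_eq_zero (G := V) p)|]. symmetry. exact (scal_zero_r (K := R_AbsRing) (V := V) k). }
      destruct (H (P p) (HP p Hp)) as [_ [A2 _]].
      assert (Hdk : dist ((p, U p + k) : VR) (P p) <= Rabs k).
      { unfold dist. rewrite Em. eapply Rle_trans; [exact (norm_scal (K := R_AbsRing) (V := VR) k e)|].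
        change (abs k) with (Rabs k). pose proof (Rabs_pos k). nra. }
      rewrite Em, A2 in T.
      assert (T' : C * dist ((p, U p + k) : VR) (P p) ^ 2 <= C * k ^ 2).
      { apply Rmult_le_compat_l; [exact HC|]. rewrite <- (Rsqr_pow2 k), Rsqr_abs, Rsqr_pow2.
        apply pow_incr. split; [apply dist_pos|exact Hdk]. }
      apply Rabs_le_between in T.
      assert (T2 : - (C * k ^ 2) <= Phi (p, U p + k) - Phi (p, U p) - k * D (P p) e <= C * k ^ 2).
      { destruct T as [Ta Tb]. split.
        - eapply Rle_trans; [|exact Ta]. apply Ropp_le_contravar, T'.
        - eapply Rle_trans; [exact Tb|exact T']. }
      destruct (Rtotal_order k 0) as [Hn|[Hn|Hn]]; [|lra|].
      - rewrite Rabs_left by exact Hn.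
        assert (M := Hmono p (U p + k) (U p) Hp ltac:(lra) ltac:(lra)).
        lra.
      - rewrite Rabs_right by lra.
        assert (M := Hmono p (U p) (U p + k) Hp ltac:(lra) ltac:(lra)).
        lra. }
    (* U p may be an end point of [a, b], so the increment goes upwards when there is room and
       downwards otherwise. *)
    assert (Hk : exists k, a <= U p + k <= b /\ k <> 0 /\ Rabs k <= h0).
    { destruct (Rlt_dec (U p) b) as [Hb|Hb].
      - exists (Rmin h0 (b - U p)). assert (0 < Rmin h0 (b - U p)) by (apply Rmin_pos; lra).
        pose proof (Rmin_l h0 (b - U p)). pose proof (Rmin_r h0 (b - U p)).
        rewrite Rabs_pos_eq by lra. repeat split; lra.
      - exists (- Rmin h0 (b - a)). assert (0 < Rmin h0 (b - a)) by (apply Rmin_pos; lra).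
        pose proof (Rmin_l h0 (b - a)). pose proof (Rmin_r h0 (b - a)).
        rewrite Rabs_Ropp, Rabs_pos_eq by lra. repeat split; lra. }
    destruct Hk as [k [Hk1 [Hk2 Hk3]]]. specialize (E k Hk1 Hk2).
    assert (Hk4 : 0 < Rabs k) by (apply Rabs_pos_lt, Hk2).
    rewrite <- (Rsqr_pow2 k), Rsqr_abs, Rsqr_pow2 in E.
    assert (E2 : m <= D (P p) e + C * Rabs k) by nra.
    assert (C * Rabs k <= (C + 1) * h0) by (apply Rmult_le_compat; lra).
    replace ((C + 1) * h0) with ((m - D (P p) e) / 2) in H0 by (unfold h0; field; lra). lra. }
  assert (Hdist : forall p q : V, dist (P q) (P p) <= dist q p + Rabs (U q - U p)).
  { intros p q. unfold dist. apply (norm_pair_le (minus q p) (U q - U p)). }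
  assert (LU : forall p q, B p -> B q -> Rabs (U q - U p) <= L / m * dist q p).
  { intros p q Hp Hq. destruct (HU p Hp) as [Up Ep]. destruct (HU q Hq) as [Uq Eq].
    assert (HX : Rabs (Phi (q, U p) - Phi (p, U p)) <= L * dist q p).
    { eapply Rle_trans; [apply (LPhi ((p, U p) : VR) ((q, U p) : VR)); split; assumption|].
      apply Rmult_le_compat_l; [exact HL|]. unfold dist.
      eapply Rle_trans; [apply (norm_pair_le (minus q p) (U p - U p))|].
      rewrite Rminus_diag, Rabs_R0. lra. }
    rewrite Ep, Rminus_0_r in HX.
    apply Rmult_le_reg_l with m; [exact Hm|].
    replace (m * (L / m * dist q p)) with (L * dist q p) by (field; lra).
    apply Rabs_le_between in HX.
    destruct (Rle_dec (U p) (U q)) as [Hle|Hle].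
    - assert (M := Hmono q (U p) (U q) Hq ltac:(lra) ltac:(lra)). rewrite Rabs_pos_eq by lra. lra.
    - assert (M := Hmono q (U q) (U p) Hq ltac:(lra) ltac:(lra)). rewrite Rabs_left by lra. lra. }
  set (K := 1 + L / m).
  assert (HLm : 0 <= L / m) by (apply Rmult_le_pos; [exact HL|left; apply Rinv_0_lt_compat; lra]).
  assert (HPK : forall p q, B p -> B q -> dist (P q) (P p) <= K * dist q p).
  { intros p q Hp Hq. eapply Rle_trans; [apply Hdist|]. specialize (LU p q Hp Hq). unfold K. lra. }
  assert (HK : 1 <= K) by (unfold K; lra).
  assert (Him : 0 < / m) by (apply Rinv_0_lt_compat; exact Hm).
  (* The derivative obtained by differentiating Phi (p, U p) = 0. *)
  exists (fun p v => - D (P p) (inj v) / D (P p) e).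
  set (C' := Rabs a + Rabs b + C / m + C * K / m + C * (C * K) / (m * m) + C * K ^ 2 / m).
  assert (HCm : 0 <= C / m) by (apply Rmult_le_pos; lra).
  assert (HCK : 0 <= C * K) by nra.
  assert (HCKm : 0 <= C * K / m) by (apply Rmult_le_pos; lra).
  assert (HCC : 0 <= C * (C * K) / (m * m)).
  { apply Rmult_le_pos; [apply Rmult_le_pos; assumption|left; apply Rinv_0_lt_compat; nra]. }
  assert (HCKK : 0 <= C * K ^ 2 / m).
  { apply Rmult_le_pos; [apply Rmult_le_pos; [exact HC|apply pow2_ge_0]|lra]. }
  pose proof (Rabs_pos a) as Ha0. pose proof (Rabs_pos b) as Hb0.
  exists C'. split; [unfold C'; lra|]. intros p Hp.
  destruct (H (P p) (HP p Hp)) as [A1 [A2 [A3 [A4 A5]]]].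
  specialize (Hd p Hp) as Hdp.
  split.
  { intros u v. replace (inj (plus u v)) with (plus (inj u) (inj v)).
    - rewrite A1. field. lra.
    - unfold inj. change ((plus u v, 0 + 0) = (plus u v, 0)). apply (f_equal2 (@pair V R)); [reflexivity|simpl; ring]. }
  split.
  { intros k v. replace (inj (scal k v)) with (scal k (inj v)).
    - rewrite A2. field. lra.
    - unfold inj. change ((scal k v, k * 0) = (scal k v, 0)). apply (f_equal2 (@pair V R)); [reflexivity|simpl; ring]. }
  split.
  { destruct (HU p Hp) as [Up _]. apply Rle_trans with (Rabs a + Rabs b); [|unfold C'; lra].
    unfold Rabs; repeat destruct Rcase_abs; lra. }
  assert (Hinvd : forall p, B p -> 0 < / D (P p) e <= / m).
  { intros r Hr. specialize (Hd r Hr). split; [apply Rinv_0_lt_compat; lra|apply Rinv_le_contravar; lra]. }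
  assert (HDinj : forall r v, B r -> Rabs (D (P r) (inj v)) <= C * norm v).
  { intros r v Hr. destruct (H (P r) (HP r Hr)) as [_ [_ [_ [X _]]]].
    eapply Rle_trans; [apply X|]. apply Rmult_le_compat_l; [exact HC|apply Hinj]. }
  split.
  { intros v. unfold Rdiv. pose proof (norm_ge_0 v). specialize (Hinvd p Hp).
    apply Rle_trans with (C * norm v * / m).
    - apply Rabs_mult_le; [rewrite Rabs_Ropp; apply HDinj, Hp|rewrite Rabs_pos_eq; lra].
    - replace (C * norm v * / m) with (C / m * norm v) by (unfold Rdiv; ring).
      apply Rmult_le_compat_r; [assumption|unfold C'; lra]. }
  intros q Hq. specialize (Hd q Hq) as Hdq. specialize (LU p q Hp Hq) as LUpq.
  destruct (A5 (P q) (HP q Hq)) as [A6 A7].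
  pose proof (dist_pos q p) as Hdpos. specialize (HPK p q Hp Hq) as HPKpq.
  split.
  - intros v. pose proof (norm_ge_0 v) as Hv.
    replace (- D (P q) (inj v) / D (P q) e - - D (P p) (inj v) / D (P p) e) with
      (- (D (P q) (inj v) - D (P p) (inj v)) * / D (P q) e
       + D (P p) (inj v) * ((D (P q) e - D (P p) e) * (/ D (P q) e * / D (P p) e))) by (field; lra).
    eapply Rle_trans; [apply Rabs_triang|].
    apply Rle_trans with (C * (K * dist q p) * norm v * / m
       + C * norm v * (C * (K * dist q p) * 1 * (/ m * / m))).
    + destruct (Hinvd p Hp) as [I1 I2]. destruct (Hinvd q Hq) as [I3 I4].
      apply Rplus_le_compat.
      * apply Rabs_mult_le; [|rewrite Rabs_pos_eq; lra]. rewrite Rabs_Ropp.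
        eapply Rle_trans; [apply A6|].
        apply Rmult_le_compat; [apply Rmult_le_pos; [exact HC|apply dist_pos]|apply norm_ge_0| |apply Hinj].
        apply Rmult_le_compat_l; assumption.
      * apply Rabs_mult_le; [apply HDinj, Hp|]. apply Rabs_mult_le.
        -- eapply Rle_trans; [apply A6|].
           apply Rmult_le_compat; [apply Rmult_le_pos; [exact HC|apply dist_pos]|apply norm_ge_0| |exact He].
           apply Rmult_le_compat_l; assumption.
        -- apply Rabs_mult_le; rewrite Rabs_pos_eq; lra.
    + replace (C * (K * dist q p) * norm v * / m + C * norm v * (C * (K * dist q p) * 1 * (/ m * / m)))
        with ((C * K / m + C * (C * K) / (m * m)) * (dist q p * norm v)) by (field; lra).
      rewrite Rmult_assoc. apply Rmult_le_compat_r; [apply Rmult_le_pos; assumption|unfold C'; lra].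
  - destruct (HU p Hp) as [_ Ep]. destruct (HU q Hq) as [_ Eq].
    change (Phi (P q)) with (Phi (q, U q)) in A7. change (Phi (P p)) with (Phi (p, U p)) in A7.
    rewrite Ep, Eq in A7.
    change (minus (P q) (P p)) with ((minus q p, U q - U p) : VR) in A7.
    rewrite (Hlin p Hp) in A7.
    replace (U q - U p - - D (P p) (inj (minus q p)) / D (P p) e) with
      (- (0 - 0 - (D (P p) (inj (minus q p)) + (U q - U p) * D (P p) e)) * / D (P p) e) by (field; lra).
    destruct (Hinvd p Hp) as [I1 I2].
    apply Rle_trans with (C * (K * dist q p) ^ 2 * / m).
    + apply Rabs_mult_le; [|rewrite Rabs_pos_eq; lra]. rewrite Rabs_Ropp.
      eapply Rle_trans; [exact A7|]. apply Rmult_le_compat_l; [exact HC|].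
      apply pow_incr. split; [apply dist_pos|exact HPKpq].
    + replace (C * (K * dist q p) ^ 2 * / m) with (C * K ^ 2 / m * dist q p ^ 2) by (field; lra).
      apply Rmult_le_compat_r; [apply pow2_ge_0|unfold C'; lra].
Qed.

(** * Differentiable dependence on the initial value *)

Lemma is_derive_dist {V : NormedModule R_AbsRing} (g : R -> V) (x : R) (l : V) :
  is_derive g x l <->
  (forall e, 0 < e -> exists d, 0 < d /\ forall y, Rabs (y - x) < d ->
     norm (minus (minus (g y) (g x)) (scal (y - x) l)) <= e * Rabs (y - x)).
Proof.
  split.
  - intros [_ H] e He.
    destruct (H x (fun P HP => HP) (mkposreal e He)) as [d Hd].
    exists d. split; [apply cond_pos|]. intros y Hy. exact (Hd y Hy).
  - intros H. split; [apply is_linear_scal_l|].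
    intros z Hz. rewrite <- (is_filter_lim_locally_unique x z Hz).
    intros e. destruct (H e (cond_pos e)) as [d [Hd H']].
    exists (mkposreal d Hd). intros y Hy. exact (H' y Hy).
Qed.

Lemma norm_le_increment {V : NormedModule R_AbsRing} (u l : V) (h e : R) :
  norm (minus u (scal h l)) <= e * Rabs h -> norm u <= (norm l + e) * Rabs h.
Proof.
  intros H. eapply Rle_trans; [apply (norm_le_dist u (scal h l))|].
  apply Rle_trans with (Rabs h * norm l + e * Rabs h); [|lra].
  apply Rplus_le_compat; [exact (norm_scal (K := R_AbsRing) (V := V) h l)|exact H].
Qed.

Lemma is_derive_scal_vec {V : NormedModule R_AbsRing} (g : R -> V) (x k : R) (l : V) :
  is_derive g x l -> is_derive (fun t => scal k (g t)) x (scal k l).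
Proof.
  intros H. apply filterdiff_ext_lin with (fun y : R_AbsRing => scal k (scal y l)).
  - apply (filterdiff_scal_r_fct k g (fun y => scal y l)); [exact Rmult_comm|exact H].
  - intros y. rewrite !scal_assoc. f_equal. apply Rmult_comm.
Qed.

Lemma additive_minus {V : NormedModule R_AbsRing} (l : V -> V) :
  (forall u v, l (plus u v) = plus (l u) (l v)) -> (forall (k : R) v, l (scal k v) = scal k (l v)) ->
  forall u v, l (minus u v) = minus (l u) (l v).
Proof.
  intros Ha Hs u v. unfold minus. eapply eq_trans; [apply Ha|]. apply f_equal.
  eapply eq_trans; [exact (f_equal l (eq_sym (scal_opp_one v)))|].
  eapply eq_trans; [apply Hs|]. exact (scal_opp_one (l v)).
Qed.

Definition C11v {V : NormedModule R_AbsRing} (B : V -> Prop) (f : V -> V) (D : V -> V -> V) : Prop :=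
  exists C, 0 <= C /\
  forall p, B p ->
    (forall u v, D p (plus u v) = plus (D p u) (D p v)) /\
    (forall k v, D p (scal k v) = scal k (D p v)) /\
    (forall v, norm (D p v) <= C * norm v) /\
    forall q, B q ->
      (forall v, norm (minus (D q v) (D p v)) <= C * dist q p * norm v) /\
      norm (minus (minus (f q) (f p)) (D p (minus q p))) <= C * dist q p ^ 2.

(** The map (p, v) -> D p v is Lipschitz in p at fixed v and linear bounded in v, so its values
    along continuous curves are continuous. This is what makes the variational equation accessible
    to [picard]. *)
Lemma C11v_continuous {V : NormedModule R_AbsRing} (B : V -> Prop) (f : V -> V) (D : V -> V -> V) :
  C11v B f D -> forall (g w : R -> V) (s : R), (forall r, B (g r)) ->
  continuous g s -> continuous w s -> continuous (fun s => D (g s) (w s)) s.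
Proof.
  intros [C [HC HD]] g w s HB Hg Hw. apply continuous_dist. intros e He.
  set (M := norm (w s) + 1). assert (HM : 1 <= M) by (unfold M; pose proof (norm_ge_0 (w s)); lra).
  assert (He2 : 0 < e / (2 * (C + 1) * M)) by (apply Rdiv_lt_0_compat; [lra|nra]).
  destruct (proj1 (continuous_dist _ s) Hg _ He2) as [a1 [Ha1 A1]].
  destruct (proj1 (continuous_dist _ s) Hw _ He2) as [a2 [Ha2 A2]].
  exists (Rmin a1 a2). split; [apply Rmin_pos; assumption|]. intros y Hy.
  specialize (A1 y ltac:(eapply Rlt_le_trans; [exact Hy|apply Rmin_l])).
  specialize (A2 y ltac:(eapply Rlt_le_trans; [exact Hy|apply Rmin_r])).
  destruct (HD _ (HB s)) as [_ [_ [_ X]]]. destruct (X _ (HB y)) as [X1 _].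
  destruct (HD _ (HB y)) as [Xp [Xs [Xn _]]].
  assert (Y1 : dist (D (g y) (w y)) (D (g y) (w s)) <= C * dist (w y) (w s)).
  { unfold dist at 1.
    replace (minus (D (g y) (w y)) (D (g y) (w s))) with (D (g y) (minus (w y) (w s))); [apply Xn|].
    exact (additive_minus (D (g y)) Xp Xs _ _). }
  specialize (X1 (w s)). fold (dist (D (g y) (w s)) (D (g s) (w s))) in X1.
  eapply Rle_lt_trans; [apply (dist_triangle _ (D (g y) (w s)))|].
  assert (Hu : e / (2 * (C + 1) * M) * (2 * (C + 1) * M) = e) by (field; nra).
  set (u := e / (2 * (C + 1) * M)) in *.
  assert (norm (w s) <= M) by (unfold M; lra).
  assert (B1 : C * dist (g y) (g s) * norm (w s) <= C * u * M).
  { apply Rmult_le_compat; [apply Rmult_le_pos; [exact HC|apply dist_pos]|apply norm_ge_0| |assumption].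
    apply Rmult_le_compat_l; lra. }
  assert (B2 : C * dist (w y) (w s) <= C * u) by (apply Rmult_le_compat_l; lra).
  assert (B3 : C * u <= C * u * M) by (assert (0 <= C * u) by nra; nra).
  assert (0 < u * M) by nra. nra.
Qed.

Lemma ode_close {V : CompleteNormedModule R_AbsRing} (f : R -> V -> V) (L T : R) (z w : R -> V) :
  0 <= T -> 0 <= L ->
  (forall t p q, dist (f t p) (f t q) <= L * dist p q) ->
  (forall y : R -> V, (forall t, continuous y t) -> forall t, continuous (fun t => f t (y t)) t) ->
  (forall t, - T <= t <= T -> is_derive z t (f t (z t))) ->
  (forall t, - T <= t <= T -> is_derive w t (f t (w t))) ->
  forall t, - T <= t <= T -> dist (z t) (w t) <= dist (z 0) (w 0) * exp (L * T).
Proof.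
  intros HT HL Hf Hc Hz Hw t Ht.
  (* The solutions are known on [- T, T] only; clamping time makes the right-hand side continuous on
     the line, as the Gronwall lemma asks. *)
  set (c := clamp (- T) T).
  assert (Hcl : forall u : R -> V, (forall t, - T <= t <= T -> is_derive u t (f t (u t))) ->
     forall s, continuous (fun s => f (c s) (u (c s))) s).
  { intros u Hu s.
    assert (Huc : forall s, continuous (fun s => u (c s)) s).
    { apply (continuous_clamp (V := V) u); [lra|]. intros r Hr. eapply continuous_is_derive, Hu, Hr. }
    assert (E : forall r, f (c r) (u (c r)) = (fun r => f (c r) (u (c (c r)))) r).
    { intros r. unfold c. rewrite (clamp_id _ _ (clamp _ _ r)) by (apply clamp_range; lra). reflexivity. }
    apply (continuous_ext (fun r => f (c r) (u (c (c r))))); [intros; symmetry; apply E|].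
    apply (continuous_clamp (V := V) (fun r => f r (u (c r)))); [lra|].
    intros r _. apply (Hc (fun r => u (c r))), Huc. }
  assert (G := gronwall_both (fun t => minus (z t) (w t))
    (fun t => minus (f (c t) (z (c t))) (f (c t) (w (c t)))) L 0 T HT HL (Rle_refl 0)).
  assert (Hcid : forall s, - T <= s <= T -> c s = s) by (intros; apply clamp_id; lra).
  assert (G' := fun H1 H2 H3 => G H1 H2 H3 t Ht). clear G.
  rewrite Rmult_0_l, Rplus_0_r in G'. apply G'.
  - intros s. apply (continuous_minus (V := V)); apply Hcl; assumption.
  - intros s Hs. rewrite Hcid by exact Hs. apply (is_derive_minus (V := V)); [apply Hz, Hs|apply Hw, Hs].
  - intros s Hs. rewrite Hcid, Rplus_0_r by exact Hs. apply Hf.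
Qed.

Lemma ode_unique {V : CompleteNormedModule R_AbsRing} (f : R -> V -> V) (L T t0 : R) (z w : R -> V) :
  0 <= L -> - T <= t0 <= T ->
  (forall t p q, dist (f t p) (f t q) <= L * dist p q) ->
  (forall y : R -> V, (forall t, continuous y t) -> forall t, continuous (fun t => f t (y t)) t) ->
  (forall t, - T <= t <= T -> is_derive z t (f t (z t))) ->
  (forall t, - T <= t <= T -> is_derive w t (f t (w t))) ->
  z 0 = w 0 -> forall t, - T <= t <= T -> z t = w t.
Proof.
  intros HL Ht0 Hf Hc Hz Hw E t Ht.
  apply (dist_eq_0 (V := V)), Rle_antisym; [|apply dist_pos].
  eapply Rle_trans; [apply (ode_close f L T z w); try assumption; lra|].
  rewrite E, dist_refl. lra.
Qed.

(* The remainder [phi th t - gam t - (th - th0) W t] satisfies a linear differential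
   inequality whose source term is quadratic in the initial displacement. *)
Lemma differentiable_dependence {V : CompleteNormedModule R_AbsRing} (f : V -> V) (D : V -> V -> V)
    (B : V -> Prop) (L T r d0 th0 : R) (gam : R -> V) (phi : R -> R -> V) (W : R -> V) (v0 : V) :
  0 <= T -> 0 <= L -> 0 < r -> 0 < d0 ->
  (forall p q, dist (f p) (f q) <= L * dist p q) ->
  C11v B f D ->
  (forall t, - T <= t <= T -> is_derive gam t (f (gam t))) ->
  (forall t q, - T <= t <= T -> dist q (gam t) <= r -> B q) ->
  (forall th, Rabs (th - th0) < d0 -> forall t, - T <= t <= T -> is_derive (phi th) t (f (phi th t))) ->
  phi th0 0 = gam 0 ->
  is_derive (fun th => phi th 0) th0 v0 ->
  (forall t, - T <= t <= T -> is_derive W t (D (gam t) (W t))) -> W 0 = v0 ->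
  forall t, - T <= t <= T -> is_derive (fun th => phi th t) th0 (W t).
Proof.
  intros HT HL Hr Hd0 Hf HC11 Hgam Htube Hphi Hphi0 Hinit HW HW0 t Ht.
  assert (Hfc : forall y : R -> V, (forall t, continuous y t) -> forall t, continuous (fun t => f (y t)) t).
  { intros y Hy s. apply (continuous_lip (V := V) (W := V) f L); [exact HL|exact Hf|apply Hy]. }
  assert (Hth0 : Rabs (th0 - th0) < d0) by (rewrite Rminus_diag, Rabs_R0; exact Hd0).
  assert (Hphigam : forall s, - T <= s <= T -> phi th0 s = gam s).
  { apply (ode_unique (fun _ => f) L T 0 (phi th0) gam); try assumption; try lra.
    - intros _; exact Hf.
    - apply Hphi, Hth0. }
  destruct HC11 as [C [HC HD]] eqn:EC11. clear EC11.
  set (K := exp (L * T)). assert (HK : 0 < K) by apply exp_pos.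
  assert (Hclose : forall th, Rabs (th - th0) < d0 -> forall s, - T <= s <= T ->
     dist (phi th s) (gam s) <= dist (phi th 0) (phi th0 0) * K).
  { intros th Hth s Hs. rewrite Hphi0.
    apply (ode_close (fun _ => f) L T (phi th) gam); try assumption.
    - intros _; exact Hf.
    - apply Hphi, Hth. }
  set (N := norm v0 + 1). assert (HN : 1 <= N) by (unfold N; pose proof (norm_ge_0 v0); lra).
  destruct (proj1 (is_derive_dist (V := V) _ _ _) Hinit 1 Rlt_0_1) as [d1 [Hd1 H1]].
  assert (HN1 : forall th, Rabs (th - th0) < d1 -> dist (phi th 0) (phi th0 0) <= N * Rabs (th - th0)).
  { intros th Hth. specialize (H1 th Hth).
    exact (norm_le_increment (V := V) _ v0 (th - th0) 1 H1). }
  apply (proj2 (is_derive_dist (V := V) _ _ _)). intros e He.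
  set (EC := exp (C * T)). assert (HEC : 0 < EC) by apply exp_pos.
  destruct (proj1 (is_derive_dist (V := V) _ _ _) Hinit (e / (2 * EC))) as [d2 [Hd2 H2]].
  { apply Rdiv_lt_0_compat; lra. }
  set (Q := C * (N * K) ^ 2 * T * EC + 1).
  assert (HQ : 1 <= Q).
  { unfold Q. assert (0 <= C * (N * K) ^ 2 * T * EC); [|lra].
    apply Rmult_le_pos; [apply Rmult_le_pos; [apply Rmult_le_pos; [lra|apply pow2_ge_0]|lra]|lra]. }
  (* In this order: the domain of [phi], the linear bound on the initial displacement, its
     first-order error e / (2 EC), the radius of the tube around [gam], and a quadratic source below
     e / 2. *)
  set (d := Rmin (Rmin d0 d1) (Rmin d2 (Rmin (r / (N * K)) (e / (2 * Q))))).
  assert (HNK : 0 < N * K) by (apply Rmult_lt_0_compat; lra).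
  exists d. split.
  { unfold d. repeat apply Rmin_pos; try assumption; apply Rdiv_lt_0_compat; lra. }
  intros th Hth.
  assert (Hd_le : d <= d0 /\ d <= d1 /\ d <= d2 /\ d <= r / (N * K) /\ d <= e / (2 * Q)).
  { unfold d. repeat split.
    - eapply Rle_trans; [apply Rmin_l|apply Rmin_l].
    - eapply Rle_trans; [apply Rmin_l|apply Rmin_r].
    - eapply Rle_trans; [apply Rmin_r|apply Rmin_l].
    - eapply Rle_trans; [apply Rmin_r|]. eapply Rle_trans; [apply Rmin_r|apply Rmin_l].
    - eapply Rle_trans; [apply Rmin_r|]. eapply Rle_trans; [apply Rmin_r|apply Rmin_r]. }
  destruct Hd_le as [L0 [L1 [L2 [L3 L4]]]].
  set (h := th - th0) in *. pose proof (Rabs_pos h) as Hh.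
  assert (Hnear : forall s, - T <= s <= T -> dist (phi th s) (gam s) <= N * K * Rabs h).
  { intros s Hs. eapply Rle_trans; [apply Hclose; [fold h; lra|exact Hs]|].
    assert (X := HN1 th ltac:(fold h; lra)). fold h in X.
    replace (N * K * Rabs h) with (N * Rabs h * K) by ring. apply Rmult_le_compat_r; lra. }
  assert (HBphi : forall s, - T <= s <= T -> B (phi th s)).
  { intros s Hs. apply (Htube s); [exact Hs|]. eapply Rle_trans; [apply Hnear, Hs|].
    apply Rle_trans with (N * K * (r / (N * K))); [apply Rmult_le_compat_l; lra|right; field; lra]. }
  assert (HBgam : forall s, - T <= s <= T -> B (gam s)).
  { intros s Hs. apply (Htube s); [exact Hs|]. rewrite dist_refl; lra. }
  set (c := clamp (- T) T).
  set (ez := fun s => minus (minus (phi th s) (gam s)) (scal h (W s))).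
  set (F := fun s => minus (minus (f (phi th s)) (f (gam s))) (scal h (D (gam s) (W s)))).
  assert (Hcont : forall s, - T <= s <= T -> continuous (phi th) s /\ continuous gam s /\ continuous W s).
  { intros s Hs. split; [|split].
    - exact (continuous_is_derive (V := V) _ _ _ (Hphi th ltac:(fold h; lra) s Hs)).
    - exact (continuous_is_derive (V := V) _ _ _ (Hgam s Hs)).
    - exact (continuous_is_derive (V := V) _ _ _ (HW s Hs)). }
  assert (HDc : forall s, continuous (fun s => D (gam (c s)) (W (c s))) s).
  { intros s. apply (C11v_continuous (V := V) B f D HC11 (fun s => gam (c s)) (fun s => W (c s))).
    - intros r'. apply HBgam, clamp_range; lra.
    - apply (continuous_clamp (V := V) gam); [lra|]. intros r' Hr'; apply Hcont, Hr'.
    - apply (continuous_clamp (V := V) W); [lra|]. intros r' Hr'; apply Hcont, Hr'. }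
  assert (HFc : forall s, continuous (fun s => F (c s)) s).
  { intros s. unfold F. apply (continuous_minus (V := V)).
    - apply (continuous_minus (V := V)).
      + apply (Hfc (fun s => phi th (c s))). apply (continuous_clamp (V := V)); [lra|]. intros r' Hr'; apply Hcont, Hr'.
      + apply (Hfc (fun s => gam (c s))). apply (continuous_clamp (V := V)); [lra|]. intros r' Hr'; apply Hcont, Hr'.
    - apply (continuous_scal_r (V := V)), HDc. }
  set (del := C * (N * K * Rabs h) ^ 2).
  assert (Hdel : 0 <= del) by (apply Rmult_le_pos; [exact HC|apply pow2_ge_0]).
  assert (HcidT : forall s, - T <= s <= T -> c s = s) by (intros; apply clamp_id; lra).
  assert (G := gronwall_both ez (fun s => F (c s)) C del T HT HC Hdel HFc).
  assert (Gt : norm (ez t) <= (norm (ez 0) + del * T) * EC).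
  { apply G; [| |exact Ht]; clear G.
    - intros s Hs. rewrite HcidT by exact Hs. unfold ez, F.
      apply (is_derive_minus (V := V)).
      + apply (is_derive_minus (V := V)); [apply Hphi; [fold h; lra|exact Hs]|apply Hgam, Hs].
      + exact (is_derive_scal_vec (V := V) W s h _ (HW s Hs)).
    - intros s Hs. rewrite HcidT by exact Hs.
      destruct (HD _ (HBgam s Hs)) as [Xp [Xs [Xn X]]].
      destruct (X _ (HBphi s Hs)) as [_ X1].
      assert (ED : D (gam s) (ez s) = minus (D (gam s) (minus (phi th s) (gam s))) (scal h (D (gam s) (W s)))).
      { unfold ez. rewrite <- Xs. exact (additive_minus (V := V) (D (gam s)) Xp Xs _ _). }
      assert (EF : dist (V := V) (F s) (D (gam s) (ez s)) <= C * dist (phi th s) (gam s) ^ 2).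
      { rewrite ED. unfold F, dist.
        assert (Em : forall x y z : V, minus (minus x z) (minus y z) = minus x y).
        { intros x y z. eapply eq_trans; [exact (minus_minus_minus (V := V) x z y z)|].
          eapply eq_trans; [exact (f_equal (fun u => minus (minus x y) u) (minus_eq_zero (G := V) z))|].
          exact (minus_zero_r (G := V) _). }
        rewrite Em. exact X1. }
      eapply Rle_trans; [apply (norm_le_dist (V := V) (F s) (D (gam s) (ez s)))|].
      apply Rplus_le_compat; [apply Xn|].
      eapply Rle_trans; [exact EF|]. unfold del. apply Rmult_le_compat_l; [exact HC|].
      apply pow_incr. split; [apply dist_pos|apply Hnear, Hs]. }
  unfold ez in Gt. rewrite <- Hphi0, <- (Hphigam t Ht) in Gt. rewrite HW0 in Gt.
  eapply Rle_trans; [exact Gt|].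
  specialize (H2 th ltac:(fold h; lra)). fold h in H2.
  apply Rle_trans with ((e / (2 * EC) * Rabs h + del * T) * EC).
  { apply Rmult_le_compat_r; [lra|]. apply Rplus_le_compat_r. exact H2. }
  replace ((e / (2 * EC) * Rabs h + del * T) * EC) with (e / 2 * Rabs h + (C * (N * K) ^ 2 * T * EC) * Rabs h * Rabs h).
  2:{ unfold del. field. lra. }
  assert (Hq : Q * Rabs h <= e / 2).
  { apply Rle_trans with (Q * (e / (2 * Q))); [apply Rmult_le_compat_l; lra|right; field; lra]. }
  assert (C * (N * K) ^ 2 * T * EC * Rabs h <= e / 2).
  { unfold Q in Hq. lra. }
  nra.
Qed.

(** * Analytic functions of three variables *)

Lemma series_half (u : nat -> R) (M : R) : (forall j, Rabs (u j) <= M * (/ 2) ^ j) ->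
  ex_series u /\ Rabs (Series u) <= 2 * M /\
  forall n, Rabs (Series u - sum_n u n) <= M * (/ 2) ^ n.
Proof.
  assert (G : forall u M, (forall j, Rabs (u j) <= M * (/ 2) ^ j) -> ex_series u /\ Rabs (Series u) <= 2 * M).
  { clear u M. intros u M H.
    assert (Hg : is_series (fun n => M * (/ 2) ^ n) (2 * M)).
    { evar_last.
      - apply (is_series_scal (K := R_AbsRing) (V := R_NormedModule) M), is_series_geom.
        rewrite Rabs_pos_eq; lra.
      - change (M * / (1 - / 2) = 2 * M). field. }
    assert (Hge : ex_series (fun n => M * (/ 2) ^ n)) by (eexists; exact Hg).
    assert (Ha : ex_series (fun n => Rabs (u n))).
    { apply (ex_series_le (K := R_AbsRing) (V := R_CompleteNormedModule) _ (fun n => M * (/ 2) ^ n)); [|exact Hge].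
      intros n. change (Rabs (Rabs (u n)) <= M * (/ 2) ^ n). rewrite Rabs_Rabsolu. apply H. }
    split; [apply ex_series_Rabs, Ha|].
    eapply Rle_trans; [apply Series_Rabs, Ha|].
    rewrite <- (is_series_unique _ _ Hg). apply Series_le; [|exact Hge].
    intros n; split; [apply Rabs_pos|apply H]. }
  intros H. destruct (G u M H) as [G1 G2]. split; [exact G1|]. split; [exact G2|].
  intros n. rewrite (Series_incr_n u (S n)) by (try lia; exact G1).
  simpl Init.Nat.pred. rewrite sum_n_Reals.
  replace (sum_f_R0 u n + Series (fun k => u (S n + k)%nat) - sum_f_R0 u n) with
    (Series (fun k => u (S n + k)%nat)) by ring.
  destruct (G (fun k => u (S n + k)%nat) (M * (/ 2) ^ S n)) as [_ G3].
  - intros j. eapply Rle_trans; [apply H|]. rewrite pow_add. lra.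
  - eapply Rle_trans; [exact G3|]. simpl. lra.
Qed.

Lemma pow_half_le (r h : R) i : 0 < r -> Rabs h <= r / 2 -> Rabs ((/ r) ^ i * h ^ i) <= (/ 2) ^ i.
Proof.
  intros Hr Hh. rewrite <- Rpow_mult_distr, <- RPow_abs. apply pow_incr. split; [apply Rabs_pos|].
  rewrite Rabs_mult, Rabs_pos_eq by (left; apply Rinv_0_lt_compat; exact Hr).
  apply Rmult_le_reg_l with r; [exact Hr|]. rewrite <- Rmult_assoc, Rinv_r by lra. lra.
Qed.

Lemma pseries_bound (g : nat -> R) (r M h : R) : 0 < r -> Rabs h <= r / 2 ->
  (forall i, Rabs (g i) <= M * (/ r) ^ i) ->
  ex_pseries g h /\ Rabs (PSeries g h) <= 2 * M /\ Rbar_lt (Rabs h) (CV_radius g).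
Proof.
  intros Hr Hh Hg.
  assert (HM : 0 <= M).
  { specialize (Hg 0%nat). rewrite pow_O, Rmult_1_r in Hg. pose proof (Rabs_pos (g 0%nat)). lra. }
  assert (Hir : 0 < / r) by (apply Rinv_0_lt_compat; exact Hr).
  destruct (series_half (fun i => g i * h ^ i) M) as [H1 [H2 _]].
  { intros j. rewrite Rabs_mult.
    apply Rle_trans with (M * (/ r) ^ j * Rabs (h ^ j)).
    - apply Rmult_le_compat_r; [apply Rabs_pos|apply Hg].
    - rewrite Rmult_assoc. apply Rmult_le_compat_l; [exact HM|].
      rewrite <- (Rabs_pos_eq ((/ r) ^ j)) by (apply pow_le; lra). rewrite <- Rabs_mult.
      apply pow_half_le; assumption. }
  split; [|split; [exact H2|]].
  - apply (proj2 (ex_pseries_R g h)), H1.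
  - apply Rbar_lt_le_trans with r; [simpl; lra|].
    apply (CV_radius_bounded g). exists M. intros n.
    rewrite Rabs_mult. eapply Rle_trans; [apply Rmult_le_compat_r; [apply Rabs_pos|apply Hg]|].
    rewrite (Rabs_pos_eq (r ^ n)) by (apply pow_le; lra).
    rewrite Rmult_assoc, <- Rpow_mult_distr, Rinv_l, pow1 by lra. lra.
Qed.

Lemma pseries_derive_bound (g : nat -> R) (r M h : R) : 0 < r -> Rabs h <= r / 4 ->
  (forall i, Rabs (g i) <= M * (/ r) ^ i) ->
  exists g', is_derive (PSeries g) h g' /\ Rabs g' <= 2 * (M / r).
Proof.
  intros Hr Hh Hg.
  destruct (pseries_bound g r M h Hr ltac:(lra) Hg) as [_ [_ HR]].
  exists (PSeries (PS_derive g) h). split; [apply is_derive_PSeries, HR|].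
  assert (HM : 0 <= M).
  { specialize (Hg 0%nat). rewrite pow_O, Rmult_1_r in Hg. pose proof (Rabs_pos (g 0%nat)). lra. }
  assert (HMr : 0 <= M / r) by (apply Rmult_le_pos; [exact HM|left; apply Rinv_0_lt_compat; exact Hr]).
  apply (pseries_bound (PS_derive g) (r / 2) (M / r) h); [lra|lra|].
  intros i. unfold PS_derive. rewrite Rabs_mult, (Rabs_pos_eq (INR _)) by apply pos_INR.
  assert (Hi : INR (S i) <= 2 ^ i).
  { clear. induction i as [|i IH]; [simpl; lra|]. rewrite S_INR. simpl pow.
    assert (1 <= 2 ^ i) by (apply pow_R1_Rle; lra). lra. }
  apply Rle_trans with (2 ^ i * (M * (/ r) ^ S i)).
  - apply Rmult_le_compat; [apply pos_INR|apply Rabs_pos|exact Hi|apply Hg].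
  - right. replace (/ (r / 2)) with (2 * / r) by (field; lra).
    rewrite Rpow_mult_distr. simpl. unfold Rdiv. ring.
Qed.

(** Shifting the coefficients by two leaves a series with bound M / r^2, and the sum is g0 + g1 h +
    h^2 times that series. The constants depend on M and r only, which gives uniformity in
    parameters. *)
Lemma pseries_taylor (g : nat -> R) (r M h : R) : 0 < r -> Rabs h < r / 4 ->
  (forall i, Rabs (g i) <= M * (/ r) ^ i) ->
  exists g', is_derive (PSeries g) h g' /\
    Rabs (g' - g 1%nat) <= 5 * (M / r ^ 2) * Rabs h /\
    Rabs (PSeries g h - g 0%nat - g 1%nat * h) <= 2 * (M / r ^ 2) * h ^ 2.
Proof.
  intros Hr Hh Hg.
  set (g2 := PS_decr_1 (PS_decr_1 g)).
  assert (Hg2 : forall i, Rabs (g2 i) <= M / r ^ 2 * (/ r) ^ i).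
  { intros i. unfold g2, PS_decr_1. eapply Rle_trans; [apply Hg|]. right.
    unfold Rdiv. rewrite <- (pow_inv r 2). simpl. ring. }
  assert (Hg1 : forall i, Rabs (PS_decr_1 g i) <= M / r * (/ r) ^ i).
  { intros i. unfold PS_decr_1. eapply Rle_trans; [apply Hg|]. right. simpl. unfold Rdiv; ring. }
  assert (E : forall x, Rabs x <= r / 4 -> PSeries g x = g 0%nat + x * (g 1%nat + x * PSeries g2 x)).
  { intros x Hx.
    rewrite (PSeries_decr_1 g x) by (apply (pseries_bound g r M x Hr ltac:(lra) Hg)).
    rewrite (PSeries_decr_1 (PS_decr_1 g) x) by (apply (pseries_bound _ r (M / r) x Hr ltac:(lra) Hg1)).
    reflexivity. }
  destruct (pseries_derive_bound g2 r (M / r ^ 2) h Hr ltac:(lra) Hg2) as [g2' [Hd Hb]].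
  destruct (pseries_bound g2 r (M / r ^ 2) h Hr ltac:(lra) Hg2) as [_ [Hb0 _]].
  exists (g 1%nat + 2 * h * PSeries g2 h + h ^ 2 * g2').
  assert (HM : 0 <= M / r ^ 2).
  { specialize (Hg2 0%nat). rewrite pow_O, Rmult_1_r in Hg2. pose proof (Rabs_pos (g2 0%nat)). lra. }
  split; [|split].
  - apply (is_derive_ext_loc (fun x => g 0%nat + x * (g 1%nat + x * PSeries g2 x))).
    + assert (Hpos : 0 < r / 4 - Rabs h) by lra.
      exists (mkposreal _ Hpos). intros y Hy. symmetry. apply E.
      change (Rabs (y - h) < r / 4 - Rabs h) in Hy.
      replace y with ((y - h) + h) by ring. eapply Rle_trans; [apply Rabs_triang|]. lra.
    + assert (Ed : Derive (fun x : R => PSeries g2 x) h = g2') by exact (is_derive_unique _ _ _ Hd).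
      set (G := PSeries g2) in *.
      auto_derive; [exists g2'; exact Hd|]. change (Derive (fun x : R => G x) h) with (Derive G h).
      change (Derive (fun x : R => G x) h) with (Derive G h) in Ed. rewrite Ed. ring.
  - replace (g 1%nat + 2 * h * PSeries g2 h + h ^ 2 * g2' - g 1%nat) with
      (h * (2 * PSeries g2 h + h * g2')) by ring.
    rewrite Rabs_mult, Rmult_comm. apply Rmult_le_compat_r; [apply Rabs_pos|].
    eapply Rle_trans; [apply Rabs_triang|]. rewrite !Rabs_mult, (Rabs_pos_eq 2) by lra.
    assert (Rabs h * Rabs g2' <= r / 4 * (2 * (M / r ^ 2 / r))) by (apply Rmult_le_compat; try apply Rabs_pos; lra).
    replace (r / 4 * (2 * (M / r ^ 2 / r))) with (/ 2 * (M / r ^ 2)) in H by (field; lra). lra.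
  - rewrite (E h) by lra.
    replace (g 0%nat + h * (g 1%nat + h * PSeries g2 h) - g 0%nat - g 1%nat * h) with (PSeries g2 h * h ^ 2) by ring.
    rewrite Rabs_mult, (Rabs_pos_eq (h ^ 2)) by apply pow2_ge_0.
    apply Rmult_le_compat_r; [apply pow2_ge_0|exact Hb0].
Qed.

Lemma sum_n_term_le (u : nat -> R) n i : (forall j, 0 <= u j) -> (i <= n)%nat -> u i <= sum_n u n.
Proof.
  intros Hu. revert i; induction n as [|n IH]; intros i Hi.
  - replace i with 0%nat by lia. rewrite sum_O. lra.
  - rewrite sum_Sn. change (u i <= sum_n u n + u (S n)).
    destruct (Nat.eq_dec i (S n)) as [->|Hne].
    + assert (0 <= sum_n u n); [|lra]. specialize (IH 0%nat ltac:(lia)). pose proof (Hu 0%nat). lra.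
    + pose proof (Hu (S n)). specialize (IH i ltac:(lia)). lra.
Qed.

Lemma sum_n_nonneg (u : nat -> R) n : (forall j, 0 <= u j) -> 0 <= sum_n u n.
Proof.
  intros Hu. eapply Rle_trans; [apply (Hu 0%nat)|apply sum_n_term_le; [exact Hu|lia]].
Qed.

Lemma sum_n_pow0 (u : nat -> R) n : sum_n (fun i => u i * 0 ^ i) n = u 0%nat.
Proof.
  induction n as [|n IH]; [rewrite sum_O; simpl; ring|].
  rewrite sum_Sn, IH. change (u 0%nat + u (S n) * 0 ^ S n = u 0%nat). simpl; ring.
Qed.

Lemma sum_n_abs_le (u w : nat -> R) n : (forall i, Rabs (u i) <= w i) -> Rabs (sum_n u n) <= sum_n w n.
Proof.
  intros H; induction n as [|n IH]; [rewrite !sum_O; apply H|].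
  rewrite !sum_Sn. change (Rabs (sum_n u n + u (S n)) <= sum_n w n + w (S n)).
  eapply Rle_trans; [apply Rabs_triang|]. specialize (H (S n)). lra.
Qed.

Lemma sum_n_minus_R (u w : nat -> R) n : sum_n u n - sum_n w n = sum_n (fun i => u i - w i) n.
Proof.
  induction n as [|n IH]; [rewrite !sum_O; reflexivity|].
  rewrite !sum_Sn, <- IH. unfold plus; simpl. ring.
Qed.

Lemma sum_n_scal_R (c : R) (u : nat -> R) n : sum_n (fun i => c * u i) n = c * sum_n u n.
Proof.
  induction n as [|n IH]; [rewrite !sum_O; reflexivity|].
  rewrite !sum_Sn, IH. unfold plus; simpl. ring.
Qed.

(** The third variable stays at z. Boundedness of the absolute partial sums at (r, r) yields
    Cauchy-type bounds M r^(- i - j) on the coefficients, and with these the convergence over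
    squares of indices becomes an iterated power series on half that square. *)
Lemma analytic3_two (f : R -> R -> R -> R) (x y z : R) : analytic3_at f x y z ->
  exists (a : nat -> nat -> R) (r M : R), 0 < r /\ 0 <= M /\
    (forall i j, Rabs (a i j) <= M * (/ r) ^ i * (/ r) ^ j) /\
    (forall h k, Rabs h <= r / 2 -> Rabs k <= r / 2 ->
       f (x + h) (y + k) z = PSeries (fun i => PSeries (a i) k) h).
Proof.
  intros [c [d [Hd H]]].
  set (r := d / 2). assert (Hr : 0 < r) by (unfold r; lra).
  assert (Hir : 0 < / r) by (apply Rinv_0_lt_compat; exact Hr).
  set (a := fun i j => c i j 0%nat).
  (* Since 0 ^ 0 = 1, a vanishing third increment keeps exactly the terms with i3 = 0. *)
  assert (Hred : forall (g : R -> R) h k n, (forall t, g (t * 0) = g t * 0) ->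
     sum_n (fun i1 => sum_n (fun i2 => sum_n (fun i3 => g (c i1 i2 i3 * h ^ i1 * k ^ i2 * 0 ^ i3)) n) n) n
     = sum_n (fun i1 => sum_n (fun i2 => g (a i1 i2 * h ^ i1 * k ^ i2)) n) n).
  { intros g h k n Hg. apply sum_n_ext; intros i1. apply sum_n_ext; intros i2.
    rewrite (sum_n_ext _ (fun i3 => g (c i1 i2 i3 * h ^ i1 * k ^ i2) * 0 ^ i3)).
    - apply sum_n_pow0.
    - intros [|i3]; [simpl; rewrite !Rmult_1_r; reflexivity|].
      rewrite pow_i by lia. apply Hg. }
  assert (Hr0 : Rabs r < d) by (rewrite Rabs_pos_eq; unfold r; lra).
  assert (H00 : Rabs 0 < d) by (rewrite Rabs_R0; exact Hd).
  destruct (H r r 0 Hr0 Hr0 H00) as [[l Hl] _].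
  apply is_lim_seq_spec in Hl. destruct (Hl (mkposreal 1 Rlt_0_1)) as [N HN]. simpl in HN.
  set (S := fun n => sum_n (fun i => sum_n (fun j => Rabs (a i j * r ^ i * r ^ j)) n) n).
  assert (HS : forall n, (N <= n)%nat -> S n <= Rabs l + 1).
  { intros n Hn. specialize (HN n Hn). rewrite (Hred Rabs) in HN.
    - fold (S n) in HN. apply Rabs_def2 in HN. pose proof (Rle_abs l). lra.
    - intros t. rewrite Rmult_0_r, Rabs_R0; ring. }
  set (M := Rabs l + 1). assert (HM : 0 <= M) by (unfold M; pose proof (Rabs_pos l); lra).
  assert (Ha : forall i j, Rabs (a i j) <= M * (/ r) ^ i * (/ r) ^ j).
  { intros i j.
    assert (Hs : Rabs (a i j * r ^ i * r ^ j) <= M).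
    { set (n := (N + i + j)%nat). eapply Rle_trans; [|apply (HS n); lia]. unfold S.
      eapply Rle_trans; [|apply (sum_n_term_le _ n i); [|lia]].
      - cbv beta. apply (sum_n_term_le (fun j => Rabs (a i j * r ^ i * r ^ j)) n j); [intros; apply Rabs_pos|lia].
      - intros; apply sum_n_nonneg; intros; apply Rabs_pos. }
    assert (Hri : 0 < r ^ i) by (apply pow_lt; exact Hr).
    assert (Hrj : 0 < r ^ j) by (apply pow_lt; exact Hr).
    rewrite !Rabs_mult, (Rabs_pos_eq (r ^ i)), (Rabs_pos_eq (r ^ j)) in Hs by lra.
    rewrite !pow_inv. apply Rmult_le_reg_r with (r ^ i * r ^ j); [nra|].
    replace (M * / r ^ i * / r ^ j * (r ^ i * r ^ j)) with M by (field; lra). lra. }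
  exists a, r, M. split; [exact Hr|]. split; [exact HM|]. split; [exact Ha|].
  intros h k Hh Hk.
  assert (Hb : forall i, Rabs (PSeries (a i) k) <= 2 * M * (/ r) ^ i).
  { intros i. rewrite Rmult_assoc. apply (pseries_bound (a i) r (M * (/ r) ^ i) k); assumption || apply Ha. }
  assert (Hh' : Rabs h < d) by (unfold r in Hh; lra).
  assert (Hk' : Rabs k < d) by (unfold r in Hk; lra).
  destruct (H h k 0 Hh' Hk' H00) as [_ L].
  rewrite Rplus_0_r in L.
  assert (L1 : is_lim_seq (fun n => sum_n (fun i => sum_n (fun j => a i j * h ^ i * k ^ j) n) n) (f (x + h) (y + k) z)).
  { refine (is_lim_seq_ext _ _ _ _ L). intros n. exact (Hred (fun v => v) h k n (fun t => eq_refl)). }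
  destruct (series_half (fun i => PSeries (a i) k * h ^ i) (2 * M)) as [_ [_ HT]].
  { intros i. rewrite Rabs_mult.
    apply Rle_trans with (2 * M * (/ r) ^ i * Rabs (h ^ i)).
    - apply Rmult_le_compat_r; [apply Rabs_pos|apply Hb].
    - rewrite Rmult_assoc. apply Rmult_le_compat_l; [lra|].
      rewrite <- (Rabs_pos_eq ((/ r) ^ i)) by (apply pow_le; lra). rewrite <- Rabs_mult.
      apply pow_half_le; assumption. }
  assert (L2 : is_lim_seq (fun n => sum_n (fun i => sum_n (fun j => a i j * h ^ i * k ^ j) n) n)
     (PSeries (fun i => PSeries (a i) k) h)).
  { apply is_lim_seq_spec. intros e.
    destruct (pow_lt_1_zero (/ 2) ltac:(rewrite Rabs_pos_eq; lra) (e / (4 * M + 1))) as [n0 Hn0].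
    { apply Rdiv_lt_0_compat; [apply cond_pos|lra]. }
    exists n0. intros n Hn. specialize (Hn0 n Hn). rewrite Rabs_pos_eq in Hn0 by (apply pow_le; lra).
    specialize (HT n). unfold PSeries at 1.
    assert (D1 : Rabs (sum_n (fun i => sum_n (fun j => a i j * h ^ i * k ^ j) n) n
        - sum_n (fun i => PSeries (a i) k * h ^ i) n) <= 2 * M * (/ 2) ^ n).
    { assert (Em : sum_n (fun i => sum_n (fun j => a i j * h ^ i * k ^ j) n) n
          - sum_n (fun i => PSeries (a i) k * h ^ i) n =
          sum_n (fun i => sum_n (fun j => a i j * h ^ i * k ^ j) n - PSeries (a i) k * h ^ i) n).
      { apply sum_n_minus_R. }
      rewrite Em.
      eapply Rle_trans; [apply (sum_n_abs_le _ (fun i => M * (/ 2) ^ n * (/ 2) ^ i))|].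
      - intros i.
        assert (Ej : sum_n (fun j => a i j * h ^ i * k ^ j) n = h ^ i * sum_n (fun j => a i j * k ^ j) n).
        { rewrite <- sum_n_scal_R. apply sum_n_ext; intros j. ringR. }
        rewrite Ej.
        destruct (series_half (fun j => a i j * k ^ j) (M * (/ r) ^ i)) as [_ [_ HTi]].
        { intros j. rewrite Rabs_mult.
          apply Rle_trans with (M * (/ r) ^ i * (/ r) ^ j * Rabs (k ^ j)).
          - apply Rmult_le_compat_r; [apply Rabs_pos|apply Ha].
          - rewrite Rmult_assoc. apply Rmult_le_compat_l; [apply Rmult_le_pos; [exact HM|apply pow_le; lra]|].
            rewrite <- (Rabs_pos_eq ((/ r) ^ j)) by (apply pow_le; lra). rewrite <- Rabs_mult.
            apply pow_half_le; assumption. }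
        specialize (HTi n). unfold PSeries.
        replace (h ^ i * sum_n (fun j => a i j * k ^ j) n - Series (fun k0 => a i k0 * k ^ k0) * h ^ i) with
          (- ((Series (fun k0 => a i k0 * k ^ k0) - sum_n (fun j => a i j * k ^ j) n) * h ^ i)) by ring.
        rewrite Rabs_Ropp, Rabs_mult.
        apply Rle_trans with (M * (/ r) ^ i * (/ 2) ^ n * Rabs (h ^ i)).
        { apply Rmult_le_compat_r; [apply Rabs_pos|exact HTi]. }
        replace (M * (/ r) ^ i * (/ 2) ^ n * Rabs (h ^ i)) with (M * (/ 2) ^ n * ((/ r) ^ i * Rabs (h ^ i))) by ring.
        apply Rmult_le_compat_l; [apply Rmult_le_pos; [exact HM|apply pow_le; lra]|].
        rewrite <- (Rabs_pos_eq ((/ r) ^ i)) by (apply pow_le; lra). rewrite <- Rabs_mult.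
        apply pow_half_le; assumption.
      - assert (Eg : forall m, sum_n (fun i => M * (/ 2) ^ n * (/ 2) ^ i) m = M * (/ 2) ^ n * (2 - (/ 2) ^ m)).
        { induction m as [|m IH]; [rewrite sum_O; simpl; ring|]. rewrite sum_Sn, IH.
          unfold plus; simpl. field. }
        rewrite Eg. assert (0 < (/ 2) ^ n) by (apply pow_lt; lra).
        assert (0 <= M * (/ 2) ^ n) by (apply Rmult_le_pos; lra). nra. }
    set (A := sum_n (fun i => sum_n (fun j => a i j * h ^ i * k ^ j) n) n) in *.
    set (B := sum_n (fun i => PSeries (a i) k * h ^ i) n) in *.
    set (C := Series (fun i => PSeries (a i) k * h ^ i)) in *.
    change (Rabs (A - C) < e).
    replace (A - C) with ((A - B) - (C - B)) by ring.
    eapply Rle_lt_trans; [apply Rabs_triang|]. rewrite Rabs_Ropp.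
    apply Rle_lt_trans with (4 * M * (/ 2) ^ n); [lra|].
    apply Rmult_lt_compat_r with (r := 4 * M + 1) in Hn0; [|lra].
    unfold Rdiv in Hn0. rewrite Rmult_assoc, Rinv_l in Hn0 by lra.
    assert (0 < (/ 2) ^ n) by (apply pow_lt; lra). lra. }
  apply is_lim_seq_unique in L1. apply is_lim_seq_unique in L2. rewrite L1 in L2. congruence.
Qed.

Lemma analytic3_slice (f : R -> R -> R -> R) (x y z : R) : analytic3_at f x y z ->
  ex_derive (fun th => f th y z) x.
Proof.
  intros Hf. destruct (analytic3_two f x y z Hf) as [a [r [M [Hr [HM [Ha HF]]]]]].
  assert (Hb : forall i, Rabs (PSeries (a i) 0) <= 2 * M * (/ r) ^ i).
  { intros i. rewrite Rmult_assoc. apply (pseries_bound (a i) r (M * (/ r) ^ i) 0); [exact Hr|rewrite Rabs_R0; lra|apply Ha]. }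
  destruct (pseries_taylor (fun i => PSeries (a i) 0) r (2 * M) 0 Hr ltac:(rewrite Rabs_R0; lra) Hb) as [g' [Hd _]].
  exists g'.
  apply (is_derive_ext_loc (fun th => PSeries (fun i => PSeries (a i) 0) (th - x))).
  - assert (Hp : 0 < r / 2) by lra. exists (mkposreal _ Hp). intros th Hth.
    change (Rabs (th - x) < r / 2) in Hth.
    rewrite <- (HF (th - x) 0) by (try rewrite Rabs_R0; lra). f_equal; ring.
  - evar_last.
    + apply (is_derive_comp (K := R_AbsRing) (V := R_NormedModule) (PSeries (fun i => PSeries (a i) 0)) (fun th => th - x)).
      * replace (x - x) with 0 by ring. exact Hd.
      * auto_derive; [exact I|reflexivity].
    + change (1 * g' = g'). ring.
Qed.

Lemma analytic3_continuous_second (f : R -> R -> R -> R) (x y z : R) : analytic3_at f x y z ->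
  forall e, 0 < e -> exists d, 0 < d /\ forall k, Rabs k < d -> Rabs (f x (y + k) z - f x y z) < e.
Proof.
  intros Hf e He. destruct (analytic3_two f x y z Hf) as [a [r [M [Hr [HM [Ha HF]]]]]].
  assert (Ha0 : forall j, Rabs (a 0%nat j) <= M * (/ r) ^ j).
  { intros j. specialize (Ha 0%nat j). simpl in Ha. lra. }
  assert (HF0 : forall k, Rabs k <= r / 2 -> f x (y + k) z = PSeries (a 0%nat) k).
  { intros k Hk. replace x with (x + 0) by ring. rewrite HF by (try rewrite Rabs_R0; lra). apply PSeries_0. }
  destruct (pseries_taylor (a 0%nat) r M 0 Hr ltac:(rewrite Rabs_R0; lra) Ha0) as [g' [Hd _]].
  assert (Hc : continuity_pt (PSeries (a 0%nat)) 0).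
  { apply continuity_pt_filterlim. apply (ex_derive_continuous (K := R_AbsRing) (V := R_NormedModule)). exists g'; exact Hd. }
  destruct (Hc e He) as [d [Hd0 Hc']].
  exists (Rmin d (r / 2)). split; [apply Rmin_pos; lra|]. intros k Hk.
  assert (K1 : Rabs k < d) by (eapply Rlt_le_trans; [exact Hk|apply Rmin_l]).
  assert (K2 : Rabs k < r / 2) by (eapply Rlt_le_trans; [exact Hk|apply Rmin_r]).
  rewrite HF0 by lra. replace (f x y z) with (PSeries (a 0%nat) 0).
  2:{ rewrite <- HF0 by (rewrite Rabs_R0; lra). f_equal; ring. }
  destruct (Req_dec k 0) as [->|Hk0]; [rewrite Rminus_diag, Rabs_R0; exact He|].
  apply Hc'. split; [split; [exact I|auto]|]. simpl. unfold R_dist. rewrite Rminus_0_r. exact K1.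
Qed.

Lemma analytic3_minus (f g : R -> R -> R -> R) (x y z : R) :
  analytic3_at f x y z -> analytic3_at g x y z ->
  exists (a : nat -> nat -> R) (r M : R), 0 < r /\ 0 <= M /\
    (forall i j, Rabs (a i j) <= M * (/ r) ^ i * (/ r) ^ j) /\
    (forall h k, Rabs h <= r / 2 -> Rabs k <= r / 2 ->
       f (x + h) (y + k) z - g (x + h) (y + k) z = PSeries (fun i => PSeries (a i) k) h).
Proof.
  intros Hf Hg.
  destruct (analytic3_two f x y z Hf) as [a1 [r1 [M1 [Hr1 [HM1 [Ha1 HF1]]]]]].
  destruct (analytic3_two g x y z Hg) as [a2 [r2 [M2 [Hr2 [HM2 [Ha2 HF2]]]]]].
  set (r := Rmin r1 r2). assert (Hr : 0 < r) by (apply Rmin_pos; assumption).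
  assert (Hrr1 : r <= r1) by apply Rmin_l. assert (Hrr2 : r <= r2) by apply Rmin_r.
  assert (Hup : forall a r' M', r <= r' -> 0 <= M' ->
    (forall i j, Rabs (a i j) <= M' * (/ r') ^ i * (/ r') ^ j) ->
    forall i j : nat, Rabs (a i j) <= M' * (/ r) ^ i * (/ r) ^ j).
  { intros a r' M' Hr' HM' Ha i j. eapply Rle_trans; [apply Ha|].
    assert (Hi : 0 < / r' <= / r) by (split; [apply Rinv_0_lt_compat; lra|apply Rinv_le_contravar; lra]).
    rewrite !Rmult_assoc. apply Rmult_le_compat_l; [exact HM'|].
    apply Rmult_le_compat; try (apply pow_le; lra); apply pow_incr; lra. }
  specialize (Hup a1 r1 M1 Hrr1 HM1 Ha1) as Hb1. specialize (Hup a2 r2 M2 Hrr2 HM2 Ha2) as Hb2. clear Hup.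
  exists (fun i j => a1 i j - a2 i j), r, (M1 + M2).
  split; [exact Hr|]. split; [lra|]. split.
  { intros i j. unfold Rminus. eapply Rle_trans; [apply Rabs_triang|]. rewrite Rabs_Ropp.
    specialize (Hb1 i j). specialize (Hb2 i j). lra. }
  intros h k Hh Hk.
  rewrite HF1, HF2 by lra.
  assert (Hc : forall a M', (forall i j, Rabs (a i j) <= M' * (/ r) ^ i * (/ r) ^ j) ->
     (forall i, ex_pseries (a i) k) /\ ex_pseries (fun i => PSeries (a i) k) h).
  { intros a M' Ha.
    assert (X : forall i, ex_pseries (a i) k /\ Rabs (PSeries (a i) k) <= 2 * M' * (/ r) ^ i).
    { intros i. destruct (pseries_bound (a i) r (M' * (/ r) ^ i) k Hr Hk (Ha i)) as [X1 [X2 _]]. split; [exact X1|lra]. }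
    split; [intros; apply X|].
    apply (pseries_bound (fun i => PSeries (a i) k) r (2 * M') h Hr Hh). intros; apply X. }
  destruct (Hc a1 M1 Hb1) as [E1 G1]. destruct (Hc a2 M2 Hb2) as [E2 G2].
  rewrite <- PSeries_minus by assumption.
  apply PSeries_ext. intros i. unfold PS_minus, PS_plus, PS_opp.
  change (PSeries (a1 i) k - PSeries (a2 i) k = PSeries (fun j => a1 i j - a2 i j) k).
  rewrite <- PSeries_minus by auto. apply PSeries_ext. intros j. reflexivity.
Qed.

(** As f - g vanishes for k = 0, division by k leaves a power series in h with coefficients [b k i].
    They satisfy bounds uniform in k and differ from a i 1 by O(|k|), so the first-order expansion
    in h is uniform as k -> 0. *)
Lemma analytic3_divided (f g : R -> R -> R -> R) (x y z : R) :
  analytic3_at f x y z -> analytic3_at g x y z ->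
  (forall h, f h y z = g h y z) ->
  exists a0 a1 C d, 0 < d /\ 0 <= C /\ forall h k, Rabs h < d -> 0 < Rabs k < d ->
    (exists d', is_derive (fun t => f t (y + k) z - g t (y + k) z) (x + h) d' /\
       Rabs (d' / k - a1) <= C * (Rabs h + Rabs k)) /\
    Rabs ((f (x + h) (y + k) z - g (x + h) (y + k) z) / k - a0 - a1 * h) <= C * (h ^ 2 + Rabs k).
Proof.
  intros Hf Hg H0.
  destruct (analytic3_minus f g x y z Hf Hg) as [a [r [M [Hr [HM [Ha HF]]]]]].
  assert (Hir : 0 < / r) by (apply Rinv_0_lt_compat; exact Hr).
  set (M1 := 3 * (M / r)). set (M2 := 2 * (M / r ^ 2)).
  assert (HMr : 0 <= M / r) by (apply Rmult_le_pos; lra).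
  assert (HMr2 : 0 <= M / r ^ 2) by (apply Rmult_le_pos; [lra|left; apply Rinv_0_lt_compat, pow_lt, Hr]).
  set (b := fun k i => (PSeries (a i) k - a i 0%nat) / k).
  assert (Hb : forall k i, 0 < Rabs k < r / 4 ->
     Rabs (b k i - a i 1%nat) <= M2 * Rabs k * (/ r) ^ i /\ Rabs (b k i) <= M1 * (/ r) ^ i).
  { intros k i Hk.
    destruct (pseries_taylor (a i) r (M * (/ r) ^ i) k Hr ltac:(lra) (Ha i)) as [_ [_ [_ T]]].
    assert (Hk0 : k <> 0) by (intros ->; rewrite Rabs_R0 in Hk; lra).
    assert (P : 0 < (/ r) ^ i) by (apply pow_lt; exact Hir).
    assert (T1 : Rabs (b k i - a i 1%nat) <= M2 * Rabs k * (/ r) ^ i).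
    { apply Rmult_le_reg_r with (Rabs k); [lra|]. rewrite <- Rabs_mult.
      replace ((b k i - a i 1%nat) * k) with (PSeries (a i) k - a i 0%nat - a i 1%nat * k) by (unfold b; field; exact Hk0).
      eapply Rle_trans; [exact T|]. right. unfold M2.
      replace (k ^ 2) with (Rabs k * Rabs k) by (rewrite <- Rabs_mult, Rabs_pos_eq; [ring|nra]).
      unfold Rdiv; ring. }
    split; [exact T1|].
    replace (b k i) with ((b k i - a i 1%nat) + a i 1%nat) by ring.
    eapply Rle_trans; [apply Rabs_triang|].
    assert (A1 : Rabs (a i 1%nat) <= M / r * (/ r) ^ i).
    { eapply Rle_trans; [apply Ha|]. right. simpl. unfold Rdiv; ring. }
    assert (M2 * Rabs k <= 2 * (M / r)).
    { apply Rle_trans with (M2 * r); [apply Rmult_le_compat_l; unfold M2; lra|right; unfold M2; field; lra]. }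
    assert (M2 * Rabs k * (/ r) ^ i <= 2 * (M / r) * (/ r) ^ i) by (apply Rmult_le_compat_r; lra).
    unfold M1. lra. }
  assert (E : forall h k, Rabs h <= r / 2 -> 0 < Rabs k < r / 4 ->
     f (x + h) (y + k) z - g (x + h) (y + k) z = k * PSeries (b k) h).
  { intros h k Hh Hk. rewrite HF by lra.
    assert (Hk0 : k <> 0) by (intros ->; rewrite Rabs_R0 in Hk; lra).
    (* The coefficients a i 0 sum to zero for every h. Subtracting their series does the same
       service as proving that each of them vanishes. *)
    assert (Z : PSeries (fun i => PSeries (a i) 0) h = 0).
    { rewrite <- HF by (try rewrite Rabs_R0; lra). rewrite Rplus_0_r, H0. ring. }
    rewrite <- PSeries_scal, <- (Rminus_0_r (PSeries _ h)), <- Z.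
    assert (X : forall k, Rabs k <= r / 2 -> ex_pseries (fun i => PSeries (a i) k) h).
    { intros k' Hk'. apply (pseries_bound _ r (2 * M) h Hr Hh). intros i.
      destruct (pseries_bound (a i) r (M * (/ r) ^ i) k' Hr Hk' (Ha i)) as [_ [X2 _]]. lra. }
    rewrite <- PSeries_minus by (apply X; try rewrite Rabs_R0; lra).
    apply PSeries_ext. intros i.
    change (PSeries (a i) k - PSeries (a i) 0 = k * b k i). rewrite PSeries_0. unfold b. field. exact Hk0. }
  set (C := 5 * (M1 / r ^ 2) + M2 * / r + 2 * M2 + 2 * (M1 / r ^ 2)).
  assert (HM1r : 0 <= M1 / r ^ 2).
  { apply Rmult_le_pos; [unfold M1; lra|left; apply Rinv_0_lt_compat, pow_lt, Hr]. }
  assert (HM2 : 0 <= M2) by (unfold M2; lra).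
  assert (HM2r : 0 <= M2 * / r) by (apply Rmult_le_pos; lra).
  exists (a 0%nat 1%nat), (a 1%nat 1%nat), C, (r / 4).
  split; [lra|]. split; [unfold C; lra|]. intros h k Hh Hk.
  assert (Hk0 : k <> 0) by (intros ->; rewrite Rabs_R0 in Hk; lra).
  destruct (pseries_taylor (b k) r M1 h Hr Hh (fun i => proj2 (Hb k i Hk))) as [b' [Hd [T1 T0]]].
  destruct (Hb k 1%nat Hk) as [B1 _]. destruct (Hb k 0%nat Hk) as [B0 _].
  rewrite pow_1 in B1. rewrite pow_O, Rmult_1_r in B0.
  pose proof (Rabs_pos h) as Hh0. pose proof (pow2_ge_0 h) as Hh2. split.
  - exists (k * b'). split.
    + apply (is_derive_ext_loc (fun t => k * PSeries (b k) (t - x))).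
      * assert (Hpos : 0 < r / 4 - Rabs h) by lra. exists (mkposreal _ Hpos). intros t Ht.
        change (Rabs (t - (x + h)) < r / 4 - Rabs h) in Ht.
        assert (Et : forall u : R, x + (u - x) = u) by (intros; ring).
        assert (Et2 : forall u : R, u - x = (u - (x + h)) + h) by (intros; ring).
        rewrite <- E; [rewrite (Et t); reflexivity| |exact Hk].
        rewrite (Et2 t). eapply Rle_trans; [apply Rabs_triang|]. lra.
      * evar_last.
        -- apply (is_derive_scal (fun t => PSeries (b k) (t - x))).
           apply (is_derive_comp (K := R_AbsRing) (V := R_NormedModule) (PSeries (b k)) (fun t => t - x)).
           ++ replace (x + h - x) with h by ring. exact Hd.
           ++ auto_derive; [exact I|reflexivity].
        -- change (k * (1 * b') = k * b'). ring.
    + replace (k * b' / k - a 1%nat 1%nat) with ((b' - b k 1%nat) + (b k 1%nat - a 1%nat 1%nat)) by (field; exact Hk0).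
      eapply Rle_trans; [apply Rabs_triang|].
      apply Rle_trans with (5 * (M1 / r ^ 2) * Rabs h + M2 * / r * Rabs k); [lra|].
      unfold C. nra.
  - rewrite E by lra.
    replace (k * PSeries (b k) h / k - a 0%nat 1%nat - a 1%nat 1%nat * h) with
      ((PSeries (b k) h - b k 0%nat - b k 1%nat * h) + ((b k 0%nat - a 0%nat 1%nat) + (b k 1%nat - a 1%nat 1%nat) * h))
      by (field; exact Hk0).
    eapply Rle_trans; [apply Rabs_triang|].
    apply Rle_trans with (2 * (M1 / r ^ 2) * h ^ 2 + (M2 * Rabs k + M2 * Rabs k * / r * (r / 4))).
    + apply Rplus_le_compat; [exact T0|]. eapply Rle_trans; [apply Rabs_triang|].
      apply Rplus_le_compat; [exact B0|apply Rabs_mult_le; [exact B1|lra]].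
    + replace (M2 * Rabs k * / r * (r / 4)) with (M2 * Rabs k / 4) by (field; lra).
      unfold C. pose proof (Rabs_pos k).
      assert (0 <= M2 * Rabs k) by (apply Rmult_le_pos; lra).
      assert (0 <= M1 / r ^ 2 * h ^ 2) by (apply Rmult_le_pos; lra).
      assert (0 <= M1 / r ^ 2 * Rabs k) by (apply Rmult_le_pos; lra).
      assert (0 <= M2 * / r * h ^ 2) by (apply Rmult_le_pos; lra).
      assert (0 <= M2 * / r * Rabs k) by (apply Rmult_le_pos; lra).
      assert (0 <= M2 * h ^ 2) by (apply Rmult_le_pos; lra).
      lra.
Qed.

(* The quotient [(f - g) / k] is [a0 + a1 h + O(h^2 + |k|)], with derivative [a1 + O(|h| + |k|)];
   the hypotheses on [m] force [a0 = 0 < a1]. *)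
Lemma analytic3_simple_zero (f g : R -> R -> R -> R) (x y z c h0 : R) (m : R -> R) :
  analytic3_at f x y z -> analytic3_at g x y z ->
  (forall h, f h y z = g h y z) -> 0 < c -> 0 < h0 ->
  m 0 = 0 -> (forall h, 0 < h < h0 -> c * h <= m h) ->
  (forall h, 0 <= h < h0 -> forall e, 0 < e -> exists d, 0 < d /\ forall k, 0 < k < d ->
     Rabs ((f (x + h) (y + k) z - g (x + h) (y + k) z) / k - m h) < e) ->
  forall eta, 0 < eta -> exists k1, 0 < k1 /\ forall k, 0 < k < k1 ->
    exists h d', Rabs h < eta /\ f (x + h) (y + k) z = g (x + h) (y + k) z /\
      is_derive (fun t => f t (y + k) z - g t (y + k) z) (x + h) d' /\ d' <> 0.
Proof.
  intros Hf Hg H0 Hc Hh0 Hm0 Hm Hlim eta Heta.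
  destruct (analytic3_divided f g x y z Hf Hg H0) as [a0 [a1 [C [d [Hd [HC HD]]]]]].
  (* Letting k tend to 0 at fixed h replaces the quotient by m h and removes the error C |k|. *)
  assert (Happ : forall h, 0 <= h < h0 -> h < d -> Rabs (m h - a0 - a1 * h) <= C * h ^ 2).
  { intros h Hh Hhd. apply Rnot_lt_le. intros Hlt.
    set (e := (Rabs (m h - a0 - a1 * h) - C * h ^ 2) / 2).
    assert (He : 0 < e) by (unfold e; lra).
    destruct (Hlim h Hh e He) as [d' [Hd' Hk]].
    set (k := Rmin (d / 2) (Rmin (d' / 2) (e / (2 * (C + 1))))).
    assert (Hk0 : 0 < k).
    { unfold k. repeat apply Rmin_pos; try lra. apply Rdiv_lt_0_compat; lra. }
    assert (K1 : k <= d / 2) by apply Rmin_l.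
    assert (K2 : k <= d' / 2) by (eapply Rle_trans; [apply Rmin_r|apply Rmin_l]).
    assert (K3 : k <= e / (2 * (C + 1))) by (eapply Rle_trans; [apply Rmin_r|apply Rmin_r]).
    destruct (HD h k) as [_ T]; [rewrite Rabs_pos_eq; lra|rewrite Rabs_pos_eq; lra|].
    specialize (Hk k ltac:(lra)). rewrite (Rabs_pos_eq k) in T by lra.
    set (q := (f (x + h) (y + k) z - g (x + h) (y + k) z) / k) in *.
    assert (X : Rabs (m h - a0 - a1 * h) <= Rabs (q - m h) + Rabs (q - a0 - a1 * h)).
    { replace (m h - a0 - a1 * h) with (- (q - m h) + (q - a0 - a1 * h)) by ring.
      eapply Rle_trans; [apply Rabs_triang|]. rewrite Rabs_Ropp. lra. }
    assert (Ck : C * k <= e / 2).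
    { apply Rle_trans with ((C + 1) * (e / (2 * (C + 1)))); [apply Rmult_le_compat; lra|right; field; lra]. }
    unfold e in *. lra. }
  assert (Ha0 : a0 = 0).
  { specialize (Happ 0 ltac:(lra) Hd). rewrite Hm0 in Happ.
    replace (0 - a0 - a1 * 0) with (- a0) in Happ by ring. rewrite Rabs_Ropp in Happ.
    replace (C * 0 ^ 2) with 0 in Happ by ring. pose proof (Rabs_pos a0).
    destruct (Req_dec a0 0) as [|Hn]; [assumption|]. apply Rabs_pos_lt in Hn. lra. }
  subst a0.
  (* A smaller slope fails for small h > 0, because c h <= m h <= a1 h + C h^2. *)
  assert (Ha1 : c <= a1).
  { apply Rnot_lt_le. intros Hlt.
    set (h := Rmin (h0 / 2) (Rmin (d / 2) ((c - a1) / (2 * (C + 1))))).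
    assert (Hh : 0 < h).
    { unfold h. repeat apply Rmin_pos; try lra. apply Rdiv_lt_0_compat; lra. }
    assert (L1 : h <= h0 / 2) by apply Rmin_l.
    assert (L2 : h <= d / 2) by (eapply Rle_trans; [apply Rmin_r|apply Rmin_l]).
    assert (L3 : h <= (c - a1) / (2 * (C + 1))) by (eapply Rle_trans; [apply Rmin_r|apply Rmin_r]).
    specialize (Happ h ltac:(lra) ltac:(lra)). specialize (Hm h ltac:(lra)).
    apply Rabs_le_between in Happ.
    assert (Ch : C * h <= (c - a1) / 2).
    { apply Rle_trans with ((C + 1) * ((c - a1) / (2 * (C + 1)))); [apply Rmult_le_compat; lra|right; field; lra]. }
    assert (C * h ^ 2 <= (c - a1) / 2 * h) by (replace (C * h ^ 2) with (C * h * h) by ring; apply Rmult_le_compat_r; lra).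
    nra. }
  (* At h = h1 and h = - h1 the term a1 h outweighs the error C (h^2 + k), so the difference changes
     sign in between; the same smallness keeps the derivative a1 + O(|h| + k) away from zero on the
     whole interval. *)
  set (h1 := Rmin (eta / 2) (Rmin (d / 2) (c / (8 * (C + 1))))).
  assert (Hh1 : 0 < h1).
  { unfold h1. repeat apply Rmin_pos; try lra. apply Rdiv_lt_0_compat; lra. }
  assert (L1 : h1 <= eta / 2) by apply Rmin_l.
  assert (L2 : h1 <= d / 2) by (eapply Rle_trans; [apply Rmin_r|apply Rmin_l]).
  assert (L3 : h1 <= c / (8 * (C + 1))) by (eapply Rle_trans; [apply Rmin_r|apply Rmin_r]).
  assert (Ch1 : C * h1 <= c / 8).
  { apply Rle_trans with ((C + 1) * (c / (8 * (C + 1)))); [apply Rmult_le_compat; lra|right; field; lra]. }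
  set (k1 := Rmin (d / 2) (Rmin (c / (8 * (C + 1))) (h1 * c / (8 * (C + 1))))).
  assert (Hk1 : 0 < k1).
  { unfold k1. repeat apply Rmin_pos; try lra; apply Rdiv_lt_0_compat; nra. }
  exists k1. split; [exact Hk1|]. intros k Hk.
  assert (K1 : k1 <= d / 2) by apply Rmin_l.
  assert (K2 : k1 <= c / (8 * (C + 1))) by (eapply Rle_trans; [apply Rmin_r|apply Rmin_l]).
  assert (K3 : k1 <= h1 * c / (8 * (C + 1))) by (eapply Rle_trans; [apply Rmin_r|apply Rmin_r]).
  assert (Ck : C * k <= c / 8).
  { apply Rle_trans with ((C + 1) * (c / (8 * (C + 1)))); [apply Rmult_le_compat; lra|right; field; lra]. }
  assert (Ckh : C * k <= h1 * c / 8).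
  { apply Rle_trans with ((C + 1) * (h1 * c / (8 * (C + 1)))); [apply Rmult_le_compat; lra|right; field; lra]. }
  assert (Hkk : 0 < Rabs k < d) by (rewrite Rabs_pos_eq; lra).
  set (q := fun h => f (x + h) (y + k) z - g (x + h) (y + k) z).
  assert (HDq : forall h, Rabs h <= h1 -> Rabs (q h / k - a1 * h) <= C * (h ^ 2 + k)
     /\ exists d', is_derive (fun t => f t (y + k) z - g t (y + k) z) (x + h) d' /\ d' <> 0).
  { intros h Hh. destruct (HD h k ltac:(lra) Hkk) as [[d' [D1 D2]] D3].
    rewrite (Rabs_pos_eq k) in D2, D3 by lra. split.
    - unfold q. replace (_ / k - a1 * h) with ((f (x + h) (y + k) z - g (x + h) (y + k) z) / k - 0 - a1 * h) by ring. exact D3.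
    - exists d'. split; [exact D1|]. intros ->.
      replace (0 / k - a1) with (- a1) in D2 by (field; lra).
      rewrite Rabs_Ropp, Rabs_pos_eq in D2 by lra.
      assert (C * Rabs h <= C * h1) by (apply Rmult_le_compat_l; lra). lra. }
  assert (Hq1 : 0 < q h1).
  { destruct (HDq h1) as [X _]; [rewrite Rabs_pos_eq; lra|]. apply Rabs_le_between in X.
    assert (C * h1 ^ 2 <= c / 8 * h1) by (replace (C * h1 ^ 2) with (C * h1 * h1) by ring; apply Rmult_le_compat_r; lra).
    assert (c * h1 <= a1 * h1) by (apply Rmult_le_compat_r; lra).
    assert (0 < q h1 / k) by nra.
    replace (q h1) with (q h1 / k * k) by (field; lra). apply Rmult_lt_0_compat; lra. }
  assert (Hq2 : q (- h1) < 0).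
  { destruct (HDq (- h1)) as [X _]; [rewrite Rabs_Ropp, Rabs_pos_eq; lra|]. apply Rabs_le_between in X.
    replace ((- h1) ^ 2) with (h1 ^ 2) in X by ring.
    assert (C * h1 ^ 2 <= c / 8 * h1) by (replace (C * h1 ^ 2) with (C * h1 * h1) by ring; apply Rmult_le_compat_r; lra).
    assert (c * h1 <= a1 * h1) by (apply Rmult_le_compat_r; lra).
    assert (0 < - (q (- h1) / k)) by nra.
    replace (q (- h1)) with (- (- (q (- h1) / k) * k)) by (field; lra).
    assert (0 < - (q (- h1) / k) * k) by (apply Rmult_lt_0_compat; lra). lra. }
  destruct (Ranalysis5.IVT_interv q (- h1) h1) as [h [Hh Hqh]]; try lra.
  { intros h Hh. destruct (HDq h) as [_ [d' [X _]]]; [apply Rabs_le; lra|].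
    apply continuity_pt_filterlim. apply (ex_derive_continuous (K := R_AbsRing) (V := R_NormedModule)).
    exists (scal 1 d').
    apply (is_derive_comp (K := R_AbsRing) (V := R_NormedModule) (fun t => f t (y + k) z - g t (y + k) z) (fun h => x + h)).
    - exact X.
    - auto_derive; [exact I|reflexivity]. }
  assert (Hhabs : Rabs h <= h1) by (apply Rabs_le; lra).
  destruct (HDq h Hhabs) as [_ [d' [X1 X2]]].
  exists h, d'. split; [lra|]. split; [unfold q in Hqh; lra|]. split; assumption.
Qed.

(** * The vector field *)

(** Both distances depend on eps, u and x only through this quantity. *)
Definition sfun (eps u x : R) : R := eps ^ 2 * u ^ 2 * x ^ 2.

Definition q13 (rho s c : R) : R := 1 + (rho * s) ^ 2 + 2 * (rho * s) * c.

Definition q23 (rho s c : R) : R := 1 + ((1 - rho) * s) ^ 2 - 2 * ((1 - rho) * s) * c.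

Lemma R13_q rho eps u th x : R13 rho eps u th x = sqrt (q13 rho (sfun eps u x) (cos th)).
Proof. unfold R13, q13, sfun. f_equal. ring. Qed.

Lemma R23_q rho eps u th x : R23 rho eps u th x = sqrt (q23 rho (sfun eps u x) (cos th)).
Proof. unfold R23, q23, sfun. f_equal. ring. Qed.

(** One factor x is kept in the bound: the perturbation has to vanish with X for the decay and tail
    estimates. *)
Lemma sfun_bound eps u x : 0 < eps <= / 10 ^ 9 -> / 2 <= u <= 3 / 2 -> 0 < x <= 3 / 2 ->
  0 < sfun eps u x <= / 10 ^ 15 * x.
Proof.
  intros He Hu Hx. unfold sfun. split.
  - apply Rmult_lt_0_compat; [apply Rmult_lt_0_compat|]; apply pow_lt; lra.
  - replace (eps ^ 2 * u ^ 2 * x ^ 2) with (eps ^ 2 * (u ^ 2 * x) * x) by ring.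
    apply Rmult_le_compat_r; [lra|].
    apply Rle_trans with (/ 10 ^ 18 * 4).
    + assert (H1 : eps ^ 2 <= (/ 10 ^ 9) ^ 2) by (apply pow_incr; lra).
      apply Rmult_le_compat; [apply pow2_ge_0|nra| |nra].
      replace (/ 10 ^ 18) with ((/ 10 ^ 9) ^ 2) by (rewrite pow_inv, <- pow_mult; reflexivity). exact H1.
    + lra.
Qed.

Lemma q_near_1 rho s c : 0 <= rho <= 1 / 2 -> 0 <= s <= / 100 -> -1 <= c <= 1 ->
  Rabs (q13 rho s c - 1) <= 3 * s /\ Rabs (q23 rho s c - 1) <= 3 * s.
Proof.
  intros Hr Hs Hc. unfold q13, q23.
  assert (H1 : 0 <= rho * s <= s) by nra. assert (H2 : 0 <= (1 - rho) * s <= s) by nra.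
  split; apply Rabs_le; nra.
Qed.

Lemma sqrt_near_1 q : Rabs (q - 1) <= / 10 ->
  / 2 <= sqrt q <= 2 /\ Rabs (/ sqrt q ^ 3 - 1) <= 8 * Rabs (q - 1).
Proof.
  intros Hq. apply Rabs_le_between in Hq as Hq'.
  assert (Hss : sqrt q * sqrt q = q) by (apply sqrt_sqrt; lra).
  assert (Hs0 : 0 <= sqrt q) by apply sqrt_pos.
  assert (H1 : 9 / 10 <= sqrt q) by nra.
  assert (H2 : sqrt q <= 11 / 10) by nra.
  split; [lra|].
  set (r := sqrt q) in *.
  replace (/ r ^ 3 - 1) with ((1 - r * r) * ((r ^ 2 + r + 1) * / ((r + 1) * r ^ 3))) by (field; lra).
  rewrite Hss, Rabs_mult, Rmult_comm. replace (Rabs (1 - q)) with (Rabs (q - 1)) by apply Rabs_minus_sym.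
  apply Rmult_le_compat_r; [apply Rabs_pos|].
  assert (Hr3 : (9 / 10) ^ 3 <= r ^ 3) by (apply pow_incr; lra).
  assert (Hp : 0 < (r + 1) * r ^ 3) by (apply Rmult_lt_0_compat; lra).
  rewrite Rabs_pos_eq.
  - apply Rmult_le_reg_r with ((r + 1) * r ^ 3); [exact Hp|]. rewrite Rmult_assoc, Rinv_l by lra. nra.
  - apply Rmult_le_pos; [nra|left; apply Rinv_0_lt_compat, Hp].
Qed.

Lemma R_bounds rho eps u th x : 0 <= rho <= 1 / 2 -> 0 < eps <= / 10 ^ 9 ->
  / 2 <= u <= 3 / 2 -> 0 < x <= 3 / 2 ->
  / 2 <= R13 rho eps u th x <= 2 /\ / 2 <= R23 rho eps u th x <= 2 /\
  Rabs (/ R13 rho eps u th x ^ 3 - 1) <= 24 * sfun eps u x /\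
  Rabs (/ R23 rho eps u th x ^ 3 - 1) <= 24 * sfun eps u x.
Proof.
  intros Hr He Hu Hx.
  destruct (sfun_bound eps u x He Hu Hx) as [Hs1 Hs2].
  assert (Hs3 : sfun eps u x <= / 100) by lra.
  destruct (q_near_1 rho (sfun eps u x) (cos th) Hr ltac:(lra) (COS_bound th)) as [H13 H23].
  rewrite R13_q, R23_q.
  destruct (sqrt_near_1 (q13 rho (sfun eps u x) (cos th)) ltac:(lra)) as [A1 A2].
  destruct (sqrt_near_1 (q23 rho (sfun eps u x) (cos th)) ltac:(lra)) as [B1 B2].
  repeat split; try lra.
Qed.

Lemma FG_bounds rho eps u th x : 0 <= rho <= 1 / 2 -> 0 < eps <= / 10 ^ 9 ->
  / 2 <= u <= 3 / 2 -> 0 < x <= 3 / 2 ->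
  Rabs (Ffun rho eps u th x) <= / 1000 /\
  Rabs (Gfun rho eps u th x) <= 48 * rho * sfun eps u x.
Proof.
  intros Hr He Hu Hx.
  destruct (sfun_bound eps u x He Hu Hx) as [Hs1 Hs2].
  destruct (R_bounds rho eps u th x Hr He Hu Hx) as [_ [_ [E1 E2]]].
  assert (Hs3 : sfun eps u x <= / 10 ^ 6) by lra.
  pose proof (COS_bound th) as Hc. pose proof (SIN_bound th) as Hsn.
  unfold Ffun, Gfun.
  set (e1 := / R13 rho eps u th x ^ 3 - 1) in *. set (e2 := / R23 rho eps u th x ^ 3 - 1) in *.
  replace (/ R13 rho eps u th x ^ 3) with (1 + e1) by (unfold e1; ring).
  replace (/ R23 rho eps u th x ^ 3) with (1 + e2) by (unfold e2; ring).
  split.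
  - set (s := sfun eps u x) in *.
    (* With the inverse cubes written as 1 + e1 and 1 + e2, all terms free of e1 and e2 cancel. *)
    replace (1 - (1 - rho) * (1 + rho * eps ^ 2 * u ^ 2 * x ^ 2 * cos th) * (1 + e1) -
      rho * (1 - (1 - rho) * eps ^ 2 * u ^ 2 * x ^ 2 * cos th) * (1 + e2)) with
      (- (((1 - rho) * (1 + rho * s * cos th)) * e1 + (rho * (1 - (1 - rho) * s * cos th)) * e2))
      by (unfold s, sfun; ring).
    rewrite Rabs_Ropp. eapply Rle_trans; [apply Rabs_triang|].
    apply Rle_trans with (2 * (24 * s) + 2 * (24 * s)); [|lra].
    assert (0 <= rho * s <= s) by nra. assert (0 <= (1 - rho) * s <= s) by nra.
    assert (- s <= rho * s * cos th <= s) by nra. assert (- s <= (1 - rho) * s * cos th <= s) by nra.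
    apply Rplus_le_compat; apply Rabs_mult_le; try assumption; apply Rabs_le; nra.
  - replace (rho * (1 - rho) * sin th * (1 + e1 - (1 + e2))) with (rho * ((1 - rho) * sin th * (e1 + - e2))) by ring.
    rewrite Rabs_mult, (Rabs_pos_eq rho) by lra.
    replace (48 * rho * sfun eps u x) with (rho * (48 * sfun eps u x)) by ring. apply Rmult_le_compat_l; [lra|].
    replace (48 * sfun eps u x) with (1 * 1 * (24 * sfun eps u x + 24 * sfun eps u x)) by ring.
    apply Rabs_mult_le; [apply Rabs_mult_le; apply Rabs_le; lra|].
    eapply Rle_trans; [apply Rabs_triang|]. rewrite Rabs_Ropp. lra.
Qed.

(** The derivative is left unnamed: its existence with bounds is what the vector field has to
    provide, and closure under operations can then be proved automatically. *)
Definition exC11 {V : NormedModule R_AbsRing} (B : V -> Prop) (F : V -> R) : Prop := exists D, C11 B F D.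

Lemma exC11_ext {V : NormedModule R_AbsRing} (B : V -> Prop) F G :
  (forall p, B p -> F p = G p) -> exC11 B F -> exC11 B G.
Proof. intros E [D H]. exists D. exact (C11_ext B F G D E H). Qed.

Lemma exC11_const {V : NormedModule R_AbsRing} (B : V -> Prop) c : exC11 B (fun _ => c).
Proof. eexists; apply C11_const. Qed.

Lemma exC11_plus {V : NormedModule R_AbsRing} (B : V -> Prop) F G :
  exC11 B F -> exC11 B G -> exC11 B (fun p => F p + G p).
Proof. intros [D H] [D' H']. eexists; apply C11_plus; eassumption. Qed.

Lemma exC11_mult {V : NormedModule R_AbsRing} (B : V -> Prop) F G :
  exC11 B F -> exC11 B G -> exC11 B (fun p => F p * G p).
Proof. intros [D H] [D' H']. eexists; apply C11_mult; eassumption. Qed.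

Lemma exC11_opp {V : NormedModule R_AbsRing} (B : V -> Prop) F : exC11 B F -> exC11 B (fun p => - F p).
Proof.
  intros H. apply (exC11_ext B (fun p => (-1) * F p)); [intros; ring|].
  apply exC11_mult; [apply exC11_const|exact H].
Qed.

Lemma exC11_minus {V : NormedModule R_AbsRing} (B : V -> Prop) F G :
  exC11 B F -> exC11 B G -> exC11 B (fun p => F p - G p).
Proof. intros H1 H2. apply exC11_plus; [exact H1|apply exC11_opp, H2]. Qed.

Lemma exC11_pow {V : NormedModule R_AbsRing} (B : V -> Prop) F n : exC11 B F -> exC11 B (fun p => F p ^ n).
Proof.
  intros H; induction n as [|n IH]; simpl; [apply exC11_const|apply exC11_mult; assumption].
Qed.

Lemma exC11_inv {V : NormedModule R_AbsRing} (B : V -> Prop) F a b : 0 < a ->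
  (forall p, B p -> a <= F p <= b) -> exC11 B F -> exC11 B (fun p => / F p).
Proof. intros Ha Hr [D H]. eexists. exact (C11_comp B _ F D _ _ H (C11_inv a b Ha) Hr). Qed.

Lemma exC11_sqrt {V : NormedModule R_AbsRing} (B : V -> Prop) F a b : 0 < a <= b ->
  (forall p, B p -> a <= F p <= b) -> exC11 B F -> exC11 B (fun p => sqrt (F p)).
Proof.
  intros Ha Hr [D H]. destruct (C11_sqrt a b Ha) as [s' Hs].
  eexists. exact (C11_comp B _ F D _ _ H Hs Hr).
Qed.

Ltac exC11_auto :=
  repeat first
    [ assumption | apply exC11_const | apply exC11_plus | apply exC11_minus | apply exC11_opp
    | apply exC11_mult | apply exC11_pow ].

(** [rho] and [u] are functions on B because they are variables in some applications and parameters
    in others. For the angle, regularity of its cosine is assumed, as the angle itself is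
    unbounded. *)
Lemma exC11_Rinv {V : NormedModule R_AbsRing} (B : V -> Prop) (eps : R) (rho u th x : V -> R) :
  0 < eps <= / 10 ^ 9 ->
  (forall p, B p -> 0 <= rho p <= 1 / 2 /\ / 2 <= u p <= 3 / 2 /\ 0 < x p <= 3 / 2) ->
  exC11 B rho -> exC11 B u -> exC11 B x -> exC11 B (fun p => cos (th p)) ->
  exC11 B (fun p => / R13 (rho p) eps (u p) (th p) (x p)) /\
  exC11 B (fun p => / R23 (rho p) eps (u p) (th p) (x p)).
Proof.
  intros He HB Hrho Hu Hx Hc.
  assert (Hq : forall p, B p -> 9 / 10 <= q13 (rho p) (sfun eps (u p) (x p)) (cos (th p)) <= 11 / 10 /\
     9 / 10 <= q23 (rho p) (sfun eps (u p) (x p)) (cos (th p)) <= 11 / 10).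
  { intros p Hp. destruct (HB p Hp) as [B1 [B2 B3]].
    destruct (sfun_bound eps (u p) (x p) He B2 B3) as [Hs1 Hs2].
    destruct (q_near_1 (rho p) (sfun eps (u p) (x p)) (cos (th p)) B1 ltac:(lra) (COS_bound (th p))) as [H13 H23].
    apply Rabs_le_between in H13, H23. lra. }
  assert (Hr := fun p Hp => R_bounds (rho p) eps (u p) (th p) (x p) (proj1 (HB p Hp)) He
    (proj1 (proj2 (HB p Hp))) (proj2 (proj2 (HB p Hp)))).
  split.
  - apply (exC11_inv B _ (/ 2) 2); [lra|intros p Hp; apply Hr, Hp|].
    apply (exC11_ext B (fun p => sqrt (q13 (rho p) (sfun eps (u p) (x p)) (cos (th p)))));
      [intros; symmetry; apply R13_q|].
    apply (exC11_sqrt B _ (9 / 10) (11 / 10)); [lra|intros p Hp; apply Hq, Hp|].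
    unfold q13, sfun. exC11_auto.
  - apply (exC11_inv B _ (/ 2) 2); [lra|intros p Hp; apply Hr, Hp|].
    apply (exC11_ext B (fun p => sqrt (q23 (rho p) (sfun eps (u p) (x p)) (cos (th p)))));
      [intros; symmetry; apply R23_q|].
    apply (exC11_sqrt B _ (9 / 10) (11 / 10)); [lra|intros p Hp; apply Hq, Hp|].
    unfold q23, sfun. exC11_auto.
Qed.

(** * The implicit function U *)

Definition energy (rho eps u th x y : R) : R :=
  u - 1 + eps ^ 3 * u ^ 3 *
    (y ^ 2 + / 2 * x ^ 4 - x ^ 2 * ((1 - rho) * / R13 rho eps u th x + rho * / R23 rho eps u th x)).

Lemma energy_zero rho eps u th x y : energy rho eps u th x y = 0 <->
  u = 1 - eps ^ 3 * u ^ 3 * y ^ 2 - 1 / 2 * eps ^ 3 * u ^ 3 * x ^ 4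
        + (1 - rho) * eps ^ 3 * u ^ 3 * x ^ 2 * / R13 rho eps u th x
        + rho * eps ^ 3 * u ^ 3 * x ^ 2 * / R23 rho eps u th x.
Proof. unfold energy. split; intros H; lra. Qed.

Lemma is_derive_Rinv_sqrt (q : R -> R) u dq : is_derive q u dq -> 0 < q u ->
  is_derive (fun u => / sqrt (q u)) u (- dq * / (2 * sqrt (q u) ^ 3)).
Proof.
  intros Hd Hq. assert (0 < sqrt (q u)) by (apply sqrt_lt_R0, Hq).
  evar_last.
  - apply is_derive_inv; [apply is_derive_sqrt; [exact Hd|exact Hq]|lra].
  - simpl. field. lra.
Qed.

(** The correction to u carries the factor eps^3 and has a bounded u-derivative on [1/2, 3/2]. As a
    function of u, [energy] is thus close to a translation; existence, uniqueness and smoothness of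
    U all rest on this. *)
Lemma energy_near rho eps th x y u u' : 0 <= rho <= 1 / 2 -> 0 < eps <= / 10 ^ 9 ->
  0 < x <= 3 / 2 -> Rabs y <= 2 -> / 2 <= u <= 3 / 2 -> / 2 <= u' <= 3 / 2 ->
  Rabs (energy rho eps u' th x y - energy rho eps u th x y - (u' - u)) <= / 100 * Rabs (u' - u).
Proof.
  intros Hr He Hx Hy Hu Hu'.
  set (K := fun u => u ^ 3 *
    (y ^ 2 + / 2 * x ^ 4 - x ^ 2 * ((1 - rho) * / R13 rho eps u th x + rho * / R23 rho eps u th x))).
  set (ds := fun u => 2 * eps ^ 2 * u * x ^ 2).
  set (d13 := fun u => - ((2 * rho ^ 2 * sfun eps u x + 2 * rho * cos th) * ds u) * / (2 * R13 rho eps u th x ^ 3)).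
  set (d23 := fun u => - ((2 * (1 - rho) ^ 2 * sfun eps u x - 2 * (1 - rho) * cos th) * ds u) * / (2 * R23 rho eps u th x ^ 3)).
  set (dK := fun u => 3 * u ^ 2 *
    (y ^ 2 + / 2 * x ^ 4 - x ^ 2 * ((1 - rho) * / R13 rho eps u th x + rho * / R23 rho eps u th x))
    + u ^ 3 * (- x ^ 2 * ((1 - rho) * d13 u + rho * d23 u))).
  assert (HdK : forall v, / 2 <= v <= 3 / 2 -> is_derive K v (dK v)).
  { intros v Hv.
    destruct (R_bounds rho eps v th x Hr He Hv Hx) as [A13 [A23 _]].
    assert (Q13 : 0 < q13 rho (sfun eps v x) (cos th)).
    { rewrite R13_q in A13. apply Rnot_le_lt. intros Hle. rewrite sqrt_neg_0 in A13 by exact Hle. lra. }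
    assert (Q23 : 0 < q23 rho (sfun eps v x) (cos th)).
    { rewrite R23_q in A23. apply Rnot_le_lt. intros Hle. rewrite sqrt_neg_0 in A23 by exact Hle. lra. }
    assert (D13 : is_derive (fun v => / R13 rho eps v th x) v (d13 v)).
    { apply (is_derive_ext (fun v => / sqrt (q13 rho (sfun eps v x) (cos th)))).
      { intros t. rewrite R13_q. reflexivity. }
      unfold d13. rewrite R13_q.
      apply (is_derive_Rinv_sqrt (fun v => q13 rho (sfun eps v x) (cos th))); [|exact Q13].
      unfold q13, sfun, ds. auto_derive; [exact I|ring]. }
    assert (D23 : is_derive (fun v => / R23 rho eps v th x) v (d23 v)).
    { apply (is_derive_ext (fun v => / sqrt (q23 rho (sfun eps v x) (cos th)))).
      { intros t. rewrite R23_q. reflexivity. }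
      unfold d23. rewrite R23_q.
      apply (is_derive_Rinv_sqrt (fun v => q23 rho (sfun eps v x) (cos th))); [|exact Q23].
      unfold q23, sfun, ds. auto_derive; [exact I|ring]. }
    set (f13 := fun v => / R13 rho eps v th x) in *. set (f23 := fun v => / R23 rho eps v th x) in *.
    assert (E13 : Derive (fun v : R => f13 v) v = d13 v) by exact (is_derive_unique _ _ _ D13).
    assert (E23 : Derive (fun v : R => f23 v) v = d23 v) by exact (is_derive_unique _ _ _ D23).
    apply (is_derive_ext (fun v => v ^ 3 * (y ^ 2 + / 2 * x ^ 4 - x ^ 2 * ((1 - rho) * f13 v + rho * f23 v)))).
    { intros t; reflexivity. }
    auto_derive.
    - split; [exists (d13 v); exact D13|]. split; [exists (d23 v); exact D23|exact I].
    - change (Derive (fun x0 : R => f13 x0) v) with (Derive (fun v : R => f13 v) v). 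
      change (Derive (fun x0 : R => f23 x0) v) with (Derive (fun v : R => f23 v) v).
      rewrite E13, E23. unfold dK. change (/ R13 rho eps v th x) with (f13 v). change (/ R23 rho eps v th x) with (f23 v). ring. }
  assert (HbK : forall v, / 2 <= v <= 3 / 2 -> Rabs (dK v) <= 1000).
  { intros v Hv.
    destruct (R_bounds rho eps v th x Hr He Hv Hx) as [A13 [A23 _]].
    destruct (sfun_bound eps v x He Hv Hx) as [S1 S2].
    assert (I13 : / 2 <= / R13 rho eps v th x <= 2).
    { split; [apply Rinv_le_contravar; lra|rewrite <- (Rinv_inv 2); apply Rinv_le_contravar; lra]. }
    assert (I23 : / 2 <= / R23 rho eps v th x <= 2).
    { split; [apply Rinv_le_contravar; lra|rewrite <- (Rinv_inv 2); apply Rinv_le_contravar; lra]. }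
    assert (Hdv : 0 <= ds v <= 1).
    { unfold ds. assert (0 <= eps ^ 2 <= / 1000).
      { split; [apply pow2_ge_0|]. assert (eps <= / 1000) by lra. nra. }
      assert (0 <= v * x ^ 2 <= 4) by (split; [apply Rmult_le_pos; [lra|apply pow2_ge_0]|nra]). nra. }
    pose proof (COS_bound th) as Hc.
    assert (C13 : Rabs (/ (2 * R13 rho eps v th x ^ 3)) <= 4).
    { replace (/ (2 * R13 rho eps v th x ^ 3)) with (/ 2 * (/ R13 rho eps v th x) ^ 3) by (field; lra).
      rewrite Rabs_pos_eq by (apply Rmult_le_pos; [lra|apply pow_le; lra]).
      assert ((/ R13 rho eps v th x) ^ 3 <= 2 ^ 3) by (apply pow_incr; lra). lra. }
    assert (C23 : Rabs (/ (2 * R23 rho eps v th x ^ 3)) <= 4).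
    { replace (/ (2 * R23 rho eps v th x ^ 3)) with (/ 2 * (/ R23 rho eps v th x) ^ 3) by (field; lra).
      rewrite Rabs_pos_eq by (apply Rmult_le_pos; [lra|apply pow_le; lra]).
      assert ((/ R23 rho eps v th x) ^ 3 <= 2 ^ 3) by (apply pow_incr; lra). lra. }
    assert (S3 : sfun eps v x <= / 100) by lra.
    assert (B13 : Rabs (d13 v) <= 16).
    { unfold d13. replace 16 with (4 * 1 * 4) by ring. apply Rabs_mult_le; [|exact C13].
      rewrite Rabs_Ropp. apply Rabs_mult_le; [|rewrite Rabs_pos_eq; lra]. apply Rabs_le; nra. }
    assert (B23 : Rabs (d23 v) <= 16).
    { unfold d23. replace 16 with (4 * 1 * 4) by ring. apply Rabs_mult_le; [|exact C23].
      rewrite Rabs_Ropp. apply Rabs_mult_le; [|rewrite Rabs_pos_eq; lra]. apply Rabs_le.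
      assert (0 <= (1 - rho) ^ 2 <= 1) by nra. nra. }
    assert (Hy2 : 0 <= y ^ 2 <= 4).
    { split; [apply pow2_ge_0|]. apply Rabs_le_between in Hy. nra. }
    assert (Hx2 : 0 <= x ^ 2 <= 9 / 4) by (split; [apply pow2_ge_0|nra]).
    assert (Hx4 : 0 <= x ^ 4 <= 6) by (replace (x ^ 4) with (x ^ 2 * x ^ 2) by ring; nra).
    assert (Hv2 : 0 <= v ^ 2 <= 9 / 4) by (split; [apply pow2_ge_0|nra]).
    assert (Hv3 : 0 <= v ^ 3 <= 27 / 8) by (replace (v ^ 3) with (v ^ 2 * v) by ring; nra).
    unfold dK.
    set (w := (1 - rho) * / R13 rho eps v th x + rho * / R23 rho eps v th x).
    assert (Hw : 0 <= w <= 2).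
    { unfold w. split; [nra|]. nra. }
    eapply Rle_trans; [apply Rabs_triang|].
    apply Rle_trans with (3 * (9 / 4) * 12 + 27 / 8 * (9 / 4 * (1 * 16 + 1 * 16))); [|lra].
    apply Rplus_le_compat; apply Rabs_mult_le.
    - rewrite Rabs_pos_eq; lra.
    - apply Rabs_le; nra.
    - rewrite Rabs_pos_eq; lra.
    - apply Rabs_mult_le; [rewrite Rabs_Ropp, Rabs_pos_eq; lra|].
      eapply Rle_trans; [apply Rabs_triang|]. apply Rplus_le_compat; apply Rabs_mult_le; try assumption; apply Rabs_le; lra. }
  assert (HM : Rabs (K u' - K u) <= 1000 * Rabs (u' - u)).
  { apply (MVT_abs_le K dK); intros v Hv; [apply HdK|apply HbK];
      apply (interval_convex _ _ u u' v Hu Hu'), Hv. }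
  replace (energy rho eps u' th x y - energy rho eps u th x y - (u' - u)) with (eps ^ 3 * (K u' - K u)) by (unfold energy, K; ring).
  assert (He3 : 0 <= eps ^ 3 <= / 10 ^ 9).
  { split; [apply pow_le; lra|]. replace (eps ^ 3) with (eps * (eps * eps)) by ring.
    assert (0 <= eps * eps <= 1) by nra. nra. }
  rewrite Rabs_mult, (Rabs_pos_eq (eps ^ 3)) by lra.
  apply Rle_trans with (/ 10 ^ 9 * (1000 * Rabs (u' - u))).
  - apply Rmult_le_compat; try apply Rabs_pos; lra.
  - pose proof (Rabs_pos (u' - u)). lra.
Qed.

Lemma energy_at_1 rho eps th x y : 0 <= rho <= 1 / 2 -> 0 < eps <= / 10 ^ 9 ->
  0 < x <= 3 / 2 -> Rabs y <= 2 -> Rabs (energy rho eps 1 th x y) <= / 100.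
Proof.
  intros Hr He Hx Hy. unfold energy.
  destruct (R_bounds rho eps 1 th x Hr He ltac:(lra) Hx) as [A13 [A23 _]].
  assert (I13 : / 2 <= / R13 rho eps 1 th x <= 2).
  { split; [apply Rinv_le_contravar; lra|rewrite <- (Rinv_inv 2); apply Rinv_le_contravar; lra]. }
  assert (I23 : / 2 <= / R23 rho eps 1 th x <= 2).
  { split; [apply Rinv_le_contravar; lra|rewrite <- (Rinv_inv 2); apply Rinv_le_contravar; lra]. }
  assert (Hy2 : 0 <= y ^ 2 <= 4).
  { split; [apply pow2_ge_0|]. apply Rabs_le_between in Hy. nra. }
  assert (Hx2 : 0 <= x ^ 2 <= 9 / 4) by (split; [apply pow2_ge_0|nra]).
  assert (Hx4 : 0 <= x ^ 4 <= 6) by (replace (x ^ 4) with (x ^ 2 * x ^ 2) by ring; nra).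
  set (w := (1 - rho) * / R13 rho eps 1 th x + rho * / R23 rho eps 1 th x).
  assert (Hw : 0 <= w <= 2) by (unfold w; split; nra).
  assert (He3 : 0 <= eps ^ 3 <= / 10 ^ 9).
  { split; [apply pow_le; lra|]. replace (eps ^ 3) with (eps * (eps * eps)) by ring.
    assert (0 <= eps * eps <= 1) by nra. nra. }
  replace (1 - 1 + eps ^ 3 * 1 ^ 3 * (y ^ 2 + / 2 * x ^ 4 - x ^ 2 * w)) with
    (eps ^ 3 * (y ^ 2 + / 2 * x ^ 4 - x ^ 2 * w)) by ring.
  apply Rle_trans with (/ 10 ^ 9 * 12); [|lra].
  apply Rabs_mult_le; [rewrite Rabs_pos_eq; lra|apply Rabs_le; nra].
Qed.

Lemma is_U_exists_unique rho eps p : 0 <= rho <= 1 / 2 -> 0 < eps <= / 10 ^ 9 ->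
  0 < st_X p <= 3 / 2 -> Rabs (st_Y p) <= 2 -> exists! u, is_U rho eps p u.
Proof.
  intros Hr He Hx Hy.
  set (x := st_X p) in *. set (y := st_Y p) in *. set (th := st_theta p).
  set (g := fun u => energy rho eps u th x y).
  assert (Hg : forall u u', / 2 <= u <= 3 / 2 -> / 2 <= u' <= 3 / 2 ->
     Rabs (g u' - g u - (u' - u)) <= / 100 * Rabs (u' - u)).
  { intros u u' Hu Hu'. apply energy_near; assumption. }
  assert (H1 := energy_at_1 rho eps th x y Hr He Hx Hy). fold (g 1) in H1.
  apply Rabs_le_between in H1.
  (* The clamp makes the function continuous on the line, although the estimate [Hg] holds on
     [1/2, 3/2] only. *)
  set (gc := fun u => g (clamp (/ 2) (3 / 2) u)).
  assert (Hgc : forall u, continuity_pt gc u).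
  { intros u e Hep. exists (e / 2). split; [lra|]. intros v [_ Hv]. simpl in Hv |- *. unfold R_dist in *.
    assert (Hc1 := clamp_range (/ 2) (3 / 2) u ltac:(lra)). assert (Hc2 := clamp_range (/ 2) (3 / 2) v ltac:(lra)).
    assert (X := Hg _ _ Hc1 Hc2). assert (Y := clamp_lip (/ 2) (3 / 2) v u ltac:(lra)).
    unfold gc. set (a := clamp (/ 2) (3 / 2) u) in *. set (b := clamp (/ 2) (3 / 2) v) in *.
    replace (g b - g a) with ((g b - g a - (b - a)) + (b - a)) by ring.
    eapply Rle_lt_trans; [apply Rabs_triang|]. lra. }
  assert (Hlo := Hg 1 (/ 2) ltac:(lra) ltac:(lra)). rewrite (Rabs_left (/ 2 - 1)) in Hlo by lra.
  assert (Hhi := Hg 1 (3 / 2) ltac:(lra) ltac:(lra)). rewrite (Rabs_pos_eq (3 / 2 - 1)) in Hhi by lra.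
  apply Rabs_le_between in Hlo, Hhi.
  destruct (Ranalysis5.IVT_interv gc (/ 2) (3 / 2)) as [u [Hu Hgu]]; try lra.
  { intros a _; apply Hgc. }
  { unfold gc. rewrite clamp_id by lra. lra. }
  { unfold gc. rewrite clamp_id by lra. lra. }
  unfold gc in Hgu. rewrite clamp_id in Hgu by exact Hu.
  assert (Hint : Rabs (u - 1) < 1 / 2).
  { assert (X := Hg 1 u ltac:(lra) Hu). rewrite Hgu in X. 
    unfold Rabs in X |- *. repeat destruct Rcase_abs; lra. }
  destruct (R_bounds rho eps u th x Hr He Hu Hx) as [A13 [A23 _]].
  exists u. split.
  - unfold is_U. fold x y th. split; [lra|]. split; [lra|]. split; [exact Hint|].
    apply energy_zero, Hgu.
  - intros u' [_ [_ [Hu' E]]]. fold x y th in E. apply energy_zero in E.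
    assert (Hu'2 : / 2 <= u' <= 3 / 2) by (apply Rabs_def2 in Hu'; lra).
    assert (X := Hg u u' Hu Hu'2). unfold g in X at 1. rewrite E, Hgu in X.
    unfold Rabs in X. repeat destruct Rcase_abs in X; lra.
Qed.

(** A function of the state, as needed to differentiate the vector field. Its value is the root
    wherever [is_U_exists_unique] applies. *)
Definition Ufun (rho eps : R) (p : state) : R := iota (fun u => is_U rho eps p u).

Lemma Ufun_spec rho eps p : 0 <= rho <= 1 / 2 -> 0 < eps <= / 10 ^ 9 ->
  0 < st_X p <= 3 / 2 -> Rabs (st_Y p) <= 2 ->
  is_U rho eps p (Ufun rho eps p) /\ (forall u, is_U rho eps p u -> u = Ufun rho eps p) /\
  / 2 <= Ufun rho eps p <= 3 / 2 /\
  energy rho eps (Ufun rho eps p) (st_theta p) (st_X p) (st_Y p) = 0.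
Proof.
  intros Hr He Hx Hy. assert (H := is_U_exists_unique rho eps p Hr He Hx Hy).
  assert (HU : is_U rho eps p (Ufun rho eps p)) by exact (iota_correct _ H).
  split; [exact HU|]. split.
  - intros u Hu. destruct H as [u0 [_ Hun]]. rewrite <- (Hun _ Hu). apply Hun, HU.
  - destruct HU as [_ [_ [Hi E]]]. apply Rabs_def2 in Hi. split; [lra|].
    apply energy_zero, E.
Qed.

Lemma norm_state_comp (v : state) :
  Rabs (st_theta v) <= norm v /\ Rabs (st_X v) <= norm v /\ Rabs (st_Y v) <= norm v.
Proof.
  destruct v as [[th x] y].
  destruct (norm_pair_ge (V := prod_NormedModule R_AbsRing R_NormedModule R_NormedModule) (th, x) y) as [H1 H2].
  destruct (norm_pair_ge (V := R_NormedModule) th x) as [H3 H4].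
  split; [|split; [|exact H2]].
  - eapply Rle_trans; [exact H3|exact H1].
  - eapply Rle_trans; [exact H4|exact H1].
Qed.

Lemma norm_state_le (v : state) : norm v <= Rabs (st_theta v) + Rabs (st_X v) + Rabs (st_Y v).
Proof.
  destruct v as [[th x] y].
  eapply Rle_trans; [apply (norm_pair_le (V := prod_NormedModule R_AbsRing R_NormedModule R_NormedModule) (th, x) y)|].
  apply Rplus_le_compat_r. apply (norm_pair_le (V := R_NormedModule) th x).
Qed.

(** The lower bound keeps X away from the singularity of the theta-equation; the angle is
    unrestricted. *)
Definition box (c : R) (p : state) : Prop := c <= st_X p <= 3 / 2 /\ Rabs (st_Y p) <= 2.

Lemma exC11_lin {V : NormedModule R_AbsRing} (B : V -> Prop) (S : R -> Prop) (l : V -> R) (g g' : R -> R) :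
  (forall u v, l (plus u v) = l u + l v) -> (forall k v, l (scal k v) = k * l v) ->
  (forall v, Rabs (l v) <= norm v) ->
  C11 (V := R_NormedModule) S g (fun x h => g' x * h) ->
  (forall p, B p -> S (l p)) -> exC11 B (fun p => g (l p)).
Proof. intros. eexists. eapply C11_comp_lin; eassumption. Qed.

Lemma exC11_coords (c : R) :
  exC11 (box c) (fun p => cos (st_theta p)) /\ exC11 (box c) (fun p => sin (st_theta p)) /\
  exC11 (box c) st_X /\ exC11 (box c) st_Y.
Proof.
  split; [|split; [|split]].
  - apply (exC11_lin (box c) (fun _ => True) st_theta cos (fun x => - sin x)); auto.
    + intros; apply norm_state_comp.
    + apply C11_cos.
  - apply (exC11_lin (box c) (fun _ => True) st_theta sin cos); auto.
    + intros; apply norm_state_comp.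
    + apply C11_sin.
  - apply (exC11_lin (box c) (fun x => c <= x <= 3 / 2) st_X (fun x => x) (fun _ => 1)); auto.
    + intros; apply norm_state_comp.
    + apply C11_id.
    + intros p Hp; apply Hp.
  - apply (exC11_lin (box c) (fun x => -2 <= x <= 2) st_Y (fun x => x) (fun _ => 1)); auto.
    + intros; apply norm_state_comp.
    + apply C11_id.
    + intros p [_ Hp]. apply Rabs_le_between in Hp; lra.
Qed.

(** The bounds are left general because the slots change their meaning: the Y-slot of the state also
    carries u, and the last slot carries u or [rho]. *)
Lemma exC11_product_coords (B : prod_NormedModule R_AbsRing state R_NormedModule -> Prop) (c a b a' b' : R) :
  (forall w, B w -> c <= st_X (fst w) <= 3 / 2 /\ a <= st_Y (fst w) <= b /\ a' <= snd w <= b') ->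
  exC11 B (fun w => cos (st_theta (fst w))) /\ exC11 B (fun w => sin (st_theta (fst w))) /\
  exC11 B (fun w => st_X (fst w)) /\ exC11 B (fun w => st_Y (fst w)) /\ exC11 B (fun w => snd w).
Proof.
  intros HB. set (W := prod_NormedModule R_AbsRing state R_NormedModule).
  assert (Hl1 : forall w : W, norm (fst w) <= norm w) by (intros [p u]; apply (norm_pair_ge (V := state) p u)).
  split; [|split; [|split; [|split]]].
  - apply (exC11_lin B (fun _ => True) (fun w : W => st_theta (fst w)) cos (fun x => - sin x)); auto.
    + intros w. eapply Rle_trans; [apply norm_state_comp|apply Hl1].
    + apply C11_cos.
  - apply (exC11_lin B (fun _ => True) (fun w : W => st_theta (fst w)) sin cos); auto.
    + intros w. eapply Rle_trans; [apply norm_state_comp|apply Hl1].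
    + apply C11_sin.
  - apply (exC11_lin B (fun x => c <= x <= 3 / 2) (fun w : W => st_X (fst w)) (fun x => x) (fun _ => 1)); auto.
    + intros w. eapply Rle_trans; [apply norm_state_comp|apply Hl1].
    + apply C11_id.
    + intros w Hw; apply HB, Hw.
  - apply (exC11_lin B (fun x => a <= x <= b) (fun w : W => st_Y (fst w)) (fun x => x) (fun _ => 1)); auto.
    + intros w. eapply Rle_trans; [apply norm_state_comp|apply Hl1].
    + apply C11_id.
    + intros w Hw; apply HB, Hw.
  - apply (exC11_lin B (fun x => a' <= x <= b') (fun w : W => snd w) (fun x => x) (fun _ => 1)); auto.
    + intros [p u]. apply (norm_pair_ge (V := state) p u).
    + apply C11_id.
    + intros w Hw; apply HB, Hw.
Qed.

Lemma exC11_Ufun rho eps c : 0 <= rho <= 1 / 2 -> 0 < eps <= / 10 ^ 9 -> 0 < c ->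
  exC11 (box c) (Ufun rho eps).
Proof.
  intros Hr He Hc.
  set (W := prod_NormedModule R_AbsRing state R_NormedModule).
  set (B := fun w : W => box c (fst w) /\ / 2 <= snd w <= 3 / 2).
  destruct (exC11_product_coords B c (-2) 2 (/ 2) (3 / 2)) as [C1 [_ [C2 [C3 C4]]]].
  { intros w [[Hx Hy] Hu]. apply Rabs_le_between in Hy. lra. }
  destruct (exC11_Rinv B eps (fun _ => rho) (fun w => snd w) (fun w => st_theta (fst w)) (fun w => st_X (fst w)) He) as [C5 C6];
    try assumption.
  { intros w [[Hx _] Hu]. lra. }
  { apply exC11_const. }
  assert (C7 : exC11 B (fun w => energy rho eps (snd w) (st_theta (fst w)) (st_X (fst w)) (st_Y (fst w)))).
  { unfold energy. exC11_auto. }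
  destruct C7 as [D HD].
  apply (C11_implicit (V := state) (box c) (/ 2) (3 / 2) (/ 2)
    (fun w : W => energy rho eps (snd w) (st_theta (fst w)) (st_X (fst w)) (st_Y (fst w))) D (Ufun rho eps)); try lra.
  - exact HD.
  - intros p u u' [Hx Hy] Hu Hu'. simpl.
    assert (X := energy_near rho eps (st_theta p) (st_X p) (st_Y p) u u' Hr He ltac:(lra) Hy ltac:(lra) ltac:(lra)).
    rewrite (Rabs_pos_eq (u' - u)) in X by lra. apply Rabs_le_between in X. lra.
  - intros p [Hx Hy]. simpl. apply Ufun_spec; try assumption; lra.
Qed.

Definition vfield (rho eps : R) (p : state) : state := vector_field rho eps (Ufun rho eps p) p.

Lemma exC11_vfield rho eps c : 0 <= rho <= 1 / 2 -> 0 < eps <= / 10 ^ 9 -> 0 < c ->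
  exC11 (box c) (fun p => st_theta (vfield rho eps p)) /\
  exC11 (box c) (fun p => st_X (vfield rho eps p)) /\
  exC11 (box c) (fun p => st_Y (vfield rho eps p)).
Proof.
  intros Hr He Hc.
  destruct (exC11_coords c) as [Cc [Cs [Cx Cy]]].
  assert (CU := exC11_Ufun rho eps c Hr He Hc).
  assert (HU : forall p, box c p -> / 2 <= Ufun rho eps p <= 3 / 2).
  { intros p [Hx Hy]. apply Ufun_spec; try assumption; lra. }
  destruct (exC11_Rinv (box c) eps (fun _ => rho) (Ufun rho eps) st_theta st_X He) as [C13 C23]; try assumption.
  { intros p Hp. specialize (HU p Hp). destruct Hp as [Hx _]. lra. }
  { apply exC11_const. }
  assert (H13 : exC11 (box c) (fun p => / R13 rho eps (Ufun rho eps p) (st_theta p) (st_X p) ^ 3)).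
  { apply (exC11_ext _ (fun p => (/ R13 rho eps (Ufun rho eps p) (st_theta p) (st_X p)) ^ 3)).
    - intros; apply pow_inv.
    - exC11_auto. }
  assert (H23 : exC11 (box c) (fun p => / R23 rho eps (Ufun rho eps p) (st_theta p) (st_X p) ^ 3)).
  { apply (exC11_ext _ (fun p => (/ R23 rho eps (Ufun rho eps p) (st_theta p) (st_X p)) ^ 3)).
    - intros; apply pow_inv.
    - exC11_auto. }
  unfold vfield, vector_field. split; [|split]; cbn [st_theta st_X st_Y mk_state fst snd].
  - assert (CI : exC11 (box c) (fun p => / (Ufun rho eps p ^ 3 * st_X p ^ 3))).
    { apply (exC11_inv _ _ ((/ 2) ^ 3 * c ^ 3) ((3 / 2) ^ 3 * (3 / 2) ^ 3)).
      - apply Rmult_lt_0_compat; apply pow_lt; lra.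
      - intros p Hp. specialize (HU p Hp). destruct Hp as [Hx _].
        split; apply Rmult_le_compat; try (apply pow_le; lra); apply pow_incr; lra.
      - exC11_auto. }
    apply (exC11_ext _ (fun p => sqrt 2 * (st_X p - / eps ^ 3 * / (Ufun rho eps p ^ 3 * st_X p ^ 3)))).
    + intros p Hp. specialize (HU p Hp). destruct Hp as [Hx _]. unfold st_X in *. field. repeat split; lra.
    + exC11_auto.
  - unfold Gfun. fold st_theta. exC11_auto.
  - unfold Gfun, Ffun, Rdiv. exC11_auto.
Qed.

(** * One-sided derivatives, components and chain rules *)

Lemma norm_scal_eq {V : NormedModule R_AbsRing} (k : R) (x : V) : norm (scal k x) = Rabs k * norm x.
Proof.
  apply Rle_antisym; [exact (norm_scal (K := R_AbsRing) (V := V) k x)|].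
  destruct (Req_dec k 0) as [->|Hk].
  - rewrite Rabs_R0, Rmult_0_l. apply norm_ge_0.
  - assert (E : scal (/ k) (scal k x) = x).
    { eapply eq_trans; [apply scal_assoc|]. eapply eq_trans; [|exact (scal_one (K := R_AbsRing) (V := V) x)].
      apply (f_equal (fun c : R => scal c x)). change (/ k * k = 1). field. exact Hk. }
    assert (H : norm x <= Rabs (/ k) * norm (scal k x)).
    { rewrite <- E at 1. exact (norm_scal (K := R_AbsRing) (V := V) (/ k) (scal k x)). }
    rewrite Rabs_inv in H. assert (Hp : 0 < Rabs k) by (apply Rabs_pos_lt, Hk).
    apply Rmult_le_compat_l with (r := Rabs k) in H; [|lra].
    rewrite <- Rmult_assoc, Rinv_r, Rmult_1_l in H by lra. exact H.
Qed.

Lemma is_derive_within_dist {V : NormedModule R_AbsRing} (J : R -> Prop) (f : R -> V) (t : R) (l : V) :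
  is_derive_within J f t l <->
  (forall e, 0 < e -> exists d, 0 < d /\ forall s, J s -> Rabs (s - t) < d ->
     norm (minus (minus (f s) (f t)) (scal (s - t) l)) <= e * Rabs (s - t)).
Proof.
  assert (Hscal : forall s, s <> t -> norm (minus (minus (f s) (f t)) (scal (s - t) l)) =
     Rabs (s - t) * norm (minus (scal (/ (s - t)) (minus (f s) (f t))) l)).
  { intros s Hs.
    assert (Hst : s - t <> 0) by lra.
    set (w := minus (scal (/ (s - t)) (minus (f s) (f t))) l).
    assert (E : minus (minus (f s) (f t)) (scal (s - t) l) = scal (s - t) w).
    { unfold w. symmetry. eapply eq_trans; [exact (scal_minus_distr_l (K := R_AbsRing) (V := V) (s - t) _ _)|].
      apply (f_equal (fun u => minus u (scal (s - t) l))).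
      eapply eq_trans; [apply scal_assoc|].
      eapply eq_trans; [|exact (scal_one (K := R_AbsRing) (V := V) _)].
      apply (f_equal (fun k : R => scal k (minus (f s) (f t)))). change ((s - t) * / (s - t) = 1). field. exact Hst. }
    rewrite E. exact (norm_scal_eq (V := V) (s - t) w). }
  split.
  - intros H e He.
    destruct (H _ (locally_ball_norm l (mkposreal e He))) as [d Hd].
    exists d. split; [apply cond_pos|]. intros s Js Hs.
    destruct (Req_dec s t) as [->|Hne].
    + assert (E : norm (minus (minus (f t) (f t)) (scal (t - t) l)) = 0).
      { replace (t - t) with 0 by ring.
        assert (Ez : minus (minus (f t) (f t)) (scal 0 l) = (zero : V)).
        { eapply eq_trans; [exact (f_equal (fun u => minus u (scal 0 l)) (minus_eq_zero (G := V) (f t)))|].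
          eapply eq_trans; [exact (f_equal (fun u => minus (zero : V) u) (scal_zero_l (K := R_AbsRing) (V := V) l))|].
          exact (minus_eq_zero (G := V) zero). }
        rewrite Ez. exact (norm_zero (V := V)). }
      rewrite E, Rminus_diag, Rabs_R0, Rmult_0_r. lra.
    + rewrite (Hscal s Hne), Rmult_comm. apply Rmult_le_compat_r; [apply Rabs_pos|].
      left. apply (Hd s Hs). split; assumption.
  - intros H P [e He].
    assert (He2 : 0 < e / 2) by (pose proof (cond_pos e); lra).
    destruct (H (e / 2) He2) as [d [Hd H']].
    exists (mkposreal d Hd). intros s Hs [Js Hne]. apply He. apply norm_compat1.
    specialize (H' s Js Hs). rewrite (Hscal s Hne), Rmult_comm in H'.
    assert (Hp : 0 < Rabs (s - t)) by (apply Rabs_pos_lt; lra).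
    apply Rmult_le_reg_r in H'; [|exact Hp]. eapply Rle_lt_trans; [exact H'|]. pose proof (cond_pos e). lra.
Qed.

Lemma is_derive_within_of_derive {V : NormedModule R_AbsRing} (J : R -> Prop) (f : R -> V) t l :
  is_derive f t l -> is_derive_within J f t l.
Proof.
  intros H. apply is_derive_within_dist. intros e He.
  destruct (proj1 (is_derive_dist f t l) H e He) as [d [Hd H']].
  exists d. split; [exact Hd|]. intros s _ Hs. apply H', Hs.
Qed.

Lemma is_derive_within_ext {V : NormedModule R_AbsRing} (J : R -> Prop) (f g : R -> V) t l :
  J t -> (forall s, J s -> f s = g s) -> is_derive_within J f t l -> is_derive_within J g t l.
Proof.
  intros Jt E H. apply is_derive_within_dist. intros e He.
  destruct (proj1 (is_derive_within_dist J f t l) H e He) as [d [Hd H']].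
  exists d. split; [exact Hd|]. intros s Js Hs. rewrite <- (E s Js), <- (E t Jt). apply H'; assumption.
Qed.

Lemma is_derive_glue {V : NormedModule R_AbsRing} (f : R -> V) t l :
  is_derive_within (fun s => t <= s) f t l -> is_derive_within (fun s => s <= t) f t l -> is_derive f t l.
Proof.
  intros H1 H2. apply is_derive_dist. intros e He.
  destruct (proj1 (is_derive_within_dist _ f t l) H1 e He) as [d1 [Hd1 H1']].
  destruct (proj1 (is_derive_within_dist _ f t l) H2 e He) as [d2 [Hd2 H2']].
  exists (Rmin d1 d2). split; [apply Rmin_pos; assumption|]. intros s Hs.
  destruct (Rle_dec t s).
  - apply H1'; [assumption|]. eapply Rlt_le_trans; [exact Hs|apply Rmin_l].
  - apply H2'; [lra|]. eapply Rlt_le_trans; [exact Hs|apply Rmin_r].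
Qed.

Lemma is_derive_within_interior {V : NormedModule R_AbsRing} (J : R -> Prop) (f : R -> V) t l d :
  0 < d -> (forall s, Rabs (s - t) < d -> J s) -> is_derive_within J f t l -> is_derive f t l.
Proof.
  intros Hd HJ H. apply is_derive_dist. intros e He.
  destruct (proj1 (is_derive_within_dist _ f t l) H e He) as [d1 [Hd1 H1']].
  exists (Rmin d1 d). split; [apply Rmin_pos; assumption|]. intros s Hs.
  apply H1'; [apply HJ|]; (eapply Rlt_le_trans; [exact Hs|]); [apply Rmin_r|apply Rmin_l].
Qed.

Lemma is_derive_lin {V : NormedModule R_AbsRing} (l : V -> R) (g : R -> V) t v :
  (forall u w, l (plus u w) = l u + l w) -> (forall k w, l (scal k w) = k * l w) ->
  (forall w, Rabs (l w) <= norm w) -> is_derive g t v -> is_derive (fun t => l (g t)) t (l v).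
Proof.
  intros Ha Hs Hn H. apply (proj2 (is_derive_dist (V := R_NormedModule) (fun t => l (g t)) t (l v))). intros e He.
  destruct (proj1 (is_derive_dist g t v) H e He) as [d [Hd H']].
  exists d. split; [exact Hd|]. intros s Hs'.
  change (Rabs (l (g s) - l (g t) - (s - t) * l v) <= e * Rabs (s - t)).
  eapply Rle_trans; [|apply (H' s Hs')].
  assert (Hm : forall p q, l (minus p q) = l p - l q).
  { intros p q. unfold minus. rewrite Ha.
    replace (opp q) with (scal (opp one) q) by exact (scal_opp_one q).
    rewrite Hs. change (l p + - 1 * l q = l p - l q). ring. }
  eapply Rle_trans; [|apply Hn]. right. f_equal. rewrite !Hm, Hs. reflexivity.
Qed.

Lemma is_derive_state_comp (g : R -> state) t v : is_derive g t v ->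
  is_derive (fun t => st_theta (g t)) t (st_theta v) /\
  is_derive (fun t => st_X (g t)) t (st_X v) /\ is_derive (fun t => st_Y (g t)) t (st_Y v).
Proof.
  intros H. split; [|split]; (apply is_derive_lin; [reflexivity|reflexivity|apply norm_state_comp|exact H]).
Qed.

Lemma is_derive_state_of_comp (g : R -> state) t v :
  is_derive (fun t => st_theta (g t)) t (st_theta v) ->
  is_derive (fun t => st_X (g t)) t (st_X v) -> is_derive (fun t => st_Y (g t)) t (st_Y v) ->
  is_derive g t v.
Proof.
  intros H1 H2 H3. apply is_derive_dist. intros e He.
  assert (He3 : 0 < e / 3) by lra.
  destruct (proj1 (is_derive_dist (V := R_NormedModule) _ _ _) H1 _ He3) as [d1 [Hd1 A1]].
  destruct (proj1 (is_derive_dist (V := R_NormedModule) _ _ _) H2 _ He3) as [d2 [Hd2 A2]].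
  destruct (proj1 (is_derive_dist (V := R_NormedModule) _ _ _) H3 _ He3) as [d3 [Hd3 A3]].
  exists (Rmin d1 (Rmin d2 d3)). split; [repeat apply Rmin_pos; assumption|]. intros s Hs.
  specialize (A1 s ltac:(eapply Rlt_le_trans; [exact Hs|apply Rmin_l])).
  specialize (A2 s ltac:(eapply Rlt_le_trans; [exact Hs|eapply Rle_trans; [apply Rmin_r|apply Rmin_l]])).
  specialize (A3 s ltac:(eapply Rlt_le_trans; [exact Hs|eapply Rle_trans; [apply Rmin_r|apply Rmin_r]])).
  eapply Rle_trans; [apply norm_state_le|].
  change (Rabs (st_theta (g s) - st_theta (g t) - (s - t) * st_theta v) <= e / 3 * Rabs (s - t)) in A1.
  change (Rabs (st_X (g s) - st_X (g t) - (s - t) * st_X v) <= e / 3 * Rabs (s - t)) in A2.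
  change (Rabs (st_Y (g s) - st_Y (g t) - (s - t) * st_Y v) <= e / 3 * Rabs (s - t)) in A3.
  change (Rabs (st_theta (g s) - st_theta (g t) - (s - t) * st_theta v)
    + Rabs (st_X (g s) - st_X (g t) - (s - t) * st_X v)
    + Rabs (st_Y (g s) - st_Y (g t) - (s - t) * st_Y v) <= e * Rabs (s - t)).
  lra.
Qed.

Lemma C11_chain {V : NormedModule R_AbsRing} (B : V -> Prop) F D (g : R -> V) t v :
  C11 B F D -> (exists d, 0 < d /\ forall s, Rabs (s - t) < d -> B (g s)) ->
  is_derive g t v -> is_derive (fun s => F (g s)) t (D (g t) v).
Proof.
  intros [C [HC H]] [d0 [Hd0 HB]] Hg.
  assert (Bt : B (g t)) by (apply HB; rewrite Rminus_diag, Rabs_R0; exact Hd0).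
  destruct (H _ Bt) as [Da [Ds [_ [Dn HT]]]].
  apply (proj2 (is_derive_dist (V := R_NormedModule) (fun s => F (g s)) t (D (g t) v))). intros e He.
  set (e1 := Rmin 1 (e / (2 * (C + 1)))).
  assert (He1 : 0 < e1) by (apply Rmin_pos; [lra|apply Rdiv_lt_0_compat; lra]).
  assert (He1a : e1 <= 1) by apply Rmin_l. assert (He1b : e1 <= e / (2 * (C + 1))) by apply Rmin_r.
  destruct (proj1 (is_derive_dist g t v) Hg e1 He1) as [d1 [Hd1 H1]].
  set (N := norm v + 1). assert (HN : 1 <= N) by (unfold N; pose proof (norm_ge_0 v); lra).
  set (d2 := e / (2 * (C + 1) * N ^ 2)).
  assert (Hd2 : 0 < d2) by (apply Rdiv_lt_0_compat; [lra|nra]).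
  exists (Rmin d0 (Rmin d1 d2)). split; [repeat apply Rmin_pos; assumption|]. intros s Hs.
  assert (S0 : Rabs (s - t) < d0) by (eapply Rlt_le_trans; [exact Hs|apply Rmin_l]).
  assert (S1 : Rabs (s - t) < d1) by (eapply Rlt_le_trans; [exact Hs|eapply Rle_trans; [apply Rmin_r|apply Rmin_l]]).
  assert (S2 : Rabs (s - t) < d2) by (eapply Rlt_le_trans; [exact Hs|eapply Rle_trans; [apply Rmin_r|apply Rmin_r]]).
  specialize (H1 s S1). destruct (HT _ (HB s S0)) as [_ T].
  assert (Hdist : dist (g s) (g t) <= N * Rabs (s - t)).
  { unfold dist. eapply Rle_trans; [apply (norm_le_increment _ v (s - t) e1 H1)|].
    apply Rmult_le_compat_r; [apply Rabs_pos|unfold N; lra]. }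
  change (Rabs (F (g s) - F (g t) - (s - t) * D (g t) v) <= e * Rabs (s - t)).
  assert (Hm : forall p q, D (g t) (minus p q) = D (g t) p - D (g t) q).
  { intros p q. unfold minus. rewrite Da.
    replace (opp q) with (scal (opp one) q) by exact (scal_opp_one q).
    rewrite Ds. change (D (g t) p + - 1 * D (g t) q = D (g t) p - D (g t) q). ring. }
  replace (F (g s) - F (g t) - (s - t) * D (g t) v) with
    ((F (g s) - F (g t) - D (g t) (minus (g s) (g t)))
     + D (g t) (minus (minus (g s) (g t)) (scal (s - t) v))) by (rewrite (Hm (minus (g s) (g t))), Ds; ring).
  eapply Rle_trans; [apply Rabs_triang|].
  pose proof (Rabs_pos (s - t)) as Hp.
  apply Rle_trans with (C * (N * Rabs (s - t)) ^ 2 + C * (e1 * Rabs (s - t))).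
  - apply Rplus_le_compat.
    + eapply Rle_trans; [exact T|]. apply Rmult_le_compat_l; [exact HC|]. apply pow_incr. split; [apply dist_pos|exact Hdist].
    + eapply Rle_trans; [apply Dn|]. apply Rmult_le_compat_l; [exact HC|exact H1].
  - assert (X1 : C * e1 <= e / 2).
    { apply Rle_trans with ((C + 1) * (e / (2 * (C + 1)))); [apply Rmult_le_compat; lra|right; field; lra]. }
    assert (X2 : C * N ^ 2 * Rabs (s - t) <= e / 2).
    { apply Rle_trans with ((C + 1) * N ^ 2 * d2).
      - apply Rmult_le_compat; [apply Rmult_le_pos; [exact HC|apply pow2_ge_0]|lra|apply Rmult_le_compat_r; [apply pow2_ge_0|lra]|lra].
      - right. unfold d2. field. lra. }
    nra.
Qed.

(* Continuing a solution by its tangent line makes its derivative at [0] two-sided. *)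
Definition extend (gam : R -> state) (v : state) (t : R) : state :=
  if Rle_dec 0 t then gam t else plus (gam 0) (scal t v).

Lemma extend_pos gam v t : 0 <= t -> extend gam v t = gam t.
Proof. intros H. unfold extend. destruct (Rle_dec 0 t); [reflexivity|contradiction]. Qed.

Lemma extend_derive gam v t l : 0 <= t -> (t = 0 -> l = v) ->
  is_derive_within (fun s => 0 <= s) gam t l -> is_derive (extend gam v) t l.
Proof.
  intros Ht Hl H.
  assert (H' : is_derive_within (fun s => 0 <= s) (extend gam v) t l).
  { apply (is_derive_within_ext _ gam); [exact Ht| |exact H]. intros s Hs. symmetry. apply extend_pos, Hs. }
  destruct (Req_dec t 0) as [->|Hne].
  - apply is_derive_glue; [exact H'|]. rewrite (Hl eq_refl).
    apply (is_derive_within_ext _ (fun t => plus (gam 0) (scal t v))).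
    + lra.
    + intros s Hs. unfold extend. destruct (Rle_dec 0 s) as [H0|H0]; [|reflexivity].
      replace s with 0 by lra. eapply eq_trans; [|apply plus_zero_r]. apply f_equal. apply (scal_zero_l v).
    + apply is_derive_within_of_derive. evar_last.
      * apply (is_derive_plus (V := state)); [apply is_derive_const|].
        apply (is_derive_scal_l (V := state) (fun t => t) 0 1 v). apply (is_derive_id (K := R_AbsRing) 0).
      * eapply eq_trans; [apply plus_zero_l|]. exact (scal_one (K := R_AbsRing) (V := state) v).
  - apply (is_derive_within_interior _ _ _ _ t ltac:(lra)) in H'; [exact H'|].
    intros s Hs. apply Rabs_def2 in Hs. lra.
Qed.

(** * Stable solutions near the loop *)

Lemma sqrt2_bounds : sqrt 2 * sqrt 2 = 2 /\ 14142 / 10000 <= sqrt 2 <= 14143 / 10000.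
Proof.
  assert (H : sqrt 2 * sqrt 2 = 2) by (apply sqrt_sqrt; lra).
  assert (H0 : 0 <= sqrt 2) by apply sqrt_pos. split; [exact H|]. split; nra.
Qed.

(** The loop lies on the level Y^2 = X^2 - X^4 / 2 of the unperturbed planar system. *)
Lemma loop_point t : 0 < a_sol t <= sqrt 2 /\ b_sol t ^ 2 = a_sol t ^ 2 - a_sol t ^ 4 / 2 /\
  (0 <= t -> b_sol t <= 0).
Proof.
  assert (He : 0 < exp t) by apply exp_pos. assert (He' : 0 < exp (- t)) by apply exp_pos.
  assert (Hee : exp t * exp (- t) = 1) by (rewrite <- exp_plus; replace (t + - t) with 0 by ring; apply exp_0).
  destruct sqrt2_bounds as [H2 H2']. unfold a_sol, b_sol.
  set (E := exp t) in *. set (e := exp (- t)) in *.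
  assert (HEe : 2 <= E + e).
  { assert (0 <= (E - e) ^ 2) by apply pow2_ge_0. nra. }
  split; [|split].
  - split; [apply Rdiv_lt_0_compat; lra|].
    apply Rmult_le_reg_r with (E + e); [lra|]. unfold Rdiv. rewrite Rmult_assoc, Rinv_l by lra. nra.
  - replace ((2 * sqrt 2 * (e - E) / (E + e) ^ 2) ^ 2) with (4 * (sqrt 2 * sqrt 2) * (e - E) ^ 2 / (E + e) ^ 4) by (field; lra).
    replace ((2 * sqrt 2 / (E + e)) ^ 2) with (4 * (sqrt 2 * sqrt 2) / (E + e) ^ 2) by (field; lra).
    replace ((2 * sqrt 2 / (E + e)) ^ 4) with (16 * ((sqrt 2 * sqrt 2) * (sqrt 2 * sqrt 2)) / (E + e) ^ 4) by (field; lra).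
    rewrite H2. replace ((e - E) ^ 2) with ((E + e) ^ 2 - 4 * (E * e)) by ring. rewrite Hee. field. lra.
  - intros Ht. assert (e <= E).
    { unfold e, E. destruct (Req_dec t 0) as [->|]; [rewrite Ropp_0; lra|left; apply exp_increasing; lra]. }
    assert (0 < / (E + e) ^ 2) by (apply Rinv_0_lt_compat, pow_lt; lra).
    unfold Rdiv. assert (2 * sqrt 2 * (e - E) <= 0) by nra. nra.
Qed.

Definition near_loop (D : R * R -> Prop) : Prop :=
  forall q, D q -> exists p, loop_plus p /\ ball p (/ 100) q.

Lemma near_loop_bounds D x y : near_loop D -> D (x, y) ->
  x < 3 / 2 /\ Rabs y < 1 /\ (/ 4 <= x <= 1 -> y <= - / 8).
Proof.
  intros HD Hxy. destruct (HD _ Hxy) as [[a b] [Hp [H1 H2]]].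
  change (Rabs (x - a) < / 100) in H1. change (Rabs (y - b) < / 100) in H2.
  apply Rabs_def2 in H1, H2.
  destruct sqrt2_bounds as [_ Hs].
  destruct Hp as [[t [Ht E]]|E].
  - injection E as -> ->. destruct (loop_point t) as [Ha [Hb Hn]]. specialize (Hn Ht).
    set (a := a_sol t) in *. set (b := b_sol t) in *.
    assert (Hb1 : b ^ 2 <= / 2) by (rewrite Hb; assert (0 <= (a ^ 2 - 1) ^ 2) by apply pow2_ge_0; nra).
    assert (Hb2 : - (3 / 4) <= b) by nra.
    split; [lra|]. split; [apply Rabs_def1; lra|].
    (* The loop point has a between 24/100 and 101/100, where a^2 - a^4 / 2 >= 1/36. So b <= - 1/6,
       which leaves room for the tolerance 1/100. *)
    intros Hx. assert (Hb3 : / 36 <= b ^ 2).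
    { rewrite Hb. replace (a ^ 4) with (a ^ 2 * a ^ 2) by ring.
      assert (576 / 10000 <= a ^ 2 <= 10202 / 10000) by (split; nra). nra. }
    assert (b <= - / 6) by nra. lra.
  - injection E as -> ->. split; [lra|]. split; [apply Rabs_def1; lra|]. intros; lra.
Qed.

Lemma small_neighborhood_near D delta : 0 < delta <= / 100 -> small_neighborhood delta loop_plus D -> near_loop D.
Proof.
  intros Hd [_ H] q Hq. destruct (H q Hq) as [p [Hp Hb]]. exists p. split; [exact Hp|].
  apply ball_le with delta; [lra|exact Hb].
Qed.

(* The clause on [1/4 <= X <= 1] comes from [Y = - sqrt (X^2 - X^4 / 2)] on the loop. *)
Definition stable_orbit (rho eps th0 : R) (g : R -> state) : Prop :=
  (forall t, 0 <= t -> is_derive g t (vfield rho eps (g t))) /\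
  (forall t, 0 <= t -> 0 < st_X (g t) < 3 / 2 /\ Rabs (st_Y (g t)) < 1 /\
     (/ 4 <= st_X (g t) <= 1 -> st_Y (g t) <= - / 8)) /\
  st_theta (g 0) = th0 /\ st_Y (g 0) = 0 /\
  is_lim (fun t => st_X (g t)) p_infty 0 /\ is_lim (fun t => st_Y (g t)) p_infty 0.

Lemma is_lim_ext_pos (f h : R -> R) (l : Rbar) : (forall t, 0 <= t -> f t = h t) ->
  is_lim f p_infty l -> is_lim h p_infty l.
Proof.
  intros E. apply is_lim_ext_loc. exists 0. intros t Ht. apply E. lra.
Qed.

(** Passes from one-sided derivatives and an unspecified root u to a curve with ordinary derivatives
    and the explicit field [vfield]. The root is identified by uniqueness, which requires 0 < X
    first. *)
Lemma primary_stable_orbit D r rho eps th0 gam :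
  0 <= rho <= 1 / 2 -> 0 < eps <= / 10 ^ 9 -> near_loop D -> r < / 100 ->
  primary_stable D r rho eps th0 gam ->
  exists g, (forall t, 0 <= t -> g t = gam t) /\ stable_orbit rho eps th0 g.
Proof.
  intros Hr He HD Hrr [Hsol [[X0 [HX0 H0]] [HDp [LX LY]]]].
  destruct (Hsol 0 (Rle_refl 0)) as [_ [u0 [Hu0 Hd0]]].
  set (g := extend gam (vector_field rho eps u0 (gam 0))).
  assert (Eg : forall t, 0 <= t -> g t = gam t) by (intros; apply extend_pos; assumption).
  assert (Hg : forall t, 0 <= t -> st_X (g t) <> 0 /\ exists l, is_derive g t l).
  { intros t Ht. rewrite (Eg t Ht). split; [apply (Hsol t Ht)|].
    destruct (Req_dec t 0) as [->|Hne].
    - eexists. apply extend_derive; [lra| |exact Hd0]. reflexivity.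
    - destruct (Hsol t Ht) as [_ [u [_ Hd]]]. eexists. apply extend_derive; [exact Ht| |exact Hd]. intros; contradiction. }
  assert (Hcont : forall t, 0 <= t -> continuity_pt (fun t => st_X (g t)) t).
  { intros t Ht. destruct (Hg t Ht) as [_ [l Hl]].
    apply (continuity_pt_is_derive _ _ (st_X l)), is_derive_state_comp, Hl. }
  destruct sqrt2_bounds as [_ Hs2].
  assert (HX00 : 0 < st_X (g 0)).
  { rewrite Eg, H0 by lra. simpl. apply Rabs_le_between in HX0. unfold st_X; simpl. lra. }
  (* X is continuous and starts near sqrt 2; a change of sign would give a zero, which [solves]
     excludes. *)
  assert (Hpos : forall t, 0 <= t -> 0 < st_X (g t)).
  { intros t Ht. apply Rnot_le_lt. intros Hle.
    destruct (Req_dec t 0) as [->|Hne]; [lra|].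
    destruct (Req_dec (st_X (g t)) 0) as [Hz|Hz]; [apply (Hg t Ht), Hz|].
    destruct (Ranalysis5.IVT_interv (fun t => - st_X (g t)) 0 t) as [s [Hs1 Hs2']].
    - intros a Ha. apply continuity_pt_opp, Hcont. lra.
    - lra.
    - lra.
    - assert (st_X (g t) < 0) by lra. lra.
    - apply (Hg s ltac:(lra)). lra. }
  assert (Hrange : forall t, 0 <= t -> 0 < st_X (g t) < 3 / 2 /\ Rabs (st_Y (g t)) < 1 /\
     (/ 4 <= st_X (g t) <= 1 -> st_Y (g t) <= - / 8)).
  { intros t Ht. specialize (HDp t Ht). rewrite <- (Eg t Ht) in HDp.
    destruct (near_loop_bounds D _ _ HD HDp) as [B1 [B2 B3]]. specialize (Hpos t Ht).
    split; [split; assumption|split; assumption]. }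
  assert (HU : forall t, 0 <= t -> forall u, is_U rho eps (gam t) u -> u = Ufun rho eps (gam t)).
  { intros t Ht u Hu. specialize (Hrange t Ht). rewrite (Eg t Ht) in Hrange.
    apply (Ufun_spec rho eps (gam t) Hr He); try lra; exact Hu. }
  exists g. split; [exact Eg|]. split; [|split; [exact Hrange|]].
  - intros t Ht. destruct (Hsol t Ht) as [_ [u [Hu Hd]]].
    rewrite (Eg t Ht). unfold vfield. rewrite <- (HU t Ht u Hu).
    apply extend_derive; [exact Ht| |exact Hd].
    intros ->. rewrite (HU 0 (Rle_refl 0) u Hu), (HU 0 (Rle_refl 0) u0 Hu0). reflexivity.
  - rewrite Eg, H0 by lra. split; [reflexivity|]. split; [reflexivity|].
    split.
    + apply (is_lim_ext_pos (fun t => st_X (gam t))); [|exact LX]. intros t Ht. rewrite (Eg t Ht). reflexivity.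
    + apply (is_lim_ext_pos (fun t => st_Y (gam t))); [|exact LY]. intros t Ht. rewrite (Eg t Ht). reflexivity.
Qed.

Lemma stable_orbit_box rho eps th0 g t : stable_orbit rho eps th0 g -> 0 <= t ->
  0 < st_X (g t) <= 3 / 2 /\ Rabs (st_Y (g t)) <= 2.
Proof. intros [_ [H _]] Ht. specialize (H t Ht). lra. Qed.

Lemma orbit_comp rho eps (g : R -> state) t :
  is_derive g t (vfield rho eps (g t)) ->
  let u := Ufun rho eps (g t) in let th := st_theta (g t) in let x := st_X (g t) in let y := st_Y (g t) in
  is_derive (fun t => st_theta (g t)) t (sqrt 2 * (x - 1 / (eps ^ 3 * u ^ 3 * x ^ 3))) /\
  is_derive (fun t => st_X (g t)) t (y + sqrt 2 * eps ^ 2 * u ^ 2 * x ^ 2 * Gfun rho eps u th x) /\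
  is_derive (fun t => st_Y (g t)) t
    (x - x ^ 3 - x * Ffun rho eps u th x + sqrt 2 * eps ^ 2 * u ^ 2 * x * y * Gfun rho eps u th x).
Proof. intros H. exact (is_derive_state_comp g t _ H). Qed.

Lemma continuity_pt_positive (f : R -> R) t c d : continuity_pt f t -> c < f t < d ->
  exists e, 0 < e /\ forall s, Rabs (s - t) < e -> c < f s < d.
Proof.
  intros Hf Hc.
  destruct (Hf (Rmin (f t - c) (d - f t))) as [e [He H]]; [apply Rmin_pos; lra|].
  exists e. split; [exact He|]. intros s Hs.
  destruct (Req_dec s t) as [->|Hne]; [exact Hc|].
  specialize (H s (conj (conj I (fun E => Hne (eq_sym E))) Hs)). simpl in H. unfold R_dist in H.
  pose proof (Rmin_l (f t - c) (d - f t)). pose proof (Rmin_r (f t - c) (d - f t)).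
  apply Rabs_def2 in H. lra.
Qed.

Lemma orbit_box_near (g : R -> state) t l : is_derive g t l ->
  0 < st_X (g t) < 3 / 2 -> Rabs (st_Y (g t)) < 2 ->
  exists d, 0 < d /\ forall s, Rabs (s - t) < d -> box (st_X (g t) / 2) (g s).
Proof.
  intros Hd HX HY. destruct (is_derive_state_comp g t l Hd) as [_ [D2 D3]].
  apply continuity_pt_is_derive in D2, D3. apply Rabs_def2 in HY.
  destruct (continuity_pt_positive _ t (st_X (g t) / 2) (3 / 2) D2 ltac:(lra)) as [d1 [Hd1 H1]].
  destruct (continuity_pt_positive _ t (-2) 2 D3 ltac:(lra)) as [d2 [Hd2 H2]].
  exists (Rmin d1 d2). split; [apply Rmin_pos; assumption|]. intros s Hs.
  specialize (H1 s ltac:(eapply Rlt_le_trans; [exact Hs|apply Rmin_l])).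
  specialize (H2 s ltac:(eapply Rlt_le_trans; [exact Hs|apply Rmin_r])).
  split; [lra|]. apply Rabs_le; lra.
Qed.

(** Turns the increment estimate of [energy_near] into a lower bound for the partial derivative of
    [energy] in u. *)
Lemma near_identity_derive (f : R -> R) u l d : 0 < d ->
  (forall v, Rabs (v - u) < d -> Rabs (f v - f u - (v - u)) <= / 100 * Rabs (v - u)) ->
  is_derive f u l -> / 2 <= l.
Proof.
  intros Hd H Hl. apply Rnot_lt_le. intros Hlt.
  destruct (proj1 (is_derive_dist (V := R_NormedModule) f u l) Hl (/ 10) ltac:(lra)) as [d1 [Hd1 H1]].
  set (h := Rmin d d1 / 2).
  assert (Hm : 0 < Rmin d d1) by (apply Rmin_pos; assumption).
  pose proof (Rmin_l d d1). pose proof (Rmin_r d d1).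
  assert (Hh : Rabs (u + h - u) = h) by (replace (u + h - u) with h by ring; apply Rabs_pos_eq; unfold h; lra).
  specialize (H (u + h) ltac:(rewrite Hh; unfold h; lra)).
  specialize (H1 (u + h) ltac:(rewrite Hh; unfold h; lra)).
  change (Rabs (f (u + h) - f u - (u + h - u) * l) <= / 10 * Rabs (u + h - u)) in H1.
  rewrite Hh in H, H1. replace (u + h - u) with h in * by ring.
  apply Rabs_le_between in H, H1. assert (0 < h) by (unfold h; lra). nra.
Qed.

(* Conservation of the Jacobi constant, in differential form. *)
Lemma U_derive rho eps (g : R -> state) t :
  0 <= rho <= 1 / 2 -> 0 < eps <= / 10 ^ 9 ->
  is_derive g t (vfield rho eps (g t)) ->
  0 < st_X (g t) < 3 / 2 -> Rabs (st_Y (g t)) < 2 ->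
  is_derive (fun t => Ufun rho eps (g t)) t
    (- sqrt 2 * eps ^ 2 * Ufun rho eps (g t) ^ 3 * st_X (g t) *
       Gfun rho eps (Ufun rho eps (g t)) (st_theta (g t)) (st_X (g t))).
Proof.
  intros Hr He Hd HX HY.
  destruct (orbit_box_near g t _ Hd HX HY) as [d [Hd0 Hbox]].
  destruct (exC11_Ufun rho eps (st_X (g t) / 2) Hr He ltac:(lra)) as [DU HDU].
  set (u' := DU (g t) (vfield rho eps (g t))).
  assert (Hu : is_derive (fun t => Ufun rho eps (g t)) t u').
  { apply (C11_chain _ _ DU g t _ HDU); [exists d; split; assumption|exact Hd]. }
  destruct (orbit_comp rho eps g t Hd) as [Dth [Dx Dy]].
  set (uf := fun t => Ufun rho eps (g t)) in *.
  set (thf := fun t => st_theta (g t)) in *. set (xf := fun t => st_X (g t)) in *. set (yf := fun t => st_Y (g t)) in *.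
  change (Ufun rho eps (g t)) with (uf t) in *.
  change (st_theta (g t)) with (thf t) in *. change (st_X (g t)) with (xf t) in *. change (st_Y (g t)) with (yf t) in *.
  set (th' := sqrt 2 * (xf t - 1 / (eps ^ 3 * uf t ^ 3 * xf t ^ 3))) in *.
  set (x' := yf t + sqrt 2 * eps ^ 2 * uf t ^ 2 * xf t ^ 2 * Gfun rho eps (uf t) (thf t) (xf t)) in *.
  set (y' := xf t - xf t ^ 3 - xf t * Ffun rho eps (uf t) (thf t) (xf t) +
      sqrt 2 * eps ^ 2 * uf t ^ 2 * xf t * yf t * Gfun rho eps (uf t) (thf t) (xf t)) in *.
  assert (HUall : forall s, Rabs (s - t) < d -> / 2 <= uf s <= 3 / 2 /\ energy rho eps (uf s) (thf s) (xf s) (yf s) = 0).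
  { intros s Hs. destruct (Hbox s Hs) as [B1 B2].
    apply (Ufun_spec rho eps (g s) Hr He); [lra|exact B2]. }
  destruct (HUall t ltac:(rewrite Rminus_diag, Rabs_R0; exact Hd0)) as [Hut Et].
  assert (Hut1 : Rabs (uf t - 1) < 1 / 2).
  { assert (B := Hbox t ltac:(rewrite Rminus_diag, Rabs_R0; exact Hd0)). destruct B as [B1 B2].
    apply (Ufun_spec rho eps (g t) Hr He); [|exact B2]. change (st_X (g t)) with (xf t). lra. }
  apply Rabs_def2 in Hut1.
  destruct (R_bounds rho eps (uf t) (thf t) (xf t) Hr He Hut ltac:(lra)) as [A13 [A23 _]].
  set (Q13 := fun v s => q13 rho (sfun eps v (xf s)) (cos (thf s))).
  set (Q23 := fun v s => q23 rho (sfun eps v (xf s)) (cos (thf s))).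
  assert (Q13p : 0 < Q13 (uf t) t).
  { rewrite R13_q in A13. apply Rnot_le_lt. intros Hle. unfold Q13 in Hle. rewrite sqrt_neg_0 in A13 by exact Hle. lra. }
  assert (Q23p : 0 < Q23 (uf t) t).
  { rewrite R23_q in A23. apply Rnot_le_lt. intros Hle. unfold Q23 in Hle. rewrite sqrt_neg_0 in A23 by exact Hle. lra. }
  assert (Eth : Derive (fun s : R => thf s) t = th') by exact (is_derive_unique _ _ _ Dth).
  assert (Ex : Derive (fun s : R => xf s) t = x') by exact (is_derive_unique _ _ _ Dx).
  assert (Ey : Derive (fun s : R => yf s) t = y') by exact (is_derive_unique _ _ _ Dy).
  assert (Eu : Derive (fun s : R => uf s) t = u') by exact (is_derive_unique _ _ _ Hu).
  assert (Xth : ex_derive (fun s : R => thf s) t) by (exists th'; exact Dth).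
  assert (Xx : ex_derive (fun s : R => xf s) t) by (exists x'; exact Dx).
  assert (Xy : ex_derive (fun s : R => yf s) t) by (exists y'; exact Dy).
  assert (Xu : ex_derive (fun s : R => uf s) t) by (exists u'; exact Hu).
  set (S := sfun eps (uf t) (xf t)).
  set (c := cos (thf t)). set (sn := sin (thf t)).
  (* derivatives along a direction in which [u] moves with speed [w] *)
  set (ds := fun w x' => 2 * eps ^ 2 * (uf t * w * xf t ^ 2 + uf t ^ 2 * xf t * x')).
  set (dq13 := fun w x' th' => (2 * rho ^ 2 * S + 2 * rho * c) * ds w x' - 2 * rho * S * sn * th').
  set (dq23 := fun w x' th' => (2 * (1 - rho) ^ 2 * S - 2 * (1 - rho) * c) * ds w x' + 2 * (1 - rho) * S * sn * th').
  set (A := / R13 rho eps (uf t) (thf t) (xf t) ^ 3). set (B := / R23 rho eps (uf t) (thf t) (xf t) ^ 3).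
  set (f13 := / R13 rho eps (uf t) (thf t) (xf t)). set (f23 := / R23 rho eps (uf t) (thf t) (xf t)).
  set (K := yf t ^ 2 + / 2 * xf t ^ 4 - xf t ^ 2 * ((1 - rho) * f13 + rho * f23)).
  (* [dE] is the total derivative of [energy], linear in the velocities w, x', y', th'. The true
     velocity u' makes it vanish, the claimed one will be shown to do so too, and the coefficient of
     w is at least 1/2; hence the two agree. *)
  set (dE := fun w x' y' th' => w * (1 + 3 * eps ^ 3 * uf t ^ 2 * K) + eps ^ 3 * uf t ^ 3 *
     (2 * yf t * y' + 2 * xf t ^ 3 * x' - 2 * xf t * x' * ((1 - rho) * f13 + rho * f23)
      + xf t ^ 2 * / 2 * ((1 - rho) * A * dq13 w x' th' + rho * B * dq23 w x' th'))).
  assert (D1 : is_derive (fun s => energy rho eps (uf s) (thf s) (xf s) (yf s)) t (dE u' x' y' th')).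
  { assert (D13 : is_derive (fun s => / sqrt (Q13 (uf s) s)) t (- dq13 u' x' th' * / (2 * sqrt (Q13 (uf t) t) ^ 3))).
    { apply (is_derive_Rinv_sqrt (fun s => Q13 (uf s) s)); [|exact Q13p].
      unfold Q13, q13, sfun. auto_derive; [repeat split; assumption|].
      rewrite Eth, Ex, Eu. unfold dq13, ds, S, sfun, c, sn. ring. }
    assert (D23 : is_derive (fun s => / sqrt (Q23 (uf s) s)) t (- dq23 u' x' th' * / (2 * sqrt (Q23 (uf t) t) ^ 3))).
    { apply (is_derive_Rinv_sqrt (fun s => Q23 (uf s) s)); [|exact Q23p].
      unfold Q23, q23, sfun. auto_derive; [repeat split; assumption|].
      rewrite Eth, Ex, Eu. unfold dq23, ds, S, sfun, c, sn. ring. }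
    set (h13 := fun s => / sqrt (Q13 (uf s) s)) in *. set (h23 := fun s => / sqrt (Q23 (uf s) s)) in *.
    assert (E13 := is_derive_unique _ _ _ D13). assert (E23 := is_derive_unique _ _ _ D23).
    assert (X13 : ex_derive (fun s : R => h13 s) t) by (eexists; exact D13).
    assert (X23 : ex_derive (fun s : R => h23 s) t) by (eexists; exact D23).
    change (Derive (fun s : R => h13 s) t = - dq13 u' x' th' * / (2 * sqrt (Q13 (uf t) t) ^ 3)) in E13.
    change (Derive (fun s : R => h23 s) t = - dq23 u' x' th' * / (2 * sqrt (Q23 (uf t) t) ^ 3)) in E23.
    assert (F13 : h13 t = f13) by (unfold h13, f13; rewrite R13_q; reflexivity).
    assert (F23 : h23 t = f23) by (unfold h23, f23; rewrite R23_q; reflexivity).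
    assert (G13 : / (2 * sqrt (Q13 (uf t) t) ^ 3) = / 2 * A) by (unfold A; rewrite R13_q, Rinv_mult; reflexivity).
    assert (G23 : / (2 * sqrt (Q23 (uf t) t) ^ 3) = / 2 * B) by (unfold B; rewrite R23_q, Rinv_mult; reflexivity).
    rewrite G13 in E13. rewrite G23 in E23.
    apply (is_derive_ext (fun s => uf s - 1 + eps ^ 3 * uf s ^ 3 *
       (yf s ^ 2 + / 2 * xf s ^ 4 - xf s ^ 2 * ((1 - rho) * h13 s + rho * h23 s)))).
    { intros s. unfold energy. rewrite R13_q, R23_q. reflexivity. }
    auto_derive; [repeat split; assumption|].
    rewrite Ex, Ey, Eu, E13, E23, F13, F23. unfold dE, K. field. }
  assert (D0 : dE u' x' y' th' = 0).
  { assert (Z : is_derive (fun s => energy rho eps (uf s) (thf s) (xf s) (yf s)) t 0).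
    { apply (is_derive_ext_loc (fun _ => 0)).
      - exists (mkposreal d Hd0). intros s Hs. symmetry. apply HUall, Hs.
      - auto_derive; [exact I|reflexivity]. }
    apply is_derive_unique in D1. apply is_derive_unique in Z. rewrite D1 in Z. exact Z. }
  assert (Dp : / 2 <= dE 1 0 0 0).
  { apply (near_identity_derive (fun v => energy rho eps v (thf t) (xf t) (yf t)) (uf t) _ (Rmin (uf t - / 2) (3 / 2 - uf t))).
    - apply Rmin_pos; lra.
    - intros v Hv. pose proof (Rmin_l (uf t - / 2) (3 / 2 - uf t)). pose proof (Rmin_r (uf t - / 2) (3 / 2 - uf t)).
      apply Rabs_def2 in Hv. apply energy_near; try assumption; lra.
    - assert (D13 : is_derive (fun v => / sqrt (Q13 v t)) (uf t) (- dq13 1 0 0 * / (2 * sqrt (Q13 (uf t) t) ^ 3))).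
      { apply (is_derive_Rinv_sqrt (fun v => Q13 v t)); [|exact Q13p].
        unfold Q13, q13, sfun. auto_derive; [exact I|]. unfold dq13, ds, S, sfun, c, sn. ring. }
      assert (D23 : is_derive (fun v => / sqrt (Q23 v t)) (uf t) (- dq23 1 0 0 * / (2 * sqrt (Q23 (uf t) t) ^ 3))).
      { apply (is_derive_Rinv_sqrt (fun v => Q23 v t)); [|exact Q23p].
        unfold Q23, q23, sfun. auto_derive; [exact I|]. unfold dq23, ds, S, sfun, c, sn. ring. }
      set (h13 := fun v => / sqrt (Q13 v t)) in *. set (h23 := fun v => / sqrt (Q23 v t)) in *.
      assert (E13 := is_derive_unique _ _ _ D13). assert (E23 := is_derive_unique _ _ _ D23).
      assert (X13 : ex_derive (fun s : R => h13 s) (uf t)) by (eexists; exact D13).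
      assert (X23 : ex_derive (fun s : R => h23 s) (uf t)) by (eexists; exact D23).
      change (Derive (fun s : R => h13 s) (uf t) = - dq13 1 0 0 * / (2 * sqrt (Q13 (uf t) t) ^ 3)) in E13.
      change (Derive (fun s : R => h23 s) (uf t) = - dq23 1 0 0 * / (2 * sqrt (Q23 (uf t) t) ^ 3)) in E23.
      assert (F13 : h13 (uf t) = f13) by (unfold h13, f13; rewrite R13_q; reflexivity).
      assert (F23 : h23 (uf t) = f23) by (unfold h23, f23; rewrite R23_q; reflexivity).
      assert (G13 : / (2 * sqrt (Q13 (uf t) t) ^ 3) = / 2 * A) by (unfold A; rewrite R13_q, Rinv_mult; reflexivity).
      assert (G23 : / (2 * sqrt (Q23 (uf t) t) ^ 3) = / 2 * B) by (unfold B; rewrite R23_q, Rinv_mult; reflexivity).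
      rewrite G13 in E13. rewrite G23 in E23.
      apply (is_derive_ext (fun v => v - 1 + eps ^ 3 * v ^ 3 *
         (yf t ^ 2 + / 2 * xf t ^ 4 - xf t ^ 2 * ((1 - rho) * h13 v + rho * h23 v)))).
      { intros s. unfold energy. rewrite R13_q, R23_q. reflexivity. }
      auto_derive; [repeat split; assumption|].
      rewrite E13, E23, F13, F23. unfold dE, K. field. }
  set (w := - sqrt 2 * eps ^ 2 * uf t ^ 3 * xf t * Gfun rho eps (uf t) (thf t) (xf t)).
  assert (Dw : dE w x' y' th' = 0).
  (* Writing 1 / sqrt q as q / sqrt q ^ 3 expresses everything rationally through the inverse cubes
     A and B, so that [field] can decide the identity. *)
  { assert (f13q : f13 = q13 rho S c * A).
    { unfold f13, A. rewrite R13_q. change (q13 rho (sfun eps (uf t) (xf t)) (cos (thf t))) with (Q13 (uf t) t).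
      change (q13 rho S c) with (Q13 (uf t) t).
      assert (H0 : sqrt (Q13 (uf t) t) <> 0) by (apply Rgt_not_eq, sqrt_lt_R0, Q13p).
      rewrite <- (sqrt_sqrt (Q13 (uf t) t)) at 2 by lra. field. exact H0. }
    assert (f23q : f23 = q23 rho S c * B).
    { unfold f23, B. rewrite R23_q. change (q23 rho (sfun eps (uf t) (xf t)) (cos (thf t))) with (Q23 (uf t) t).
      change (q23 rho S c) with (Q23 (uf t) t).
      assert (H0 : sqrt (Q23 (uf t) t) <> 0) by (apply Rgt_not_eq, sqrt_lt_R0, Q23p).
      rewrite <- (sqrt_sqrt (Q23 (uf t) t)) at 2 by lra. field. exact H0. }
    assert (EE : energy rho eps (uf t) (thf t) (xf t) (yf t) = uf t - 1 + eps ^ 3 * uf t ^ 3 * K) by reflexivity.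
    rewrite Et in EE.
    (* Along the vector field the expression collapses to a multiple of [energy], which is zero on
       the solution. This is where the particular form of F and G enters. *)
    assert (Id : dE w x' y' th' = (uf t - 1 + eps ^ 3 * uf t ^ 3 * K) * w / uf t).
    { unfold dE, K. rewrite f13q, f23q. unfold w, x', y', th', dq13, dq23, ds, q13, q23, Ffun, Gfun.
      fold A B c sn. unfold S, sfun. field. repeat split; lra. }
    rewrite Id, <- EE. field. lra. }
  assert (Elin : dE u' x' y' th' - dE w x' y' th' = (u' - w) * dE 1 0 0 0).
  { unfold dE, dq13, dq23, ds. field. }
  rewrite D0, Dw in Elin.
  assert (Euw : u' = w) by nra.
  rewrite <- Euw. exact Hu.
Qed.

(** * Decay of X and the tail estimate for U *)

Lemma derive_nonneg_le (f df : R -> R) a b : a <= b ->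
  (forall t, a <= t <= b -> is_derive f t (df t)) -> (forall t, a <= t <= b -> 0 <= df t) -> f a <= f b.
Proof.
  intros Hab Hd Hp.
  destruct (MVT_gen f a b df) as [c [Hc E]].
  - intros x Hx. rewrite Rmin_left, Rmax_right in Hx by exact Hab. apply Hd. lra.
  - intros x Hx. rewrite Rmin_left, Rmax_right in Hx by exact Hab.
    apply (continuity_pt_is_derive _ _ (df x)), Hd, Hx.
  - rewrite Rmin_left, Rmax_right in Hc by exact Hab. specialize (Hp c Hc). nra.
Qed.

Lemma continuity_pt_dist f t : continuity_pt f t ->
  forall e, 0 < e -> exists d, 0 < d /\ forall s, Rabs (s - t) < d -> Rabs (f s - f t) < e.
Proof.
  intros Hf e He.
  destruct (continuity_pt_positive f t (f t - e) (f t + e) Hf ltac:(lra)) as [d [Hd H]].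
  exists d. split; [exact Hd|]. intros s Hs. specialize (H s Hs). apply Rabs_def1; lra.
Qed.

(** Let T be the supremum of the times up to which f stays below c1. If f ever reaches c1, then f T
    = c1 and the negative derivative there puts f above c1 just before T. *)
Lemma barrier (f df : R -> R) (S c1 c2 : R) : c1 < c2 ->
  (forall t, S <= t -> is_derive f t (df t)) ->
  (forall t, S <= t -> c1 <= f t <= c2 -> df t < 0) ->
  f S < c1 -> forall t, S <= t -> f t < c1.
Proof.
  intros Hc Hd Hn HS t1 Ht1. apply Rnot_le_lt. intros Hf1.
  assert (Hct : forall t, S <= t -> continuity_pt f t) by (intros t Ht; apply (continuity_pt_is_derive _ _ (df t)), Hd, Ht).
  set (E := fun t => S <= t <= t1 /\ forall s, S <= s <= t -> f s < c1).
  assert (ES : E S) by (split; [lra|intros s Hs; replace s with S by lra; exact HS]).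
  destruct (completeness E) as [T [Tub Tl]].
  { exists t1. intros t [Ht _]. lra. }
  { exists S; exact ES. }
  assert (HST : S <= T) by (apply Tub, ES).
  assert (HT1 : T <= t1) by (apply Tl; intros t [Ht _]; lra).
  assert (Hbel : forall s, S <= s < T -> f s < c1).
  { intros s Hs. apply Rnot_le_lt. intros Hle.
    assert (T <= s); [|lra]. apply Tl. intros t [Ht Ht']. apply Rnot_lt_le. intros Hlt.
    specialize (Ht' s ltac:(lra)). lra. }
  destruct (Rlt_le_dec (f T) c1) as [Hlt|Hge].
  - destruct (continuity_pt_dist f T (Hct T HST) (c1 - f T) ltac:(lra)) as [d [Hd0 H]].
    assert (HTlt : T < t1) by (destruct (Req_dec T t1) as [->|]; lra).
    set (t' := Rmin t1 (T + d / 2)). 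
    assert (T < t' <= t1 /\ t' <= T + d / 2) by (unfold t', Rmin; destruct Rle_dec; lra).
    assert (E t'); [|assert (t' <= T) by (apply Tub; assumption); lra].
    split; [lra|]. intros s Hs. destruct (Rlt_le_dec s T); [apply Hbel; lra|].
    specialize (H s ltac:(apply Rabs_def1; lra)). apply Rabs_def2 in H. lra.
  - assert (HST' : S < T) by (destruct (Req_dec S T) as [<-|]; lra).
    assert (Hle : f T <= c1).
    { apply Rnot_lt_le. intros Hgt.
      destruct (continuity_pt_dist f T (Hct T HST) (f T - c1) ltac:(lra)) as [d [Hd0 H]].
      set (s := Rmax S (T - d / 2)).
      assert (S <= s < T /\ T - d / 2 <= s) by (unfold s, Rmax; destruct Rle_dec; lra).
      specialize (H s ltac:(apply Rabs_def1; lra)). apply Rabs_def2 in H.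
      assert (f s < c1) by (apply Hbel; lra). lra. }
    assert (Hneg : df T < 0) by (apply Hn; lra).
    destruct (proj1 (is_derive_dist (V := R_NormedModule) f T (df T)) (Hd T HST) (- df T / 2) ltac:(lra)) as [d [Hd0 H]].
    set (s := Rmax S (T - d / 2)).
    assert (Hs : S <= s < T /\ T - d / 2 <= s) by (unfold s, Rmax; destruct Rle_dec; lra).
    specialize (H s ltac:(apply Rabs_def1; lra)).
    change (Rabs (f s - f T - (s - T) * df T) <= - df T / 2 * Rabs (s - T)) in H.
    rewrite (Rabs_left (s - T)) in H by lra. apply Rabs_le_between in H.
    assert (f s < c1) by (apply Hbel; lra). nra.
Qed.

Lemma is_lim_0_dist (f : R -> R) : is_lim f p_infty 0 ->
  forall e, 0 < e -> exists T, forall t, T < t -> Rabs (f t) < e.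
Proof.
  intros H e He. apply is_lim_spec in H. destruct (H (mkposreal e He)) as [T HT]. exists T.
  intros t Ht. specialize (HT t Ht). simpl in HT. rewrite Rminus_0_r in HT. exact HT.
Qed.

Lemma is_lim_squeeze_0 (f g : R -> R) : (forall t, 0 <= t -> Rabs (f t) <= g t) ->
  is_lim g p_infty 0 -> is_lim f p_infty 0.
Proof.
  intros H Hg. apply is_lim_spec. intros [e He].
  destruct (is_lim_0_dist g Hg e He) as [T HT]. exists (Rmax T 0). intros t Ht. simpl.
  pose proof (Rmax_l T 0). pose proof (Rmax_r T 0). rewrite Rminus_0_r.
  specialize (H t ltac:(lra)). specialize (HT t ltac:(lra)).
  eapply Rle_lt_trans; [exact H|]. eapply Rle_lt_trans; [apply Rle_abs|exact HT].
Qed.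

Lemma monotone_limit_le (f df : R -> R) (S l : R) :
  (forall t, S <= t -> is_derive f t (df t)) -> (forall t, S <= t -> 0 <= df t) ->
  (forall e, 0 < e -> exists T, forall t, T < t -> f t < l + e) -> f S <= l.
Proof.
  intros Hd Hp Hl. apply Rnot_lt_le. intros Hlt.
  destruct (Hl (f S - l) ltac:(lra)) as [T HT].
  set (t := Rmax S T + 1). pose proof (Rmax_l S T). pose proof (Rmax_r S T).
  specialize (HT t ltac:(unfold t; lra)).
  assert (f S <= f t); [|lra].
  apply (derive_nonneg_le f df); [unfold t; lra| |]; intros; [apply Hd|apply Hp]; lra.
Qed.

(** The last quantity is the derivative of U along solutions. Its bound keeps both factors [rho] and
    X: integrated against the exponential decay of X it gives the tail estimate. *)
Lemma perturbation_small rho eps (p : state) : 0 <= rho <= 1 / 2 -> 0 < eps <= / 10 ^ 9 ->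
  0 < st_X p <= 3 / 2 -> Rabs (st_Y p) <= 2 ->
  let u := Ufun rho eps p in let th := st_theta p in let x := st_X p in
  / 2 <= u <= 3 / 2 /\ Rabs (Ffun rho eps u th x) <= / 1000 /\
  Rabs (sqrt 2 * eps ^ 2 * u ^ 2 * x * Gfun rho eps u th x) <= / 1000 * x /\
  Rabs (- sqrt 2 * eps ^ 2 * u ^ 3 * x * Gfun rho eps u th x) <= rho * x.
Proof.
  intros Hr He Hx Hy u th x.
  destruct (Ufun_spec rho eps p Hr He Hx Hy) as [_ [_ [Hu _]]]. fold u in Hu. fold x in Hx.
  destruct (FG_bounds rho eps u th x Hr He Hu Hx) as [HF HG].
  destruct (sfun_bound eps u x He Hu Hx) as [S1 S2].
  split; [exact Hu|]. split; [exact HF|].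
  destruct sqrt2_bounds as [_ Hs].
  assert (He2 : 0 <= eps ^ 2 <= / 1000).
  { split; [apply pow2_ge_0|]. assert (eps <= / 1000) by lra. nra. }
  assert (HG' : Rabs (Gfun rho eps u th x) <= rho * / 1000).
  { eapply Rle_trans; [exact HG|]. assert (sfun eps u x <= / 10 ^ 6) by lra. nra. }
  assert (Hu2 : 0 <= u ^ 2 <= 9 / 4) by (split; [apply pow2_ge_0|nra]).
  assert (Hu3 : 0 <= u ^ 3 <= 27 / 8) by (replace (u ^ 3) with (u ^ 2 * u) by ring; nra).
  split.
  - apply Rle_trans with (3 / 2 * / 1000 * (9 / 4) * x * (rho * / 1000)); [|nra].
    apply Rabs_mult_le; [|exact HG'].
    apply Rabs_mult_le; [|rewrite Rabs_pos_eq; lra].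
    apply Rabs_mult_le; [|rewrite Rabs_pos_eq; lra].
    apply Rabs_mult_le; rewrite Rabs_pos_eq; lra.
  - apply Rle_trans with (3 / 2 * / 1000 * (27 / 8) * x * (rho * / 1000)); [|nra].
    apply Rabs_mult_le; [|exact HG'].
    apply Rabs_mult_le; [|rewrite Rabs_pos_eq; lra].
    apply Rabs_mult_le; [|rewrite Rabs_pos_eq; lra].
    apply Rabs_mult_le; [rewrite Rabs_Ropp|]; rewrite Rabs_pos_eq; lra.
Qed.

(* [Z = Y + X / 2] satisfies [Z' >= Z / 2] as long as [X < 1/4]; since [Z] tends to 0, this
   forces [Z <= 0]. *)
Lemma stable_orbit_decay rho eps th0 g S : 0 <= rho <= 1 / 2 -> 0 < eps <= / 10 ^ 9 ->
  stable_orbit rho eps th0 g -> 0 <= S -> st_X (g S) < / 4 ->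
  exists dX, forall t, S <= t -> is_derive (fun t => st_X (g t)) t (dX t) /\ dX t <= - st_X (g t) / 4.
Proof.
  intros Hr He Hg HS HX.
  assert (Hbox := fun t Ht => stable_orbit_box rho eps th0 g t Hg Ht).
  destruct Hg as [Hd [Hrg [_ [_ [LX LY]]]]].
  assert (Hc := fun t Ht => orbit_comp rho eps g t (Hd t Ht)).
  assert (Hpert := fun t Ht => perturbation_small rho eps (g t) Hr He (proj1 (Hbox t Ht)) (proj2 (Hbox t Ht))).
  cbv zeta in Hc, Hpert.
  set (x := fun t => st_X (g t)) in *. set (y := fun t => st_Y (g t)) in *.
  set (u := fun t => Ufun rho eps (g t)) in *. set (th := fun t => st_theta (g t)) in *.
  set (G := fun t => Gfun rho eps (u t) (th t) (x t)).
  set (F := fun t => Ffun rho eps (u t) (th t) (x t)).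
  set (q := fun t => sqrt 2 * eps ^ 2 * u t ^ 2 * x t * G t).
  set (dx := fun t => y t + sqrt 2 * eps ^ 2 * u t ^ 2 * x t ^ 2 * G t).
  set (dy := fun t => x t - x t ^ 3 - x t * F t + sqrt 2 * eps ^ 2 * u t ^ 2 * x t * y t * G t).
  assert (Hdx : forall t, 0 <= t -> is_derive x t (dx t)) by (intros t Ht; apply (Hc t Ht)).
  assert (Hdy : forall t, 0 <= t -> is_derive y t (dy t)) by (intros t Ht; apply (Hc t Ht)).
  assert (Hq : forall t, 0 <= t -> Rabs (q t) <= / 1000 * x t /\ Rabs (F t) <= / 1000) by (intros t Ht; split; apply (Hpert t Ht)).
  assert (Hx1 : forall t, 0 <= t -> 0 < x t < 3 / 2) by (intros t Ht; apply (Hrg t Ht)).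
  assert (Edx : forall t, dx t = y t + x t * q t) by (intros; unfold dx, q; ring).
  assert (Edy : forall t, dy t = x t - x t ^ 3 - x t * F t + y t * q t) by (intros; unfold dy, q; ring).
  (* Between X = 1/4 and X = 1 the orbit has Y <= - 1/8, hence X' < 0, so X cannot climb back to
     1/4. *)
  assert (Hsm : forall t, S <= t -> x t < / 4).
  { apply (barrier x dx S (/ 4) 1); [lra|intros t Ht; apply Hdx; lra| |exact HX].
    intros t Ht Hxt. rewrite Edx. assert (Hyt : y t <= - / 8) by (apply (Hrg t ltac:(lra)); exact Hxt).
    destruct (Hq t ltac:(lra)) as [Hq1 _]. apply Rabs_le_between in Hq1. specialize (Hx1 t ltac:(lra)). nra. }
  assert (HZ : forall t, S <= t -> y t + x t / 2 <= 0).
  { intros t Ht. apply Rnot_lt_le. intros HZ.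
    (* Multiplying by exp (- s / 2) turns Z' >= Z / 2 into monotonicity. *)
    assert (HdZ : forall s, t <= s -> is_derive (fun s => exp (- s / 2) * (y s + x s / 2)) s
       (exp (- s / 2) * (dy s + dx s / 2 - (y s + x s / 2) / 2))).
    { intros s Hs. assert (D1 := Hdx s ltac:(lra)). assert (D2 := Hdy s ltac:(lra)).
      auto_derive; [split; [exists (dy s); exact D2|split; [exists (dx s); exact D1|exact I]]|].
      replace (Derive (fun s => x s) s) with (dx s) by (symmetry; apply (is_derive_unique x), D1).
      replace (Derive (fun s => y s) s) with (dy s) by (symmetry; apply (is_derive_unique y), D2). unfold Rdiv. ring. }
    assert (HpZ : forall s, t <= s -> 0 <= exp (- s / 2) * (dy s + dx s / 2 - (y s + x s / 2) / 2)).
    { intros s Hs. apply Rmult_le_pos; [left; apply exp_pos|]. rewrite Edx, Edy.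
      assert (Hx0 : 0 < x s) by apply (Hrg s ltac:(lra)). specialize (Hsm s ltac:(lra)).
      destruct (Hq s ltac:(lra)) as [Hq1 HF1]. apply Rabs_le_between in Hq1, HF1.
      assert (Hy1 : Rabs (y s) < 1) by apply (Hrg s ltac:(lra)). apply Rabs_def2 in Hy1.
      assert (Hyq : - (/ 1000 * x s) <= y s * q s) by nra.
      replace (x s - x s ^ 3 - x s * F s + y s * q s + (y s + x s * q s) / 2 - (y s + x s / 2) / 2) with
        (x s * (3 / 4 - x s * x s - F s + q s / 2) + y s * q s) by field.
      assert (/ 2 <= 3 / 4 - x s * x s - F s + q s / 2) by nra. nra. }
    destruct (is_lim_0_dist x LX ((y t + x t / 2) / 4) ltac:(lra)) as [T1 HT1].
    destruct (is_lim_0_dist y LY ((y t + x t / 2) / 4) ltac:(lra)) as [T2 HT2].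
    set (s := Rmax t (Rmax T1 T2) + 1).
    pose proof (Rmax_l t (Rmax T1 T2)). pose proof (Rmax_r t (Rmax T1 T2)).
    pose proof (Rmax_l T1 T2). pose proof (Rmax_r T1 T2).
    assert (Hts : t < s) by (unfold s; lra).
    assert (HE := derive_nonneg_le _ _ t s ltac:(lra) (fun r Hr => HdZ r (proj1 Hr)) (fun r Hr => HpZ r (proj1 Hr))).
    cbv beta in HE.
    specialize (HT1 s ltac:(unfold s; lra)). specialize (HT2 s ltac:(unfold s; lra)).
    apply Rabs_def2 in HT1, HT2.
    assert (Hee : exp (- s / 2) <= exp (- t / 2)) by (left; apply exp_increasing; lra).
    assert (He0 : 0 < exp (- s / 2)) by apply exp_pos.
    assert (exp (- s / 2) * (y t + x t / 2) <= exp (- t / 2) * (y t + x t / 2)) by (apply Rmult_le_compat_r; lra).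
    assert (y t + x t / 2 <= y s + x s / 2) by (apply Rmult_le_reg_l with (exp (- s / 2)); lra). lra. }
  exists dx. intros t Ht. split; [apply Hdx; lra|]. rewrite Edx. specialize (HZ t Ht).
  destruct (Hq t ltac:(lra)) as [Hq1 _]. apply Rabs_le_between in Hq1.
  specialize (Hx1 t ltac:(lra)). change (y t + x t * q t <= - x t / 4). nra.
Qed.

Lemma Ufun_near_1 rho eps (p : state) : 0 <= rho <= 1 / 2 -> 0 < eps <= / 10 ^ 9 ->
  0 < st_X p <= 3 / 2 -> Rabs (st_Y p) <= 2 ->
  Rabs (Ufun rho eps p - 1) <= st_X p + Rabs (st_Y p).
Proof.
  intros Hr He Hx Hy.
  destruct (Ufun_spec rho eps p Hr He Hx Hy) as [_ [_ [Hu E]]].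
  set (u := Ufun rho eps p) in *. set (th := st_theta p) in *. set (x := st_X p) in *. set (y := st_Y p) in *.
  unfold energy in E.
  destruct (R_bounds rho eps u th x Hr He Hu Hx) as [A13 [A23 _]].
  assert (I13 : / 2 <= / R13 rho eps u th x <= 2).
  { split; [apply Rinv_le_contravar; lra|rewrite <- (Rinv_inv 2); apply Rinv_le_contravar; lra]. }
  assert (I23 : / 2 <= / R23 rho eps u th x <= 2).
  { split; [apply Rinv_le_contravar; lra|rewrite <- (Rinv_inv 2); apply Rinv_le_contravar; lra]. }
  set (w := (1 - rho) * / R13 rho eps u th x + rho * / R23 rho eps u th x) in *.
  assert (Hw : 0 <= w <= 2) by (unfold w; split; nra).
  assert (He3 : 0 <= eps ^ 3 <= / 1000).
  { split; [apply pow_le; lra|]. replace (eps ^ 3) with (eps * (eps * eps)) by ring.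
    assert (0 <= eps * eps <= 1) by nra. nra. }
  assert (Hu3 : 0 <= u ^ 3 <= 27 / 8).
  { replace (u ^ 3) with (u * u * u) by ring. assert (0 <= u * u <= 9 / 4) by nra. nra. }
  assert (Hx2 : 0 <= x ^ 2 <= 3 / 2 * x) by (split; [apply pow2_ge_0|nra]).
  assert (Hx4 : 0 <= x ^ 4 <= 6 * x) by (replace (x ^ 4) with (x ^ 2 * x ^ 2) by ring; nra).
  assert (Hy2 : 0 <= y ^ 2 <= 2 * Rabs y).
  { split; [apply pow2_ge_0|]. rewrite <- (pow2_abs y). pose proof (Rabs_pos y). nra. }
  replace (u - 1) with (- (eps ^ 3 * u ^ 3 * (y ^ 2 + / 2 * x ^ 4 - x ^ 2 * w))) by lra.
  rewrite Rabs_Ropp.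
  apply Rle_trans with (/ 1000 * (27 / 8) * (2 * Rabs y + 6 * x)); [|pose proof (Rabs_pos y); lra].
  apply Rabs_mult_le; [apply Rabs_mult_le; rewrite Rabs_pos_eq; lra|].
  apply Rabs_le. split; nra.
Qed.

Lemma Ufun_limit rho eps th0 g : 0 <= rho <= 1 / 2 -> 0 < eps <= / 10 ^ 9 ->
  stable_orbit rho eps th0 g -> forall e, 0 < e -> exists T, 0 <= T /\ forall t, T < t -> Rabs (Ufun rho eps (g t) - 1) < e.
Proof.
  intros Hr He Hg e Hep.
  assert (Hbox := fun t Ht => stable_orbit_box rho eps th0 g t Hg Ht).
  destruct Hg as [_ [_ [_ [_ [LX LY]]]]].
  destruct (is_lim_0_dist _ LX (e / 2) ltac:(lra)) as [T1 HT1].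
  destruct (is_lim_0_dist _ LY (e / 2) ltac:(lra)) as [T2 HT2].
  exists (Rmax 0 (Rmax T1 T2)). split; [apply Rmax_l|]. intros t Ht.
  pose proof (Rmax_l 0 (Rmax T1 T2)). pose proof (Rmax_r 0 (Rmax T1 T2)).
  pose proof (Rmax_l T1 T2). pose proof (Rmax_r T1 T2).
  specialize (HT1 t ltac:(lra)). specialize (HT2 t ltac:(lra)). destruct (Hbox t ltac:(lra)) as [B1 B2].
  rewrite (Rabs_pos_eq (st_X (g t))) in HT1 by lra.
  eapply Rle_lt_trans; [apply (Ufun_near_1 rho eps (g t) Hr He B1 B2)|]. lra.
Qed.

(* [u - 4 rho X] is nondecreasing and [u + 4 rho X] is nonincreasing, and both tend to 1. *)
Lemma stable_orbit_tail rho eps th0 g S : 0 <= rho <= 1 / 2 -> 0 < eps <= / 10 ^ 9 ->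
  stable_orbit rho eps th0 g -> 0 <= S -> st_X (g S) < / 4 ->
  Rabs (Ufun rho eps (g S) - 1) <= 4 * rho * st_X (g S).
Proof.
  intros Hr He Hg HS HX.
  destruct (stable_orbit_decay rho eps th0 g S Hr He Hg HS HX) as [dX HdX].
  assert (Hlim := Ufun_limit rho eps th0 g Hr He Hg).
  assert (Hbox := fun t Ht => stable_orbit_box rho eps th0 g t Hg Ht).
  destruct Hg as [Hd [Hrg [_ [_ [LX _]]]]].
  set (x := fun t => st_X (g t)) in *. set (u := fun t => Ufun rho eps (g t)) in *.
  set (du := fun t => - sqrt 2 * eps ^ 2 * u t ^ 3 * x t * Gfun rho eps (u t) (st_theta (g t)) (x t)).
  assert (Hdu : forall t, S <= t -> is_derive u t (du t) /\ Rabs (du t) <= rho * x t).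
  { intros t Ht. destruct (Hrg t ltac:(lra)) as [B1 [B2 _]]. split.
    - apply (U_derive rho eps g t Hr He); [apply Hd; lra|exact B1|lra].
    - apply (perturbation_small rho eps (g t) Hr He); lra. }
  assert (Hxt : forall t, S <= t -> Rabs (x t) = x t).
  { intros t Ht. apply Rabs_pos_eq. destruct (Hrg t ltac:(lra)) as [B1 _]. unfold x. lra. }
  assert (LXe : forall e, 0 < e -> exists T, forall t, T < t -> Rabs (4 * rho * x t) < e).
  { intros e Hep. destruct (is_lim_0_dist _ LX (e / 4) ltac:(lra)) as [T HT]. exists T.
    intros t Ht. specialize (HT t Ht). replace (4 * rho * x t) with (4 * (rho * x t)) by ring.
    rewrite Rabs_mult, Rabs_mult, (Rabs_pos_eq 4), (Rabs_pos_eq rho) by lra. pose proof (Rabs_pos (x t)). nra. }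
  assert (Hsum : forall (c : R), (c = 1 \/ c = -1) -> c * u S - 4 * rho * x S <= c * 1).
  { intros c Hc.
    apply (monotone_limit_le (fun t => c * u t - 4 * rho * x t) (fun t => c * du t - 4 * rho * dX t) S).
    - intros t Ht. destruct (Hdu t Ht) as [D1 _]. destruct (HdX t Ht) as [D2 _].
      auto_derive; [split; [exists (du t); exact D1|split; [exists (dX t); exact D2|exact I]]|].
      replace (Derive (fun s => x s) t) with (dX t) by (symmetry; apply (is_derive_unique x), D2).
      replace (Derive (fun s => u s) t) with (du t) by (symmetry; apply (is_derive_unique u), D1). ring.
    - intros t Ht. destruct (Hdu t Ht) as [_ B]. destruct (HdX t Ht) as [_ B2]. change (st_X (g t)) with (x t) in B2.
      apply Rabs_le_between in B. destruct Hc as [-> | ->]; nra.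
    - intros e Hep. destruct (Hlim (e / 2) ltac:(lra)) as [T1 [_ HT1]]. destruct (LXe (e / 2) ltac:(lra)) as [T2 HT2].
      exists (Rmax T1 T2). pose proof (Rmax_l T1 T2). pose proof (Rmax_r T1 T2).
      intros t Ht. specialize (HT1 t ltac:(lra)). specialize (HT2 t ltac:(lra)). change (Ufun rho eps (g t)) with (u t) in HT1.
      apply Rabs_def2 in HT1, HT2. destruct Hc as [-> | ->]; lra. }
  assert (H1 := Hsum 1 (or_introl eq_refl)). assert (H2 := Hsum (-1) (or_intror eq_refl)).
  apply Rabs_le. change (Ufun rho eps (g S)) with (u S). change (st_X (g S)) with (x S). lra.
Qed.

(** * The variation of U to first order in [rho] *)

Definition kern (eps rho th x u : R) : R :=
  - sqrt 2 * eps ^ 2 * u ^ 3 * x *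
    ((1 - rho) * sin th * (/ R13 rho eps u th x ^ 3 - / R23 rho eps u th x ^ 3)).

Lemma kern_lip eps c : 0 < eps <= / 10 ^ 9 -> 0 < c ->
  exists L, 0 <= L /\ forall r r' th th' x x' u u',
    0 <= r <= 1 / 2 -> 0 <= r' <= 1 / 2 -> c <= x <= 3 / 2 -> c <= x' <= 3 / 2 ->
    / 2 <= u <= 3 / 2 -> / 2 <= u' <= 3 / 2 ->
    Rabs (kern eps r th x u - kern eps r' th' x' u') <=
      L * (Rabs (r - r') + Rabs (th - th') + Rabs (x - x') + Rabs (u - u')).
Proof.
  intros He Hc.
  set (W := prod_NormedModule R_AbsRing state R_NormedModule).
  set (B := fun w : W => (c <= st_X (fst w) <= 3 / 2 /\ / 2 <= st_Y (fst w) <= 3 / 2) /\ 0 <= snd w <= 1 / 2).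
  destruct (exC11_product_coords B c (/ 2) (3 / 2) 0 (1 / 2)) as [C1 [C1' [C2 [C3 C4]]]].
  { intros w [[Hx Hu] Hr]. lra. }
  destruct (exC11_Rinv B eps (fun w => snd w) (fun w => st_Y (fst w)) (fun w => st_theta (fst w)) (fun w => st_X (fst w)) He) as [C5 C6];
    try assumption.
  { intros w [[Hx Hu] Hr]. lra. }
  assert (C7 : exC11 B (fun w => kern eps (snd w) (st_theta (fst w)) (st_X (fst w)) (st_Y (fst w)))).
  { unfold kern.
    apply (exC11_ext B (fun w => - sqrt 2 * eps ^ 2 * st_Y (fst w) ^ 3 * st_X (fst w) * ((1 - snd w) * sin (st_theta (fst w)) *
      ((/ R13 (snd w) eps (st_Y (fst w)) (st_theta (fst w)) (st_X (fst w))) ^ 3 -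
       (/ R23 (snd w) eps (st_Y (fst w)) (st_theta (fst w)) (st_X (fst w))) ^ 3)))).
    - intros w _. rewrite !pow_inv. reflexivity.
    - exC11_auto. }
  destruct C7 as [D HD]. destruct (C11_lip B _ D HD) as [L [HL H]].
  exists L. split; [exact HL|]. intros r r' th th' x x' u u' Hr Hr' Hx Hx' Hu Hu'.
  assert (X := H (mk_state th' x' u', r') (mk_state th x u, r)). 
  assert (B1 : B (mk_state th' x' u', r')) by (split; [split; assumption|assumption]).
  assert (B2 : B (mk_state th x u, r)) by (split; [split; assumption|assumption]).
  specialize (X B1 B2). cbn [fst snd st_theta st_X st_Y mk_state] in X.
  eapply Rle_trans; [exact X|]. apply Rmult_le_compat_l; [exact HL|].
  unfold dist. change (minus ((mk_state th x u, r) : W) (mk_state th' x' u', r')) with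
    ((mk_state (th - th') (x - x') (u - u'), r - r') : W).
  eapply Rle_trans; [apply (norm_pair_le (V := state))|].
  assert (N := norm_state_le (mk_state (th - th') (x - x') (u - u'))).
  cbn [fst snd st_theta st_X st_Y mk_state] in N. lra.
Qed.

(** G carries an explicit factor [rho]. Once it is split off, U / [rho] has along solutions a
    derivative that converges as [rho] tends to 0. *)
Lemma kern_spec rho eps u th x :
  - sqrt 2 * eps ^ 2 * u ^ 3 * x * Gfun rho eps u th x = rho * kern eps rho th x u.
Proof. unfold kern, Gfun. ring. Qed.

(** Analytic dependence gives convergence as r -> 0 only at each fixed time. Equi-Lipschitz
    functions converging pointwise on [0, S] converge uniformly, by comparison on a finite grid, and
    the mean value theorem passes this on to the primitives. *)
Lemma equi_lipschitz_primitive (h : R -> R -> R) (u0 uS : R -> R) (k K : R -> R) (L S r1 : R) :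
  0 <= S -> 0 <= L -> 0 < r1 ->
  (forall r, 0 < r < r1 -> forall s t, 0 <= s <= S -> 0 <= t <= S -> Rabs (h r s - h r t) <= L * Rabs (s - t)) ->
  (forall r, 0 < r < r1 -> exists u, (forall t, 0 <= t <= S -> is_derive u t (h r t)) /\ u 0 = u0 r /\ u S = uS r) ->
  (forall t, 0 <= t <= S -> forall e, 0 < e -> exists d, 0 < d /\ forall r, 0 < r < d -> Rabs (h r t - k t) < e) ->
  (forall t, 0 <= t <= S -> is_derive K t (k t)) ->
  forall e, 0 < e -> exists d, 0 < d /\ forall r, 0 < r < d -> Rabs (uS r - u0 r - (K S - K 0)) <= e.
Proof.
  intros HS HL Hr1 Hlip Hu Hpt HK e He.
  (* The limit inherits the Lipschitz constant. *)
  assert (Hk : forall s t, 0 <= s <= S -> 0 <= t <= S -> Rabs (k s - k t) <= L * Rabs (s - t)).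
  { intros s t Hs Ht. apply le_epsilon. intros e' He'.
    destruct (Hpt s Hs (e' / 2) ltac:(lra)) as [d1 [Hd1 H1]]. destruct (Hpt t Ht (e' / 2) ltac:(lra)) as [d2 [Hd2 H2]].
    set (r := Rmin r1 (Rmin d1 d2) / 2).
    assert (0 < Rmin r1 (Rmin d1 d2)) by (repeat apply Rmin_pos; assumption).
    pose proof (Rmin_l r1 (Rmin d1 d2)). pose proof (Rmin_r r1 (Rmin d1 d2)).
    pose proof (Rmin_l d1 d2). pose proof (Rmin_r d1 d2).
    assert (Hr : 0 < r < r1) by (unfold r; lra).
    specialize (H1 r ltac:(unfold r; lra)). specialize (H2 r ltac:(unfold r; lra)).
    specialize (Hlip r Hr s t Hs Ht).
    replace (k s - k t) with ((h r s - h r t) + (- (h r s - k s) + (h r t - k t))) by ring.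
    eapply Rle_trans; [apply Rabs_triang|]. apply Rplus_le_compat; [exact Hlip|].
    eapply Rle_trans; [apply Rabs_triang|]. rewrite Rabs_Ropp. lra. }
  set (e1 := e / (S + 1)).
  assert (He1 : 0 < e1) by (apply Rdiv_lt_0_compat; lra).
  set (del := e1 / (4 * (L + 1))).
  assert (Hdel : 0 < del) by (apply Rdiv_lt_0_compat; lra).
  assert (HLd : L * del <= e1 / 4).
  { apply Rle_trans with ((L + 1) * del); [apply Rmult_le_compat_r; lra|].
    unfold del. right. field. lra. }
  (* The grid has step [del] with L del <= e1 / 4. One more grid point is treated at each step of
     the induction, with a possibly smaller d. *)
  assert (Hunif : forall n, exists d, 0 < d /\ forall r, 0 < r < d -> forall t, 0 <= t <= S -> t <= INR n * del ->
     Rabs (h r t - k t) <= e1).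
  { induction n as [|n [d [Hd IH]]].
    - destruct (Hpt 0 ltac:(lra) e1 He1) as [d [Hd H]]. exists d. split; [exact Hd|].
      intros r Hr t Ht Ht'. simpl in Ht'. replace t with 0 by lra. left. apply H, Hr.
    - destruct (Rle_lt_dec (INR n * del) S) as [Hn|Hn].
      + assert (Hn0 : 0 <= INR n * del) by (apply Rmult_le_pos; [apply pos_INR|lra]).
        destruct (Hpt (INR n * del) ltac:(lra) (e1 / 2) ltac:(lra)) as [d1 [Hd1 H1]].
        exists (Rmin r1 (Rmin d d1)). split; [repeat apply Rmin_pos; assumption|].
        pose proof (Rmin_l r1 (Rmin d d1)). pose proof (Rmin_r r1 (Rmin d d1)).
        pose proof (Rmin_l d d1). pose proof (Rmin_r d d1).
        intros r Hr t Ht Ht'. destruct (Rle_lt_dec t (INR n * del)) as [Htn|Htn]; [apply IH; try assumption; lra|].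
        rewrite S_INR in Ht'. specialize (H1 r ltac:(lra)).
        assert (Habs : Rabs (t - INR n * del) <= del) by (apply Rabs_le; lra).
        assert (A1 := Hlip r ltac:(lra) t (INR n * del) Ht ltac:(lra)). assert (A2 := Hk t (INR n * del) Ht ltac:(lra)).
        assert (A3 : L * Rabs (t - INR n * del) <= e1 / 4).
        { eapply Rle_trans; [|exact HLd]. apply Rmult_le_compat_l; assumption. }
        replace (h r t - k t) with ((h r t - h r (INR n * del)) + ((h r (INR n * del) - k (INR n * del)) + - (k t - k (INR n * del)))) by ring.
        eapply Rle_trans; [apply Rabs_triang|]. eapply Rle_trans; [apply Rplus_le_compat_l, Rabs_triang|].
        rewrite Rabs_Ropp. lra.
      + exists d. split; [exact Hd|]. intros r Hr t Ht _. apply IH; lra. }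
  destruct (INR_unbounded (S / del)) as [n Hn].
  assert (HnS : S <= INR n * del).
  { apply Rlt_le. apply Rmult_lt_reg_r with (/ del); [apply Rinv_0_lt_compat, Hdel|].
    rewrite Rmult_assoc, Rinv_r by lra. lra. }
  destruct (Hunif n) as [d [Hd H]]. exists (Rmin d r1). split; [apply Rmin_pos; assumption|].
  intros r Hr. pose proof (Rmin_l d r1). pose proof (Rmin_r d r1).
  destruct (Hu r ltac:(lra)) as [u [Hud [E0 ES]]]. rewrite <- E0, <- ES.
  replace (u S - u 0 - (K S - K 0)) with ((u S - K S) - (u 0 - K 0)) by ring.
  eapply Rle_trans.
  - apply (MVT_abs_le (fun t => u t - K t) (fun t => h r t - k t) 0 S e1);
      intros t Ht; rewrite Rmin_left, Rmax_right in Ht by exact HS.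
    + apply (is_derive_minus (V := R_NormedModule)); [apply Hud, Ht|apply HK, Ht].
    + apply H; [lra|exact Ht|lra].
  - rewrite Rminus_0_r, Rabs_pos_eq by exact HS. unfold e1.
    apply Rle_trans with (e / (S + 1) * (S + 1)); [apply Rmult_le_compat_l; [left; exact He1|lra]|].
    right. field. lra.
Qed.

Definition mel_integrand (eps th z : R) : R :=
  sdist eps z * (sin (th + phase eps z) *
     (/ sqrt (1 + sdist eps z ^ 2 - 2 * sdist eps z * cos (th + phase eps z)) ^ 3 - 1)).

Definition half_melnikov (eps th Z : R) : R := RInt (mel_integrand eps th) 0 Z.

Lemma mel_integrand_continuous eps th z : 0 < eps <= 1 / 4 -> continuous (mel_integrand eps th) z.
Proof.
  intros He. destruct (sdist_range eps z He) as [Hs1 Hs2].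
  pose proof (COS_bound (th + phase eps z)).
  set (q := fun z => 1 + sdist eps z ^ 2 - 2 * sdist eps z * cos (th + phase eps z)).
  assert (0 < q z) by (unfold q; nra).
  apply continuous_of_ex_derive. unfold mel_integrand.
  assert (Xs := ex_derive_sdist eps z). assert (Xp := ex_derive_phase eps z).
  auto_derive. repeat match goal with |- _ /\ _ => split end; try assumption; try exact I.
  change (sdist eps z * (sdist eps z * 1)) with (sdist eps z ^ 2).
  change (sqrt (q z) * (sqrt (q z) * (sqrt (q z) * 1)) <> 0).
  assert (0 < sqrt (q z)) by (apply sqrt_lt_R0; assumption).
  apply Rgt_not_eq. repeat apply Rmult_lt_0_compat; lra.
Qed.

Lemma a_sol_cosh t : a_sol t * cosh t = sqrt 2 /\ 1 <= cosh t /\ 1 + sinh t ^ 2 = cosh t ^ 2.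
Proof.
  assert (He : 0 < exp t) by apply exp_pos. assert (He' : 0 < exp (- t)) by apply exp_pos.
  assert (Hee : exp t * exp (- t) = 1) by (rewrite <- exp_plus; replace (t + - t) with 0 by ring; apply exp_0).
  unfold a_sol, cosh, sinh. split; [field; lra|]. split; [|nra].
  assert (0 <= (exp t - exp (- t)) ^ 2) by apply pow2_ge_0. nra.
Qed.

Lemma is_derive_sinh t : is_derive sinh t (cosh t).
Proof. unfold sinh, cosh. auto_derive; [exact I|field]. Qed.

(** Under z = sinh t one has [a_sol] t = sqrt 2 / cosh t. Hence eps^2 a^2 is [sdist] at z, and dz =
    cosh t dt leaves exactly the prefactor of [kern] at rho = 0, u = 1. *)
Lemma half_melnikov_derive eps th t : 0 < eps <= / 10 ^ 9 ->
  is_derive (fun t => half_melnikov eps th (sinh t)) t (kern eps 0 (th + phase eps (sinh t)) (a_sol t) 1).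
Proof.
  intros He. destruct (a_sol_cosh t) as [Ha [Hc Hs]].
  evar_last.
  - apply (is_derive_comp (V := R_NormedModule) (half_melnikov eps th) sinh t).
    + unfold half_melnikov. apply (is_derive_RInt_cont (V := R_CompleteNormedModule)).
      intros z. apply mel_integrand_continuous. lra.
    + apply is_derive_sinh.
  - change (cosh t * mel_integrand eps th (sinh t) = kern eps 0 (th + phase eps (sinh t)) (a_sol t) 1).
    unfold mel_integrand, kern. set (Th := th + phase eps (sinh t)).
    rewrite R13_q, R23_q. unfold q13, q23, sfun.
    assert (Ea : a_sol t = sqrt 2 / cosh t) by (rewrite <- Ha; field; lra).
    destruct sqrt2_bounds as [H2 _].
    assert (Es : eps ^ 2 * 1 ^ 2 * a_sol t ^ 2 = sdist eps (sinh t)).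
    { unfold sdist. rewrite Hs, Ea. replace ((sqrt 2 / cosh t) ^ 2) with (sqrt 2 * sqrt 2 / cosh t ^ 2) by (field; lra).
      rewrite H2. field. lra. }
    rewrite Es. set (s := sdist eps (sinh t)).
    replace (1 + (0 * s) ^ 2 + 2 * (0 * s) * cos Th) with 1 by ring. rewrite sqrt_1.
    replace (1 + ((1 - 0) * s) ^ 2 - 2 * ((1 - 0) * s) * cos Th) with (1 + s ^ 2 - 2 * s * cos Th) by ring.
    assert (E2 : cosh t * s = sqrt 2 * eps ^ 2 * a_sol t).
    { unfold s. rewrite <- Es, Ea. field. lra. }
    set (Q := / sqrt (1 + s ^ 2 - 2 * s * cos Th) ^ 3).
    replace (cosh t * (s * (sin Th * (Q - 1)))) with ((cosh t * s) * (sin Th * (Q - 1))) by ring.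
    rewrite E2, pow1, Rinv_1. ring.
Qed.

Lemma a_sol_lt e : 0 < e -> exists T, 0 <= T /\ forall t, T <= t -> a_sol t < e.
Proof.
  intros He. destruct sqrt2_bounds as [_ Hs].
  exists (4 / e). assert (H4 : 0 < 4 / e) by (apply Rdiv_lt_0_compat; lra).
  split; [lra|]. intros t Ht.
  assert (H1 : 1 + t < exp t) by (apply exp_ineq1; lra).
  assert (H2 : 0 < exp (- t)) by apply exp_pos.
  unfold a_sol. apply Rmult_lt_reg_r with (exp t + exp (- t)); [lra|].
  unfold Rdiv. rewrite Rmult_assoc, Rinv_l by lra.
  assert (4 <= e * t) by (apply Rmult_le_reg_r with (/ e); [apply Rinv_0_lt_compat, He|];
    replace (e * t * / e) with t by (field; lra); exact Ht). nra.
Qed.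

Lemma theta_speed eps c u x : 0 < eps <= / 10 ^ 9 -> 0 < c -> c <= x <= 3 / 2 -> / 2 <= u <= 3 / 2 ->
  Rabs (sqrt 2 * (x - 1 / (eps ^ 3 * u ^ 3 * x ^ 3))) <= 3 / 2 * (3 / 2 + 8 / (eps ^ 3 * c ^ 3)).
Proof.
  intros He Hc Hx Hu. destruct sqrt2_bounds as [_ Hs].
  assert (He3 : 0 < eps ^ 3) by (apply pow_lt; lra). assert (Hc3 : 0 < c ^ 3) by (apply pow_lt; lra).
  assert (Hu3 : (/ 2) ^ 3 <= u ^ 3) by (apply pow_incr; lra).
  assert (Hx3 : c ^ 3 <= x ^ 3) by (apply pow_incr; lra).
  apply Rabs_mult_le; [rewrite Rabs_pos_eq; lra|].
  unfold Rminus. eapply Rle_trans; [apply Rabs_triang|]. rewrite Rabs_Ropp.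
  apply Rplus_le_compat; [rewrite Rabs_pos_eq; lra|].
  assert (Hp : eps ^ 3 * (/ 8) * c ^ 3 <= eps ^ 3 * u ^ 3 * x ^ 3).
  { apply Rmult_le_compat; [| lra| |exact Hx3].
    - apply Rmult_le_pos; lra.
    - apply Rmult_le_compat_l; lra. }
  assert (Hp0 : 0 < eps ^ 3 * (/ 8) * c ^ 3) by (repeat apply Rmult_lt_0_compat; lra).
  rewrite Rabs_pos_eq.
  - unfold Rdiv. rewrite Rmult_1_l. apply Rle_trans with (/ (eps ^ 3 * (/ 8) * c ^ 3)).
    + apply Rinv_le_contravar; assumption.
    + right. field. lra.
  - unfold Rdiv. rewrite Rmult_1_l. left. apply Rinv_0_lt_compat. lra.
Qed.

(** Once below 1/4, X decreases up to time S, so earlier values are not smaller than the one at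
    S. *)
Lemma stable_orbit_lower rho eps th0 g S c : 0 <= rho <= 1 / 2 -> 0 < eps <= / 10 ^ 9 ->
  stable_orbit rho eps th0 g -> 0 <= S -> c <= / 4 -> c <= st_X (g S) ->
  forall t, 0 <= t <= S -> c <= st_X (g t).
Proof.
  intros Hr He Hg HS Hc4 Hc t Ht.
  destruct (Rlt_le_dec (st_X (g t)) (/ 4)) as [Hlt|]; [|lra].
  destruct (stable_orbit_decay rho eps th0 g t Hr He Hg ltac:(lra) Hlt) as [dX HdX].
  assert (- st_X (g t) <= - st_X (g S)); [|lra].
  apply (derive_nonneg_le (fun t => - st_X (g t)) (fun t => - dX t)); [lra| |].
  - intros s Hs. apply (is_derive_opp (V := R_NormedModule)), HdX. lra.
  - intros s Hs. destruct (HdX s ltac:(lra)) as [_ H]. 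
    assert (0 < st_X (g s)) by apply (stable_orbit_box rho eps th0 g s Hg ltac:(lra)). lra.
Qed.

Lemma stable_orbit_lipschitz rho eps th0 g S c : 0 <= rho <= 1 / 2 -> 0 < eps <= / 10 ^ 9 ->
  stable_orbit rho eps th0 g -> 0 <= S -> 0 < c -> (forall t, 0 <= t <= S -> c <= st_X (g t)) ->
  forall s t, 0 <= s <= S -> 0 <= t <= S ->
    Rabs (st_theta (g s) - st_theta (g t)) <= 3 / 2 * (3 / 2 + 8 / (eps ^ 3 * c ^ 3)) * Rabs (s - t) /\
    Rabs (st_X (g s) - st_X (g t)) <= 2 * Rabs (s - t) /\
    Rabs (Ufun rho eps (g s) - Ufun rho eps (g t)) <= 2 * rho * Rabs (s - t).
Proof.
  intros Hr He Hg HS Hc Hlow s t Hs Ht.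
  assert (Hbox := fun t Ht => stable_orbit_box rho eps th0 g t Hg Ht).
  destruct Hg as [Hd [Hrg _]].
  assert (Hin : forall r, Rmin t s <= r <= Rmax t s -> 0 <= r <= S) by (intros r; apply interval_convex; assumption).
  assert (Hp := fun r (Hr0 : 0 <= r <= S) => perturbation_small rho eps (g r) Hr He (proj1 (Hbox r (proj1 Hr0))) (proj2 (Hbox r (proj1 Hr0)))).
  cbv zeta in Hp.
  split; [|split].
  - eapply (MVT_abs_le (fun t => st_theta (g t))); intros r Hr1; apply Hin in Hr1.
    + destruct (orbit_comp rho eps g r (Hd r ltac:(lra))) as [D1 _]. exact D1.
    + apply theta_speed; try assumption.
      * specialize (Hlow r Hr1). specialize (Hrg r ltac:(lra)). lra.
      * apply (Hp r Hr1).
  - eapply (MVT_abs_le (fun t => st_X (g t))); intros r Hr1; apply Hin in Hr1.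
    + destruct (orbit_comp rho eps g r (Hd r ltac:(lra))) as [_ [D2 _]]. exact D2.
    + destruct (Hp r Hr1) as [_ [_ [Hq _]]]. destruct (Hrg r ltac:(lra)) as [Hx [Hy _]].
      set (q := sqrt 2 * eps ^ 2 * _ * _ * _) in Hq.
      apply Rle_trans with (Rabs (st_Y (g r) + st_X (g r) * q)); [right; f_equal; unfold q; ring|].
      apply Rabs_le_between in Hq. apply Rabs_def2 in Hy. apply Rabs_le. nra.
  - eapply (MVT_abs_le (fun t => Ufun rho eps (g t))); intros r Hr1; apply Hin in Hr1.
    + destruct (Hrg r ltac:(lra)) as [Hx [Hy _]]. apply (U_derive rho eps g r Hr He); [apply Hd; lra|exact Hx|lra].
    + destruct (Hp r Hr1) as [_ [_ [_ Hq]]]. destruct (Hrg r ltac:(lra)) as [Hx _].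
      eapply Rle_trans; [exact Hq|]. nra.
Qed.

(** U(0) - 1 is the tail U(S) - 1 minus [rho] times the integral of [kern] over [0, S]. The tail is
    at most 4 [rho] X(S), small compared with [rho] uniformly once S is large; with S fixed, the
    integral converges to the half Melnikov integral as [rho] tends to 0. *)
Lemma stable_splitting eps th (Gam : R -> R -> state) r1 :
  0 < eps <= / 10 ^ 9 -> 0 < r1 <= 1 / 2 ->
  (forall rho, 0 < rho < r1 -> exists g, stable_orbit rho eps th g /\ forall t, 0 <= t -> g t = Gam rho t) ->
  (forall t, 0 <= t -> forall e, 0 < e -> exists d, 0 < d /\ forall rho, 0 < rho < d ->
     Rabs (st_theta (Gam rho t) - (th + phase eps (sinh t))) < e /\ Rabs (st_X (Gam rho t) - a_sol t) < e) ->
  forall e, 0 < e -> exists S0, 0 <= S0 /\ forall S, S0 <= S -> exists d, 0 < d /\ forall rho, 0 < rho < d ->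
    Rabs ((Ufun rho eps (Gam rho 0) - 1) / rho + half_melnikov eps th (sinh S)) <= e.
Proof.
  intros He Hr1 Hg Hpt e Hep.
  (* X(S) will be below 3/2 of [a_sol] S. The bound 1/8 thus brings it below 1/4, where the tail
     estimate applies, and e / 64 makes the tail at most [rho] e / 8. *)
  destruct (a_sol_lt (Rmin (/ 8) (e / 64))) as [S0 [HS0 Ha]]; [apply Rmin_pos; lra|].
  exists S0. split; [exact HS0|]. intros S HS.
  assert (HaS := Ha S HS). pose proof (Rmin_l (/ 8) (e / 64)). pose proof (Rmin_r (/ 8) (e / 64)).
  destruct (loop_point S) as [[HaS0 _] _].
  destruct (Hpt S ltac:(lra) (a_sol S / 2) ltac:(lra)) as [r2 [Hr2 HrS]].
  set (c := a_sol S / 2).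
  set (r3 := Rmin r1 r2). assert (Hr3 : 0 < r3) by (apply Rmin_pos; lra).
  assert (Hr31 : r3 <= r1) by apply Rmin_l. assert (Hr32 : r3 <= r2) by apply Rmin_r.
  assert (Horb : forall rho, 0 < rho < r3 -> exists g, stable_orbit rho eps th g /\ (forall t, 0 <= t -> g t = Gam rho t) /\
     (forall t, 0 <= t <= S -> c <= st_X (g t)) /\ st_X (g S) < / 4 /\ st_X (g S) <= e / 32).
  { intros rho Hrho. destruct (Hg rho ltac:(lra)) as [g [Hs Eg]]. exists g.
    destruct (HrS rho ltac:(lra)) as [_ HX]. rewrite <- Eg in HX by lra. apply Rabs_def2 in HX.
    split; [exact Hs|]. split; [exact Eg|]. split; [|split; lra].
    apply (stable_orbit_lower rho eps th); try assumption; unfold c; lra. }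
  destruct (kern_lip eps c He ltac:(unfold c; lra)) as [L [HL Hk]].
  set (u := fun rho t => Ufun rho eps (Gam rho t)).
  set (h := fun rho t => kern eps rho (st_theta (Gam rho t)) (st_X (Gam rho t)) (u rho t)).
  (* The loop inherits the lower bound c from the perturbed orbits in the limit. *)
  assert (Hat : forall t, 0 <= t <= S -> c <= a_sol t <= 3 / 2).
  { intros t Ht. destruct (loop_point t) as [[A1 A2] _]. destruct sqrt2_bounds as [_ Hs2]. split; [|lra].
    apply le_epsilon. intros e' He'. destruct (Hpt t ltac:(lra) e' He') as [d [Hd H1]].
    pose proof (Rmin_l d r3). pose proof (Rmin_r d r3). assert (0 < Rmin d r3) by (apply Rmin_pos; assumption).
    destruct (H1 (Rmin d r3 / 2) ltac:(lra)) as [_ HX2].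
    destruct (Horb (Rmin d r3 / 2) ltac:(lra)) as [g [_ [Eg [Hlow _]]]].
    specialize (Hlow t Ht). rewrite Eg in Hlow by lra. apply Rabs_def2 in HX2. lra. }
  (* On [0, S] the variation of U is at most 2 S [rho] and the tail at most [rho]; so u tends to 1
     in the argument of [kern]. *)
  assert (Hu1 : forall rho, 0 < rho < r3 -> forall t, 0 <= t <= S -> Rabs (u rho t - 1) <= (2 * S + 1) * rho).
  { intros rho Hrho t Ht. destruct (Horb rho Hrho) as [g [Hs [Eg [Hlow [HXS HXe]]]]].
    destruct (stable_orbit_lipschitz rho eps th g S c ltac:(lra) He Hs ltac:(lra) ltac:(unfold c; lra) Hlow t S Ht ltac:(lra)) as [_ [_ Hl]].
    assert (Htail := stable_orbit_tail rho eps th g S ltac:(lra) He Hs ltac:(lra) HXS).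
    rewrite !Eg in * by lra. fold (u rho t) in Hl. fold (u rho S) in Hl, Htail.
    replace (u rho t - 1) with ((u rho t - u rho S) + (u rho S - 1)) by ring.
    eapply Rle_trans; [apply Rabs_triang|].
    assert (Rabs (t - S) <= S) by (apply Rabs_le; lra). nra. }
  set (M := 3 / 2 * (3 / 2 + 8 / (eps ^ 3 * c ^ 3))).
  assert (HM : 0 <= M).
  { unfold M. assert (0 < 8 / (eps ^ 3 * c ^ 3)); [|lra].
    apply Rdiv_lt_0_compat; [lra|]. apply Rmult_lt_0_compat; apply pow_lt; unfold c; lra. }
  destruct (equi_lipschitz_primitive h (fun rho => u rho 0 / rho) (fun rho => u rho S / rho)
    (fun t => kern eps 0 (th + phase eps (sinh t)) (a_sol t) 1) (fun t => half_melnikov eps th (sinh t))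
    (L * (M + 3)) S r3 ltac:(lra) ltac:(apply Rmult_le_pos; lra) Hr3) with (e := e / 2) as [d [Hd H1]].
  - intros rho Hrho s t Hs Ht. destruct (Horb rho Hrho) as [g [Hgs [Eg [Hlow _]]]].
    destruct (stable_orbit_lipschitz rho eps th g S c ltac:(lra) He Hgs ltac:(lra) ltac:(unfold c; lra) Hlow s t Hs Ht) as [L1 [L2 L3]].
    assert (Bs := stable_orbit_box rho eps th g s Hgs (proj1 Hs)). assert (Bt := stable_orbit_box rho eps th g t Hgs (proj1 Ht)).
    assert (Us := Ufun_spec rho eps (g s) ltac:(lra) He (proj1 Bs) (proj2 Bs)).
    assert (Ut := Ufun_spec rho eps (g t) ltac:(lra) He (proj1 Bt) (proj2 Bt)).
    assert (Ls := Hlow s Hs). assert (Lt := Hlow t Ht). fold M in L1.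
    rewrite !Eg in * by lra. unfold h.
    eapply Rle_trans; [apply Hk; try lra; [apply Us|apply Ut]|].
    rewrite Rminus_diag, Rabs_R0, Rmult_assoc. apply Rmult_le_compat_l; [exact HL|].
    fold (u rho s) (u rho t) in L3. pose proof (Rabs_pos (s - t)). nra.
  - intros rho Hrho. destruct (Horb rho Hrho) as [g [Hgs [Eg [Hlow _]]]].
    exists (fun t => Ufun rho eps (g t) / rho). split; [|unfold u; rewrite !Eg by lra; split; reflexivity].
    intros t Ht. destruct Hgs as [Hgd [Hrg _]]. destruct (Hrg t ltac:(lra)) as [B1 [B2 _]].
    assert (D := U_derive rho eps g t ltac:(lra) He (Hgd t ltac:(lra)) B1 ltac:(lra)).
    rewrite kern_spec in D. unfold h, u. rewrite <- Eg by lra.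
    apply (is_derive_ext (fun t => / rho * Ufun rho eps (g t))); [intros; unfold Rdiv; apply Rmult_comm|].
    replace (kern eps rho (st_theta (g t)) (st_X (g t)) (Ufun rho eps (g t))) with
      (/ rho * (rho * kern eps rho (st_theta (g t)) (st_X (g t)) (Ufun rho eps (g t)))) by (field; lra).
    apply (is_derive_scal (fun t => Ufun rho eps (g t))), D.
  - intros t Ht e' He'.
    set (e2 := e' / (4 * (L + 1))). assert (He2 : 0 < e2) by (apply Rdiv_lt_0_compat; lra).
    assert (HLe : L * (4 * e2) < e').
    { apply Rlt_le_trans with ((L + 1) * (4 * e2)); [apply Rmult_lt_compat_r; lra|]. unfold e2. right. field. lra. }
    destruct (Hpt t ltac:(lra) e2 He2) as [d [Hd H1]].
    set (d' := Rmin r3 (Rmin d (Rmin e2 (e2 / (2 * S + 1))))).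
    assert (He2' : 0 < e2 / (2 * S + 1)) by (apply Rdiv_lt_0_compat; lra).
    assert (Hd' : 0 < d') by (repeat first [assumption | apply Rmin_pos]).
    assert (d' <= r3 /\ d' <= d /\ d' <= e2 /\ d' <= e2 / (2 * S + 1)) as [D1 [D2 [D3 D4]]].
    { unfold d'. pose proof (Rmin_l r3 (Rmin d (Rmin e2 (e2 / (2 * S + 1))))). pose proof (Rmin_r r3 (Rmin d (Rmin e2 (e2 / (2 * S + 1))))).
      pose proof (Rmin_l d (Rmin e2 (e2 / (2 * S + 1)))). pose proof (Rmin_r d (Rmin e2 (e2 / (2 * S + 1)))).
      pose proof (Rmin_l e2 (e2 / (2 * S + 1))). pose proof (Rmin_r e2 (e2 / (2 * S + 1))). lra. }
    exists d'. split; [exact Hd'|]. intros rho Hrho. destruct (H1 rho ltac:(lra)) as [E1 E2].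
    assert (E3 := Hu1 rho ltac:(lra) t Ht).
    assert (E4 : (2 * S + 1) * rho <= e2).
    { apply Rle_trans with ((2 * S + 1) * (e2 / (2 * S + 1))); [apply Rmult_le_compat_l; lra|right; field; lra]. }
    destruct (Horb rho ltac:(lra)) as [g [Hgs [Eg [Hlow _]]]].
    assert (Bt := stable_orbit_box rho eps th g t Hgs (proj1 Ht)).
    assert (Ut := Ufun_spec rho eps (g t) ltac:(lra) He (proj1 Bt) (proj2 Bt)).
    assert (Lt := Hlow t Ht). rewrite Eg in * by lra. unfold h.
    eapply Rle_lt_trans; [apply Hk; try lra; [apply Hat, Ht|apply Ut]|].
    eapply Rle_lt_trans; [|exact HLe]. apply Rmult_le_compat_l; [exact HL|].
    rewrite Rminus_0_r, (Rabs_pos_eq rho) by lra. fold (u rho t). lra.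
  - intros t Ht. apply half_melnikov_derive, He.
  - lra.
  - exists (Rmin d r3). split; [apply Rmin_pos; assumption|]. intros rho Hrho.
    pose proof (Rmin_l d r3). pose proof (Rmin_r d r3). specialize (H1 rho ltac:(lra)).
    destruct (Horb rho ltac:(lra)) as [g [Hgs [Eg [Hlow [HXS HXe]]]]].
    assert (Htail := stable_orbit_tail rho eps th g S ltac:(lra) He Hgs ltac:(lra) HXS).
    assert (HXp : 0 < st_X (g S)) by apply (stable_orbit_box rho eps th g S Hgs ltac:(lra)).
    rewrite Eg in Htail, HXe, HXp by lra. fold (u rho S) in Htail. fold (u rho 0).
    assert (E0 : half_melnikov eps th (sinh 0) = 0) by (unfold half_melnikov; rewrite sinh_0; apply (RInt_point (V := R_CompleteNormedModule))).
    rewrite E0 in H1.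
    replace ((u rho 0 - 1) / rho + half_melnikov eps th (sinh S)) with
      (- (u rho S / rho - u rho 0 / rho - (half_melnikov eps th (sinh S) - 0)) + (u rho S - 1) / rho) by (field; lra).
    eapply Rle_trans; [apply Rabs_triang|]. rewrite Rabs_Ropp.
    assert (Rabs ((u rho S - 1) / rho) <= e / 8); [|lra].
    unfold Rdiv at 1. rewrite Rabs_mult, (Rabs_pos_eq (/ rho)) by (left; apply Rinv_0_lt_compat; lra).
    apply Rmult_le_reg_r with rho; [lra|]. rewrite Rmult_assoc, Rinv_l by lra. nra.
Qed.

(** * The unperturbed problem and the reversing symmetry *)

(** The solution at rho = 0, where the planar equations decouple from the angle; [phase] of sinh t
    is the increment of the angle along it. *)
Definition free_orbit (eps th t : R) : state := mk_state (th + phase eps (sinh t)) (a_sol t) (b_sol t).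

Lemma R13_0 eps u th x : R13 0 eps u th x = 1.
Proof. rewrite R13_q. unfold q13. replace (1 + _ + _) with 1 by ring. apply sqrt_1. Qed.

(** At u = 1 the eps^3 terms cancel because the loop satisfies b^2 = a^2 - a^4 / 2. *)
Lemma is_U_free eps th t : 0 < eps <= / 10 ^ 9 -> is_U 0 eps (free_orbit eps th t) 1.
Proof.
  intros He. destruct (loop_point t) as [[Ha1 Ha2] [Hb _]]. destruct sqrt2_bounds as [_ Hs].
  unfold is_U, free_orbit. cbn [fst snd st_theta st_X st_Y mk_state].
  destruct (R_bounds 0 eps 1 (th + phase eps (sinh t)) (a_sol t) ltac:(lra) He ltac:(lra) ltac:(lra)) as [A13 [A23 _]].
  split; [lra|]. split; [lra|]. split; [rewrite Rminus_diag, Rabs_R0; lra|].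
  rewrite R13_0, Hb. field. lra.
Qed.

Lemma is_derive_phase eps z : 0 < eps ->
  is_derive (phase eps) z (2 / (1 + z ^ 2) - / (2 * eps ^ 3) * (1 + z ^ 2)).
Proof.
  intros He. unfold phase.
  evar_last.
  - apply (is_derive_minus (V := R_NormedModule) (fun z => 2 * atan z) (fun z => / (2 * eps ^ 3) * (z + z ^ 3 / 3))).
    + apply is_derive_scal. apply is_derive_Reals, derivable_pt_lim_atan.
    + auto_derive; [exact I|reflexivity].
  - assert (0 < eps ^ 3) by (apply pow_lt, He). assert (0 < 1 + z ^ 2) by nra.
    unfold minus, plus, opp; simpl. unfold Rsqr. simpl in *. field. repeat split; lra.
Qed.

Lemma free_orbit_derive eps th t : 0 < eps ->
  is_derive (free_orbit eps th) t (vector_field 0 eps 1 (free_orbit eps th t)).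
Proof.
  intros He. destruct (a_sol_cosh t) as [Hac [Hc Hs]].
  assert (E1 : 0 < exp t) by apply exp_pos. assert (E2 : 0 < exp (- t)) by apply exp_pos.
  assert (Hee : exp t * exp (- t) = 1) by (rewrite <- exp_plus; replace (t + - t) with 0 by ring; apply exp_0).
  destruct sqrt2_bounds as [H2 H2'].
  assert (Hcosh : cosh t <> 0) by lra.
  assert (Ea : forall t, a_sol t = sqrt 2 / cosh t).
  { intros s. destruct (a_sol_cosh s) as [<- [Hcs _]]. field. lra. }
  apply is_derive_state_of_comp; unfold free_orbit, vector_field, Ffun, Gfun; cbn [fst snd st_theta st_X st_Y mk_state].
  - evar_last.
    + apply (is_derive_plus (V := R_NormedModule) (fun _ => th) (fun t => phase eps (sinh t))).
      * apply is_derive_const.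
      * apply (is_derive_comp (V := R_NormedModule) (phase eps) sinh t);
          [apply is_derive_phase; lra|apply is_derive_sinh].
    + change (0 + cosh t * (2 / (1 + sinh t ^ 2) - / (2 * eps ^ 3) * (1 + sinh t ^ 2)) =
        sqrt 2 * (a_sol t - 1 / (eps ^ 3 * 1 ^ 3 * a_sol t ^ 3))).
      rewrite Hs, (Ea t).
      replace (sqrt 2 * (sqrt 2 / cosh t - 1 / (eps ^ 3 * 1 ^ 3 * (sqrt 2 / cosh t) ^ 3))) with
        (sqrt 2 * sqrt 2 / cosh t - cosh t ^ 3 / ((sqrt 2 * sqrt 2) * eps ^ 3)).
      2:{ field. repeat split; lra. }
      rewrite H2. field. lra.
  - replace (b_sol t + _) with (b_sol t) by ring. unfold a_sol, b_sol.
    auto_derive; [lra|]. field. lra.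
  - rewrite R13_0.
    match goal with |- context [/ R23 ?a ?b ?c ?d ?e ^ 3] => generalize (/ R23 a b c d e ^ 3); intros r end.
    replace (a_sol t - a_sol t ^ 3 - _ + _) with (a_sol t - a_sol t ^ 3) by field.
    unfold a_sol, b_sol.
    auto_derive; [nra|].
    set (E := exp t) in *. set (e := exp (- t)) in *.
    replace (2 * sqrt 2 / (E + e) - (2 * sqrt 2 / (E + e)) ^ 3) with
      (2 * sqrt 2 / (E + e) - 8 * (sqrt 2 * sqrt 2) * sqrt 2 / (E + e) ^ 3) by (field; lra).
    rewrite H2.
    assert (He1 : e = / E) by (unfold e, E; apply exp_Ropp).
    rewrite He1 in *. field. split; nra.
Qed.

Lemma loop_limits : is_lim a_sol p_infty 0 /\ is_lim b_sol p_infty 0.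
Proof.
  assert (Ha : is_lim a_sol p_infty 0).
  { apply is_lim_spec. intros [e He]. destruct (a_sol_lt e He) as [T [_ HT]]. exists T.
    intros t Ht. simpl. rewrite Rminus_0_r. destruct (loop_point t) as [[A _] _].
    rewrite Rabs_pos_eq by lra. apply HT. lra. }
  split; [exact Ha|]. apply (is_lim_squeeze_0 b_sol a_sol); [|exact Ha].
  intros t _. destruct (loop_point t) as [[A _] [B _]]. apply Rabs_le.
  assert (0 <= a_sol t ^ 4) by (apply pow_le; lra). split; nra.
Qed.

Lemma loop_reflect t : a_sol (- t) = a_sol t /\ b_sol (- t) = - b_sol t.
Proof.
  assert (E1 : 0 < exp t) by apply exp_pos. assert (E2 : 0 < exp (- t)) by apply exp_pos.
  unfold a_sol, b_sol. rewrite Ropp_involutive. split; field; lra.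
Qed.

Lemma is_lim_reflect (f : R -> R) (l : Rbar) : is_lim f p_infty l -> is_lim (fun t => f (- t)) m_infty l.
Proof.
  intros H. apply (is_lim_comp f (fun t => - t) m_infty l p_infty H).
  - replace p_infty with (Rbar_opp m_infty) by reflexivity. apply (is_lim_opp (fun t => t)), is_lim_id.
  - exists 0. intros; discriminate.
Qed.

Lemma is_lim_reflect_neg (f : R -> R) (l : Rbar) : is_lim f m_infty l -> is_lim (fun t => f (- t)) p_infty l.
Proof.
  intros H. apply (is_lim_comp f (fun t => - t) p_infty l m_infty H).
  - replace m_infty with (Rbar_opp p_infty) by reflexivity. apply (is_lim_opp (fun t => t)), is_lim_id.
  - exists 0. intros; discriminate.
Qed.

Lemma free_orbit_solves eps th J : 0 < eps <= / 10 ^ 9 -> solves 0 eps J (free_orbit eps th).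
Proof.
  intros He t _. destruct (loop_point t) as [[A _] _]. split.
  - unfold free_orbit, st_X; simpl. lra.
  - exists 1. split; [apply is_U_free, He|].
    apply is_derive_within_of_derive, free_orbit_derive. lra.
Qed.

Lemma free_orbit_0 eps th : 0 < eps -> free_orbit eps th 0 = mk_state th (sqrt 2) 0.
Proof.
  intros He. unfold free_orbit, a_sol, b_sol, phase. rewrite Ropp_0, exp_0, sinh_0, atan_0.
  unfold mk_state. f_equal; [f_equal|]; field. lra.
Qed.

(** With the uniqueness hypothesis this identifies the given analytic family at rho = 0, which lies
    inside the parameter range. *)
Lemma free_orbit_stable D r eps th : 0 < eps <= / 10 ^ 9 -> 0 < r -> (forall q, loop_plus q -> locally q D) ->
  primary_stable D r 0 eps th (free_orbit eps th).
Proof.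
  intros He Hr HD. split; [apply free_orbit_solves, He|]. split.
  - exists (sqrt 2). rewrite Rminus_diag, Rabs_R0. split; [lra|apply free_orbit_0; lra].
  - split; [|apply loop_limits]. intros t Ht.
    apply locally_singleton, HD. left. exists t. split; [exact Ht|reflexivity].
Qed.

Lemma free_orbit_unstable D r eps th : 0 < eps <= / 10 ^ 9 -> 0 < r -> (forall q, loop_minus q -> locally q D) ->
  primary_unstable D r 0 eps th (free_orbit eps th).
Proof.
  intros He Hr HD. split; [apply free_orbit_solves, He|]. split.
  - exists (sqrt 2). rewrite Rminus_diag, Rabs_R0. split; [lra|apply free_orbit_0; lra].
  - split.
    + intros t Ht. apply locally_singleton, HD. left. exists t. split; [exact Ht|reflexivity].
    + destruct loop_limits as [LX LY]. split.
      * apply (is_lim_ext (fun t => a_sol (- t))); [intros t; apply loop_reflect|].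
        apply is_lim_reflect, LX.
      * apply (is_lim_ext (fun t => - b_sol (- t))).
        { intros t. rewrite (proj2 (loop_reflect t)). apply Ropp_involutive. }
        replace (Finite 0) with (Rbar_opp 0) by (simpl; f_equal; ring).
        apply (is_lim_opp (fun t => b_sol (- t))), is_lim_reflect, LY.
Qed.

(* The reversing symmetry: [mirror] together with [t -> - t] preserves the equations and
   exchanges stable and unstable solutions. *)
Definition mirror (p : state) : state := mk_state (- st_theta p) (st_X p) (- st_Y p).

Lemma mirror_norm (p : state) : norm (mirror p) = norm p.
Proof.
  destruct p as [[th x] y]. unfold mirror, st_theta, st_X, st_Y, mk_state; simpl.
  unfold norm; simpl. unfold prod_norm; simpl. unfold norm; simpl. unfold prod_norm; simpl.
  unfold norm; simpl. unfold abs; simpl. rewrite !Rabs_Ropp. reflexivity.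
Qed.

Lemma mirror_increment (p q v : state) (k : R) :
  mirror (minus (minus (mirror p) (mirror q)) (scal k (opp (mirror v)))) = minus (minus p q) (scal (- k) v).
Proof.
  destruct p as [[a b] c]. destruct q as [[a' b'] c']. destruct v as [[a'' b''] c''].
  change (mk_state (- (- a - - a' - k * - - a'')) (b - b' - k * - b'') (- (- c - - c' - k * - - c'')) =
    mk_state (a - a' - - k * a'') (b - b' - - k * b'') (c - c' - - k * c'')).
  unfold mk_state. f_equal; [f_equal|]; ring.
Qed.

Lemma mirror_R13 rho eps u th x : R13 rho eps u (- th) x = R13 rho eps u th x /\ R23 rho eps u (- th) x = R23 rho eps u th x.
Proof. unfold R13, R23. rewrite cos_neg. split; reflexivity. Qed.

Lemma mirror_is_U rho eps p u : is_U rho eps (mirror p) u <-> is_U rho eps p u.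
Proof.
  unfold is_U, mirror, st_theta, st_X, st_Y, mk_state; cbv zeta; cbn [fst snd].
  destruct (mirror_R13 rho eps u (fst (fst p)) (snd (fst p))) as [E1 E2]. rewrite E1, E2.
  replace ((- snd p) ^ 2) with (snd p ^ 2) by ring. reflexivity.
Qed.

Lemma mirror_field rho eps u p : vector_field rho eps u (mirror p) = opp (mirror (vector_field rho eps u p)).
Proof.
  unfold vector_field, mirror, Ffun, Gfun, st_theta, st_X, st_Y, mk_state; cbv zeta; cbn [fst snd].
  destruct (mirror_R13 rho eps u (fst (fst p)) (snd (fst p))) as [E1 E2]. rewrite E1, E2, cos_neg, sin_neg.
  unfold opp; simpl. unfold prod_opp; simpl. unfold opp; simpl. unfold prod_opp; simpl. unfold opp; simpl.
  unfold mk_state. f_equal; [f_equal|]; ring.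
Qed.

Lemma mirror_solves rho eps (gam : R -> state) : solves rho eps (fun t => t <= 0) gam ->
  solves rho eps (fun t => 0 <= t) (fun t => mirror (gam (- t))).
Proof.
  intros H t Ht. destruct (H (- t) ltac:(lra)) as [HX [u [Hu Hd]]].
  split; [exact HX|]. exists u. split; [apply mirror_is_U, Hu|].
  rewrite mirror_field. apply is_derive_within_dist. intros e He.
  destruct (proj1 (is_derive_within_dist _ _ _ _) Hd e He) as [d [Hd0 H1]].
  exists d. split; [exact Hd0|]. intros s Hs Hst.
  assert (E : Rabs (- s - - t) = Rabs (s - t)) by (rewrite <- Rabs_Ropp; f_equal; ring).
  specialize (H1 (- s) ltac:(lra) ltac:(rewrite E; exact Hst)). rewrite E in H1.
  eapply Rle_trans; [|exact H1]. right. rewrite <- mirror_norm. f_equal.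
  rewrite mirror_increment. f_equal. f_equal. f_equal. ring.
Qed.

Lemma mirror_primary D r rho eps th gam : primary_unstable D r rho eps th gam ->
  primary_stable (fun q => D (fst q, - snd q)) r rho eps (- th) (fun t => mirror (gam (- t))).
Proof.
  intros [Hs [[X0 [HX0 H0]] [HD [LX LY]]]].
  split; [apply mirror_solves, Hs|]. split.
  - exists X0. split; [exact HX0|]. rewrite Ropp_0, H0. unfold mirror; cbn [fst snd st_theta st_X st_Y mk_state].
    rewrite Ropp_0. reflexivity.
  - split.
    + intros t Ht. simpl. specialize (HD (- t) ltac:(lra)). unfold st_X, st_Y in *; simpl. rewrite Ropp_involutive. exact HD.
    + split; [exact (is_lim_reflect_neg _ _ LX)|].
      replace (Finite 0) with (Rbar_opp 0) by (simpl; f_equal; ring).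
      apply (is_lim_opp (fun t => st_Y (gam (- t)))). exact (is_lim_reflect_neg _ _ LY).
Qed.

(** [a_sol] is even and [b_sol] is odd, so reflection in Y carries one half of the loop to the
    other. *)
Lemma mirror_near D delta : 0 < delta <= / 100 -> small_neighborhood delta loop_minus D ->
  near_loop (fun q => D (fst q, - snd q)).
Proof.
  intros Hd [_ H] [x y] Hq. destruct (H _ Hq) as [[a b] [Hp [B1 B2]]]. simpl in B1, B2.
  exists (a, - b). split.
  - destruct Hp as [[t [Ht E]]|E].
    + left. exists (- t). split; [lra|]. injection E as -> ->.
      destruct (loop_reflect t) as [-> ->]. reflexivity.
    + right. injection E as -> ->. f_equal. ring.
  - split; simpl.
    + apply ball_le with delta; [lra|exact B1].
    + change (Rabs (y - - b) < / 100). change (Rabs (- y - b) < delta) in B2.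
      rewrite <- Rabs_Ropp. replace (- (y - - b)) with (- y - b) by ring. lra.
Qed.

(* At [rho = 0], [X = sqrt 2], [Y = 0], [u = 1] the function [energy] has derivative 1 in [u]
   and [2 sqrt 2 eps^3] in [X]. *)
Lemma energy_taylor eps th : 0 < eps <= / 10 ^ 9 -> forall e, 0 < e ->
  exists d, 0 < d /\ forall rho x x' u u', 0 <= rho < d ->
    Rabs (x - sqrt 2) < d -> Rabs (x' - sqrt 2) < d -> Rabs (u - 1) < d -> Rabs (u' - 1) < d ->
    Rabs (energy rho eps u th x 0 - energy rho eps u' th x' 0 - ((u - u') + 2 * sqrt 2 * eps ^ 3 * (x - x')))
      <= e * (Rabs (x - x') + Rabs (u - u')).
Proof.
  intros He e Hep. destruct sqrt2_bounds as [H2 Hs2].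
  set (W := prod_NormedModule R_AbsRing state R_NormedModule).
  set (B := fun w : W => (1 <= st_X (fst w) <= 3 / 2 /\ / 2 <= st_Y (fst w) <= 3 / 2) /\ 0 <= snd w <= 1 / 2).
  destruct (exC11_product_coords B 1 (/ 2) (3 / 2) 0 (1 / 2)) as [C1 [_ [C2 [C3 C4]]]].
  { intros w [[Hx Hu] Hr]. lra. }
  destruct (exC11_Rinv B eps (fun w => snd w) (fun w => st_Y (fst w)) (fun w => st_theta (fst w)) (fun w => st_X (fst w)) He) as [C5 C6];
    try assumption.
  { intros w [[Hx Hu] Hr]. lra. }
  assert (C7 : exC11 B (fun w => energy (snd w) eps (st_Y (fst w)) (st_theta (fst w)) (st_X (fst w)) 0)).
  { unfold energy. exC11_auto. }
  destruct C7 as [D HD].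
  set (Phi := fun w : W => energy (snd w) eps (st_Y (fst w)) (st_theta (fst w)) (st_X (fst w)) 0) in *.
  set (p0 := (mk_state th (sqrt 2) 1, 0) : W).
  assert (Bp0 : B p0) by (unfold B, p0, st_X, st_Y, mk_state; simpl; lra).
  (* The derivative D is known only to exist. It is computed by differentiating along straight lines
     through the base point, where at rho = 0 the angle drops out. *)
  assert (HD0 : forall h k, D p0 (mk_state 0 h k, 0) = k + 2 * sqrt 2 * eps ^ 3 * h).
  { intros h k.
    set (g := fun t : R => (mk_state th (sqrt 2 + t * h) (1 + t * k), 0) : W).
    assert (Hg : is_derive g 0 ((mk_state 0 h k, 0) : W)).
    { apply is_derive_dist. intros e' He'. exists 1. split; [lra|]. intros y _.
      match goal with |- norm ?v <= _ => replace v with (zero : W) end.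
      - rewrite (norm_zero (V := W)). apply Rmult_le_pos; [lra|apply Rabs_pos].
      - symmetry.
        change ((mk_state (th - th - (y - 0) * 0) (sqrt 2 + y * h - (sqrt 2 + 0 * h) - (y - 0) * h)
            (1 + y * k - (1 + 0 * k) - (y - 0) * k), 0 - 0 - (y - 0) * 0) = (((0, 0), 0), 0) :> W).
        unfold mk_state. f_equal; [f_equal; [f_equal|]|]; ring. }
    assert (E0 : g 0 = p0) by (unfold g, p0; rewrite !Rmult_0_l, !Rplus_0_r; reflexivity).
    set (dl := / (100 * (1 + Rabs h + Rabs k))).
    pose proof (Rabs_pos h) as Ph. pose proof (Rabs_pos k) as Pk.
    assert (Hdl : 0 < dl) by (apply Rinv_0_lt_compat; lra).
    assert (C := C11_chain B Phi D g 0 ((mk_state 0 h k, 0) : W) HD).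
    assert (Hin : exists d, 0 < d /\ forall s, Rabs (s - 0) < d -> B (g s)).
    { exists dl. split; [exact Hdl|]. intros s Hs. rewrite Rminus_0_r in Hs.
      assert (Hsm : forall v, Rabs v <= 1 + Rabs h + Rabs k -> Rabs (s * v) <= / 100).
      { intros v Hv. rewrite Rabs_mult. apply Rle_trans with (dl * (1 + Rabs h + Rabs k)).
        - apply Rmult_le_compat; try apply Rabs_pos; lra.
        - right. unfold dl. field. lra. }
      assert (S1 := Hsm h ltac:(lra)). assert (S2 := Hsm k ltac:(lra)).
      apply Rabs_le_between in S1, S2. unfold B, g, st_X, st_Y, mk_state; simpl. lra. }
    specialize (C Hin Hg). rewrite E0 in C.
    assert (C' : is_derive (fun s => Phi (g s)) 0 (k + 2 * sqrt 2 * eps ^ 3 * h)).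
    { apply (is_derive_ext (fun s => 1 + s * k - 1 + eps ^ 3 * (1 + s * k) ^ 3 *
        (/ 2 * (sqrt 2 + s * h) ^ 4 - (sqrt 2 + s * h) ^ 2))).
      { intros s. unfold Phi, g, energy, st_theta, st_X, st_Y, mk_state; simpl fst; simpl snd.
        rewrite R13_0. generalize (/ R23 0 eps (1 + s * k) th (sqrt 2 + s * h)). intros r. match goal with |- @eq _ ?a ?b => change (@eq R a b) end. field. }
      auto_derive; [exact I|].
      rewrite !Rmult_0_l, !Rplus_0_r. set (q := sqrt 2) in *. unfold pow, pred.
      replace (q * (q * (q * (q * 1)))) with 4 by (transitivity ((q * q) * (q * q)); [rewrite H2|]; ring).
      replace (q * (q * (q * 1))) with (2 * q) by (rewrite <- H2 at 1; ring).
      replace (q * (q * 1)) with 2 by (rewrite <- H2 at 1; ring). field. }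
    rewrite <- (is_derive_unique _ _ _ C'). symmetry. apply is_derive_unique. exact C. }
  destruct HD as [C [HC HD]].
  (* The increment has norm at most 4 d and the distance to the base point is at most 3 d; together
     they stay below 8 d, and C 8 d <= e. *)
  set (d := Rmin (/ 100) (e / (8 * (C + 1)))).
  assert (Hd1 : d <= / 100) by apply Rmin_l. assert (Hd2 : d <= e / (8 * (C + 1))) by apply Rmin_r.
  assert (Hd : 0 < d) by (apply Rmin_pos; [lra|apply Rdiv_lt_0_compat; lra]).
  assert (HCd : C * (8 * d) <= e).
  { apply Rle_trans with ((C + 1) * (8 * d)); [apply Rmult_le_compat_r; lra|].
    apply Rle_trans with ((C + 1) * (8 * (e / (8 * (C + 1))))); [apply Rmult_le_compat_l; lra|right; field; lra]. }
  exists d. split; [exact Hd|]. intros rho x x' u u' Hr Hx Hx' Hu Hu'.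
  set (p := (mk_state th x u, rho) : W). set (p' := (mk_state th x' u', rho) : W).
  assert (Hxx := Hx). assert (Hxx' := Hx'). assert (Huu := Hu). assert (Huu' := Hu').
  apply Rabs_def2 in Hxx, Hxx', Huu, Huu'.
  assert (Bp : B p) by (unfold B, p, st_X, st_Y, mk_state; simpl; lra).
  assert (Bp' : B p') by (unfold B, p', st_X, st_Y, mk_state; simpl; lra).
  destruct (HD p' Bp') as [_ [_ [_ [_ T1]]]]. destruct (T1 p Bp) as [_ T]. clear T1.
  destruct (HD p0 Bp0) as [_ [_ [_ [_ T1]]]]. destruct (T1 p' Bp') as [T2 _]. clear T1.
  set (v := (mk_state 0 (x - x') (u - u'), 0) : W).
  assert (Ev : minus p p' = v).
  { change ((mk_state (th - th) (x - x') (u - u'), rho - rho) = v :> W). unfold v. rewrite !Rminus_diag. reflexivity. }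
  specialize (T2 v). rewrite Ev, <- Ev in T. rewrite Ev in T.
  assert (Hnv : norm v <= Rabs (x - x') + Rabs (u - u')).
  { eapply Rle_trans; [apply (norm_pair_le (V := state))|]. rewrite Rabs_R0, Rplus_0_r.
    eapply Rle_trans; [apply norm_state_le|]. unfold st_theta, st_X, st_Y, mk_state; simpl. rewrite Rabs_R0. lra. }
  assert (Hn0 : dist p' p0 <= 3 * d).
  { unfold dist. change (minus p' p0) with ((mk_state (th - th) (x' - sqrt 2) (u' - 1), rho - 0) : W).
    eapply Rle_trans; [apply (norm_pair_le (V := state))|]. rewrite Rminus_0_r, (Rabs_pos_eq rho) by lra.
    apply Rle_trans with (Rabs (th - th) + Rabs (x' - sqrt 2) + Rabs (u' - 1) + rho).
    - apply Rplus_le_compat_r. apply norm_state_le.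
    - rewrite Rminus_diag, Rabs_R0. lra. }
  assert (Hdv : dist p p' = norm v) by (unfold dist; rewrite Ev; reflexivity). rewrite Hdv in T.
  unfold v in T2 at 2. rewrite HD0 in T2.
  assert (Hv4 : norm v <= 4 * d).
  { eapply Rle_trans; [exact Hnv|]. 
    assert (Rabs (x - x') <= 2 * d) by (apply Rabs_le; lra). assert (Rabs (u - u') <= 2 * d) by (apply Rabs_le; lra). lra. }
  assert (Nv : 0 <= norm v) by apply norm_ge_0. 
  change (energy rho eps u th x 0) with (Phi p). change (energy rho eps u' th x' 0) with (Phi p').
  replace (Phi p - Phi p' - (u - u' + 2 * sqrt 2 * eps ^ 3 * (x - x'))) with
    ((Phi p - Phi p' - D p' v) + (D p' v - (u - u' + 2 * sqrt 2 * eps ^ 3 * (x - x')))) by ring.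
  eapply Rle_trans; [apply Rabs_triang|].
  apply Rle_trans with (C * norm v ^ 2 + C * dist p' p0 * norm v); [lra|].
  apply Rle_trans with (C * (8 * d) * norm v).
  - replace (C * norm v ^ 2 + C * dist p' p0 * norm v) with (C * norm v * (norm v + dist p' p0)) by ring.
    replace (C * (8 * d) * norm v) with (C * norm v * (8 * d)) by ring.
    apply Rmult_le_compat_l; [apply Rmult_le_pos; assumption|lra].
  - apply Rmult_le_compat; try assumption. apply Rmult_le_pos; lra.
Qed.

(** * Splitting of the crossing points *)

(** Subtracting the two equations [energy] = 0 at Y = 0 gives du + K dx = 0 up to a relative error,
    K = 2 sqrt 2 eps^3. The error involves |dx| itself, so dx must first be bounded by a multiple of
    du. *)
Lemma X_splitting eps th (xs xu us uu : R -> R) m e : 0 < eps <= / 10 ^ 9 -> 0 < e ->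
  (exists d, 0 < d /\ forall rho, 0 < rho < d ->
     energy rho eps (us rho) th (xs rho) 0 = 0 /\ energy rho eps (uu rho) th (xu rho) 0 = 0) ->
  (forall e, 0 < e -> exists d, 0 < d /\ forall rho, 0 < rho < d ->
     Rabs (xs rho - sqrt 2) < e /\ Rabs (xu rho - sqrt 2) < e /\ Rabs (us rho - 1) < e /\ Rabs (uu rho - 1) < e) ->
  (exists d, 0 < d /\ forall rho, 0 < rho < d -> Rabs ((us rho - uu rho) / rho + m) <= e) ->
  exists d, 0 < d /\ forall rho, 0 < rho < d ->
    Rabs (2 * sqrt 2 * eps ^ 3 * ((xs rho - xu rho) / rho) - m) <= 2 * e.
Proof.
  intros He Hep [d1 [Hd1 H1]] Hlim [d2 [Hd2 H2]].
  destruct sqrt2_bounds as [_ Hs2].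
  set (K := 2 * sqrt 2 * eps ^ 3).
  assert (HK : 0 < K) by (apply Rmult_lt_0_compat; [lra|apply pow_lt; lra]).
  (* K / 2 allows the |dx| part of the error to be absorbed; the last entry makes the remaining
     error, divided by [rho], at most e. *)
  set (e' := Rmin (Rmin 1 (K / 2)) (e / ((4 / K + 1) * (Rabs m + e)))).
  assert (H4K : 0 < 4 / K) by (apply Rdiv_lt_0_compat; lra).
  pose proof (Rabs_pos m) as Hm.
  assert (Hden : 0 < (4 / K + 1) * (Rabs m + e)) by (apply Rmult_lt_0_compat; lra).
  assert (He' : 0 < e').
  { apply Rmin_pos; [apply Rmin_pos; lra|]. apply Rdiv_lt_0_compat; lra. }
  assert (B1 : e' <= 1) by (eapply Rle_trans; [apply Rmin_l|apply Rmin_l]).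
  assert (B2 : e' <= K / 2) by (eapply Rle_trans; [apply Rmin_l|apply Rmin_r]).
  assert (B3 : e' * ((4 / K + 1) * (Rabs m + e)) <= e).
  { apply Rle_trans with (e / ((4 / K + 1) * (Rabs m + e)) * ((4 / K + 1) * (Rabs m + e))).
    - apply Rmult_le_compat_r; [lra|apply Rmin_r].
    - right. field. lra. }
  destruct (energy_taylor eps th He e' He') as [d3 [Hd3 H3]].
  destruct (Hlim d3 Hd3) as [d4 [Hd4 H4]].
  exists (Rmin (Rmin d1 d2) (Rmin d3 d4)). split; [repeat apply Rmin_pos; assumption|].
  intros rho Hrho.
  pose proof (Rmin_l (Rmin d1 d2) (Rmin d3 d4)). pose proof (Rmin_r (Rmin d1 d2) (Rmin d3 d4)).
  pose proof (Rmin_l d1 d2). pose proof (Rmin_r d1 d2). pose proof (Rmin_l d3 d4). pose proof (Rmin_r d3 d4).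
  destruct (H1 rho ltac:(lra)) as [E1 E2]. destruct (H4 rho ltac:(lra)) as [L1 [L2 [L3 L4]]].
  specialize (H2 rho ltac:(lra)).
  assert (T := H3 rho (xs rho) (xu rho) (us rho) (uu rho) ltac:(lra) L1 L2 L3 L4).
  rewrite E1, E2 in T. fold K in T.
  set (dx := xs rho - xu rho) in *. set (du := us rho - uu rho) in *.
  replace (0 - 0 - (du + K * dx)) with (- (du + K * dx)) in T by ring. rewrite Rabs_Ropp in T.
  assert (Hdx : Rabs dx <= 4 / K * Rabs du).
  { apply Rmult_le_reg_l with (K / 2); [lra|]. replace (K / 2 * (4 / K * Rabs du)) with (2 * Rabs du) by (field; lra).
    assert (K * Rabs dx <= Rabs (du + K * dx) + Rabs du).
    { rewrite <- (Rabs_pos_eq K) at 1 by lra. rewrite <- Rabs_mult.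
      replace (K * dx) with ((du + K * dx) + - du) at 1 by ring.
      eapply Rle_trans; [apply Rabs_triang|]. rewrite Rabs_Ropp. lra. }
    pose proof (Rabs_pos dx). pose proof (Rabs_pos du). nra. }
  assert (T' : Rabs (du + K * dx) <= e' * (4 / K + 1) * Rabs du).
  { eapply Rle_trans; [exact T|]. rewrite Rmult_assoc. apply Rmult_le_compat_l; [lra|]. lra. }
  assert (Hr : 0 < / rho) by (apply Rinv_0_lt_compat; lra).
  assert (Hdu : Rabs (du / rho) <= Rabs m + e).
  { replace (du / rho) with (du / rho + m + - m) by ring.
    eapply Rle_trans; [apply Rabs_triang|]. rewrite Rabs_Ropp. lra. }
  assert (T2 : Rabs (du / rho + K * (dx / rho)) <= e).
  { replace (du / rho + K * (dx / rho)) with ((du + K * dx) * / rho) by (unfold Rdiv; ring).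
    rewrite Rabs_mult, (Rabs_pos_eq (/ rho)) by lra.
    apply Rle_trans with (e' * (4 / K + 1) * Rabs du * / rho); [apply Rmult_le_compat_r; lra|].
    eapply Rle_trans; [|exact B3].
    replace (e' * (4 / K + 1) * Rabs du * / rho) with (e' * ((4 / K + 1) * Rabs (du / rho))).
    2:{ unfold Rdiv at 2. rewrite Rabs_mult, (Rabs_pos_eq (/ rho)) by lra. ring. }
    apply Rmult_le_compat_l; [lra|]. apply Rmult_le_compat_l; [lra|exact Hdu]. }
  replace (K * (dx / rho) - m) with ((du / rho + K * (dx / rho)) + - (du / rho + m)) by ring.
  eapply Rle_trans; [apply Rabs_triang|]. rewrite Rabs_Ropp. lra.
Qed.

(** The integrand is odd under (th, z) -> (- th, - z). The negative half-line therefore yields the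
    half integral at the reflected angle, which is the one attached to the mirrored unstable
    solution. *)
Lemma melnikov_halves eps th Z : 0 < eps <= / 10 ^ 9 ->
  melnikov eps th Z = half_melnikov eps th Z - half_melnikov eps (- th) Z.
Proof.
  intros He.
  assert (Hc : forall th z, continuous (mel_integrand eps th) z) by (intros; apply mel_integrand_continuous; lra).
  assert (Hex : forall th a b, ex_RInt (mel_integrand eps th) a b) by (intros; apply ex_RInt_of_continuous; intros; apply Hc).
  change (melnikov eps th Z) with (RInt (mel_integrand eps th) (- Z) Z).
  rewrite <- (RInt_Chasles (V := R_CompleteNormedModule) (mel_integrand eps th) (- Z) 0 Z) by apply Hex.
  assert (E := RInt_comp_lin (V := R_CompleteNormedModule) (mel_integrand eps th) (-1) 0 Z 0 ltac:(apply Hex)).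
  replace (-1 * Z + 0) with (- Z) in E by ring. replace (-1 * 0 + 0) with 0 in E by ring.
  rewrite <- E.
  rewrite (RInt_ext_R _ (mel_integrand eps (- th))).
  - rewrite <- (opp_RInt_swap (V := R_CompleteNormedModule) (mel_integrand eps (- th)) 0 Z) by apply Hex.
    unfold half_melnikov, plus, opp; simpl. ring.
  - intros z. replace (-1 * z + 0) with (- z) by ring. unfold mel_integrand. rewrite sdist_opp, phase_opp.
    replace (th + - phase eps z) with (- (- th + phase eps z)) by ring. rewrite sin_neg, cos_neg.
    unfold scal; simpl. unfold mult; simpl. ring.
Qed.

Lemma sin_ge_half h : 0 <= h <= 1 -> h / 2 <= sin h.
Proof.
  intros Hh.
  assert (sin 0 - 0 / 2 <= sin h - h / 2); [|rewrite sin_0 in *; lra].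
  apply (derive_nonneg_le (fun t => sin t - t / 2) (fun t => cos t - / 2)); [lra| |].
  - intros t _. auto_derive; [exact I|field].
  - intros t Ht. pose proof (cos_ge_quadratic t). nra.
Qed.

Definition analytic_family (eps0 : R) (J : R -> Prop) (P : R -> R -> R -> (R -> state) -> Prop)
    (Gam : R -> R -> R -> R -> state) : Prop :=
  forall theta0 rho eps, param_range eps0 rho eps ->
    P rho eps theta0 (Gam theta0 rho eps) /\
    (forall gam, P rho eps theta0 gam -> forall t, J t -> gam t = Gam theta0 rho eps t) /\
    (forall t, J t ->
       analytic3_at (fun th r e => st_theta (Gam th r e t)) theta0 rho eps /\
       analytic3_at (fun th r e => st_X (Gam th r e t)) theta0 rho eps /\
       analytic3_at (fun th r e => st_Y (Gam th r e t)) theta0 rho eps).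

Lemma analytic_family_limit eps0 J P Gam th eps t p : analytic_family eps0 J P Gam ->
  0 < eps0 -> 0 < eps < eps0 -> J t -> Gam th 0 eps t = p ->
  forall e, 0 < e -> exists d, 0 < d /\ forall rho, 0 < rho < d ->
    Rabs (st_theta (Gam th rho eps t) - st_theta p) < e /\
    Rabs (st_X (Gam th rho eps t) - st_X p) < e /\ Rabs (st_Y (Gam th rho eps t) - st_Y p) < e.
Proof.
  intros HG H0 He Ht <- e Hep.
  destruct (HG th 0 eps ltac:(unfold param_range; lra)) as [_ [_ HA]]. destruct (HA t Ht) as [A1 [A2 A3]].
  destruct (analytic3_continuous_second _ _ _ _ A1 e Hep) as [d1 [Hd1 B1]].
  destruct (analytic3_continuous_second _ _ _ _ A2 e Hep) as [d2 [Hd2 B2]].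
  destruct (analytic3_continuous_second _ _ _ _ A3 e Hep) as [d3 [Hd3 B3]].
  exists (Rmin d1 (Rmin d2 d3)). split; [repeat apply Rmin_pos; assumption|]. intros rho Hr.
  pose proof (Rmin_l d1 (Rmin d2 d3)). pose proof (Rmin_r d1 (Rmin d2 d3)).
  pose proof (Rmin_l d2 d3). pose proof (Rmin_r d2 d3).
  assert (Ha : Rabs rho = rho) by (apply Rabs_pos_eq; lra).
  specialize (B1 rho ltac:(rewrite Ha; lra)). specialize (B2 rho ltac:(rewrite Ha; lra)). specialize (B3 rho ltac:(rewrite Ha; lra)).
  rewrite Rplus_0_l in B1, B2, B3. split; [exact B1|split; [exact B2|exact B3]].
Qed.

Lemma quotient_bound_limit (u : R -> R) (m : R) :
  (exists d, 0 < d /\ forall rho, 0 < rho < d -> Rabs ((u rho - 1) / rho + m) <= 1) ->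
  forall e, 0 < e -> exists d, 0 < d /\ forall rho, 0 < rho < d -> Rabs (u rho - 1) < e.
Proof.
  intros [d [Hd H]] e He. pose proof (Rabs_pos m) as Hm.
  exists (Rmin d (e / (2 * (1 + Rabs m)))).
  split; [apply Rmin_pos; [exact Hd|apply Rdiv_lt_0_compat; lra]|]. intros rho Hr.
  pose proof (Rmin_l d (e / (2 * (1 + Rabs m)))). pose proof (Rmin_r d (e / (2 * (1 + Rabs m)))).
  specialize (H rho ltac:(lra)).
  replace (u rho - 1) with (rho * ((u rho - 1) / rho + m + - m)) by (field; lra).
  rewrite Rabs_mult, (Rabs_pos_eq rho) by lra.
  apply Rle_lt_trans with (rho * (1 + Rabs m)).
  - apply Rmult_le_compat_l; [lra|]. eapply Rle_trans; [apply Rabs_triang|]. rewrite Rabs_Ropp. lra.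
  - apply Rle_lt_trans with (e / (2 * (1 + Rabs m)) * (1 + Rabs m)); [apply Rmult_le_compat_r; lra|].
    replace (e / (2 * (1 + Rabs m)) * (1 + Rabs m)) with (e / 2) by (field; lra). lra.
Qed.

(** The unstable family enters through its mirror image, a stable orbit with angle - th, so
    [stable_splitting] serves both sides. At time 0 the mirror image has the same X and the same U
    equation, as the distances are even in the angle. *)
Lemma splitting_ratio Dp Dm r eps0 GS GU eps th :
  small_neighborhood (/ 100) loop_plus Dp -> small_neighborhood (/ 100) loop_minus Dm ->
  0 < r < / 100 -> 0 < eps0 -> 0 < eps < eps0 -> eps <= / 10 ^ 9 ->
  analytic_family eps0 (fun t => 0 <= t) (primary_stable Dp r) GS ->
  analytic_family eps0 (fun t => t <= 0) (primary_unstable Dm r) GU ->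
  forall e, 0 < e -> exists S0, 0 <= S0 /\ forall S, S0 <= S -> exists d, 0 < d /\ forall rho, 0 < rho < d ->
    Rabs (2 * sqrt 2 * eps ^ 3 * ((st_X (GS th rho eps 0) - st_X (GU th rho eps 0)) / rho)
          - melnikov eps th (sinh S)) <= e.
Proof.
  intros HDp HDm Hr H0 He He9 HGS HGU e Hep.
  assert (He' : 0 < eps <= / 10 ^ 9) by lra.
  assert (Hrng : forall rho, 0 <= rho < 1 / 2 -> param_range eps0 rho eps) by (intros; unfold param_range; lra).
  assert (HS : forall rho, 0 < rho < 1 / 2 -> exists g, stable_orbit rho eps th g /\ forall t, 0 <= t -> g t = GS th rho eps t).
  { intros rho Hrho. destruct (HGS th rho eps (Hrng rho ltac:(lra))) as [HP _].
    destruct (primary_stable_orbit Dp r rho eps th _ ltac:(lra) He' (small_neighborhood_near Dp (/ 100) ltac:(lra) HDp) ltac:(lra) HP) as [g [Eg Hg]].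
    exists g. split; assumption. }
  assert (HU : forall rho, 0 < rho < 1 / 2 -> exists g, stable_orbit rho eps (- th) g /\
     forall t, 0 <= t -> g t = mirror (GU th rho eps (- t))).
  { intros rho Hrho. destruct (HGU th rho eps (Hrng rho ltac:(lra))) as [HP _].
    destruct (primary_stable_orbit _ r rho eps (- th) _ ltac:(lra) He' (mirror_near Dm (/ 100) ltac:(lra) HDm) ltac:(lra)
      (mirror_primary _ _ _ _ _ _ HP)) as [g [Eg Hg]].
    exists g. split; assumption. }
  assert (E0S : forall t, 0 <= t -> GS th 0 eps t = free_orbit eps th t).
  { intros t Ht. destruct (HGS th 0 eps (Hrng 0 ltac:(lra))) as [_ [Hun _]]. symmetry. apply Hun; [|exact Ht].
    apply free_orbit_stable; [exact He'|lra|apply HDp]. }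
  assert (E0U : forall t, t <= 0 -> GU th 0 eps t = free_orbit eps th t).
  { intros t Ht. destruct (HGU th 0 eps (Hrng 0 ltac:(lra))) as [_ [Hun _]]. symmetry. apply Hun; [|exact Ht].
    apply free_orbit_unstable; [exact He'|lra|apply HDm]. }
  assert (LS : forall t, 0 <= t -> forall e, 0 < e -> exists d, 0 < d /\ forall rho, 0 < rho < d ->
     Rabs (st_theta (GS th rho eps t) - (th + phase eps (sinh t))) < e /\ Rabs (st_X (GS th rho eps t) - a_sol t) < e).
  { intros t Ht e1 He1.
    destruct (analytic_family_limit eps0 _ _ GS th eps t _ HGS H0 He Ht (E0S t Ht) e1 He1) as [d [Hd B]].
    exists d. split; [exact Hd|]. intros rho Hrho. destruct (B rho Hrho) as [B1 [B2 _]]. split; [exact B1|exact B2]. }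
  assert (LU : forall t, 0 <= t -> forall e, 0 < e -> exists d, 0 < d /\ forall rho, 0 < rho < d ->
     Rabs (st_theta (mirror (GU th rho eps (- t))) - (- th + phase eps (sinh t))) < e /\
     Rabs (st_X (mirror (GU th rho eps (- t))) - a_sol t) < e).
  { intros t Ht e1 He1.
    destruct (analytic_family_limit eps0 _ _ GU th eps (- t) _ HGU H0 He ltac:(simpl; lra) (E0U (- t) ltac:(lra)) e1 He1) as [d [Hd B]].
    exists d. split; [exact Hd|]. intros rho Hrho. destruct (B rho Hrho) as [B1 [B2 _]].
    split.
    - change (st_theta (mirror (GU th rho eps (- t)))) with (- st_theta (GU th rho eps (- t))).
      change (st_theta (free_orbit eps th (- t))) with (th + phase eps (sinh (- t))) in B1.
      assert (Es : sinh (- t) = - sinh t) by (unfold sinh; rewrite Ropp_involutive; field).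
      rewrite Es, phase_opp in B1.
      rewrite <- Rabs_Ropp. replace (- (- st_theta (GU th rho eps (- t)) - (- th + phase eps (sinh t)))) with
        (st_theta (GU th rho eps (- t)) - (th + - phase eps (sinh t))) by ring. exact B1.
    - change (st_X (mirror (GU th rho eps (- t)))) with (st_X (GU th rho eps (- t))).
      change (st_X (free_orbit eps th (- t))) with (a_sol (- t)) in B2. rewrite (proj1 (loop_reflect t)) in B2. exact B2. }
  set (us := fun rho => Ufun rho eps (GS th rho eps 0)).
  set (uu := fun rho => Ufun rho eps (mirror (GU th rho eps (- 0)))).
  destruct (stable_splitting eps th (fun rho => GS th rho eps) (1 / 2) He' ltac:(lra) HS LS (Rmin 1 (e / 4)) ltac:(apply Rmin_pos; lra)) as [S1 [HS1 T1]].
  destruct (stable_splitting eps (- th) (fun rho t => mirror (GU th rho eps (- t))) (1 / 2) He' ltac:(lra) HU LU (Rmin 1 (e / 4)) ltac:(apply Rmin_pos; lra)) as [S2 [HS2 T2]].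
  pose proof (Rmin_l 1 (e / 4)) as M1. pose proof (Rmin_r 1 (e / 4)) as M2.
  exists (Rmax S1 S2). pose proof (Rmax_l S1 S2). pose proof (Rmax_r S1 S2). split; [lra|].
  intros S HSS. destruct (T1 S ltac:(lra)) as [d1 [Hd1 A1]]. destruct (T2 S ltac:(lra)) as [d2 [Hd2 A2]].
  cbv beta in A1, A2.
  assert (Hbox : forall rho, 0 < rho < 1 / 2 ->
    st_theta (GS th rho eps 0) = th /\ st_Y (GS th rho eps 0) = 0 /\ 0 < st_X (GS th rho eps 0) <= 3 / 2 /\
    st_theta (mirror (GU th rho eps (- 0))) = - th /\ st_Y (mirror (GU th rho eps (- 0))) = 0 /\ 0 < st_X (mirror (GU th rho eps (- 0))) <= 3 / 2).
  { intros rho Hrho. destruct (HS rho Hrho) as [g [Hg Eg]]. destruct (HU rho Hrho) as [g' [Hg' Eg']].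
    assert (B := stable_orbit_box rho eps th g 0 Hg ltac:(lra)). assert (B' := stable_orbit_box rho eps (- th) g' 0 Hg' ltac:(lra)).
    destruct Hg as [_ [_ [G1 [G2 _]]]]. destruct Hg' as [_ [_ [G1' [G2' _]]]].
    rewrite Eg in * by lra. rewrite Eg' in * by lra.
    split; [exact G1|]. split; [exact G2|]. split; [apply B|]. split; [exact G1'|]. split; [exact G2'|apply B']. }
  rewrite melnikov_halves by exact He'.
  set (m := half_melnikov eps th (sinh S) - half_melnikov eps (- th) (sinh S)).
  destruct (X_splitting eps th (fun rho => st_X (GS th rho eps 0)) (fun rho => st_X (GU th rho eps 0)) us uu m (e / 2) He' ltac:(lra)) as [d [Hd A]].
  - exists (1 / 2). split; [lra|]. intros rho Hrho. destruct (Hbox rho Hrho) as [B1 [B2 [B3 [B4 [B5 B6]]]]].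
    assert (Z : Rabs 0 <= 2) by (rewrite Rabs_R0; lra).
    split.
    + destruct (Ufun_spec rho eps (GS th rho eps 0) ltac:(lra) He' B3 ltac:(rewrite B2; exact Z)) as [_ [_ [_ E]]].
      rewrite B1, B2 in E. exact E.
    + destruct (Ufun_spec rho eps (mirror (GU th rho eps (- 0))) ltac:(lra) He' B6 ltac:(rewrite B5; exact Z)) as [_ [_ [_ E]]].
      rewrite B4, B5 in E. fold (uu rho) in E.
      change (st_X (mirror (GU th rho eps (- 0)))) with (st_X (GU th rho eps (- 0))) in E. rewrite Ropp_0 in E.
      unfold energy in *. destruct (mirror_R13 rho eps (uu rho) th (st_X (GU th rho eps 0))) as [-> ->] in E. exact E.
  - intros e1 He1.
    destruct (LS 0 ltac:(lra) e1 He1) as [d3 [Hd3 B3]]. destruct (LU 0 ltac:(lra) e1 He1) as [d4 [Hd4 B4]].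
    destruct (quotient_bound_limit us (half_melnikov eps th (sinh S))) with (e := e1) as [d5 [Hd5 B5]]; [|exact He1|].
    { exists d1. split; [exact Hd1|]. intros rho Hrho. unfold us. specialize (A1 rho Hrho). lra. }
    destruct (quotient_bound_limit uu (half_melnikov eps (- th) (sinh S))) with (e := e1) as [d6 [Hd6 B6]]; [|exact He1|].
    { exists d2. split; [exact Hd2|]. intros rho Hrho. unfold uu. specialize (A2 rho Hrho). lra. }
    exists (Rmin (Rmin d3 d4) (Rmin d5 d6)). split; [repeat apply Rmin_pos; assumption|]. intros rho Hrho.
    pose proof (Rmin_l (Rmin d3 d4) (Rmin d5 d6)). pose proof (Rmin_r (Rmin d3 d4) (Rmin d5 d6)).
    pose proof (Rmin_l d3 d4). pose proof (Rmin_r d3 d4). pose proof (Rmin_l d5 d6). pose proof (Rmin_r d5 d6).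
    assert (Ea : a_sol 0 = sqrt 2) by (assert (F := free_orbit_0 eps th ltac:(lra)); apply (f_equal st_X) in F; exact F).
    destruct (B3 rho ltac:(lra)) as [_ C3]. destruct (B4 rho ltac:(lra)) as [_ C4].
    rewrite Ea in C3, C4. change (st_X (mirror (GU th rho eps (- 0)))) with (st_X (GU th rho eps (- 0))) in C4. rewrite Ropp_0 in C4.
    split; [exact C3|]. split; [exact C4|]. split; [apply B5; lra|apply B6; lra].
  - exists (Rmin d1 d2). split; [apply Rmin_pos; assumption|]. intros rho Hrho.
    pose proof (Rmin_l d1 d2). pose proof (Rmin_r d1 d2).
    specialize (A1 rho ltac:(lra)). specialize (A2 rho ltac:(lra)). fold (us rho) in A1. fold (uu rho) in A2.
    replace ((us rho - uu rho) / rho + m) with (((us rho - 1) / rho + half_melnikov eps th (sinh S)) +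
      - ((uu rho - 1) / rho + half_melnikov eps (- th) (sinh S))) by (unfold m; field; lra).
    eapply Rle_trans; [apply Rabs_triang|]. rewrite Rabs_Ropp. lra.
  - exists d. split; [exact Hd|]. intros rho Hrho. specialize (A rho Hrho). cbv beta in A.
    replace (2 * (e / 2)) with e in A by field. exact A.
Qed.

(** Yields the limit of the splitting ratio without prior knowledge that the cut-off Melnikov
    integrals converge: one large S already makes the ratio Cauchy as [rho] decreases to 0. *)
Lemma right_limit_cauchy (q : R -> R) :
  (forall e, 0 < e -> exists d, 0 < d /\ forall k k', 0 < k < d -> 0 < k' < d -> Rabs (q k - q k') < e) ->
  exists l, forall e, 0 < e -> exists d, 0 < d /\ forall k, 0 < k < d -> Rabs (q k - l) < e.
Proof.
  intros H.
  destruct (proj1 (filterlim_locally_cauchy (U := R_CompleteSpace) (F := at_right 0) q)) as [l Hl].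
  - intros [e He]. destruct (H e He) as [d [Hd B]].
    exists (fun k => 0 < k < d). split.
    + exists (mkposreal d Hd). intros y Hy Hy0. change (Rabs (y - 0) < d) in Hy. rewrite Rminus_0_r in Hy.
      apply Rabs_def2 in Hy. lra.
    + intros u v Hu Hv. exact (B v u Hv Hu).
  - exists l. intros e He. destruct (proj1 (filterlim_locally q l) Hl (mkposreal e He)) as [[d Hd] B].
    exists d. split; [exact Hd|]. intros k Hk. apply (B k); [|lra].
    change (Rabs (k - 0) < d). rewrite Rminus_0_r, Rabs_pos_eq; lra.
Qed.

Lemma sinh_ge_self S : 0 <= S -> S <= sinh S.
Proof.
  intros HS. assert (sinh 0 - 0 <= sinh S - S); [|rewrite sinh_0 in *; lra].
  apply (derive_nonneg_le (fun t => sinh t - t) (fun t => cosh t - 1)); [exact HS| |].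
  - intros t _. apply (is_derive_minus (V := R_NormedModule)); [apply is_derive_sinh|apply (is_derive_id (K := R_AbsRing))].
  - intros t _. destruct (a_sol_cosh t) as [_ [Hc _]]. lra.
Qed.

Lemma splitting_zero Dp Dm r eps0 GS GU eps :
  small_neighborhood (/ 100) loop_plus Dp -> small_neighborhood (/ 100) loop_minus Dm ->
  0 < r < / 100 -> 0 < eps0 -> 0 < eps < eps0 -> eps <= / 10 ^ 9 ->
  analytic_family eps0 (fun t => 0 <= t) (primary_stable Dp r) GS ->
  analytic_family eps0 (fun t => t <= 0) (primary_unstable Dm r) GU ->
  exists k1, 0 < k1 /\ forall rho, 0 < rho < k1 -> exists th d',
    st_X (GS th rho eps 0) = st_X (GU th rho eps 0) /\
    is_derive (fun t => st_X (GS t rho eps 0) - st_X (GU t rho eps 0)) th d' /\ d' <> 0.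
Proof.
  intros HDp HDm Hr H0 He He9 HGS HGU.
  assert (He' : 0 < eps <= / 10 ^ 9) by lra.
  assert (Hrng0 : param_range eps0 0 eps) by (unfold param_range; lra).
  assert (HR := fun th => splitting_ratio Dp Dm r eps0 GS GU eps th HDp HDm Hr H0 He He9 HGS HGU).
  destruct sqrt2_bounds as [_ Hs2].
  set (K := 2 * sqrt 2 * eps ^ 3) in *.
  assert (HK : 0 < K) by (apply Rmult_lt_0_compat; [lra|apply pow_lt; lra]).
  set (q := fun th rho => (st_X (GS th rho eps 0) - st_X (GU th rho eps 0)) / rho) in *.
  (* The limit of the ratio at each angle, proved to exist uniquely and then named [m]; K m is the
     full Melnikov integral. *)
  set (P := fun th l => forall e, 0 < e -> exists d, 0 < d /\ forall k, 0 < k < d -> Rabs (q th k - l) < e).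
  assert (HP : forall th, exists! l, P th l).
  { intros th.
    assert (Hex : exists l, P th l).
    { apply right_limit_cauchy. intros e Hep.
      destruct (HR th (K * e / 4) ltac:(apply Rdiv_lt_0_compat; [apply Rmult_lt_0_compat; lra|lra])) as [S0 [HS0 A]].
      destruct (A S0 ltac:(lra)) as [d [Hd B]]. exists d. split; [exact Hd|]. intros k k' Hk Hk'.
      assert (B1 := B k Hk). assert (B2 := B k' Hk').
      apply Rabs_le_between in B1, B2. fold (q th k) in B1. fold (q th k') in B2.
      assert (Rabs (K * (q th k - q th k')) <= K * e / 2) by (apply Rabs_le; lra).
      rewrite Rabs_mult, (Rabs_pos_eq K) in H by lra. apply Rmult_lt_reg_l with K; [exact HK|].
      assert (0 < K * e) by (apply Rmult_lt_0_compat; assumption). lra. }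
    destruct Hex as [l Hl]. exists l. split; [exact Hl|]. intros l' Hl'.
    apply Rminus_diag_uniq. apply Rabs_eq_0.
    apply Rle_antisym; [|apply Rabs_pos]. apply le_epsilon. intros e Hep.
    destruct (Hl (e / 2) ltac:(lra)) as [d1 [Hd1 B1]]. destruct (Hl' (e / 2) ltac:(lra)) as [d2 [Hd2 B2]].
    assert (Hm : 0 < Rmin d1 d2) by (apply Rmin_pos; assumption).
    pose proof (Rmin_l d1 d2). pose proof (Rmin_r d1 d2).
    specialize (B1 (Rmin d1 d2 / 2) ltac:(lra)). specialize (B2 (Rmin d1 d2 / 2) ltac:(lra)).
    apply Rabs_def2 in B1, B2. apply Rabs_le. lra. }
  set (m := fun th => iota (P th)).
  assert (Hm : forall th, P th (m th)) by (intros th; exact (iota_correct _ (HP th))).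
  assert (Hmel : forall th e, 0 < e -> exists S0, forall S, S0 <= S -> Rabs (K * m th - melnikov eps th (sinh S)) <= e).
  { intros th e Hep. destruct (HR th (e / 2) ltac:(lra)) as [S0 [_ A]]. exists S0. intros S HS.
    destruct (A S HS) as [d [Hd B]].
    destruct (Hm th (e / (2 * K)) ltac:(apply Rdiv_lt_0_compat; lra)) as [d2 [Hd2 B2]].
    assert (Hmin : 0 < Rmin d d2) by (apply Rmin_pos; assumption).
    pose proof (Rmin_l d d2). pose proof (Rmin_r d d2).
    specialize (B (Rmin d d2 / 2) ltac:(lra)). specialize (B2 (Rmin d d2 / 2) ltac:(lra)).
    fold (q th (Rmin d d2 / 2)) in B. set (qq := q th (Rmin d d2 / 2)) in *.
    replace (K * m th - melnikov eps th (sinh S)) with ((K * qq - melnikov eps th (sinh S)) + - (K * (qq - m th))) by ring.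
    eapply Rle_trans; [apply Rabs_triang|]. rewrite Rabs_Ropp, Rabs_mult, (Rabs_pos_eq K) by lra.
    assert (HKq : K * Rabs (qq - m th) <= K * (e / (2 * K))) by (apply Rmult_le_compat_l; lra).
    replace (K * (e / (2 * K))) with (e / 2) in HKq by (field; lra). lra. }
  destruct (melnikov_lower eps He') as [c [Hc HcM]].
  assert (E0S : forall th, st_X (GS th 0 eps 0) = st_X (GU th 0 eps 0)).
  { intros th. destruct (HGS th 0 eps Hrng0) as [_ [U1 _]]. destruct (HGU th 0 eps Hrng0) as [_ [U2 _]].
    rewrite <- (U1 (free_orbit eps th)) with (t := 0), <- (U2 (free_orbit eps th)) with (t := 0).
    - reflexivity.
    - apply free_orbit_unstable; [exact He'|lra|apply HDm].
    - simpl; lra.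
    - apply free_orbit_stable; [exact He'|lra|apply HDp].
    - simpl; lra. }
  destruct (HGS 0 0 eps Hrng0) as [_ [_ AS]]. destruct (HGU 0 0 eps Hrng0) as [_ [_ AU]].
  destruct (AS 0 ltac:(simpl; lra)) as [_ [AS1 _]]. destruct (AU 0 ltac:(simpl; lra)) as [_ [AU1 _]].
  (* At th = 0 the two half integrals coincide. *)
  assert (Hm0 : m 0 = 0).
  { assert (K * m 0 = 0); [|apply Rmult_integral in H; destruct H; [lra|assumption]].
    apply Rabs_eq_0, Rle_antisym; [|apply Rabs_pos]. apply le_epsilon. intros e Hep.
    destruct (Hmel 0 e Hep) as [S0 A]. specialize (A S0 (Rle_refl _)).
    rewrite melnikov_halves, Ropp_0, Rminus_diag, Rminus_0_r in A by exact He'. lra. }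
  (* On [0, 1] one has sin h >= h / 2, whence the slope c / (2 K). The error e is taken to 0 after
     the cut-off has been chosen for it. *)
  assert (Hmc : forall h, 0 < h < 1 -> c / (2 * K) * h <= m h).
  { intros h Hh. assert (Hpi := PI2_1). 
    assert (c * (h / 2) <= K * m h).
    { apply le_epsilon. intros e Hep.
      destruct (Hmel h (e / 2) ltac:(lra)) as [S0 A].
      destruct (HcM h (e / 2) ltac:(lra) ltac:(lra)) as [T0 [HT0 B]].
      set (S := Rmax S0 T0). pose proof (Rmax_l S0 T0). pose proof (Rmax_r S0 T0).
      specialize (A S ltac:(unfold S; lra)).
      specialize (B (sinh S) ltac:(assert (S <= sinh S) by (apply sinh_ge_self; unfold S; lra); unfold S in *; lra)).
      assert (Hsin := sin_ge_half h ltac:(lra)). apply Rabs_le_between in A.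
      assert (c * (h / 2) <= c * sin h) by (apply Rmult_le_compat_l; lra). lra. }
    apply Rmult_le_reg_l with K; [exact HK|]. replace (K * (c / (2 * K) * h)) with (c * (h / 2)) by (field; lra). exact H. }
  destruct (analytic3_simple_zero (fun th rr e => st_X (GS th rr e 0)) (fun th rr e => st_X (GU th rr e 0)) 0 0 eps
     (c / (2 * K)) 1 m AS1 AU1) with (eta := 1) as [k1 [Hk1 Z]].
  - exact E0S.
  - apply Rdiv_lt_0_compat; lra.
  - lra.
  - exact Hm0.
  - exact Hmc.
  - intros h _ e Hep. destruct (Hm h e Hep) as [d [Hd B]]. exists d. split; [exact Hd|]. intros k Hk.
    rewrite !Rplus_0_l. exact (B k Hk).
  - lra.
  - exists k1. split; [exact Hk1|]. intros rho Hrho. destruct (Z rho Hrho) as [h [d' [_ [Z1 [Z2 Z3]]]]].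
    exists (0 + h), d'. rewrite !Rplus_0_l in *. split; [exact Z1|]. split; [exact Z2|exact Z3].
Qed.

(** * Transversality along the homoclinic orbit *)

(** Limits are taken in each factor. This makes the state space complete, which [picard] and the
    Gronwall lemmas require. *)
Definition prod_lim {U V : CompleteSpace} (F : (U * V -> Prop) -> Prop) : U * V :=
  (lim (filtermap fst F), lim (filtermap snd F)).

Lemma prod_lim_ax1 {U V : CompleteSpace} (F : (prod_UniformSpace U V -> Prop) -> Prop) : ProperFilter F ->
  (forall eps : posreal, exists x : prod_UniformSpace U V, F (ball x eps)) ->
  forall eps : posreal, F (ball (prod_lim F : prod_UniformSpace U V) eps).
Proof.
  intros HF Hc eps.
  assert (H1 : F (fun q => ball (lim (filtermap fst F)) eps (fst q))).
  { apply (complete_cauchy (T := U) (filtermap fst F)).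
    - apply filtermap_proper_filter, HF.
    - intros e. destruct (Hc e) as [x Hx]. exists (fst x). unfold filtermap.
      apply (filter_imp _ _ (fun q (Hq : ball x e q) => proj1 Hq) Hx). }
  assert (H2 : F (fun q => ball (lim (filtermap snd F)) eps (snd q))).
  { apply (complete_cauchy (T := V) (filtermap snd F)).
    - apply filtermap_proper_filter, HF.
    - intros e. destruct (Hc e) as [x Hx]. exists (snd x). unfold filtermap.
      apply (filter_imp _ _ (fun q (Hq : ball x e q) => proj2 Hq) Hx). }
  apply (filter_imp (fun q => ball (lim (filtermap fst F)) eps (fst q) /\ ball (lim (filtermap snd F)) eps (snd q))).
  - intros q Hq. exact Hq.
  - apply filter_and; assumption.
Qed.

Lemma prod_lim_ax2 {U V : CompleteSpace} (F1 F2 : (prod_UniformSpace U V -> Prop) -> Prop) :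
  filter_le F1 F2 -> filter_le F2 F1 -> close (prod_lim F1 : prod_UniformSpace U V) (prod_lim F2).
Proof.
  intros H1 H2 eps. split.
  - apply (close_lim (T := U)); intros P HP; [apply H1, HP|apply H2, HP].
  - apply (close_lim (T := V)); intros P HP; [apply H1, HP|apply H2, HP].
Qed.

Canonical prod_CompleteSpace (U V : CompleteSpace) : CompleteSpace :=
  CompleteSpace.Pack (U * V) (CompleteSpace.Class _ (UniformSpace.class (prod_UniformSpace U V))
    (CompleteSpace.Mixin _ prod_lim prod_lim_ax1 prod_lim_ax2)) (U * V).

(** The same carrier and norm as [state], packed with completeness, so that results for the two
    types agree by conversion. *)
Definition stateC : CompleteNormedModule R_AbsRing :=
  CompleteNormedModule.Pack R_AbsRing (R * R * R)
    (CompleteNormedModule.Class R_AbsRing (R * R * R) (NormedModule.class R_AbsRing state)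
      (CompleteSpace.mixin _ (CompleteSpace.class (prod_CompleteSpace (prod_CompleteSpace R_CompleteSpace R_CompleteSpace) R_CompleteSpace))))
    (R * R * R).

Lemma C11v_of_comp (B : state -> Prop) (f : state -> state) :
  exC11 B (fun p => st_theta (f p)) -> exC11 B (fun p => st_X (f p)) -> exC11 B (fun p => st_Y (f p)) ->
  exists D, C11v B f D.
Proof.
  intros [D1 [C1 [HC1 H1]]] [D2 [C2 [HC2 H2]]] [D3 [C3 [HC3 H3]]].
  exists (fun p v => mk_state (D1 p v) (D2 p v) (D3 p v)), (C1 + C2 + C3). split; [lra|].
  intros p Hp. destruct (H1 p Hp) as [A1 [S1 [_ [N1 T1]]]]. destruct (H2 p Hp) as [A2 [S2 [_ [N2 T2]]]].
  destruct (H3 p Hp) as [A3 [S3 [_ [N3 T3]]]].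
  split; [|split; [|split]].
  - intros u v. rewrite A1, A2, A3. reflexivity.
  - intros k v. rewrite S1, S2, S3. reflexivity.
  - intros v. eapply Rle_trans; [apply norm_state_le|]. specialize (N1 v). specialize (N2 v). specialize (N3 v).
    unfold st_theta, st_X, st_Y, mk_state; simpl. lra.
  - intros q Hq. destruct (T1 q Hq) as [U1 V1]. destruct (T2 q Hq) as [U2 V2]. destruct (T3 q Hq) as [U3 V3]. split.
    + intros v. specialize (U1 v). specialize (U2 v). specialize (U3 v).
      eapply Rle_trans; [apply norm_state_le|].
      change (Rabs (D1 q v - D1 p v) + Rabs (D2 q v - D2 p v) + Rabs (D3 q v - D3 p v) <= (C1 + C2 + C3) * dist q p * norm v). lra.
    + eapply Rle_trans; [apply norm_state_le|].
      change (Rabs (st_theta (f q) - st_theta (f p) - D1 p (minus q p)) + Rabs (st_X (f q) - st_X (f p) - D2 p (minus q p)) +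
        Rabs (st_Y (f q) - st_Y (f p) - D3 p (minus q p)) <= (C1 + C2 + C3) * dist q p ^ 2). lra.
Qed.

Lemma lip_of_comp (B : state -> Prop) (f : state -> state) :
  exC11 B (fun p => st_theta (f p)) -> exC11 B (fun p => st_X (f p)) -> exC11 B (fun p => st_Y (f p)) ->
  exists L, 0 <= L /\ forall p q, B p -> B q -> dist (f p) (f q) <= L * dist p q.
Proof.
  intros [D1 H1] [D2 H2] [D3 H3].
  destruct (C11_lip _ _ _ H1) as [L1 [HL1 A1]]. destruct (C11_lip _ _ _ H2) as [L2 [HL2 A2]].
  destruct (C11_lip _ _ _ H3) as [L3 [HL3 A3]].
  exists (L1 + L2 + L3). split; [lra|]. intros p q Hp Hq.
  specialize (A1 q p Hq Hp). specialize (A2 q p Hq Hp). specialize (A3 q p Hq Hp).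
  eapply Rle_trans; [apply norm_state_le|].
  change (Rabs (st_theta (f p) - st_theta (f q)) + Rabs (st_X (f p) - st_X (f q)) + Rabs (st_Y (f p) - st_Y (f q))
    <= (L1 + L2 + L3) * dist p q). lra.
Qed.

Definition clamp_state (c : R) (p : state) : state :=
  mk_state (st_theta p) (clamp c (3 / 2) (st_X p)) (clamp (-2) 2 (st_Y p)).

Lemma clamp_state_box c p : c <= 3 / 2 -> box c (clamp_state c p).
Proof.
  intros Hc. unfold box, clamp_state, st_X, st_Y, mk_state; simpl. split; [apply clamp_range, Hc|].
  apply Rabs_le. apply clamp_range. lra.
Qed.

Lemma clamp_state_id c p : box c p -> clamp_state c p = p.
Proof.
  intros [Hx Hy]. apply Rabs_le_between in Hy. unfold clamp_state. rewrite !clamp_id by assumption.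
  destruct p as [[th x] y]. reflexivity.
Qed.

Lemma clamp_state_lip c p q : c <= 3 / 2 -> dist (clamp_state c p) (clamp_state c q) <= 3 * dist p q.
Proof.
  intros Hc. eapply Rle_trans; [apply norm_state_le|].
  change (Rabs (st_theta p - st_theta q) + Rabs (clamp c (3 / 2) (st_X p) - clamp c (3 / 2) (st_X q)) +
    Rabs (clamp (-2) 2 (st_Y p) - clamp (-2) 2 (st_Y q)) <= 3 * dist p q).
  destruct (norm_state_comp (minus p q)) as [N1 [N2 N3]].
  assert (C1 := clamp_lip c (3 / 2) (st_X p) (st_X q) Hc). assert (C2 := clamp_lip (-2) 2 (st_Y p) (st_Y q) ltac:(lra)).
  change (Rabs (st_theta p - st_theta q) <= dist p q) in N1. change (Rabs (st_X p - st_X q) <= dist p q) in N2.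
  change (Rabs (st_Y p - st_Y q) <= dist p q) in N3. lra.
Qed.

(* The vector field is only defined for [X > 0]; outside the box it is replaced
   by its value at the nearest point, which makes it globally Lipschitz. *)
Definition clamped_field (rho eps c : R) (p : state) : state := vfield rho eps (clamp_state c p).

Lemma clamped_field_spec rho eps c : 0 <= rho <= 1 / 2 -> 0 < eps <= / 10 ^ 9 -> 0 < c <= 3 / 2 ->
  (exists L, 0 < L /\ forall p q, dist (clamped_field rho eps c p) (clamped_field rho eps c q) <= L * dist p q) /\
  (forall p, box c p -> clamped_field rho eps c p = vfield rho eps p) /\
  exists D, C11v (box c) (clamped_field rho eps c) D /\ C11v (box c) (vfield rho eps) D.
Proof.
  intros Hr He Hc. destruct (exC11_vfield rho eps c Hr He ltac:(lra)) as [C1 [C2 C3]].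
  assert (E : forall p, box c p -> clamped_field rho eps c p = vfield rho eps p).
  { intros p Hp. unfold clamped_field. rewrite clamp_state_id by exact Hp. reflexivity. }
  split; [|split; [exact E|]].
  - destruct (lip_of_comp _ _ C1 C2 C3) as [L [HL H]]. exists (L * 3 + 1). split; [lra|]. intros p q.
    unfold clamped_field. eapply Rle_trans; [apply H; apply clamp_state_box; lra|].
    assert (X := clamp_state_lip c p q ltac:(lra)). pose proof (dist_pos p q).
    apply Rle_trans with (L * (3 * dist p q)); [apply Rmult_le_compat_l; assumption|lra].
  - destruct (C11v_of_comp _ _ C1 C2 C3) as [D HD]. exists D. split; [|exact HD].
    destruct HD as [C [HC H]]. exists C. split; [exact HC|]. intros p Hp.
    destruct (H p Hp) as [H1 [H2 [H3 H4]]]. split; [exact H1|]. split; [exact H2|]. split; [exact H3|].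
    intros q Hq. rewrite !E by assumption. apply H4, Hq.
Qed.

Lemma continuous_autonomous (f : state -> state) L : 0 <= L -> (forall p q, dist (f p) (f q) <= L * dist p q) ->
  forall y : R -> state, (forall t, continuous y t) -> forall t, continuous (fun t => f (y t)) t.
Proof. intros HL H y Hy t. apply (continuous_lip f L y t HL H), Hy. Qed.

(** * Orbits on compact intervals and the variational equation *)

Lemma compact_margin (f : R -> R) a b lo hi : a <= b ->
  (forall t, a <= t <= b -> continuity_pt f t /\ lo < f t < hi) ->
  exists m, 0 < m /\ forall t, a <= t <= b -> lo + m <= f t <= hi - m.
Proof.
  intros Hab H.
  destruct (continuity_ab_min f a b Hab) as [t1 [H1 B1]]; [intros; apply H; assumption|].
  destruct (continuity_ab_maj f a b Hab) as [t2 [H2 B2]]; [intros; apply H; assumption|].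
  destruct (H t1 B1) as [_ P1]. destruct (H t2 B2) as [_ P2].
  exists (Rmin (f t1 - lo) (hi - f t2)). split; [apply Rmin_pos; lra|]. intros t Ht.
  pose proof (Rmin_l (f t1 - lo) (hi - f t2)). pose proof (Rmin_r (f t1 - lo) (hi - f t2)).
  specialize (H1 t Ht). specialize (H2 t Ht). lra.
Qed.

Definition orbit_on (rho eps a b : R) (g : R -> state) : Prop :=
  forall t, a <= t <= b -> is_derive g t (vfield rho eps (g t)) /\ 0 < st_X (g t) < 3 / 2 /\ Rabs (st_Y (g t)) < 2.

Lemma orbit_on_box rho eps a b g : a <= b -> orbit_on rho eps a b g ->
  exists m, 0 < m < 1 /\ forall t, a <= t <= b -> m <= st_X (g t) <= 3 / 2 - m /\ Rabs (st_Y (g t)) <= 2 - m.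
Proof.
  intros Hab H.
  destruct (compact_margin (fun t => st_X (g t)) a b 0 (3 / 2) Hab) as [m1 [Hm1 B1]].
  { intros t Ht. destruct (H t Ht) as [Hd [Hx _]]. split; [|exact Hx].
    destruct (is_derive_state_comp g t _ Hd) as [_ [D2 _]]. exact (continuity_pt_is_derive _ _ _ D2). }
  destruct (compact_margin (fun t => st_Y (g t)) a b (-2) 2 Hab) as [m2 [Hm2 B2]].
  { intros t Ht. destruct (H t Ht) as [Hd [_ Hy]]. split; [|apply Rabs_def2 in Hy; lra].
    destruct (is_derive_state_comp g t _ Hd) as [_ [_ D3]]. exact (continuity_pt_is_derive _ _ _ D3). }
  exists (Rmin (/ 2) (Rmin m1 m2)). split.
  - split; [repeat apply Rmin_pos; lra|]. pose proof (Rmin_l (/ 2) (Rmin m1 m2)). lra.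
  - intros t Ht. specialize (B1 t Ht). specialize (B2 t Ht).
    pose proof (Rmin_r (/ 2) (Rmin m1 m2)). pose proof (Rmin_l m1 m2). pose proof (Rmin_r m1 m2).
    split; [lra|]. apply Rabs_le. lra.
Qed.

(** By compactness both orbits lie in a common box, where the clamped and globally Lipschitz field
    coincides with the true one. *)
Lemma orbit_on_unique rho eps T g1 g2 : 0 <= rho <= 1 / 2 -> 0 < eps <= / 10 ^ 9 -> 0 <= T ->
  orbit_on rho eps (- T) T g1 -> orbit_on rho eps (- T) T g2 -> g1 0 = g2 0 ->
  forall t, - T <= t <= T -> g1 t = g2 t.
Proof.
  intros Hr He HT H1 H2 E0 t Ht.
  destruct (orbit_on_box rho eps (- T) T g1 ltac:(lra) H1) as [m1 [Hm1 B1]].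
  destruct (orbit_on_box rho eps (- T) T g2 ltac:(lra) H2) as [m2 [Hm2 B2]].
  set (c := Rmin m1 m2). assert (Hc : 0 < c) by (apply Rmin_pos; lra).
  assert (Hc1 : c <= m1) by apply Rmin_l. assert (Hc2 : c <= m2) by apply Rmin_r.
  destruct (clamped_field_spec rho eps c Hr He ltac:(lra)) as [[L [HL HLip]] [E _]].
  apply (ode_unique (V := stateC) (fun _ => clamped_field rho eps c) L T 0 g1 g2); try lra.
  - intros _. exact HLip.
  - apply (continuous_autonomous (clamped_field rho eps c) L); [lra|exact HLip].
  - intros s Hs. destruct (B1 s Hs) as [X1 X2]. rewrite E; [apply H1, Hs|]. split; lra.
  - intros s Hs. destruct (B2 s Hs) as [X1 X2]. rewrite E; [apply H2, Hs|]. split; lra.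
  - exact E0.
Qed.

Lemma linear_field_spec (B : state -> Prop) (f : state -> state) (D : state -> state -> state) (gam : R -> state) (T : R) :
  0 <= T -> C11v B f D -> (forall t, - T <= t <= T -> B (gam t) /\ continuous gam t) ->
  exists L, 0 < L /\
    (forall t p q, dist (D (gam (clamp (- T) T t)) p) (D (gam (clamp (- T) T t)) q) <= L * dist p q) /\
    (forall y : R -> state, (forall t, continuous y t) -> forall t, continuous (fun t => D (gam (clamp (- T) T t)) (y t)) t).
Proof.
  intros HT HD Hg. assert (HD' := HD). destruct HD' as [C [HC H]]. exists (C + 1). split; [lra|].
  assert (HB : forall t, B (gam (clamp (- T) T t))) by (intros t; apply Hg, clamp_range; lra).
  split.
  - intros t p q. destruct (H _ (HB t)) as [A [S [N _]]]. unfold dist.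
    assert (E := additive_minus (V := state) (D (gam (clamp (- T) T t))) A S p q).
    rewrite <- E. eapply Rle_trans; [apply N|]. pose proof (norm_ge_0 (minus p q)). lra.
  - intros y Hy t. apply (C11v_continuous B f D HD (fun t => gam (clamp (- T) T t)) y t HB).
    + apply (continuous_clamp gam (- T) T); [lra|]. intros s Hs. apply Hg, Hs.
    + apply Hy.
Qed.

Lemma variational_exists (B : state -> Prop) (f : state -> state) (D : state -> state -> state) (gam : R -> state) (T t0 : R) (z : state) :
  0 <= T -> C11v B f D -> (forall t, - T <= t <= T -> B (gam t) /\ continuous gam t) -> - T <= t0 <= T ->
  exists W : R -> state, W t0 = z /\ forall t, - T <= t <= T -> is_derive W t (D (gam t) (W t)).
Proof.
  intros HT HD Hg Ht0. destruct (linear_field_spec B f D gam T HT HD Hg) as [L [HL [H1 H2]]].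
  destruct (picard (V := stateC) (fun t => D (gam (clamp (- T) T t))) L (2 * T) t0 z HL ltac:(lra) H1 H2) as [W [W0 HW]].
  exists W. split; [exact W0|]. intros t Ht. specialize (HW t ltac:(lra)). cbv beta in HW.
  rewrite clamp_id in HW by exact Ht. exact HW.
Qed.

Lemma variational_unique (B : state -> Prop) (f : state -> state) (D : state -> state -> state) (gam W1 W2 : R -> state) (T : R) :
  0 <= T -> C11v B f D -> (forall t, - T <= t <= T -> B (gam t) /\ continuous gam t) ->
  (forall t, - T <= t <= T -> is_derive W1 t (D (gam t) (W1 t))) ->
  (forall t, - T <= t <= T -> is_derive W2 t (D (gam t) (W2 t))) ->
  W1 0 = W2 0 -> forall t, - T <= t <= T -> W1 t = W2 t.
Proof.
  intros HT HD Hg D1 D2 E0 t Ht. destruct (linear_field_spec B f D gam T HT HD Hg) as [L [HL [H1 H2]]].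
  apply (ode_unique (V := stateC) (fun t => D (gam (clamp (- T) T t))) L T 0 W1 W2); try lra.
  - exact H1.
  - exact H2.
  - intros s Hs. cbv beta. rewrite clamp_id by exact Hs. apply D1, Hs.
  - intros s Hs. cbv beta. rewrite clamp_id by exact Hs. apply D2, Hs.
  - exact E0.
Qed.

Lemma orbit_on_tube a b m (g : R -> state) : 0 < m -> 
  (forall t, a <= t <= b -> m <= st_X (g t) <= 3 / 2 - m /\ Rabs (st_Y (g t)) <= 2 - m) ->
  forall t q, a <= t <= b -> dist q (g t) <= m / 2 ->
    box (m / 2) q /\ 0 < st_X q < 3 / 2 /\ Rabs (st_Y q) < 2.
Proof.
  intros Hm H t q Ht Hq. destruct (H t Ht) as [HX HY].
  destruct (norm_state_comp (minus q (g t))) as [_ [N2 N3]].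
  change (Rabs (st_X q - st_X (g t)) <= dist q (g t)) in N2. change (Rabs (st_Y q - st_Y (g t)) <= dist q (g t)) in N3.
  assert (N2' : Rabs (st_X q - st_X (g t)) <= m / 2) by lra. assert (N3' : Rabs (st_Y q - st_Y (g t)) <= m / 2) by lra.
  apply Rabs_le_between in N2', N3', HY.
  split; [split; [lra|apply Rabs_le; lra]|]. split; [lra|]. apply Rabs_def1; lra.
Qed.

(** The initial points are carried along by the clamped field, whose solutions exist on all of
    [- T, T]. For th near th0 they stay within m / 2 of [gam], where the clamp is inactive, so they
    are genuine orbits; their th-derivative solves the variational equation along [gam]. *)
Lemma sheet_core rho eps T gam m D (init : R -> state) th0 v0 :
  0 <= rho <= 1 / 2 -> 0 < eps <= / 10 ^ 9 -> 0 <= T -> 0 < m < 1 ->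
  orbit_on rho eps (- T) T gam ->
  (forall t, - T <= t <= T -> m <= st_X (gam t) <= 3 / 2 - m /\ Rabs (st_Y (gam t)) <= 2 - m) ->
  C11v (box (m / 2)) (vfield rho eps) D ->
  init th0 = gam 0 -> is_derive init th0 v0 ->
  exists (phi : R -> R -> state) (W : R -> state) (d : R), 0 < d /\
    (forall th, Rabs (th - th0) < d -> phi th 0 = init th /\ orbit_on rho eps (- T) T (phi th)) /\
    W 0 = v0 /\ (forall t, - T <= t <= T -> is_derive W t (D (gam t) (W t))) /\
    (forall t, - T <= t <= T -> is_derive (fun th => phi th t) th0 (W t)).
Proof.
  intros Hr He HT Hm Hg Hbox HD E0 Hv0.
  destruct (clamped_field_spec rho eps (m / 2) Hr He ltac:(lra)) as [[L [HL HLip]] [E _]].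
  assert (HDc : C11v (box (m / 2)) (clamped_field rho eps (m / 2)) D).
  { destruct HD as [C [HC H]]. exists C. split; [exact HC|]. intros p Hp. destruct (H p Hp) as [H1 [H2 [H3 H4]]].
    split; [exact H1|]. split; [exact H2|]. split; [exact H3|].
    intros q Hq. rewrite !E by assumption. apply H4, Hq. }
  assert (Htube := orbit_on_tube (- T) T m gam ltac:(lra) Hbox).
  assert (Hgb : forall t, - T <= t <= T -> box (m / 2) (gam t) /\ continuous gam t).
  { intros t Ht. split; [apply (Htube t (gam t) Ht); rewrite dist_refl; lra|].
    apply (continuous_is_derive gam t _ (proj1 (Hg t Ht))). }
  assert (Hpic : forall th, exists z : R -> state, z 0 = init th /\
    forall t, - T <= t <= T -> is_derive z t (clamped_field rho eps (m / 2) (z t))).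
  { intros th.
    destruct (picard (V := stateC) (fun _ => clamped_field rho eps (m / 2)) L T 0 (init th) HL HT (fun _ => HLip)
      (continuous_autonomous (clamped_field rho eps (m / 2)) L ltac:(lra) HLip)) as [z [Z0 Hz]].
    exists z. split; [exact Z0|]. intros t Ht. apply Hz. lra. }
  (* A solution is chosen for each th separately; regularity in th is proved afterwards and does not
     depend on the choice. *)
  set (phi := fun th => proj1_sig (constructive_indefinite_description _ (Hpic th))).
  assert (Hphi : forall th, phi th 0 = init th /\ forall t, - T <= t <= T -> is_derive (phi th) t (clamped_field rho eps (m / 2) (phi th t))).
  { intros th. exact (proj2_sig (constructive_indefinite_description _ (Hpic th))). }
  assert (Hgc : forall t, - T <= t <= T -> is_derive gam t (clamped_field rho eps (m / 2) (gam t))).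
  { intros t Ht. rewrite E by apply (Hgb t Ht). apply Hg, Ht. }
  destruct (variational_exists (box (m / 2)) (vfield rho eps) D gam T 0 v0 HT HD Hgb ltac:(lra)) as [W [W0 HW]].
  assert (Hexp : 0 < exp (L * T)) by apply exp_pos.
  (* Initial distances grow at most by the factor exp (L T), so this radius keeps the solutions in
     the tube of width m / 2. *)
  destruct (proj1 (continuous_dist init th0) (continuous_is_derive init th0 v0 Hv0) (m / 2 * / exp (L * T))) as [d [Hd Hclose]].
  { apply Rmult_lt_0_compat; [lra|apply Rinv_0_lt_compat, Hexp]. }
  exists phi, W, d. split; [exact Hd|]. split; [|split; [exact W0|split; [exact HW|]]].
  - intros th Hth. destruct (Hphi th) as [P0 P1]. split; [exact P0|]. intros t Ht.
    assert (Hdist : dist (phi th t) (gam t) <= m / 2).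
    { eapply Rle_trans.
      - apply (ode_close (V := stateC) (fun _ => clamped_field rho eps (m / 2)) L T (phi th) gam HT ltac:(lra)); try assumption.
        + intros _. exact HLip.
        + apply (continuous_autonomous (clamped_field rho eps (m / 2)) L); [lra|exact HLip].
      - change (dist (phi th 0) (gam 0) * exp (L * T) <= m / 2). rewrite P0, <- E0. specialize (Hclose th Hth).
        apply Rle_trans with (m / 2 * / exp (L * T) * exp (L * T)); [apply Rmult_le_compat_r; lra|].
        right. field. lra. }
    destruct (Htube t (phi th t) Ht Hdist) as [B1 [B2 B3]].
    split; [|split; assumption]. rewrite <- E by exact B1. apply P1, Ht.
  - apply (differentiable_dependence (V := stateC) (clamped_field rho eps (m / 2)) D (box (m / 2)) L T (m / 2) d th0 gam phi W v0);
      try assumption; try lra.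
    + intros t q Ht Hq. apply (Htube t q Ht Hq).
    + intros th _. apply Hphi.
    + rewrite (proj1 (Hphi th0)). exact E0.
    + apply (is_derive_ext init); [intros th; symmetry; apply Hphi|exact Hv0].
Qed.

(** For v = f (g t) this says that the velocity of an orbit solves the variational equation along
    it. *)
Lemma field_along_orbit (B : state -> Prop) (f : state -> state) D (g : R -> state) t v :
  C11v B f D -> (exists d, 0 < d /\ forall s, Rabs (s - t) < d -> B (g s)) ->
  is_derive g t v -> is_derive (fun s => f (g s)) t (D (g t) v).
Proof.
  intros [C [HC H]] [d0 [Hd0 HB]] Hd. apply is_derive_dist. intros e He.
  assert (Bt : B (g t)) by (apply HB; rewrite Rminus_diag, Rabs_R0; exact Hd0).
  destruct (H _ Bt) as [A [S [N T]]].
  set (M := norm v + 1). assert (HM : 1 <= M) by (unfold M; pose proof (norm_ge_0 v); lra).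
  set (e1 := Rmin 1 (e / (2 * (C + 1)))).
  assert (He1 : 0 < e1) by (apply Rmin_pos; [lra|apply Rdiv_lt_0_compat; lra]).
  assert (He1' : C * e1 <= e / 2).
  { apply Rle_trans with ((C + 1) * (e / (2 * (C + 1)))).
    - apply Rmult_le_compat; [exact HC|lra|lra|apply Rmin_r].
    - right. field. lra. }
  destruct (proj1 (is_derive_dist g t v) Hd e1 He1) as [d1 [Hd1 H1]].
  set (d2 := e / (2 * (C + 1) * M ^ 2)).
  assert (HM2 : 0 < M ^ 2) by (apply pow_lt; lra).
  assert (Hd2 : 0 < d2) by (apply Rdiv_lt_0_compat; [lra|apply Rmult_lt_0_compat; lra]).
  exists (Rmin d0 (Rmin d1 d2)). split; [repeat apply Rmin_pos; assumption|]. intros s Hs.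
  pose proof (Rmin_l d0 (Rmin d1 d2)). pose proof (Rmin_r d0 (Rmin d1 d2)).
  pose proof (Rmin_l d1 d2). pose proof (Rmin_r d1 d2).
  assert (Bs : B (g s)) by (apply HB; lra).
  specialize (H1 s ltac:(lra)). destruct (T (g s) Bs) as [_ T2].
  assert (Hinc : norm (minus (g s) (g t)) <= M * Rabs (s - t)).
  { eapply Rle_trans; [apply (norm_le_increment (minus (g s) (g t)) v (s - t) e1 H1)|].
    apply Rmult_le_compat_r; [apply Rabs_pos|]. unfold M. assert (e1 <= 1) by apply Rmin_l. lra. }
  set (a := minus (minus (f (g s)) (f (g t))) (D (g t) (minus (g s) (g t)))) in *.
  set (b := D (g t) (minus (minus (g s) (g t)) (scal (s - t) v))).
  replace (minus (minus (f (g s)) (f (g t))) (scal (s - t) (D (g t) v))) with (plus a b).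
  - eapply Rle_trans; [apply norm_triangle|].
    assert (Na : norm a <= e / 2 * Rabs (s - t)).
    { eapply Rle_trans; [exact T2|]. fold (dist (g s) (g t)) in Hinc. pose proof (dist_pos (g s) (g t)).
      pose proof (Rabs_pos (s - t)).
      assert (dist (g s) (g t) ^ 2 <= (M * Rabs (s - t)) ^ 2) by (apply pow_incr; lra).
      apply Rle_trans with (C * (M * Rabs (s - t)) ^ 2); [apply Rmult_le_compat_l; assumption|].
      apply Rle_trans with ((C + 1) * M ^ 2 * d2 * Rabs (s - t)).
      - replace (C * (M * Rabs (s - t)) ^ 2) with (C * (M ^ 2 * Rabs (s - t)) * Rabs (s - t)) by ring.
        apply Rmult_le_compat_r; [assumption|]. rewrite Rmult_assoc. apply Rmult_le_compat; [exact HC|apply Rmult_le_pos; lra|lra|].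
        apply Rmult_le_compat_l; lra.
      - right. unfold d2. field. lra. }
    assert (Nb : norm b <= e / 2 * Rabs (s - t)).
    { eapply Rle_trans; [apply N|]. apply Rle_trans with (C * (e1 * Rabs (s - t))); [apply Rmult_le_compat_l; assumption|].
      rewrite <- Rmult_assoc. apply Rmult_le_compat_r; [apply Rabs_pos|exact He1']. }
    lra.
  - unfold a, b. rewrite (additive_minus (V := state) (D (g t)) A S (minus (g s) (g t))), S.
    symmetry. apply minus_trans.
Qed.

Definition orbit_at (rho eps : R) (g : R -> state) (t : R) : Prop :=
  is_derive g t (vfield rho eps (g t)) /\ 0 < st_X (g t) < 3 / 2 /\ Rabs (st_Y (g t)) < 2.

(** The equation for U is even in theta and Y, so uniqueness of the root makes [Ufun] invariant
    under [mirror]. *)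
Lemma vfield_mirror rho eps p : 0 <= rho <= 1 / 2 -> 0 < eps <= / 10 ^ 9 ->
  0 < st_X p <= 3 / 2 -> Rabs (st_Y p) <= 2 -> vfield rho eps (mirror p) = opp (mirror (vfield rho eps p)).
Proof.
  intros Hr He Hx Hy. unfold vfield. rewrite mirror_field. f_equal. f_equal. f_equal.
  symmetry. apply (Ufun_spec rho eps (mirror p) Hr He).
  - exact Hx.
  - unfold mirror, st_Y in *; simpl in *. rewrite Rabs_Ropp. exact Hy.
  - apply mirror_is_U. apply (Ufun_spec rho eps p Hr He Hx Hy).
Qed.

Lemma primary_unstable_orbit D r rho eps th0 gam :
  0 <= rho <= 1 / 2 -> 0 < eps <= / 10 ^ 9 -> near_loop (fun q => D (fst q, - snd q)) -> r < / 100 ->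
  primary_unstable D r rho eps th0 gam ->
  exists h, (forall t, t <= 0 -> h t = gam t) /\ forall t, t <= 0 -> orbit_at rho eps h t.
Proof.
  intros Hr He HD Hrr HP.
  destruct (primary_stable_orbit _ r rho eps (- th0) _ Hr He HD Hrr (mirror_primary _ _ _ _ _ _ HP)) as [g [Eg Hg]].
  assert (Hbox := fun t Ht => stable_orbit_box rho eps (- th0) g t Hg Ht).
  destruct Hg as [Hd [Hrg _]].
  exists (fun t => mirror (g (- t))). split.
  - intros t Ht. rewrite Eg by lra. rewrite Ropp_involutive. unfold mirror, st_theta, st_X, st_Y, mk_state; simpl.
    rewrite !Ropp_involutive. destruct (gam t) as [[a b] c]. reflexivity.
  - intros t Ht. destruct (Hbox (- t) ltac:(lra)) as [B1 B2].
    assert (H := is_derive_reflect g t _ (Hd (- t) ltac:(lra))).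
    destruct (is_derive_state_comp _ t _ H) as [D1 [D2 D3]].
    split; [|split].
    + rewrite vfield_mirror by assumption. set (v := vfield rho eps (g (- t))) in *.
      apply is_derive_state_of_comp.
      * apply (is_derive_ext (fun t => - st_theta (g (- t)))); [reflexivity|].
        change (st_theta (opp (mirror v))) with (- st_theta (opp v)).
        apply (is_derive_opp (V := R_NormedModule)), D1.
      * exact D2.
      * apply (is_derive_ext (fun t => - st_Y (g (- t)))); [reflexivity|].
        change (st_Y (opp (mirror v))) with (- st_Y (opp v)).
        apply (is_derive_opp (V := R_NormedModule)), D3.
    + apply (Hrg (- t)). lra.
    + change (Rabs (- st_Y (g (- t))) < 2). rewrite Rabs_Ropp. destruct (Hrg (- t) ltac:(lra)) as [_ [B _]]. lra.
Qed.

Definition glue (f1 f2 : R -> state) (t : R) : state := if Rlt_dec t 0 then f1 t else f2 t.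

Lemma glue_pos f1 f2 t : 0 <= t -> glue f1 f2 t = f2 t.
Proof. intros Ht. unfold glue. destruct Rlt_dec; [lra|reflexivity]. Qed.

Lemma glue_neg f1 f2 t : f1 0 = f2 0 -> t <= 0 -> glue f1 f2 t = f1 t.
Proof.
  intros E Ht. unfold glue. destruct Rlt_dec; [reflexivity|].
  replace t with 0 by lra. symmetry. exact E.
Qed.

(** [h] and [g] are curves with ordinary derivatives that agree with the two pieces on their
    half-lines. At 0 the one-sided derivatives coincide, since both are the value of the field at
    the same point. *)
Lemma glue_orbit rho eps f1 f2 h g t : f1 0 = f2 0 ->
  (forall s, s <= 0 -> h s = f1 s) -> (forall s, 0 <= s -> g s = f2 s) ->
  (t <= 0 -> orbit_at rho eps h t) -> (0 <= t -> orbit_at rho eps g t) ->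
  orbit_at rho eps (glue f1 f2) t.
Proof.
  intros E0 Eh Eg Hh Hg.
  destruct (Rlt_le_dec t 0) as [Hneg|Hpos].
  - destruct (Hh ltac:(lra)) as [Hd HX]. unfold orbit_at. rewrite (glue_neg f1 f2 t E0), <- Eh by lra.
    split; [|exact HX]. apply (is_derive_ext_loc h); [|exact Hd].
    assert (Hp : 0 < - t) by lra. exists (mkposreal _ Hp). intros s Hs. change (Rabs (s - t) < - t) in Hs.
    apply Rabs_def2 in Hs. rewrite Eh by lra. symmetry. apply glue_neg; [exact E0|lra].
  - destruct (Hg Hpos) as [Hd HX]. unfold orbit_at. rewrite (glue_pos f1 f2 t), <- Eg by lra.
    split; [|exact HX].
    destruct (Req_dec t 0) as [->|Hne].
    + destruct (Hh ltac:(lra)) as [Hd' _].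
      assert (Egh : h 0 = g 0) by (rewrite Eh, Eg by lra; exact E0). rewrite Egh in Hd'.
      apply is_derive_glue.
      * apply (is_derive_within_ext _ g); [lra| |apply is_derive_within_of_derive, Hd].
        intros s Hs. rewrite Eg by exact Hs. symmetry. apply glue_pos, Hs.
      * apply (is_derive_within_ext _ h); [lra| |apply is_derive_within_of_derive, Hd'].
        intros s Hs. rewrite Eh by exact Hs. symmetry. apply glue_neg; assumption.
    + apply (is_derive_ext_loc g); [|exact Hd].
      assert (Hp : 0 < t) by lra. exists (mkposreal _ Hp). intros s Hs. change (Rabs (s - t) < t) in Hs.
      apply Rabs_def2 in Hs. rewrite Eg by lra. symmetry. apply glue_pos. lra.
Qed.

Lemma orbit_solves rho eps (J : R -> Prop) g : 0 <= rho <= 1 / 2 -> 0 < eps <= / 10 ^ 9 ->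
  (forall t, J t -> orbit_at rho eps g t) -> solves rho eps J g.
Proof.
  intros Hr He H t Ht. destruct (H t Ht) as [Hd [HX HY]]. split; [lra|].
  exists (Ufun rho eps (g t)). split; [apply Ufun_spec; try assumption; lra|].
  apply is_derive_within_of_derive, Hd.
Qed.

Lemma solves_ext rho eps (J : R -> Prop) g gam : (forall t, J t -> gam t = g t) -> solves rho eps J g -> solves rho eps J gam.
Proof.
  intros E H t Ht. destruct (H t Ht) as [HX [u [Hu Hd]]]. rewrite (E t Ht). split; [exact HX|].
  exists u. split; [exact Hu|]. apply (is_derive_within_ext J g); [exact Ht| |exact Hd].
  intros s Hs. symmetry. apply E, Hs.
Qed.

Lemma primary_stable_ext D r rho eps th g gam : (forall t, 0 <= t -> gam t = g t) ->
  primary_stable D r rho eps th g -> primary_stable D r rho eps th gam.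
Proof.
  intros E [H1 [H2 [H3 [H4 H5]]]]. split; [exact (solves_ext _ _ _ _ _ E H1)|].
  split; [rewrite E by lra; exact H2|]. split; [intros t Ht; rewrite E by exact Ht; apply H3, Ht|].
  split; [apply (is_lim_ext_pos (fun t => st_X (g t)))|apply (is_lim_ext_pos (fun t => st_Y (g t)))]; try assumption;
    intros t Ht; rewrite E by exact Ht; reflexivity.
Qed.

Lemma primary_unstable_ext D r rho eps th g gam : (forall t, t <= 0 -> gam t = g t) ->
  primary_unstable D r rho eps th g -> primary_unstable D r rho eps th gam.
Proof.
  intros E [H1 [H2 [H3 [H4 H5]]]]. split; [exact (solves_ext _ _ _ _ _ E H1)|].
  split; [rewrite E by lra; exact H2|]. split; [intros t Ht; rewrite E by exact Ht; apply H3, Ht|].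
  split; [apply (is_lim_ext_loc (fun t => st_X (g t)))|apply (is_lim_ext_loc (fun t => st_Y (g t)))]; try assumption;
    exists 0; intros t Ht; rewrite E by lra; reflexivity.
Qed.

(** On Y = 0 the second equation reads Y' = X (1 - X^2 - F) with X^2 near 2 and F small, so the flow
    crosses the section transversally. *)
Lemma crossing_speed rho eps th x : 0 <= rho <= 1 / 2 -> 0 < eps <= / 10 ^ 9 -> Rabs (x - sqrt 2) <= / 100 ->
  st_Y (vfield rho eps (mk_state th x 0)) < 0.
Proof.
  intros Hr He Hx. apply Rabs_le_between in Hx. destruct sqrt2_bounds as [_ Hs].
  destruct (perturbation_small rho eps (mk_state th x 0) Hr He) as [_ [HF _]].
  - unfold st_X, mk_state; simpl. lra.
  - unfold st_Y, mk_state; simpl. rewrite Rabs_R0. lra.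
  - unfold vfield, vector_field. set (u := Ufun rho eps (mk_state th x 0)) in *.
    change (st_theta (mk_state th x 0)) with th in *. change (st_X (mk_state th x 0)) with x in *.
    change (st_Y (mk_state th x 0)) with 0 in *.
    match goal with |- st_Y (mk_state _ _ ?c) < 0 => change (c < 0) end.
    set (F := Ffun rho eps u th x) in *. apply Rabs_le_between in HF.
    replace (x - x ^ 3 - x * F + _) with (x * (1 - x * x - F)) by ring.
    assert (1 - x * x - F < 0) by nra. nra.
Qed.

Lemma span_initial_coordinates (v1 v2 v3 z1 z2 z3 a b : R) : v3 <> 0 -> a - b <> 0 ->
  exists c1 c2 c3 c4 : R, z1 = c1 * v1 + c2 * 1 + (c3 * v1 + c4 * 1) /\
    z2 = c1 * v2 + c2 * a + (c3 * v2 + c4 * b) /\ z3 = c1 * v3 + c2 * 0 + (c3 * v3 + c4 * 0).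
Proof.
  intros Hv Hab. set (c1 := z3 / v3). set (w1 := z1 - c1 * v1). set (w2 := z2 - c1 * v2).
  exists c1, ((w2 - b * w1) / (a - b)), 0, ((a * w1 - w2) / (a - b)).
  unfold w1, w2, c1. repeat split; field; repeat split; assumption.
Qed.

Lemma span_initial (v z : state) a b : st_Y v <> 0 -> a - b <> 0 ->
  exists c1 c2 c3 c4, z = plus (plus (scal c1 v) (scal c2 (mk_state 1 a 0))) (plus (scal c3 v) (scal c4 (mk_state 1 b 0))).
Proof.
  destruct v as [[v1 v2] v3]. destruct z as [[z1 z2] z3]. intros Hv Hab. change (v3 <> 0) in Hv.
  destruct (span_initial_coordinates v1 v2 v3 z1 z2 z3 a b Hv Hab) as [c1 [c2 [c3 [c4 [E1 [E2 E3]]]]]].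
  exists c1, c2, c3, c4. rewrite E1, E2, E3. reflexivity.
Qed.

Definition combine (c1 c2 c3 c4 : R) (v w x y : state) : state :=
  plus (plus (scal c1 v) (scal c2 w)) (plus (scal c3 x) (scal c4 y)).

(* The space of solutions of the variational equation is three-dimensional, so
   that spanning at time 0 gives spanning at every time. *)
Lemma span_transport (B : state -> Prop) f D (gam V1 V2 V3 V4 : R -> state) T t0 :
  0 <= T -> C11v B f D -> (forall t, - T <= t <= T -> B (gam t) /\ continuous gam t) -> - T <= t0 <= T ->
  (forall V, (V = V1 \/ V = V2 \/ V = V3 \/ V = V4) -> forall t, - T <= t <= T -> is_derive V t (D (gam t) (V t))) ->
  (forall z, exists c1 c2 c3 c4, z = combine c1 c2 c3 c4 (V1 0) (V2 0) (V3 0) (V4 0)) ->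
  forall z, exists c1 c2 c3 c4, z = combine c1 c2 c3 c4 (V1 t0) (V2 t0) (V3 t0) (V4 t0).
Proof.
  intros HT HD Hg Ht0 HV Hspan z.
  destruct (variational_exists B f D gam T t0 z HT HD Hg Ht0) as [Z [Z0 HZ]].
  destruct (Hspan (Z 0)) as [c1 [c2 [c3 [c4 E]]]]. exists c1, c2, c3, c4. rewrite <- Z0.
  apply (variational_unique B f D gam Z (fun t => combine c1 c2 c3 c4 (V1 t) (V2 t) (V3 t) (V4 t)) T HT HD Hg HZ); try assumption.
  intros t Ht.
  assert (EL : D (gam t) (combine c1 c2 c3 c4 (V1 t) (V2 t) (V3 t) (V4 t)) =
    combine c1 c2 c3 c4 (D (gam t) (V1 t)) (D (gam t) (V2 t)) (D (gam t) (V3 t)) (D (gam t) (V4 t))).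
  { destruct HD as [C [_ H]]. destruct (H (gam t) (proj1 (Hg t Ht))) as [A [S _]].
    unfold combine. rewrite !A, !S. reflexivity. }
  rewrite EL. unfold combine.
  apply (is_derive_plus (V := state)); apply (is_derive_plus (V := state)); apply is_derive_scal_vec; apply HV; tauto.
Qed.

(** The primary solutions exist on half-lines, but both tangent planes are needed at every t0. Each
    sheet is therefore continued across time 0 by the flow, and uniqueness identifies it on a
    compact interval with the differentiable family of [sheet_core]. *)
Lemma transversal_orbit Dp Dm r rho eps (GS GU : R -> R -> state) th a b :
  0 <= rho <= 1 / 2 -> 0 < eps <= / 10 ^ 9 -> near_loop Dp -> near_loop (fun q => Dm (fst q, - snd q)) -> r < / 100 ->
  (forall t, primary_stable Dp r rho eps t (GS t)) -> (forall t, primary_unstable Dm r rho eps t (GU t)) ->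
  st_X (GS th 0) = st_X (GU th 0) ->
  is_derive (fun t => st_X (GS t 0)) th a -> is_derive (fun t => st_X (GU t 0)) th b -> a - b <> 0 ->
  transversal_homoclinic_intersection Dp Dm r rho eps.
Proof.
  intros Hr He HDp HDm Hrr HS HU E0 Ha Hb Hab.
  assert (FS : forall t, exists g, (forall s, 0 <= s -> g s = GS t s) /\ forall s, 0 <= s -> orbit_at rho eps g s).
  { intros t. destruct (primary_stable_orbit Dp r rho eps t (GS t) Hr He HDp Hrr (HS t)) as [g [Eg [Hd [Hrg _]]]].
    exists g. split; [exact Eg|]. intros s Hs. destruct (Hrg s Hs) as [B1 [B2 _]].
    split; [apply Hd, Hs|]. split; [exact B1|lra]. }
  assert (FU := fun t => primary_unstable_orbit Dm r rho eps t (GU t) Hr He HDm Hrr (HU t)).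
  assert (IS : forall t, GS t 0 = mk_state t (st_X (GS t 0)) 0).
  { intros t. destruct (HS t) as [_ [[X0 [_ E]] _]]. rewrite E. reflexivity. }
  assert (IU : forall t, GU t 0 = mk_state t (st_X (GU t 0)) 0).
  { intros t. destruct (HU t) as [_ [[X0 [_ E]] _]]. rewrite E. reflexivity. }
  assert (Ejoin : GU th 0 = GS th 0) by (rewrite IS, IU, E0; reflexivity).
  assert (DS : is_derive (fun t => GS t 0) th (mk_state 1 a 0)).
  { apply is_derive_state_of_comp.
    - apply (is_derive_ext (fun t => t)); [intros t; rewrite IS; reflexivity|]. apply (is_derive_id (K := R_AbsRing)).
    - exact Ha.
    - apply (is_derive_ext (fun t => 0)); [intros t; rewrite IS; reflexivity|]. apply (is_derive_const (V := R_NormedModule)). }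
  assert (DU : is_derive (fun t => GU t 0) th (mk_state 1 b 0)).
  { apply is_derive_state_of_comp.
    - apply (is_derive_ext (fun t => t)); [intros t; rewrite IU; reflexivity|]. apply (is_derive_id (K := R_AbsRing)).
    - exact Hb.
    - apply (is_derive_ext (fun t => 0)); [intros t; rewrite IU; reflexivity|]. apply (is_derive_const (V := R_NormedModule)). }
  set (gam := glue (GU th) (GS th)).
  assert (Hgam : forall t, orbit_at rho eps gam t).
  { intros t. destruct (FS th) as [g [Eg Hg]]. destruct (FU th) as [h [Eh Hh]].
    apply (glue_orbit rho eps (GU th) (GS th) h g t Ejoin Eh Eg); [apply Hh|apply Hg]. }
  assert (G0 : gam 0 = GS th 0) by (apply glue_pos; lra).
  exists th, gam. split; [|split].
  { apply (primary_stable_ext Dp r rho eps th (GS th)); [|apply HS]. intros t Ht. apply glue_pos, Ht. }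
  { apply (primary_unstable_ext Dm r rho eps th (GU th)); [|apply HU]. intros t Ht. apply glue_neg; assumption. }
  (* One unit of margin places t0 in the interior of [- T, T]. *)
  intros t0. set (T := Rabs t0 + 1).
  assert (Ht0 : - (T - 1) <= t0 <= T - 1) by (unfold T; pose proof (Rle_abs t0); pose proof (Rle_abs (- t0)); rewrite Rabs_Ropp in *; lra).
  assert (HT : 1 <= T) by (unfold T; pose proof (Rabs_pos t0); lra).
  (* The further unit gives every point of [- T, T] a full neighbourhood in which [gam] stays in the
     box, so that the field can be differentiated along the orbit at the end points too. *)
  destruct (orbit_on_box rho eps (- (T + 1)) (T + 1) gam ltac:(lra) (fun t _ => Hgam t)) as [m [Hm Hbox]].
  assert (HboxT : forall t, - T <= t <= T -> m <= st_X (gam t) <= 3 / 2 - m /\ Rabs (st_Y (gam t)) <= 2 - m) by (intros; apply Hbox; lra).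
  destruct (clamped_field_spec rho eps (m / 2) Hr He ltac:(lra)) as [_ [_ [D [_ HD]]]].
  assert (Hgon : orbit_on rho eps (- T) T gam) by (intros t _; apply Hgam).
  assert (Hgb : forall t, - (T + 1) <= t <= T + 1 -> box (m / 2) (gam t)).
  { intros t Ht. destruct (Hbox t Ht) as [B1 B2]. split; lra. }
  assert (Hgc : forall t, - T <= t <= T -> box (m / 2) (gam t) /\ continuous gam t).
  { intros t Ht. split; [apply Hgb; lra|]. destruct (Hgam t) as [Hd _]. exact (continuous_is_derive gam t _ Hd). }
  destruct (sheet_core rho eps T gam m D (fun t => GS t 0) th (mk_state 1 a 0) Hr He ltac:(lra) Hm Hgon HboxT HD (eq_sym G0) DS)
    as [phis [Ws [ds [Hds [Ps [Ws0 [HWs HdWs]]]]]]].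
  destruct (sheet_core rho eps T gam m D (fun t => GU t 0) th (mk_state 1 b 0) Hr He ltac:(lra) Hm Hgon HboxT HD (eq_trans Ejoin (eq_sym G0)) DU)
    as [phiu [Wu [du [Hdu [Pu [Wu0 [HWu HdWu]]]]]]].
  (* The stable sheet keeps the given primary solution for t >= 0 and follows the flow backwards;
     the unstable sheet does the opposite. *)
  set (Psis := fun t => glue (phis t) (GS t)). set (Psiu := fun t => glue (GU t) (phiu t)).
  assert (Os : forall t, Rabs (t - th) < ds -> forall s, - T <= s -> orbit_at rho eps (Psis t) s).
  { intros t Ht s Hs. destruct (Ps t Ht) as [P0 P1]. destruct (FS t) as [g [Eg Hg]].
    apply (glue_orbit rho eps (phis t) (GS t) (phis t) g s P0); [reflexivity|exact Eg| |apply Hg].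
    intros Hs0. apply P1. lra. }
  assert (Ou : forall t, Rabs (t - th) < du -> forall s, s <= T -> orbit_at rho eps (Psiu t) s).
  { intros t Ht s Hs. destruct (Pu t Ht) as [P0 P1]. destruct (FU t) as [h [Eh Hh]].
    apply (glue_orbit rho eps (GU t) (phiu t) h (phiu t) s (eq_sym P0)); [exact Eh|reflexivity|apply Hh|].
    intros Hs0. apply P1. lra. }
  (* On the compact interval the glued curve and the flow solve the same initial value problem.
     Hence the th-derivative known for [phis] is that of the sheet. *)
  assert (Es : forall t, Rabs (t - th) < ds -> forall s, - T <= s <= T -> Psis t s = phis t s).
  { intros t Ht s Hs. destruct (Ps t Ht) as [P0 P1].
    apply (orbit_on_unique rho eps T (Psis t) (phis t) Hr He ltac:(lra)); try assumption.
    - intros s' Hs'. apply (Os t Ht). lra.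
    - unfold Psis. rewrite glue_pos by lra. symmetry. exact P0. }
  assert (Eu : forall t, Rabs (t - th) < du -> forall s, - T <= s <= T -> Psiu t s = phiu t s).
  { intros t Ht s Hs. destruct (Pu t Ht) as [P0 P1].
    apply (orbit_on_unique rho eps T (Psiu t) (phiu t) Hr He ltac:(lra)); try assumption.
    - intros s' Hs'. apply (Ou t Ht). lra.
    - unfold Psiu. rewrite glue_pos by lra. reflexivity. }
  assert (Hth : forall d, 0 < d -> Rabs (th - th) < d) by (intros; rewrite Rminus_diag, Rabs_R0; assumption).
  assert (Eths : Psis th t0 = gam t0).
  { apply (orbit_on_unique rho eps T (Psis th) gam Hr He ltac:(lra)); try assumption; [|unfold Psis; rewrite glue_pos, G0 by lra; reflexivity|lra].
    intros s Hs. apply (Os th (Hth ds Hds)). lra. }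
  assert (Ethu : Psiu th t0 = gam t0).
  { apply (orbit_on_unique rho eps T (Psiu th) gam Hr He ltac:(lra)); try assumption; [| |lra].
    - intros s Hs. apply (Ou th (Hth du Hdu)). lra.
    - unfold Psiu. rewrite glue_pos, G0, <- Ejoin by lra. apply (Pu th (Hth du Hdu)). }
  exists Psis, Psiu. split; [|split; [|split; [exact Eths|split; [exact Ethu|]]]].
  (* With d <= 1/2 every time above Rmin 0 t0 - d lies above - T, where the sheet is an orbit. *)
  - exists (Rmin ds (/ 2)). split; [apply Rmin_pos; lra|]. pose proof (Rmin_l ds (/ 2)). pose proof (Rmin_r ds (/ 2)).
    intros t Ht. split.
    + apply (primary_stable_ext Dp r rho eps t (GS t)); [|apply HS]. intros s Hs. apply glue_pos, Hs.
    + apply orbit_solves; try assumption. intros s Hs. apply (Os t ltac:(lra)).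
      unfold Rmin in Hs at 1. destruct Rle_dec; lra.
  - exists (Rmin du (/ 2)). split; [apply Rmin_pos; lra|]. pose proof (Rmin_l du (/ 2)). pose proof (Rmin_r du (/ 2)).
    intros t Ht. split.
    + apply (primary_unstable_ext Dm r rho eps t (GU t)); [|apply HU]. intros s Hs. apply glue_neg; [|exact Hs].
      symmetry. apply (Pu t). lra.
    + apply orbit_solves; try assumption. intros s Hs. apply (Ou t ltac:(lra)).
      unfold Rmax in Hs. destruct Rle_dec; lra.
  - set (V := fun t => vfield rho eps (gam t)).
    exists (V t0), (Ws t0), (V t0), (Wu t0).
    assert (HV : forall t, - T <= t <= T -> is_derive V t (D (gam t) (V t))).
    { intros t Ht. apply (field_along_orbit (box (m / 2)) (vfield rho eps) D gam t _ HD); [|apply Hgam].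
      exists 1. split; [lra|]. intros s Hs. apply Rabs_def2 in Hs. apply Hgb. lra. }
    split; [split|split; [split|]].
    + unfold V. rewrite <- Eths. apply (Os th (Hth ds Hds)). lra.
    + apply (is_derive_ext_loc (fun t => phis t t0)); [|apply HdWs; lra].
      exists (mkposreal ds Hds). intros t Ht. symmetry. apply Es; [exact Ht|lra].
    + unfold V. rewrite <- Ethu. apply (Ou th (Hth du Hdu)). lra.
    + apply (is_derive_ext_loc (fun t => phiu t t0)); [|apply HdWu; lra].
      exists (mkposreal du Hdu). intros t Ht. symmetry. apply Eu; [exact Ht|lra].
    (* At time 0 the tangent vectors are (1, a, 0) and (1, b, 0) with a <> b, and the velocity has a
       nonzero Y-component; the velocity serves for both sheets. *)
    + apply (span_transport (box (m / 2)) (vfield rho eps) D gam V Ws V Wu T t0 ltac:(lra) HD Hgc ltac:(lra)).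
      * intros F [-> | [-> | [-> | ->]]]; assumption.
      * intros z. rewrite Ws0, Wu0. apply span_initial; [|exact Hab].
        unfold V. rewrite G0, IS. apply Rlt_not_eq, crossing_speed; try assumption.
        destruct (HS th) as [_ [[X0 [HX0 E]] _]]. rewrite E. change (Rabs (X0 - sqrt 2) <= / 100). lra.
Qed.

Theorem proposition4p1 :
  exists delta : R, 0 < delta /\
  forall (Dp Dm : R * R -> Prop) (r : R),
    small_neighborhood delta loop_plus Dp ->
    small_neighborhood delta loop_minus Dm ->
    0 < r < delta ->
  forall eps0 : R, 0 < eps0 ->
    exist_unique_analytic eps0 (fun t => 0 <= t) (primary_stable Dp r) ->
    exist_unique_analytic eps0 (fun t => t <= 0) (primary_unstable Dm r) ->
  exists eps1 : R, 0 < eps1 < eps0 /\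
    forall eps : R, 0 < eps < eps1 ->
    exists rho_eps : R, 0 < rho_eps /\
      forall rho : R, 0 < rho < rho_eps ->
        transversal_homoclinic_intersection Dp Dm r rho eps.
Proof.
  (* 1/100 is the tolerance of [near_loop]; it also keeps X(0) close enough to sqrt 2 for the sign
     of Y' at the crossing. *)
  exists (/ 100). split; [lra|]. intros Dp Dm r HDp HDm Hr eps0 H0 [GS HGS] [GU HGU].
  (* eps0 / 2 gives the strict inequality eps1 < eps0, and 10^(-9) is the range of all estimates. *)
  exists (Rmin (eps0 / 2) (/ 10 ^ 9)).
  pose proof (Rmin_l (eps0 / 2) (/ 10 ^ 9)). pose proof (Rmin_r (eps0 / 2) (/ 10 ^ 9)).
  split; [split; [apply Rmin_pos; lra|lra]|]. intros eps He.
  destruct (splitting_zero Dp Dm r eps0 GS GU eps HDp HDm Hr H0 ltac:(lra) ltac:(lra) HGS HGU) as [k1 [Hk1 HZ]].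
  (* The estimates of the vector field are made for 0 <= rho <= 1/2. *)
  exists (Rmin k1 (1 / 2)). split; [apply Rmin_pos; lra|]. intros rho Hrho.
  pose proof (Rmin_l k1 (1 / 2)). pose proof (Rmin_r k1 (1 / 2)).
  destruct (HZ rho ltac:(lra)) as [th [d' [E [Hd Hd0]]]].
  assert (Hrng : param_range eps0 rho eps) by (unfold param_range; lra).
  destruct (HGS th rho eps Hrng) as [_ [_ AS]]. destruct (AS 0 (Rle_refl 0)) as [_ [AS1 _]].
  destruct (HGU th rho eps Hrng) as [_ [_ AU]]. destruct (AU 0 (Rle_refl 0)) as [_ [AU1 _]].
  destruct (analytic3_slice _ _ _ _ AS1) as [a Ha]. destruct (analytic3_slice _ _ _ _ AU1) as [b Hb].
  apply (transversal_orbit Dp Dm r rho eps (fun t => GS t rho eps) (fun t => GU t rho eps) th a b); try lra.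
  - apply (small_neighborhood_near Dp (/ 100)); [lra|exact HDp].
  - apply (mirror_near Dm (/ 100)); [lra|exact HDm].
  - intros t. apply (HGS t rho eps Hrng).
  - intros t. apply (HGU t rho eps Hrng).
  - exact Ha.
  - exact Hb.
  (* The two slopes exist separately by analyticity; their difference is the nonzero derivative at
     the simple zero. *)
  - assert (Hab := is_derive_minus (V := R_NormedModule) _ _ th a b Ha Hb).
    apply is_derive_unique in Hab. apply is_derive_unique in Hd. 
    assert (Hd' : a - b = d') by (transitivity (Derive (fun t => st_X (GS t rho eps 0) - st_X (GU t rho eps 0)) th);
      [symmetry; exact Hab|exact Hd]).
    rewrite Hd'. exact Hd0.
Qed.
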